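(* Let $n\ge 1$, $s\in(0,2)$ and $\beta\in(0,\min\{n,2s\})$. There are constants $C>0$ in (i)–(iii) below, independent of $f$, such that for every $f\in\dot H^{\beta/2}(\mathbb{R}^n)$, with Caffarelli–Silvestre extension $u(x,t)=p^s_t\ast f(x)$, the following hold. (i) $$\left(\int_{\mathbb{R}^n}|f(x)|^{2n/(n-\beta)}\,dx\right)^{1-\beta/n}\le C\int_{\mathbb{R}^{n+1}_+}\left|\frac{\partial u(x,t)}{\partial t}\right|^2t^{1-\beta}\,dx\,dt.$$ (ii) If $\|f\|_{L^2(\mathbb{R}^n)}=1$, then $$\exp\left(\frac{\beta}{n}\int_{\mathbb{R}^n}|f(x)|^2\ln(|f(x)|^2)\,dx\right)\le C\int_{\mathbb{R}^{n+1}_+}\left|\frac{\partial u(x,t)}{\partial t}\right|^2t^{1-\beta}\,dx\,dt.$$ (iii) $$\int_{\mathbb{R}^n}\frac{|f(x)|^2}{|x|^{\beta}}\,dx\le C\int_{\mathbb{R}^{n+1}_+}\left|\frac{\partial u(x,t)}{\partial t}\right|^2t^{1-\beta}\,dx\,dt.$$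
   Context: $\mathbb{R}^{n+1}_+=\mathbb{R}^n\times(0,\infty)$. The fractional Poisson kernel is $p^s_t(x)=\dfrac{c(n,s)\,t^s}{(|x|^2+t^2)^{(n+s)/2}}$, $c(n,s)=\dfrac{\Gamma((n+s)/2)}{\pi^{n/2}\Gamma(s/2)}$, so that $\int_{\mathbb{R}^n}p^s_t(x)\,dx=1$. The Caffarelli–Silvestre extension of $f$ is $u(x,t)=p^s_t\ast f(x)=\int_{\mathbb{R}^n}p^s_t(x-y)f(y)\,dy$; it solves $\mathrm{div}(t^{1-s}\nabla u)=0$ in $\mathbb{R}^{n+1}_+$ with $u=f$ on $t=0$. $\dot H^{\beta/2}(\mathbb{R}^n)$ is the homogeneous Sobolev space with norm $\|f\|_{\dot H^{\beta/2}}=\|(-\Delta)^{\beta/4}f\|_{L^2}\approx\left(\int_{\mathbb{R}^n}|\xi|^{\beta}|\widehat f(\xi)|^2d\xi\right)^{1/2}$, where $\widehat f(\xi)=\int_{\mathbb{R}^n}e^{-ix\cdot\xi}f(x)\,dx$. Integrals of nonnegative functions take values in $[0,\infty]$. *)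

(* Defs.v *)
From HB Require Import structures.
From mathcomp Require Import all_boot all_order all_algebra complex.
From mathcomp Require Import all_classical all_reals all_analysis.

Set Implicit Arguments.
Unset Strict Implicit.
Unset Printing Implicit Defensive.
Import Order.TTheory GRing.Theory Num.Theory.
Import numFieldNormedType.Exports.
Import Normc.

Local Open Scope classical_set_scope.
Local Open Scope complex_scope.
Local Open Scope ring_scope.

(* R^n is 'rV[R]_n with the Borel sigma-algebra generated by the coordinates
   (same construction as the library's sigma-algebra on n.-tuple). *)
Definition measure_rV_display : measure_display.
Proof. exact: (measure_tuple_display default_measure_display). Qed.

Section measurable_rV.
Context {R : realType}.
Variable n : nat.

Let coord_rV : 'I_n -> 'rV[R]_n -> measurableTypeR R := fun i x => x 0 i.

Let rV_set0 : g_sigma_preimage coord_rV set0.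
Proof. exact: sigma_algebra0. Qed.

Let rV_setC A : g_sigma_preimage coord_rV A -> g_sigma_preimage coord_rV (~` A).
Proof. exact: sigma_algebraC. Qed.

Let rV_bigcup (F : _^nat) : (forall i, g_sigma_preimage coord_rV (F i)) ->
  g_sigma_preimage coord_rV (\bigcup_i (F i)).
Proof. exact: sigma_algebra_bigcup. Qed.

HB.instance Definition _ := @isMeasurable.Build measure_rV_display
  'rV[R]_n (g_sigma_preimage coord_rV) rV_set0 rV_setC rV_bigcup.

Lemma measurable_coord (i : 'I_n) :
  measurable_fun setT (fun x : 'rV[R]_n => x 0 i : measurableTypeR R).
Proof.
move=> _ Y mY; rewrite setTI; apply: sub_sigma_algebra => /=.
rewrite -bigcup_seq/=; exists i => /=; first by rewrite mem_index_enum.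
by exists Y => //; rewrite setTI.
Qed.

Lemma measurable_fun_rV d (T : measurableType d) (f : T -> 'rV[R]_n) :
  (forall i, measurable_fun setT (fun t => f t 0 i : measurableTypeR R)) ->
  measurable_fun setT f.
Proof.
move=> mf; suff S : @measurable _ 'rV[R]_n `<=`
    [set A | measurable (f @^-1` A)].
  by move=> _ A mA; rewrite setTI; exact: S.
apply: smallest_sub.
  split=> [|A /= mA|F /= mF]; first by rewrite /= preimage_set0.
  - by rewrite setTD preimage_setC; exact: measurableC.
  - by rewrite preimage_bigcup; exact: bigcup_measurable.
rewrite -bigcup_seq; apply: bigcup_sub => i _ _ [B mB <-] /=.
by rewrite setTI; have := mf i measurableT B mB; rewrite setTI.
Qed.

End measurable_rV.

(* Lebesgue measure on R^n: the n-fold product of the Lebesgue measure on R,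
   transported along the identification of R x R^n with R^(n+1). *)
Section lebesgue_rV.
Context {R : realType}.

Definition rV_cons n (p : measurableTypeR R * 'rV[R]_n) : 'rV[R]_n.+1 :=
  \row_i (if unlift ord0 i is Some j then p.2 0 j else p.1).

Lemma measurable_rV_cons n : measurable_fun setT (@rV_cons n).
Proof.
apply: measurable_fun_rV => i.
under eq_fun do rewrite mxE.
case: (unlift ord0 i) => [j|]; last exact: measurable_fst.
exact: (measurableT_comp (measurable_coord j) measurable_snd).
Qed.

Section step.
Variables (n : nat) (m : {sigma_finite_measure set 'rV[R]_n -> \bar R}).

Definition lebesgue_step : set 'rV[R]_n.+1 -> \bar R :=
  pushforward (@lebesgue_measure R \x m)%E (@rV_cons n).

Let step0 : lebesgue_step set0 = 0%E.
Proof. by rewrite /lebesgue_step /pushforward preimage_set0 measure0. Qed.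

Let step_ge0 A : (0 <= lebesgue_step A)%E.
Proof.
rewrite /lebesgue_step /pushforward.
exact: (@measure_ge0 _ _ _ (@lebesgue_measure R \x m)%E).
Qed.

Let measurable_rV_consI (A : set 'rV[R]_n.+1) :
  measurable A -> measurable (@rV_cons n @^-1` A).
Proof. by move=> mA; rewrite -[_ @^-1` _]setTI; exact: measurable_rV_cons. Qed.

Let step_sigma_additive : semi_sigma_additive lebesgue_step.
Proof.
move=> F mF tF mUF; rewrite /lebesgue_step /pushforward preimage_bigcup.
apply: measure_semi_sigma_additive.
- by move=> k; exact: measurable_rV_consI.
- apply/trivIsetP => /= i j _ _ ij; rewrite -preimage_setI.
  by move/trivIsetP : tF => /(_ _ _ _ _ ij) ->//; rewrite preimage_set0.
- by rewrite -preimage_bigcup; exact: measurable_rV_consI.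
Qed.

HB.instance Definition _ := isMeasure.Build _ _ _ lebesgue_step
  step0 step_ge0 step_sigma_additive.

Let rV_uncons (x : 'rV[R]_n.+1) : measurableTypeR R * 'rV[R]_n :=
  (x 0 ord0, \row_j x 0 (lift ord0 j)).

Let rV_consK : cancel (@rV_cons n) rV_uncons.
Proof.
move=> [a y]; rewrite /rV_cons /rV_uncons !mxE unlift_none; congr pair.
by apply/rowP => j; rewrite !mxE liftK.
Qed.

Let measurable_rV_uncons : measurable_fun setT rV_uncons.
Proof.
apply/measurable_fun_pair; first exact: measurable_coord.
apply: measurable_fun_rV => j.
under eq_fun do rewrite mxE.
exact: measurable_coord.
Qed.

Let step_sigma_finite : sigma_finite setT lebesgue_step.
Proof.
have /sigma_finiteP[F [TF ndF Foo]] := sigma_finiteT (@lebesgue_measure R).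
have /sigma_finiteP[G [TG ndG Goo]] := sigma_finiteT m.
exists (fun k => rV_uncons @^-1` (F k `*` G k)).
  rewrite -preimage_bigcup; apply/esym/seteqP; split => // x _ /=.
  have [i _ Fi] : (\bigcup_i F i) (x 0 ord0) by rewrite -TF.
  have [j _ Gj] : (\bigcup_i G i) (rV_uncons x).2 by rewrite -TG.
  exists (maxn i j) => //; split => /=.
  - by move: Fi; exact/subsetPset/ndF/leq_maxl.
  - by move: Gj; exact/subsetPset/ndG/leq_maxr.
move=> k; have [mF Fk] := Foo k; have [mG Gk] := Goo k.
have mFG := measurableX mF mG; split.
  by rewrite -[_ @^-1` _]setTI; exact: measurable_rV_uncons.
rewrite /lebesgue_step /pushforward -comp_preimage.
have -> : rV_uncons \o @rV_cons n = id by apply/funext => p; exact: rV_consK.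
rewrite preimage_id product_measure1E//.
by rewrite lte_mul_pinfty// ge0_fin_numE.
Qed.

HB.instance Definition _ := Measure_isSigmaFinite.Build _ _ _ lebesgue_step
  step_sigma_finite.

End step.

Fixpoint lebesgue_rV n : {sigma_finite_measure set 'rV[R]_n -> \bar R} :=
  match n with
  | 0 => @dirac _ 'rV[R]_0 0 R
  | k.+1 => @lebesgue_step k (lebesgue_rV k)
  end.

End lebesgue_rV.

Definition Cintegral d (T : measurableType d) (R : realType)
    (mu : {measure set T -> \bar R}) (f : T -> R[i]) : R[i] :=
  (\int[mu]_x complex.Re (f x)) +i* (\int[mu]_x complex.Im (f x)).

Section euclidean.
Context {R : realType} {n : nat}.
Implicit Types x y xi : 'rV[R]_n.

Definition dotp x y : R := \sum_i x 0 i * y 0 i.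

(* Euclidean norm; the library's norm on 'rV[R]_n is the sup norm. *)
Definition enorm x : R := Num.sqrt (dotp x x).

(* Iterated partial derivative along the coordinates listed in l. *)
Definition iter_partial (l : seq 'I_n) (phi : 'rV[R]_n -> R) : 'rV[R]_n -> R :=
  foldr (fun i psi => (fun x => 'D_(delta_mx 0 i) psi x)) phi l.

Definition schwartz (phi : 'rV[R]_n -> R) : Prop :=
  (forall l x, differentiable (iter_partial l phi) x) /\
  (forall l k, exists M, forall x,
     (1 + enorm x) ^+ k * `|iter_partial l phi x| <= M).

Definition cschwartz (phi : 'rV[R]_n -> R[i]) : Prop :=
  schwartz (fun x => complex.Re (phi x)) /\ schwartz (fun x => complex.Im (phi x)).

Definition cexpi (a : R) : R[i] := cos a +i* sin a.

Definition fourier (phi : 'rV[R]_n -> R[i]) xi : R[i] :=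
  Cintegral (lebesgue_rV n) (fun x => cexpi (- dotp x xi) * phi x).

(* Locally integrable function of tempered growth, i.e. a function that is a
   tempered distribution. *)
Definition tempered (f : 'rV[R]_n -> R[i]) : Prop :=
  [/\ measurable_fun setT (fun x => complex.Re (f x)),
      measurable_fun setT (fun x => complex.Im (f x)) &
      exists N : nat,
        (\int[lebesgue_rV n]_x (normc (f x) / (1 + enorm x) ^+ N)%:E < +oo)%E].

(* g is the Fourier transform of f in the sense of tempered distributions:
   <f, phi^> = <g, phi>. *)
Definition is_fourier_transform (f g : 'rV[R]_n -> R[i]) : Prop :=
  forall phi, cschwartz phi ->
    Cintegral (lebesgue_rV n) (fun x => f x * fourier phi x) =
    Cintegral (lebesgue_rV n) (fun xi => g xi * phi xi).

(* The homogeneous Sobolev space of order sigma (< n/2, where its elements are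
   functions): the tempered f whose Fourier transform g is a function with
   |xi|^sigma g in L^2. *)
Definition hom_sobolev (sigma : R) (f : 'rV[R]_n -> R[i]) : Prop :=
  tempered f /\ exists g : 'rV[R]_n -> R[i],
    [/\ tempered g, is_fourier_transform f g &
      (\int[lebesgue_rV n]_xi
         (enorm xi `^ (2 * sigma) * normc (g xi) ^+ 2)%:E < +oo)%E].

End euclidean.

Section extension.
Context {R : realType} {n : nat}.
Implicit Types (s t : R) (x : 'rV[R]_n) (f : 'rV[R]_n -> R[i]).

Definition Gamma (a : R) : R :=
  \int[lebesgue_measure]_(t in `]0, +oo[) (t `^ (a - 1) * expR (- t)).

Definition poisson_cst s : R :=
  Gamma ((n%:R + s) / 2) / (pi `^ (n%:R / 2) * Gamma (s / 2)).

Definition poisson_kernel s t x : R :=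
  poisson_cst s * t `^ s / (enorm x ^+ 2 + t ^+ 2) `^ ((n%:R + s) / 2).

Definition cs_extension s f x t : R[i] :=
  Cintegral (lebesgue_rV n) (fun y => (poisson_kernel s t (x - y))%:C * f y).

Definition dt_cs_extension s f x t : R[i] :=
  derive1 (fun r : R => complex.Re (cs_extension s f x r)) t +i*
  derive1 (fun r : R => complex.Im (cs_extension s f x r)) t.

Definition extension_energy s (beta : R) f : \bar R :=
  (\int[lebesgue_rV n \x lebesgue_measure]_(z in setT `*` `]0%R, +oo[)
     (normc (dt_cs_extension s f z.1 z.2) ^+ 2 * z.2 `^ (1 - beta))%:E)%E.

End extension.

(* Main.v *)
(* Let p_t be the Poisson kernel, c its mass, q_t = d/dt p_t and v_t = q_t * f = du/dt.
   Since d/dt (p_t * p_t * f) = 2 p_t * v_t, one has c^2 f = - 2 int_0^oo p_t * v_t dt,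
   so |f| is bounded by the potential F = 2 c^-2 int_0^oo p_t * |v_t| dt.  No
   Plancherel identity is needed.  Splitting the t-integral at T and using
   Cauchy-Schwarz gives F(x)^2 <= C (T^beta g(x)^2 + T^(beta - n) E), with g the square
   function of p_t * |v_t| and E the energy; T^n = E / g(x)^2 yields the Sobolev
   inequality, T = |x| the Hardy inequality, and Jensen's inequality (ii) from (i).
   The representation is first proved for the Gaussian mollifications f_k of f, which
   are bounded and continuous on the Fourier side.  A Bessel-type inequality for bounded
   integrable h, int |h^|^2 exp(-tau |xi|^2) <= (2 pi)^n |h|_oo |h|_1, shows that
   p_T * f_k tends to 0 as T tends to infinity and that f_k is Cauchy in L^1 for the
   weight p_1, hence converges to f almost everywhere; the energy of f_k is at most that
   of f, and Fatou's lemma concludes. *)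
Require Import Defs.
From HB Require Import structures.
From mathcomp Require Import all_boot all_order all_algebra complex.
From mathcomp Require Import all_classical all_reals all_analysis.
From mathcomp Require Import measurable_realfun.
From mathcomp Require Import ring lra.

Set Implicit Arguments.
Unset Strict Implicit.
Unset Printing Implicit Defensive.
Import Order.TTheory GRing.Theory Num.Theory.
Import numFieldNormedType.Exports.
Import Normc.

Local Open Scope classical_set_scope.
Local Open Scope ring_scope.

(** * Integration on R^n *)

(** For s = 1 the Poisson kernels form a semigroup and v_t = p_(t/2) * v_(t/2) is already an average
    at scale t. For other s this fails. Squaring the averaging operator repairs it: the derivative
    of p_t * p_t * f keeps a factor p_t in front of v_t. This factor gives both estimates on which
    the splitting rests: a sup bound of p_t * |v_t| by t^(-n/2) times the L^2 norm of v_t, and an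
    L^2 bound of p_t * |v_t| by v_t itself. The second obstacle is that f and its transform are only
    known to be tempered. Integrability of f against p_1, without which u is not given by a
    convergent integral, and the decay of p_T * f_k are both drawn from |xi|^(beta/2) f^ being in
    L^2. The tool is to pair f_k with a bounded integrable h: a sign times p_1 gives the L^1
    estimate with weight p_1, and h = p_T(x - .) gives the decay. Transforms are carried as real
    cosine and sine integrals, and radial integrals come from volumes of balls by the layer-cake
    formula. *)

Section nonneg_integral.
Context d (T : measurableType d) {R : realType}.
Variable mu : {measure set T -> \bar R}.
Local Open Scope ereal_scope.

(* No measurability is needed: the integral of a nonnegative function is a
   supremum over the simple functions below it. *)
Lemma le_nnintegral (D : set T) (f g : T -> \bar R) :
  (forall x, D x -> 0 <= f x) -> (forall x, D x -> f x <= g x) ->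
  \int[mu]_(x in D) f x <= \int[mu]_(x in D) g x.
Proof.
move=> f0 fg; rewrite integral_mkcond [leRHS]integral_mkcond.
have h0 x : 0 <= (f \_ D) x.
  by rewrite patchE; case: ifPn => // /set_mem; exact: f0.
have h1 x : (f \_ D) x <= (g \_ D) x.
  by rewrite !patchE; case: ifPn => // /set_mem; exact: fg.
have h2 x : 0 <= (g \_ D) x by exact: le_trans (h1 x).
rewrite !ge0_integralTE//.
by apply: le_ereal_sup => _ [h hf <-]; exists h => //= x; apply: le_trans (h1 x); exact: hf.
Qed.

End nonneg_integral.

Section affine_line.
Context {R : realType}.
Local Open Scope ereal_scope.
Notation lam := (@lebesgue_measure R).

(** The measure |c| times the image of Lebesgue measure under x -> b + c x agrees with Lebesgue
    measure on half-open intervals, hence on all Borel sets. A negative c exchanges the open and the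
    closed end, which leaves the length unchanged. *)
Lemma lebesgue_affine (F : R -> \bar R) (b c : R) : c != 0%R ->
  measurable_fun setT F -> (forall x, 0 <= F x) ->
  \int[lam]_x F x = (`|c|)%:E * \int[lam]_x F (b + c * x)%R.
Proof.
move=> c0 mF F0.
have nc0 : (0 < `|c|)%R by rewrite normr_gt0.
pose phi (x : R) : measurableTypeR R := (b + c * x)%R.
have mphi : measurable_fun setT phi.
  by apply: measurable_funD => //; exact: measurable_funM.
pose nu0 := mscale (NngNum (normr_ge0 c)) (pushforward lam phi).
pose nu := nu0 mphi.
have E : forall A, measurable A -> lam A = nu A.
  apply: lebesgue_measure_unique => _ [[x y]] _ <-.
  rewrite [RHS](_ : _ = (`|c|)%:E * lam (phi @^-1` `]x, y]))//.
  have [cp|cn|/eqP] := ltgtP c 0%R; last by rewrite (negbTE c0).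
    have -> : phi @^-1` `]x, y] = `[((y - b) / c)%R, ((x - b) / c)%R[%classic.
      apply/seteqP; split => z; rewrite /phi /= !in_itv/=.
        move=> /andP[h1 h2]; apply/andP; split.
          by rewrite ler_ndivrMr// lerBrDl mulrC.
        by rewrite ltr_ndivlMr// ltrBlDl mulrC.
      rewrite ler_ndivrMr// ltr_ndivlMr// lerBrDl ltrBlDl mulrC.
      by move=> /andP[-> ->].
    rewrite !lebesgue_measure_itv/= !lte_fin ltr_nM2r ?invr_lt0// ltrD2r.
    case: ifPn => xy; last by rewrite mule0.
    by rewrite -!EFinD -EFinM ltr0_norm//; congr EFin; field; rewrite lt_eqF.
  have -> : phi @^-1` `]x, y] = `]((x - b) / c)%R, ((y - b) / c)%R]%classic.
    apply/seteqP; split => z; rewrite /phi /= !in_itv/=.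
      move=> /andP[h1 h2]; apply/andP; split.
        by rewrite ltr_pdivrMr// ltrBlDl mulrC.
      by rewrite ler_pdivlMr// lerBrDl mulrC.
    rewrite ltr_pdivrMr// ler_pdivlMr// ltrBlDl lerBrDl mulrC.
    by move=> /andP[-> ->].
  rewrite !lebesgue_measure_itv/= !lte_fin ltr_pM2r ?invr_gt0// ltrD2r.
  case: ifPn => xy; last by rewrite mule0.
  by rewrite -!EFinD -EFinM gtr0_norm//; congr EFin; field; rewrite gt_eqF.
have -> : \int[lam]_x F x = \int[nu]_x F x.
  by apply: eq_measure_integral => A mA _; exact: E.
rewrite ge0_integral_mscale//=.
by rewrite ge0_integral_pushforward.
Qed.

End affine_line.

(** * Closure properties of measurable functions *)

Section measurability.
Context {R : realType} d (T : measurableType d).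
Implicit Types (f g : T -> R) (D : set T).

Lemma measurable_fun_cos f : measurable_fun setT f ->
  measurable_fun setT (fun x => cos (f x)).
Proof.
by apply: measurableT_comp; apply: continuous_measurable_fun; exact: continuous_cos.
Qed.

Lemma measurable_fun_sin f : measurable_fun setT f ->
  measurable_fun setT (fun x => sin (f x)).
Proof.
by apply: measurableT_comp; apply: continuous_measurable_fun; exact: continuous_sin.
Qed.

Lemma measurable_fun_sqrtr f : measurable_fun setT f ->
  measurable_fun setT (fun x => Num.sqrt (f x)).
Proof.
by apply: measurableT_comp; apply: continuous_measurable_fun; exact: sqrt_continuous.
Qed.

Lemma measurable_fun_expR f : measurable_fun setT f ->
  measurable_fun setT (fun x => expR (f x)).
Proof. by apply: measurableT_comp; exact: measurable_expR. Qed.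

Lemma measurable_fun_ln f : measurable_fun setT f ->
  measurable_fun setT (fun x => ln (f x)).
Proof. by apply: measurableT_comp; exact: measurable_ln. Qed.

Lemma measurable_fun_normr f : measurable_fun setT f ->
  measurable_fun setT (fun x => `|f x|).
Proof. by apply: measurableT_comp; exact: normr_measurable. Qed.

Lemma measurable_fun_powR f (p : R) : measurable_fun setT f ->
  measurable_fun setT (fun x => f x `^ p).
Proof. by apply: (measurableT_comp (measurable_powR p)). Qed.

Lemma measurable_fun_inv f : measurable_fun setT f ->
  measurable_fun setT (fun x => (f x)^-1).
Proof.
(* A real power of the square is measurable, and the form f (f^2)^(-1) also gives the right value 0
   at the zeros of f. *)
move=> mf; rewrite (_ : (fun x => (f x)^-1) = fun x => f x * (f x ^+ 2) `^ (-1)).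
  by apply: measurable_funM => //; apply: measurable_fun_powR; exact: measurable_funX.
apply/funext => x; rewrite powR_inv1 ?sqr_ge0//.
have [->|fx0] := eqVneq (f x) 0; first by rewrite invr0 mul0r.
by rewrite expr2 invfM mulrA mulfV// mul1r.
Qed.

Lemma measurable_fun_add f g : measurable_fun setT f -> measurable_fun setT g ->
  measurable_fun setT (fun x => f x + g x).
Proof. exact: measurable_funD. Qed.

Lemma measurable_fun_mul f g : measurable_fun setT f -> measurable_fun setT g ->
  measurable_fun setT (fun x => f x * g x).
Proof. exact: measurable_funM. Qed.

Lemma measurable_fun_opp f : measurable_fun setT f ->
  measurable_fun setT (fun x => - f x).
Proof. exact: measurable_funN. Qed.

Lemma measurable_fun_sgr f : measurable_fun setT f ->
  measurable_fun setT (fun x => Num.sg (f x)).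
Proof.
move=> mf; rewrite (_ : (fun x => Num.sg (f x)) = fun x => f x * `|f x|^-1).
  by apply: measurable_fun_mul => //; apply: measurable_fun_inv; exact: measurable_fun_normr.
apply/funext => x; have [->|fx0] := eqVneq (f x) 0; first by rewrite sgr0 mul0r.
by rewrite {2}[f x]numEsg mulfK// normr_eq0.
Qed.

Lemma measurable_fun_EFin f : measurable_fun setT f ->
  measurable_fun setT (fun x => (f x)%:E).
Proof. by move=> mf; apply/measurable_EFinP. Qed.

Lemma measurable_fun_adde (f g : T -> \bar R) : measurable_fun setT f ->
  measurable_fun setT g -> measurable_fun setT (fun x => (f x + g x)%E).
Proof. exact: emeasurable_funD. Qed.

Lemma measurable_fun_mule (f g : T -> \bar R) : measurable_fun setT f ->
  measurable_fun setT g -> measurable_fun setT (fun x => (f x * g x)%E).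
Proof. exact: emeasurable_funM. Qed.

Lemma measurable_fun_poweR (f : T -> \bar R) p : measurable_fun setT f ->
  measurable_fun setT (fun x => (f x `^ p)%E).
Proof. by apply: (measurableT_comp (measurable_poweR p)). Qed.

Lemma measurable_fun_abse (f : T -> \bar R) : measurable_fun setT f ->
  measurable_fun setT (fun x => `|f x|%E).
Proof. by apply: measurableT_comp; exact: abse_measurable. Qed.

Lemma measurable_fun_fine (f : T -> \bar R) : measurable_fun setT f ->
  measurable_fun setT (fun x => fine (f x)).
Proof. by apply: measurableT_comp; exact: fine_measurable. Qed.

Variable n : nat.
Implicit Types (u v : T -> 'rV[R]_n).

Lemma measurable_fun_coord u i : measurable_fun setT u ->
  measurable_fun setT (fun x => u x 0 i).
Proof. exact: (measurableT_comp (measurable_coord i)). Qed.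

Lemma measurable_fun_rVD u v : measurable_fun setT u -> measurable_fun setT v ->
  measurable_fun setT (fun x => u x + v x).
Proof.
move=> mu mv; apply: measurable_fun_rV => i; under eq_fun do rewrite mxE.
by apply: measurable_fun_add; exact: measurable_fun_coord.
Qed.

Lemma measurable_fun_rVN u : measurable_fun setT u ->
  measurable_fun setT (fun x => - u x).
Proof.
move=> mu; apply: measurable_fun_rV => i; under eq_fun do rewrite mxE.
by apply: measurable_fun_opp; exact: measurable_fun_coord.
Qed.

Lemma measurable_fun_rVZ f u : measurable_fun setT f -> measurable_fun setT u ->
  measurable_fun setT (fun x => f x *: u x).
Proof.
move=> mf mu; apply: measurable_fun_rV => i; under eq_fun do rewrite mxE.
by apply: measurable_fun_mul => //; exact: measurable_fun_coord.
Qed.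

Lemma measurable_fun_dotp u v : measurable_fun setT u -> measurable_fun setT v ->
  measurable_fun setT (fun x => dotp (u x) (v x)).
Proof.
move=> mu mv; rewrite /dotp; apply: measurable_sum => i.
by apply: measurable_fun_mul; exact: measurable_fun_coord.
Qed.

Lemma measurable_fun_enorm u : measurable_fun setT u ->
  measurable_fun setT (fun x => enorm (u x)).
Proof. by move=> mu; apply/measurable_fun_sqrtr/measurable_fun_dotp. Qed.

End measurability.

Ltac meas_step :=
  match goal with
  | |- measurable_fun _ (fun x => x) => exact: measurable_id
  | H : measurable_fun _ ?f |- measurable_fun _ ?f => exact: H
  | |- measurable_fun _ (fun x => fun_of_matrix (@?A x) _ _) => apply: measurable_fun_coord
  | |- measurable_fun _ (fun=> _) => exact: measurable_cst
  | |- measurable_fun _ (GRing.scale ?c) =>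
       apply: (@measurable_fun_rVZ _ _ _ _ (fun=> c) (fun x => x))
  | |- measurable_fun _ (GRing.mul ?c) =>
       apply: (@measurable_fun_mul _ _ _ (fun=> c) (fun x => x))
  | |- measurable_fun _ (GRing.add ?c) =>
       first [apply: (@measurable_fun_add _ _ _ (fun=> c) (fun x => x))
             |apply: (@measurable_fun_rVD _ _ _ _ (fun=> c) (fun x => x))]
  | |- measurable_fun _ GRing.opp =>
       first [apply: (@measurable_fun_opp _ _ _ (fun x => x))
             |apply: (@measurable_fun_rVN _ _ _ _ (fun x => x))]
  | |- measurable_fun _ (dotp ?z) =>
       apply: (@measurable_fun_dotp _ _ _ _ (fun=> z) (fun x => x))
  | |- measurable_fun _ EFin => apply: (@measurable_fun_EFin _ _ _ (fun x => x))
  | |- measurable_fun _ enorm => apply: (@measurable_fun_enorm _ _ _ _ (fun x => x))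
  | |- measurable_fun _ id => exact: measurable_id
  | |- measurable_fun _ fst => exact: measurable_fst
  | |- measurable_fun _ snd => exact: measurable_snd
  | |- measurable_fun _ (@fst _ _) => exact: measurable_fst
  | |- measurable_fun _ (@snd _ _) => exact: measurable_snd
  | |- measurable_fun _ (fun x => (fst (@?A x))) =>
       apply: (measurableT_comp measurable_fst)
  | |- measurable_fun _ (fun x => (snd (@?A x))) =>
       apply: (measurableT_comp measurable_snd)
  | |- measurable_fun _ (fun x => (@?A x, @?B x)) => apply: measurable_fun_pair
  | |- measurable_fun _ (fun x => dotp _ _) => apply: measurable_fun_dotp
  | |- measurable_fun _ (fun x => enorm _) => apply: measurable_fun_enorm
  | |- measurable_fun _ (fun x => (@?A x + @?B x)%R) =>
       first [apply: measurable_fun_add | apply: measurable_fun_rVD | apply: measurable_fun_adde]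
  | |- measurable_fun _ (fun x => (- @?A x)%R) =>
       first [apply: measurable_fun_opp | apply: measurable_fun_rVN]
  | |- measurable_fun _ (fun x => (@?A x * @?B x)%R) => apply: measurable_fun_mul
  | |- measurable_fun _ (fun x => (@?A x *: @?B x)%R) => apply: measurable_fun_rVZ
  | |- measurable_fun _ (fun x => ((@?A x)^-1)%R) => apply: measurable_fun_inv
  | |- measurable_fun _ (fun x => (@?A x ^+ _)%R) => apply: measurable_funX
  | |- measurable_fun _ (fun x => (@?A x `^ _)%R) => apply: measurable_fun_powR
  | |- measurable_fun _ (fun x => (@?A x `^ _)%E) => apply: measurable_fun_poweR
  | |- measurable_fun _ (fun x => `| @?A x |%R) => apply: measurable_fun_normr
  | |- measurable_fun _ (fun x => `| @?A x |%E) => apply: measurable_fun_abse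
  | |- measurable_fun _ (fun x => cos _) => apply: measurable_fun_cos
  | |- measurable_fun _ (fun x => sin _) => apply: measurable_fun_sin
  | |- measurable_fun _ (fun x => expR _) => apply: measurable_fun_expR
  | |- measurable_fun _ (fun x => ln _) => apply: measurable_fun_ln
  | |- measurable_fun _ (fun x => fine _) => apply: measurable_fun_fine
  | |- measurable_fun _ (fun x => Num.sg _) => apply: measurable_fun_sgr
  | |- measurable_fun _ (fun x => Num.sqrt _) => apply: measurable_fun_sqrtr
  | |- measurable_fun _ (fun x => (_%:E)%E) => apply: measurable_fun_EFin
  | |- measurable_fun _ (fun x => (@?A x * @?B x)%E) => apply: measurable_fun_mule
  | |- measurable_fun _ (fun x => (@?A x + @?B x)%E) => apply: measurable_fun_adde
  | H : measurable_fun _ ?f |- measurable_fun _ (fun x => ?f _) =>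
       apply: (measurableT_comp H)
  | H : measurable_fun _ (fun p => ?f (p.1) (p.2)) |-
       measurable_fun _ (fun x => ?f (@?A x) (@?B x)) =>
       apply: (measurableT_comp H (measurable_fun_pair (f := A) (g := B) _ _))
  | |- measurable_fun _ (EFin \o _) => apply: measurable_fun_EFin
  end.
Ltac meas := repeat (meas_step => //=).

Section lebesgue_rV_integral.
Context {R : realType}.
Local Open Scope ereal_scope.
Notation lam := (@lebesgue_measure R).

Lemma integral_rV_cons n (F : 'rV[R]_n.+1 -> \bar R) :
  measurable_fun setT F -> (forall x, 0 <= F x) ->
  \int[lebesgue_rV n.+1]_x F x =
  \int[lam]_a \int[lebesgue_rV n]_y F (rV_cons (a, y)).
Proof.
move=> mF F0; have mc := @measurable_rV_cons R n.
pose J := \int[pushforward (lam \x lebesgue_rV n) (@rV_cons R n)]_x F x.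
transitivity J; first by apply: eq_measure_integral => A mA _.
rewrite /J ge0_integral_pushforward// preimage_setT fubini_tonelli1//.
  by apply: measurableT_comp => //; exact: measurable_rV_cons.
by move=> x; exact: F0.
Qed.

(** Induction on the dimension: Tonelli peels off the first coordinate, and the one-dimensional
    change of variables contributes one factor [|c|]. The cases c = -1 and c = 1 give reflections
    and translations. *)
Lemma lebesgue_rV_affine n (F : 'rV[R]_n -> \bar R) (b : 'rV[R]_n) (c : R) :
  c != 0%R -> measurable_fun setT F -> (forall x, 0 <= F x) ->
  \int[lebesgue_rV n]_x F x =
  ((`|c| ^+ n)%R)%:E * \int[lebesgue_rV n]_x F (b + c *: x)%R.
Proof.
move=> c0; elim: n F b => [|n IH] F b mF F0.
  rewrite expr0 mul1e; apply: eq_integral => x _; congr F.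
  by apply/rowP => -[].
have mF1 a : measurable_fun setT (fun y => F (rV_cons (a, y))).
  apply: measurableT_comp => //.
  apply: measurableT_comp; [exact: measurable_rV_cons|exact: pair1_measurable].
rewrite integral_rV_cons// integral_rV_cons//; last first.
  by apply: measurableT_comp => //; meas.
pose b' : 'rV[R]_n := \row_j b 0%R (lift ord0 j).
have E a y : (b + c *: rV_cons (a, y) = rV_cons (b 0 ord0 + c * a, b' + c *: y))%R.
  apply/rowP => i; rewrite !mxE; case: unliftP => [j ->|->]//.
  by rewrite !mxE.
under eq_integral do rewrite (IH _ b')//.
under [in RHS]eq_integral do under eq_integral do rewrite E.
have m2 : measurable_fun setT (fun p : R * 'rV[R]_n =>
    F (rV_cons (b ord0 ord0 + c * p.1, b' + c *: p.2)%R)).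
  apply: measurableT_comp => //; apply: measurableT_comp.
    exact: measurable_rV_cons.
  by meas.
have m3 : measurable_fun setT (fun a : R => \int[lebesgue_rV n]_x F (rV_cons (a, b' + c *: x)%R)).
  apply: (@measurable_fun_fubini_tonelli_F _ _ R 'rV[R]_n R (lebesgue_rV n)
    (fun p => F (rV_cons (p.1, b' + c *: p.2)%R))) => //.
  apply: measurableT_comp => //; apply: measurableT_comp.
    exact: measurable_rV_cons.
  by meas.
rewrite ge0_integralZl; [|exact: measurableT|exact: m3|by move=> a _; exact: integral_ge0|by rewrite lee_fin exprn_ge0].
rewrite (lebesgue_affine (b 0%R ord0) c0) ?muleA//; last first.
  by move=> x; apply: integral_ge0.
by rewrite -EFinM exprSr.
Qed.

Lemma lebesgue_rV_reflect n (F : 'rV[R]_n -> \bar R) (b : 'rV[R]_n) :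
  measurable_fun setT F -> (forall x, 0 <= F x) ->
  \int[lebesgue_rV n]_x F (b - x)%R = \int[lebesgue_rV n]_x F x.
Proof.
move=> mF F0; rewrite [RHS](@lebesgue_rV_affine _ _ b (-1)) ?oppr_eq0 ?oner_eq0//.
by rewrite normrN1 expr1n mul1e; under [in RHS]eq_integral do rewrite scaleN1r.
Qed.

Lemma lebesgue_rV_translate n (F : 'rV[R]_n -> \bar R) (b : 'rV[R]_n) :
  measurable_fun setT F -> (forall x, 0 <= F x) ->
  \int[lebesgue_rV n]_x F (x + b)%R = \int[lebesgue_rV n]_x F x.
Proof.
move=> mF F0; rewrite [RHS](@lebesgue_rV_affine _ _ b 1)// ?oner_neq0//.
rewrite normr1 expr1n mul1e; under [in RHS]eq_integral do rewrite scale1r.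
by under eq_integral do rewrite addrC.
Qed.

End lebesgue_rV_integral.

Section euclidean_norm.
Context {R : realType} {n : nat}.
Implicit Types x y : 'rV[R]_n.

Lemma dotp_ge0 x : 0 <= dotp x x.
Proof. by apply: sumr_ge0 => i _; rewrite -expr2 sqr_ge0. Qed.

Lemma enorm_ge0 x : 0 <= enorm x. Proof. exact: sqrtr_ge0. Qed.

Lemma enorm_sqr x : enorm x ^+ 2 = dotp x x.
Proof. by rewrite sqr_sqrtr// dotp_ge0. Qed.

Lemma coord_le_enorm x i : `|x 0 i| <= enorm x.
Proof.
rewrite -sqrtr_sqr ler_wsqrtr// /dotp (bigD1 i)//= -expr2 lerDl.
by apply: sumr_ge0 => j _; rewrite -expr2 sqr_ge0.
Qed.

Lemma enormN x : enorm (- x) = enorm x.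
Proof.
rewrite /enorm; congr Num.sqrt; apply: eq_bigr => i _.
by rewrite !mxE mulrNN.
Qed.

Lemma enormZ a x : enorm (a *: x) = `|a| * enorm x.
Proof.
rewrite -sqrtr_sqr -sqrtrM ?sqr_ge0//; congr Num.sqrt.
rewrite /dotp mulr_sumr; apply: eq_bigr => i _.
by rewrite !mxE; ring.
Qed.

Lemma enormD_sqr_le x y : enorm (x + y) ^+ 2 <= 2 * enorm x ^+ 2 + 2 * enorm y ^+ 2.
Proof.
rewrite !enorm_sqr /dotp !mulr_sumr -big_split/=; apply: ler_sum => i _.
by rewrite !mxE -subr_ge0 (_ : _ - _ = (x 0 i - y 0 i) ^+ 2) ?sqr_ge0//; ring.
Qed.

Lemma dotpDl x y z : dotp (x + y) z = dotp x z + dotp y z.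
Proof. by rewrite /dotp -big_split/=; apply: eq_bigr => i _; rewrite !mxE mulrDl. Qed.

Lemma dotpNl x z : dotp (- x) z = - dotp x z.
Proof. by rewrite /dotp -sumrN; apply: eq_bigr => i _; rewrite !mxE mulNr. Qed.

Lemma dotpC x y : dotp x y = dotp y x.
Proof. by apply: eq_bigr => i _; rewrite mulrC. Qed.

End euclidean_norm.

(** * Power integrals on half-lines and Tonelli on a subdomain *)

Section calculus.
Context {R : realType}.
Implicit Types (F f : R -> R) (a b : R).
Notation lam := (@lebesgue_measure R).

Lemma FTC_closed F f a b : a < b ->
  (forall x, a <= x <= b -> is_derive x (1 : R) F (f x)) ->
  (forall x, a <= x <= b -> {for x, continuous f}) ->
  (\int[lam]_(x in `[a, b]) (f x)%:E = (F b - F a)%:E)%E.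
Proof.
move=> ab dF cf.
have cF x : a <= x <= b -> {for x, continuous F}.
  move=> xab; apply/differentiable_continuous/derivable1_diffP.
  by have [] := dF _ xab.
rewrite (@continuous_FTC2 _ f F)//.
- apply: continuous_in_subspaceT => x; rewrite inE/= in_itv/= => xab.
  exact: cf.
- split.
  + by move=> x; rewrite in_itv/= => /andP[/ltW ax /ltW xb]; have /dF[] : a <= x <= b; rewrite ?ax.
  + by apply/cvg_at_right_filter/cF; rewrite lexx ltW.
  + by apply/cvg_at_left_filter/cF; rewrite lexx ltW.
- move=> x; rewrite in_itv/= => /andP[/ltW ax /ltW xb].
  by have /dF[_ <-] : a <= x <= b; [rewrite ax xb|rewrite derive1E].
Qed.

Lemma FTC_infty F f a l :
  (forall x, a <= x -> 0 <= f x) ->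
  (forall x, a <= x -> is_derive x (1 : R) F (f x)) ->
  (forall x, a <= x -> {for x, continuous f}) ->
  F x @[x --> +oo] --> l ->
  (\int[lam]_(x in `[a, +oo[) (f x)%:E = (l - F a)%:E)%E.
Proof.
move=> f0 dF cf Fl.
rewrite (@ge0_continuous_FTC2y _ f F _ l)//.
- apply: continuous_in_subspaceT => x; rewrite inE/= in_itv/= andbT => xab.
  exact: cf.
- by move=> x /ltW ax; have [] := dF _ ax.
- apply/cvg_at_right_filter/differentiable_continuous/derivable1_diffP.
  by have [] := dF a (lexx a).
- move=> x; rewrite in_itv/= andbT => /ltW ax.
  by have [_ <-] := dF x ax; rewrite derive1E.
Qed.

Lemma is_derive1_powR (a x : R) : 0 < x ->
  is_derive x (1 : R) (fun y : R => y `^ a) (a * x `^ (a - 1)).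
Proof.
move=> x0; have xi : x \in `]0, +oo[ by rewrite in_itv/= x0.
by apply: DeriveDef; [exact: derivable_powR|rewrite -derive1E powR_derive1].
Qed.

Lemma continuous_powRl (a x : R) : 0 < x ->
  {for x, continuous (fun y : R => y `^ a)}.
Proof.
move=> x0; apply/differentiable_continuous/derivable1_diffP.
by have [] := is_derive1_powR a x0.
Qed.

Lemma powR_cvgy0 (a : R) : a < 0 -> (fun x : R => x `^ a) x @[x --> +oo] --> (0 : R).
Proof.
move=> a0; rewrite -[a]opprK.
apply/cvgrPdist_lt => e e0; near=> x.
have x0 : 0 < x by near: x; exact: nbhs_pinfty_gt.
rewrite sub0r normrN ger0_norm ?powR_ge0// powRN.
rewrite -[ltRHS]invrK ltf_pV2 ?posrE ?powR_gt0 ?invr_gt0//.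
have -> : e^-1 = ((e^-1) `^ (- a)^-1) `^ (- a).
  by rewrite -powRrM mulVf ?powRr1 ?invr_ge0 ?(ltW e0)// oppr_eq0 lt_eqF.
apply: gt0_ltr_powR; rewrite ?oppr_gt0// ?nnegrE ?powR_ge0 ?(ltW x0)//.
Unshelve. all: by end_near. Qed.

Lemma integral_powR_infty (d T : R) : 0 < d -> 0 < T ->
  (\int[lam]_(t in `[T, +oo[) (t `^ (- d - 1))%:E = (T `^ (- d) / d)%:E)%E.
Proof.
move=> d0 T0.
have dF x : T <= x ->
    is_derive x (1 : R) (fun t : R => - d^-1 * t `^ (- d)) (x `^ (- d - 1)).
  move=> Tx; have x0 : 0 < x by exact: lt_le_trans Tx.
  apply: is_derive_eq; first by apply: is_deriveZ; exact: is_derive1_powR.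
  by rewrite scalerA mulNr mulrN opprK mulVf ?gt_eqF// scale1r.
rewrite (FTC_infty (l := 0) _ dF).
- by rewrite sub0r mulNr opprK mulrC.
- by move=> x _; exact: powR_ge0.
- by move=> x Tx; apply: continuous_powRl; exact: lt_le_trans Tx.
- rewrite -(mulr0 (- d^-1)); apply: cvgMr.
  by apply: powR_cvgy0; rewrite oppr_lt0.
Qed.

Lemma integral_powR_0 (d T : R) : 0 < d -> 0 < T ->
  (\int[lam]_(t in `]0%R, T]) (t `^ (d - 1))%:E <= (T `^ d / d)%:E)%E.
Proof.
move=> d0 T0.
(* The antiderivative is differentiable only at positive points, so the interval is exhausted by
   [T/(k+2), T]; the offset 2 keeps the first of these nondegenerate. *)
have E : `]0%R, T]%classic = \bigcup_k `[T / k.+2%:R, T]%classic.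
  apply/seteqP; split => x /=; rewrite in_itv/=.
    move=> /andP[x0 xT].
    have [k hk] : exists k, (T / x < k%:R).
      by exists (Num.bound (T / x)); rewrite archi_boundP// divr_ge0// ltW.
    exists k => //=; rewrite in_itv/= xT andbT.
    rewrite ler_pdivrMr// mulrC -ler_pdivrMr// (le_trans (ltW hk))// ler_nat.
    by rewrite -addn2 leq_addr.
  move=> [k _] /=; rewrite in_itv/= => /andP[h ->]; rewrite andbT.
  by apply: lt_le_trans h; rewrite divr_gt0.
have := @ge0_nondecreasing_set_cvg_integral _ (measurableTypeR R) _
  (fun k => `[T / k.+2%:R, T]%classic) (fun t => (t `^ (d - 1))%:E) lam.
rewrite -E => H; rewrite -(cvg_lim (@ereal_hausdorff R) (H _ _ _ _)).
- apply: lime_le.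
    apply/cvg_ex; eexists; apply: H.
    + move=> i j ij; apply/subsetPset => x /=; rewrite !in_itv/= => /andP[h ->].
      rewrite andbT (le_trans _ h)// ler_pM2l// lef_pV2 ?posrE// ler_nat.
      by rewrite !ltnS.
    + by move=> i; exact: measurable_itv.
    + by move=> i; apply: measurable_funTS; meas.
    + by move=> i x _; rewrite lee_fin powR_ge0.
  apply: nearW => k.
  have k0 : 0 < T / k.+2%:R by rewrite divr_gt0.
  have kT : T / k.+2%:R < T by rewrite ltr_pdivrMr// ltr_pMr// ltr1n.
  have dF x : T / k.+2%:R <= x <= T ->
      is_derive x (1 : R) (fun t : R => d^-1 * t `^ d) (x `^ (d - 1)).
    move=> /andP[Tx _]; have x0 : 0 < x by exact: lt_le_trans Tx.
    apply: is_derive_eq; first by apply: is_deriveZ; exact: is_derive1_powR.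
    by rewrite scalerA mulVf ?gt_eqF// scale1r.
  rewrite (FTC_closed kT dF).
  + by rewrite lee_fin [leRHS]mulrC lerBlDr lerDl mulr_ge0 ?powR_ge0// invr_ge0 ltW.
  + by move=> x /andP[Tx _]; apply: continuous_powRl; exact: lt_le_trans Tx.
- move=> i j ij; apply/subsetPset => x /=; rewrite !in_itv/= => /andP[h ->].
  rewrite andbT (le_trans _ h)// ler_pM2l// lef_pV2 ?posrE// ler_nat.
  by rewrite !ltnS.
- by move=> i; exact: measurable_itv.
- by move=> i; apply: measurable_funTS; meas.
- by move=> i x _; rewrite lee_fin powR_ge0.
Qed.

End calculus.

Section tonelli_domain.
Context d1 d2 (T1 : measurableType d1) (T2 : measurableType d2) {R : realType}.
Variables (m1 : {sigma_finite_measure set T1 -> \bar R})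
          (m2 : {sigma_finite_measure set T2 -> \bar R}).
Local Open Scope ereal_scope.
Variables (D : set T2) (mD : measurable D) (f : T1 * T2 -> \bar R).
Hypotheses (mf : measurable_fun setT f) (f0 : forall z, 0 <= f z).

Let g z := (f \_ (setT `*` D)) z.

Let mg : measurable_fun setT g.
Proof.
apply/(measurable_restrictT _ _).1; first exact: measurableX.
exact: measurable_funS mf.
Qed.

Let g0 z : 0 <= g z. Proof. by rewrite /g patchE; case: ifP. Qed.

Let gE x y : g (x, y) = ((fun y => f (x, y)) \_ D) y.
Proof.
rewrite /g !patchE; congr (if _ then _ else _).
by apply/idP/idP; rewrite !inE => h //; case: h.
Qed.

Lemma tonelli_dom :
  \int[m1]_x \int[m2]_(y in D) f (x, y) = \int[m2]_(y in D) \int[m1]_x f (x, y).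
Proof.
transitivity (\int[m1]_x \int[m2]_y g (x, y)).
  by apply: eq_integral => x _; rewrite integral_mkcond; apply: eq_integral => y _; rewrite gE.
rewrite fubini_tonelli// [RHS]integral_mkcond; apply: eq_integral => y _.
rewrite patchE; case: ifPn => [yD|yD].
  by apply: eq_integral => x _; rewrite gE patchE yD.
by rewrite integral0_eq// => x _; rewrite gE patchE (negbTE yD).
Qed.

Lemma tonelli_dom_prod :
  \int[m1 \x m2]_(z in setT `*` D) f z = \int[m2]_(y in D) \int[m1]_x f (x, y).
Proof.
rewrite integral_mkcond fubini_tonelli2// [RHS]integral_mkcond; apply: eq_integral => y _.
rewrite patchE /fubini_G; case: ifPn => [yD|yD].
  by apply: eq_integral => x _; rewrite -/(g _) gE patchE yD.
by rewrite integral0_eq// => x _; rewrite -/(g _) gE patchE (negbTE yD).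
Qed.

Lemma measurable_fun_integral_dom :
  measurable_fun setT (fun x => \int[m2]_(y in D) f (x, y)).
Proof.
rewrite (_ : (fun x => _) = fubini_F m2 g); last first.
  apply/funext => x; rewrite /fubini_F [LHS]integral_mkcond.
  by apply: eq_integral => y _; rewrite gE.
exact: measurable_fun_fubini_tonelli_F.
Qed.

End tonelli_domain.

Section half_line.
Context {R : realType}.
Local Open Scope ereal_scope.
Notation lam := (@lebesgue_measure R).

(** Both pieces are closed at T, matching the two power integrals above; the common point is
    null. *)
Lemma integral_pos_split (T : R) (f : R -> \bar R) : (0 < T)%R ->
  measurable_fun setT f -> (forall x, 0 <= f x) ->
  \int[lam]_(t in `]0%R, +oo[) f t =
  \int[lam]_(t in `]0%R, T]) f t + \int[lam]_(t in `[T, +oo[) f t.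
Proof.
move=> T0 mf f0; rewrite -integral_itv_obnd_cbnd; last exact: measurable_funTS.
rewrite -ge0_integral_setU//; last 2 first.
- exact: measurable_funTS.
- apply/disj_setPS => x [] /=; rewrite !in_itv/= andbT => /andP[_ h1] h2.
  by rewrite ltNge h1 in h2.
congr integral; apply/seteqP; split => x /=; rewrite !in_itv/= !andbT.
- by move=> ->; case: (leP x T); [left|right].
- by move=> [/andP[]//|]; exact: lt_trans.
Qed.

(** For m > 0 this is the identity m^(-q) = q int_m^oo t^(-q-1) dt. At m = 0 the left side is 0 by
    the convention for powers of 0, so only an inequality is claimed. *)
Lemma powR_layer (q m : R) : (0 < q)%R -> (0 <= m)%R ->
  (m `^ (- q))%:E <=
  q%:E * \int[lam]_(t in `]0%R, +oo[) (if (m <= t)%R then t `^ (- q - 1) else 0)%:E.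
Proof.
move=> q0; rewrite le_eqVlt => /predU1P[<-|m0].
  rewrite powR0 ?oppr_eq0 ?gt_eqF// mule_ge0//; first by rewrite lee_fin ltW.
  by apply: integral_ge0 => t _; rewrite lee_fin; case: ifP => // _; exact: powR_ge0.
have -> : (m `^ (- q))%:E = q%:E * \int[lam]_(t in `[m, +oo[) (t `^ (- q - 1))%:E.
  by rewrite integral_powR_infty// -EFinM mulrCA mulfV ?mulr1// gt_eqF.
rewrite lee_wpmul2l ?lee_fin ?(ltW q0)// integral_mkcond [leRHS]integral_mkcond.
apply: le_nnintegral => t _; rewrite !patchE.
  by case: ifP => // _; rewrite lee_fin powR_ge0.
case: ifPn => [|_].
  rewrite inE/= in_itv/= andbT => mt; rewrite mem_set ?mt//=.
  by rewrite in_itv/= andbT (lt_le_trans m0).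
by case: ifP => // _; rewrite lee_fin; case: ifP => // _; exact: powR_ge0.
Qed.

End half_line.

(** * Radial integrals by the layer-cake formula *)

Section layer_cake.
Context d (X : measurableType d) {R : realType}.
Variable mu : {sigma_finite_measure set X -> \bar R}.
Local Open Scope ereal_scope.
Notation lam := (@lebesgue_measure R).

(** Integrate the pointwise formula for [m x] and exchange the integrals: at height t the measure of
    a sublevel set remains. With m built from |x| this estimates radial integrals on R^n from
    volumes of balls, without polar coordinates. *)
Lemma layer_cake (q : R) (m : X -> R) (A : set X) : (0 < q)%R ->
  measurable_fun setT m -> measurable A -> (forall x, (0 <= m x)%R) ->
  \int[mu]_(x in A) (m x `^ (- q))%:E <=
  q%:E * \int[lam]_(t in `]0%R, +oo[)
    ((t `^ (- q - 1))%:E * mu (A `&` [set x | (m x <= t)%R])).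
Proof.
move=> q0 mm mA m0.
pose F (z : X * R) : \bar R :=
  (\1_A z.1 * (if (m z.1 <= z.2)%R then z.2 `^ (- q - 1) else 0))%:E.
have F0 z : 0 <= F z.
  by rewrite lee_fin mulr_ge0//; case: ifP => // _; exact: powR_ge0.
have mF : measurable_fun setT F.
  apply: measurable_fun_EFin; apply: measurable_fun_mul.
    by apply: measurableT_comp => //; exact: measurable_fst.
  apply: measurable_fun_ifT; meas.
  by apply: measurable_fun_ler; meas.
apply: (@le_trans _ _ (\int[mu]_x (q%:E * \int[lam]_(t in `]0%R, +oo[) F (x, t)))).
  rewrite integral_mkcond; apply: le_nnintegral => x _.
    by rewrite patchE; case: ifP => // _; rewrite lee_fin powR_ge0.
  rewrite patchE; case: ifPn => [xA|xA].
    rewrite /F/= indicE xA; under eq_integral do rewrite mul1r.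
    exact: powR_layer.
  by rewrite mule_ge0 ?lee_fin ?(ltW q0)//; exact: integral_ge0.
rewrite ge0_integralZl//; last 3 first.
- exact: measurable_fun_integral_dom.
- by move=> x _; exact: integral_ge0.
- by rewrite lee_fin ltW.
rewrite tonelli_dom// lee_wpmul2l ?lee_fin ?(ltW q0)//.
apply: le_nnintegral => t _; first exact: integral_ge0.
rewrite -[X in _ * mu X]setIT -integral_indic//; last first.
  apply: measurableI => //; rewrite -[X in measurable X]setTI.
  by apply: measurable_fun_ler => //; exact: measurable_cst.
rewrite -ge0_integralZl//; last 2 first.
- apply: measurable_fun_EFin; apply: measurable_indic; apply: measurableI => //.
  rewrite -[X in measurable X]setTI.
  by apply: measurable_fun_ler => //; exact: measurable_cst.
- by rewrite lee_fin powR_ge0.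
apply: le_nnintegral => x _; rewrite ?F0// /F/= indicI -EFinM lee_fin/=.
rewrite mulrC [leRHS]mulrC -[leRHS]mulrA [leRHS]mulrC ler_wpM2r//.
rewrite indicE; case: ifPn => h; first by rewrite mem_set// mul1r.
by rewrite mulr_ge0// powR_ge0.
Qed.

End layer_cake.

Section boxes.
Context {R : realType}.
Notation lam := (@lebesgue_measure R).

Definition box n (A : 'I_n -> set R) : set 'rV[R]_n := [set x | forall i, A i (x 0 i)].

Lemma measurable_box n (A : 'I_n -> set R) :
  (forall i, measurable (A i)) -> measurable (box A).
Proof.
move=> mA; rewrite (_ : box A = \bigcap_(i in setT) ((fun x : 'rV[R]_n => x 0 i) @^-1` A i)).
  apply: fin_bigcap_measurable => // i _; rewrite -[X in measurable X]setTI.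
  exact: (measurable_coord i measurableT (mA i)).
by apply/seteqP; split => x /= h i; [move=> _; exact: h|exact: h].
Qed.

Lemma measure_box_cons n (A : 'I_n.+1 -> set R) : (forall i, measurable (A i)) ->
  lebesgue_rV n.+1 (box A) =
  (lam (A ord0) * lebesgue_rV n (box (fun j => A (lift ord0 j))))%E.
Proof.
move=> mA; rewrite -product_measure1E; [|exact: mA|exact: measurable_box].
rewrite [LHS](_ : _ = (lam \x lebesgue_rV n)%E (@rV_cons R n @^-1` box A))//.
congr ((_ \x _)%E _); apply/seteqP; split => -[a y] /=.
- move=> h; split => /=.
    by have := h ord0; rewrite mxE unlift_none.
  by move=> j; have := h (lift ord0 j); rewrite mxE liftK.
- by move=> [] /= h1 h2 i; rewrite mxE; case: unliftP => [j ->|->]//.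
Qed.

Lemma lebesgue_rV_cube n (r : R) : 0 <= r ->
  lebesgue_rV n (box (fun=> `[- r, r]%classic)) = ((2 * r) ^+ n)%:E.
Proof.
move=> r0; elim: n => [|n IH].
  rewrite /= diracE mem_set//= => -[] //.
rewrite measure_box_cons// IH exprS EFinM; congr (_ * _)%E.
rewrite lebesgue_measure_itv/= lte_fin; case: ifPn => h.
  by rewrite -EFinD opprK mulrDl mul1r.
have -> : r = 0 by apply/eqP; rewrite eq_le r0 andbT; lra.
by rewrite mulr0.
Qed.

(** Serves to discard the frequency 0, where negative powers of |xi| take the value 0 instead of
    being infinite. *)
Lemma lebesgue_rV_hyperplane n (i : 'I_n) (c : R) :
  lebesgue_rV n [set x | x 0 i = c] = 0%E.
Proof.
have E m (j : 'I_m) : [set x : 'rV[R]_m | x 0 j = c] =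
    box (fun k => if k == j then [set c] else setT).
  apply/seteqP; split => x /=.
    by move=> xj k; case: eqVneq => //= ->.
  by move=> /(_ j); rewrite eqxx.
have mA m (j : 'I_m) (k : 'I_m) : measurable (if k == j then [set c] else setT : set R).
  by case: eqVneq => // _; exact: measurable_set1.
elim: n i => [[]//|n IH] i.
rewrite [X in lebesgue_rV _ X](E _ i) measure_box_cons//; case: (unliftP ord0 i) => [j ->|->]; last first.
  by rewrite eqxx lebesgue_measure_set1 mul0e.
have {}IH : lebesgue_rV n (box (fun k => if k == j then [set c] else setT)) = 0%E by rewrite -(E _ j); exact: IH.
rewrite (_ : box _ = box (fun k => if k == j then [set c] else setT)).
  by rewrite IH mule0.
by congr box; apply/funext => k; rewrite (inj_eq (@lift_inj _ ord0)).
Qed.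

End boxes.

Section weights.
Context {R : realType} (n : nat).
Notation mu := (@lebesgue_rV R n).
Notation lam := (@lebesgue_measure R).
Implicit Types x y : 'rV[R]_n.

Lemma measurable_ball_enorm r : measurable [set x : 'rV[R]_n | enorm x <= r].
Proof.
rewrite -[X in measurable X]setTI.
by apply: (@measurable_fun_ler _ _ _ setT (fun x => enorm x) (fun=> r)); meas.
Qed.

Lemma ball_volume_le r : 0 <= r ->
  (mu [set x | (enorm x <= r)%R] <= ((2 * r) ^+ n)%:E)%E.
Proof.
move=> r0; rewrite -lebesgue_rV_cube// le_measure// ?inE.
- exact: measurable_ball_enorm.
- by apply: measurable_box => i; exact: measurable_itv.
- move=> x /= xr i; rewrite /= in_itv/= -ler_norml.
  exact: le_trans (coord_le_enorm x i) xr.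
Qed.

(** The set where max(T, |x|) <= t is empty for t < T and otherwise lies in the ball of radius t, of
    volume at most (2t)^n. The layer-cake formula then leaves int_T^oo t^(-s-1) dt = T^(-s) / s. *)
Lemma integral_max_enorm (s T : R) : 0 < s -> 0 < T ->
  (\int[mu]_x ((Num.max T (enorm x)) `^ (- (n%:R + s)))%:E <=
   ((n%:R + s) / s * 2 ^+ n * T `^ (- s))%:E)%E.
Proof.
move=> s0 T0; have q0 : 0 < n%:R + s by rewrite ltr_wpDl.
have m0 x : 0 <= Num.max T (enorm x) by rewrite le_max enorm_ge0 orbT.
have mm : measurable_fun setT (fun x : 'rV[R]_n => Num.max T (enorm x)).
  by apply: measurable_maxr; meas.
apply: le_trans (layer_cake mu q0 mm measurableT m0) _.
rewrite -!mulrA EFinM lee_wpmul2l ?lee_fin ?(ltW q0)//.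
apply: (@le_trans _ _ (\int[lam]_(t in `[T, +oo[) ((2 ^+ n)%:E * (t `^ (- s - 1))%:E))%E).
  rewrite integral_mkcond [leRHS]integral_mkcond; apply: le_nnintegral => t _.
    by rewrite patchE; case: ifP => // _; rewrite mule_ge0// lee_fin powR_ge0.
  rewrite !patchE; case: ifPn => [|_]; last first.
    by case: ifP => // _; rewrite mule_ge0// lee_fin ?powR_ge0// exprn_ge0.
  rewrite inE/= in_itv/= andbT => t0; rewrite setTI.
  case: ifPn => [_|/negP tT]; last first.
    rewrite (_ : [set _ | _] = set0) ?measure0 ?mule0//.
    apply/seteqP; split => x //=; rewrite ge_max => /andP[h _]; apply: tT.
    by rewrite inE/= in_itv/= h.
  apply: (@le_trans _ _ ((t `^ (- (n%:R + s) - 1))%:E * ((2 * t) ^+ n)%:E)%E).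
    rewrite lee_wpmul2l ?lee_fin ?powR_ge0//.
    apply: le_trans (ball_volume_le (ltW t0)).
    rewrite le_measure// ?inE; last by move=> x /=; rewrite ge_max => /andP[].
      rewrite -[X in measurable X]setTI.
      by apply: (@measurable_fun_ler _ _ _ setT _ (fun=> t)) => //; meas.
    exact: measurable_ball_enorm.
  rewrite lee_fin exprMn mulrCA ler_wpM2l ?exprn_ge0// -powR_mulrn ?(ltW t0)//.
  rewrite -powRD; last by rewrite (gt_eqF t0) implybT.
  by rewrite le_eqVlt; apply/orP; left; apply/eqP; congr (_ `^ _); ring.
rewrite ge0_integralZl_EFin ?exprn_ge0//; last 2 first.
- by move=> t _; rewrite lee_fin powR_ge0.
- by apply: measurable_funTS; meas.
rewrite integral_powR_infty// -EFinM lee_fin.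
by rewrite le_eqVlt; apply/orP; left; apply/eqP; ring.
Qed.

(** Within the ball of radius T the sublevel sets of |x| have volume at most (2 min(t, T))^n. The
    heights t <= T contribute 1/(n - g), the heights t > T contribute 1/g. *)
Lemma integral_ball_enorm_powR (g T : R) : 0 < g -> g < n%:R -> 0 < T ->
  (\int[mu]_(x in [set x : 'rV[R]_n | (enorm x <= T)%R]) (enorm x `^ (- g))%:E <=
   (g * 2 ^+ n * ((n%:R - g)^-1 + g^-1) * T `^ (n%:R - g))%:E)%E.
Proof.
move=> g0 gn T0.
have ng0 : 0 < n%:R - g by rewrite subr_gt0.
have me : measurable_fun setT (fun x : 'rV[R]_n => enorm x) by meas.
apply: le_trans (layer_cake mu g0 me (measurable_ball_enorm T) (@enorm_ge0 _ _)) _.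
rewrite -!mulrA EFinM lee_wpmul2l ?lee_fin ?(ltW g0)//.
pose I := fun t : R => ((t `^ (- g - 1))%:E *
  mu ([set x | (enorm x <= T)%R] `&` [set x | (enorm x <= t)%R]))%E.
have I0 t : (0 <= I t)%E by rewrite mule_ge0// lee_fin powR_ge0.
pose J := fun t : R => ((2 ^+ n)%:E * (t `^ (n%:R - g - 1))%:E)%E.
pose K := fun t : R => ((2 ^+ n * T `^ n%:R)%:E * (t `^ (- g - 1))%:E)%E.
have mIc t c : measurable ([set x | enorm x <= t] `&` [set x : 'rV[R]_n | enorm x <= c]).
  by apply: measurableI; exact: measurable_ball_enorm.
have IJ t : 0 < t -> (I t <= J t)%E.
  move=> t0; apply: (@le_trans _ _ ((t `^ (- g - 1))%:E * ((2 * t) ^+ n)%:E)%E).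
    rewrite lee_wpmul2l ?lee_fin ?powR_ge0//.
    apply: le_trans (ball_volume_le (ltW t0)).
    by rewrite le_measure// ?inE//; exact: measurable_ball_enorm.
  rewrite lee_fin exprMn mulrCA ler_wpM2l ?exprn_ge0// -powR_mulrn ?(ltW t0)//.
  rewrite -powRD; last by rewrite (gt_eqF t0) implybT.
  by rewrite le_eqVlt; apply/orP; left; apply/eqP; congr (_ `^ _); ring.
have IK t : (I t <= K t)%E.
  apply: (@le_trans _ _ ((t `^ (- g - 1))%:E * ((2 * T) ^+ n)%:E)%E).
    rewrite lee_wpmul2l ?lee_fin ?powR_ge0//.
    apply: le_trans (ball_volume_le (ltW T0)).
    by rewrite le_measure// ?inE//; exact: measurable_ball_enorm.
  by rewrite lee_fin exprMn [leLHS]mulrC -(powR_mulrn _ (ltW T0)).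
apply: (@le_trans _ _ (\int[lam]_(t in `]0%R, +oo[) (if (t <= T)%R then J t else K t))%E).
  apply: le_nnintegral => t; rewrite /= in_itv/= andbT => t0; first exact: I0.
  by case: ifPn => _; [exact: IJ|exact: IK].
rewrite (integral_pos_split T0); last 2 first.
- apply: measurable_fun_ifT; rewrite /J /K; meas.
  by apply: (@measurable_fun_ler _ _ _ setT _ (fun=> T)) => //; meas.
- by move=> x; case: ifP => _; rewrite mule_ge0// lee_fin ?powR_ge0 ?mulr_ge0 ?powR_ge0.
have -> : (2 ^+ n * (((n%:R - g)^-1 + g^-1) * T `^ (n%:R - g)))%:E =
   (2 ^+ n * (T `^ (n%:R - g) / (n%:R - g)))%:E
   + (2 ^+ n * T `^ n%:R * (T `^ (- g) / g))%:E :> \bar R.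
  rewrite -EFinD; congr EFin; rewrite -[in RHS]mulrA -mulrDr; congr (_ * _).
  rewrite [in RHS]mulrA -powRD; last by rewrite (gt_eqF T0) implybT.
  by ring.
apply: leeD.
- apply: (@le_trans _ _ (\int[lam]_(t in `]0%R, T]) J t)%E).
    apply: le_nnintegral => t; rewrite /= in_itv/= => /andP[t0 tT]; rewrite tT//.
    by rewrite mule_ge0// lee_fin powR_ge0.
  rewrite ge0_integralZl_EFin ?exprn_ge0//; last 2 first.
  + by move=> t _; rewrite lee_fin powR_ge0.
  + by apply: measurable_funTS; meas.
  by rewrite EFinM lee_wpmul2l ?lee_fin ?exprn_ge0//; exact: integral_powR_0.
- apply: (@le_trans _ _ (\int[lam]_(t in `[T, +oo[) K t)%E).
    apply: le_nnintegral => t; rewrite /= in_itv/= andbT => tT.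
      by case: ifP => _; rewrite mule_ge0// lee_fin ?powR_ge0 ?mulr_ge0 ?powR_ge0.
    case: ifPn => tT'//; have -> : t = T by apply/eqP; rewrite eq_le tT tT'.
    rewrite /J /K lee_fin -mulrA ler_wpM2l ?exprn_ge0// -powRD ?(gt_eqF T0) ?implybT//.
    by rewrite le_eqVlt; apply/orP; left; apply/eqP; congr (_ `^ _); ring.
  rewrite ge0_integralZl_EFin ?mulr_ge0 ?exprn_ge0 ?powR_ge0//; last 2 first.
  + by move=> t _; rewrite lee_fin powR_ge0.
  + by apply: measurable_funTS; meas.
  by rewrite integral_powR_infty.
Qed.

End weights.

(** * The Poisson kernel *)

Section gamma.
Context {R : realType}.
Notation lam := (@lebesgue_measure R).
Implicit Types (p t a : R).

Lemma integral_ge_cst d (T : measurableType d) (mu : {measure set T -> \bar R})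
    (D A : set T) (f : T -> \bar R) (m : R) :
  measurable A -> A `<=` D -> 0 <= m ->
  (forall x, D x -> (0 <= f x)%E) -> (forall x, A x -> (m%:E <= f x)%E) ->
  (m%:E * mu A <= \int[mu]_(x in D) f x)%E.
Proof.
move=> mA AD m0 f0 fm; rewrite -integral_cst// integral_mkcond [leRHS]integral_mkcond.
apply: le_nnintegral => x _; rewrite !patchE; first by case: ifP => // _; rewrite lee_fin.
case: ifPn => [/set_mem xA|_]; first by rewrite mem_set; [exact: fm|exact: AD].
by case: ifPn => // /set_mem; exact: f0.
Qed.

(** The inequality exp(t/p) >= t/p, raised to the power p. *)
Lemma powR_expRN_le p t : 0 < p -> 0 <= t -> t `^ p * expR (- t) <= p `^ p.
Proof.
move=> p0 t0; rewrite -ler_pdivlMr ?expR_gt0// expRN invrK.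
have -> : expR t = expR (t / p) `^ p by rewrite -expRM mulrVK// unitfE gt_eqF.
rewrite -powRM ?expR_ge0 ?(ltW p0)//; apply: ge0_ler_powR; rewrite ?nnegrE ?(ltW p0)//.
  by rewrite mulr_ge0 ?expR_ge0 ?(ltW p0).
rewrite -ler_pdivrMl// mulrC (le_trans _ (expR_ge1Dx _))// lerDr//.
Qed.

Lemma Gamma_integral_lty a : 0 < a ->
  (\int[lam]_(t in `]0%R, +oo[) (t `^ (a - 1) * expR (- t))%:E < +oo)%E.
Proof.
move=> a0; have f0 t : (0 <= (t `^ (a - 1) * expR (- t))%:E)%E.
  by rewrite lee_fin mulr_ge0 ?powR_ge0 ?expR_ge0.
rewrite (integral_pos_split ltr01)//; last by meas.
apply: lte_add_pinfty.
  apply: le_lt_trans (le_lt_trans (integral_powR_0 a0 ltr01) (ltry _)).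
  apply: le_nnintegral => t; rewrite /= in_itv/= => /andP[t0 t1]//.
  rewrite lee_fin ger_pMr ?powR_gt0// -expR0 ler_expR; lra.
apply: (@le_lt_trans _ _ (\int[lam]_(t in `[1%R, +oo[)
   (((a + 1) `^ (a + 1))%:E * (t `^ (- 1 - 1))%:E))%E).
  apply: le_nnintegral => t; rewrite /= in_itv/= andbT => t1//.
  have t0 : 0 < t by exact: lt_le_trans t1.
  have -> : t `^ (a - 1) = t `^ (a + 1) * t `^ (- 1 - 1).
    by rewrite -powRD ?(gt_eqF t0) ?implybT//; congr (_ `^ _); ring.
  rewrite -EFinM lee_fin mulrAC ler_wpM2r ?powR_ge0// powR_expRN_le ?(ltW t0)//.
  by rewrite addr_gt0.
rewrite ge0_integralZl_EFin ?powR_ge0//; last 2 first.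
- by move=> t _; rewrite lee_fin powR_ge0.
- by apply: measurable_funTS; meas.
by rewrite integral_powR_infty// -EFinM ltry.
Qed.

Lemma Gamma_gt0 a : 0 < a -> 0 < Gamma a.
Proof.
move=> a0; rewrite /Gamma /Rintegral fine_gt0// Gamma_integral_lty// andbT.
(* On [1, 2] one has t^(a-1) = t^a / t >= 1/2 whatever the sign of a - 1, and exp(-t) >= exp(-2). *)
have H : ((2^-1 * expR (- 2))%:E * lam `[1%R, 2%R]%classic <=
    \int[lam]_(t in `]0%R, +oo[) (t `^ (a - 1) * expR (- t))%:E)%E.
  apply: integral_ge_cst.
  - exact: measurable_itv.
  - by move=> x /=; rewrite !in_itv/= andbT => /andP[+ _]; exact: lt_le_trans.
  - by rewrite mulr_ge0 ?expR_ge0.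
  - by move=> t _; rewrite lee_fin mulr_ge0 ?powR_ge0 ?expR_ge0.
  - move=> t /=; rewrite in_itv/= => /andP[t1 t2]; rewrite lee_fin.
    have t0 : 0 < t by lra.
    apply: ler_pM; rewrite ?expR_ge0 ?ler_expR ?lerN2//.
    rewrite powRB; last by rewrite (gt_eqF t0) implybT.
    rewrite powRr1 ?(ltW t0)// -[2^-1]mul1r ler_pM ?lef_pV2 ?posrE//.
    by have := ler_powR t1 (ltW a0); rewrite powRr0.
apply: lt_le_trans H; rewrite lebesgue_measure_itv/= lte_fin ltr1n -EFinD -EFinM.
by rewrite lte_fin !mulr_gt0 ?expR_gt0//; lra.
Qed.

End gamma.

Section poisson.
Context {R : realType} (n : nat) (s : R) (s0 : 0 < s).
Notation mu := (@lebesgue_rV R n).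
Implicit Types (x y : 'rV[R]_n) (t : R).
Notation c0 := (@poisson_cst R n s).
Notation pk := (@poisson_kernel R n s).
Let h : R := (n%:R + s) / 2.

Let h0 : 0 < h. Proof. by rewrite divr_gt0// ltr_wpDl. Qed.

Lemma poisson_cst_gt0 : 0 < c0.
Proof.
apply: divr_gt0; first exact: Gamma_gt0 h0.
by rewrite mulr_gt0 ?powR_gt0 ?pi_gt0// Gamma_gt0// divr_gt0.
Qed.

Lemma poisson_cst_ge0 : 0 <= c0. Proof. exact/ltW/poisson_cst_gt0. Qed.

Let pref_ge0 t : 0 <= c0 * t `^ s.
Proof. exact: mulr_ge0 poisson_cst_ge0 (powR_ge0 _ _). Qed.

Lemma poisson_kernelE t x : pk t x = c0 * t `^ s * (enorm x ^+ 2 + t ^+ 2) `^ (- h).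
Proof. by rewrite /poisson_kernel powRN. Qed.

Lemma poisson_kernel_ge0 t x : 0 <= pk t x.
Proof. by rewrite poisson_kernelE mulr_ge0 ?pref_ge0 ?powR_ge0. Qed.

Lemma measurable_fun_poisson d (T : measurableType d) (f : T -> R) (u : T -> 'rV[R]_n) :
  measurable_fun setT f -> measurable_fun setT u ->
  measurable_fun setT (fun z => pk (f z) (u z)).
Proof.
move=> mf mu'; rewrite (_ : (fun z => _) = fun z =>
    c0 * f z `^ s * (enorm (u z) ^+ 2 + f z ^+ 2) `^ (- h)); first by meas.
by apply/funext => z; exact: poisson_kernelE.
Qed.

Lemma poisson_kernel_le_max t x : 0 < t ->
  pk t x <= c0 * t `^ s * Num.max t (enorm x) `^ (- (n%:R + s)).
Proof.
move=> t0; rewrite poisson_kernelE (ler_wpM2l (pref_ge0 t))//.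
have m0 : 0 < Num.max t (enorm x) by rewrite lt_max t0.
have p0 : 0 < enorm x ^+ 2 + t ^+ 2 by rewrite ltr_wpDl ?sqr_ge0// exprn_gt0.
rewrite !powRN lef_pV2 ?posrE ?powR_gt0//.
have -> : n%:R + s = 2%:R * h by rewrite /h; field.
rewrite powRrM powR_mulrn ?(ltW m0)//.
apply: ge0_ler_powR; rewrite ?nnegrE ?(ltW h0) ?(ltW p0) ?exprn_ge0 ?(ltW m0)//.
by rewrite /Num.max; case: ifP => _; rewrite ?lerDl ?lerDr sqr_ge0.
Qed.

Lemma poisson_kernel_le t x : 0 < t -> pk t x <= c0 * t `^ (- n%:R).
Proof.
move=> t0; apply: le_trans (poisson_kernel_le_max x t0) _.
rewrite -mulrA (ler_wpM2l poisson_cst_ge0)//.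
apply: (@le_trans _ _ (t `^ s * t `^ (- (n%:R + s)))).
  rewrite ler_wpM2l ?powR_ge0// !powRN lef_pV2 ?posrE ?powR_gt0 ?lt_max ?t0//.
  apply: ge0_ler_powR; rewrite ?nnegrE ?le_max ?lexx ?(ltW t0)//.
  by rewrite addr_ge0// ltW.
by rewrite -powRD ?(gt_eqF t0) ?implybT// opprD addrCA subrr addr0.
Qed.

(** An explicit upper bound for the mass of the kernel, from [integral_max_enorm]; it enters the
    constants of the potential estimates. The exact mass is [poisson_total]. *)
Definition poisson_mass : R := c0 * ((n%:R + s) / s * 2 ^+ n).

Lemma poisson_mass_gt0 : 0 < poisson_mass.
Proof.
apply: mulr_gt0; first exact: poisson_cst_gt0.
by rewrite mulr_gt0 ?exprn_gt0// divr_gt0// ltr_wpDl.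
Qed.

Lemma integral_poisson_le t : 0 < t -> (\int[mu]_x (pk t x)%:E <= poisson_mass%:E)%E.
Proof.
move=> t0.
have k0 := pref_ge0 t.
apply: (@le_trans _ _ (\int[mu]_x ((c0 * t `^ s)%:E *
    (Num.max t (enorm x) `^ (- (n%:R + s)))%:E))%E).
  apply: le_nnintegral => x _; rewrite lee_fin ?poisson_kernel_ge0//.
  exact: poisson_kernel_le_max.
rewrite ge0_integralZl_EFin//; last 2 first.
- by move=> x _; rewrite lee_fin powR_ge0.
- by apply/measurable_fun_EFin/measurable_fun_powR/measurable_maxr; meas.
apply: (@le_trans _ _ ((c0 * t `^ s)%:E *
    ((n%:R + s) / s * 2 ^+ n * t `^ (- s))%:E)%E).
  by rewrite lee_wpmul2l// integral_max_enorm.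
rewrite -EFinM lee_fin /poisson_mass -[leLHS]mulrA (ler_wpM2l poisson_cst_ge0)//.
rewrite mulrCA -powRD ?(gt_eqF t0) ?implybT// subrr powRr0 mulr1//.
Qed.

(** Homogeneity p_t(x) = t^(-n) p_1(x/t), which makes the mass of p_t the same for all t. *)
Lemma poisson_kernel_scale t x : 0 < t -> pk 1 (t^-1 *: x) = t ^+ n * pk t x.
Proof.
move=> t0; rewrite !poisson_kernelE powR1 mulr1 expr1n; move: c0 => c.
rewrite [RHS]mulrC -!mulrA; congr (_ * _).
rewrite enormZ normfV gtr0_norm// exprMn.
have -> : t^-1 ^+ 2 * enorm x ^+ 2 + 1 = t `^ (- 2%:R) * (enorm x ^+ 2 + t ^+ 2).
  rewrite powRN powR_mulrn ?(ltW t0)// mulrDr mulVf ?expf_neq0 ?gt_eqF//.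
  by rewrite exprVn.
rewrite powRM ?powR_ge0 ?addr_ge0 ?sqr_ge0// [_ * t ^+ n]mulrC [RHS]mulrA; congr (_ * _).
rewrite -powRrM -powR_mulrn ?(ltW t0)// -powRD ?(gt_eqF t0) ?implybT//.
by congr (_ `^ _); rewrite /h; field.
Qed.

Definition poisson_total : R := fine (\int[mu]_x (pk 1 x)%:E).

Lemma integral_poisson t : 0 < t -> (\int[mu]_x (pk t x)%:E = poisson_total%:E)%E.
Proof.
move=> t0; have P1 : (\int[mu]_x (pk 1 x)%:E \is a fin_num)%E.
  rewrite ge0_fin_numE; last first.
    by apply: integral_ge0 => x _; rewrite lee_fin poisson_kernel_ge0.
  exact: le_lt_trans (integral_poisson_le ltr01) (ltry _).
rewrite /poisson_total (fineK P1).
have tn0 : t^-1 != 0 by rewrite invr_neq0// gt_eqF.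
have mp : measurable_fun setT (fun x : 'rV[R]_n => (pk 1 x)%:E).
  by apply/measurable_fun_EFin/measurable_fun_poisson; meas.
have p0 x : (0 <= (pk 1 x)%:E)%E by rewrite lee_fin poisson_kernel_ge0.
apply: etrans (esym (lebesgue_rV_affine 0 tn0 mp p0)).
under [in RHS]eq_integral do rewrite add0r poisson_kernel_scale// EFinM.
rewrite ge0_integralZl_EFin ?exprn_ge0 ?(ltW t0)//; last 2 first.
- by move=> x _; rewrite lee_fin poisson_kernel_ge0.
- by apply/measurable_fun_EFin/measurable_fun_poisson; meas.
rewrite muleA -EFinM normfV gtr0_norm// exprVn mulVf ?mul1e//.
by rewrite expf_neq0// gt_eqF.
Qed.

Lemma poisson_total_gt0 : 0 < poisson_total.
Proof.
rewrite -lte_fin -(integral_poisson ltr01).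
(* A lower bound of p_1 on the cube [-1, 1]^n, where |x|^2 <= n. *)
pose m : R := c0 * (n%:R + 1) `^ (- h).
have m0 : 0 < m by apply: mulr_gt0; [exact: poisson_cst_gt0|rewrite powR_gt0 ?ltr_wpDl].
have H : (m%:E * mu (box (fun=> `[(- 1)%R, 1%R]%classic)) <= \int[mu]_x (pk 1 x)%:E)%E.
  apply: integral_ge_cst => //.
  - by apply: measurable_box => i; exact: measurable_itv.
  - exact: ltW.
  - by move=> x _; rewrite lee_fin poisson_kernel_ge0.
  - move=> x xb; rewrite lee_fin poisson_kernelE powR1 mulr1 expr1n.
  rewrite (ler_wpM2l poisson_cst_ge0)//.
  rewrite !powRN lef_pV2 ?posrE ?powR_gt0 ?ltr_wpDl ?sqr_ge0//.
  apply: ge0_ler_powR; rewrite ?nnegrE ?addr_ge0 ?sqr_ge0 ?(ltW h0)// lerD2r.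
  have -> : n%:R = \sum_(i < n) (1 : R) by rewrite sumr_const card_ord.
  rewrite enorm_sqr; apply: ler_sum => i _.
  by have := xb i; rewrite /= in_itv/= => /andP[x1 x2]; nra.
apply: lt_le_trans H.
by rewrite lebesgue_rV_cube// -EFinM lte_fin mulr_gt0// exprn_gt0// mulr1.
Qed.

End poisson.

Section poisson_derivative.
Context {R : realType} (n : nat) (s : R) (s0 : 0 < s).
Notation mu := (@lebesgue_rV R n).
Implicit Types (x y : 'rV[R]_n) (t : R).
Notation c0 := (@poisson_cst R n s).
Notation pk := (@poisson_kernel R n s).
Let h : R := (n%:R + s) / 2.

Let h0 : 0 < h. Proof. by rewrite divr_gt0// ltr_wpDl. Qed.

Let base_gt0 t x : 0 < t -> 0 < enorm x ^+ 2 + t ^+ 2.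
Proof. by move=> t0; rewrite ltr_wpDl ?sqr_ge0// exprn_gt0. Qed.

(** The kernel q_t = d/dt p_t, written as p_t times its logarithmic derivative, so that |q_t| is
    visibly at most a constant over t times p_t. *)
Definition poisson_dt t x : R :=
  pk t x * (s / t - (n%:R + s) * t / (enorm x ^+ 2 + t ^+ 2)).

Lemma is_derive_poisson t x : 0 < t ->
  is_derive t (1 : R) (fun r : R => pk r x) (poisson_dt t x).
Proof.
move=> t0; rewrite (_ : (fun r => _) =
  fun r : R => c0 * (r `^ s * (enorm x ^+ 2 + r ^+ 2) `^ (- h))); last first.
  by apply/funext => r; rewrite poisson_kernelE -mulrA.
have B0 := base_gt0 x t0.
have d1 := is_derive1_powR s t0.
have d2 : is_derive t (1 : R) (fun r : R => enorm x ^+ 2 + r ^+ 2) (2 * t).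
  by apply: is_derive_eq; rewrite add0r mul1r /GRing.scale/= mulr1 mulrDl mul1r.
have d3 := is_derive1_powR (- h) B0.
have d4 : is_derive t (1 : R) (fun r : R => (enorm x ^+ 2 + r ^+ 2) `^ (- h))
    ((- h * (enorm x ^+ 2 + t ^+ 2) `^ (- h - 1)) * (2 * t)).
  exact: (@is_derive1_comp _ (fun r : R => r `^ (- h)) (fun r : R => enorm x ^+ 2 + r ^+ 2) _ _ _ d3 d2).
have d5 : is_derive t (1 : R)
    (fun r : R => c0 * (r `^ s * (enorm x ^+ 2 + r ^+ 2) `^ (- h)))
    (c0 * (t `^ s * ((- h * (enorm x ^+ 2 + t ^+ 2) `^ (- h - 1)) * (2 * t)) +
     (enorm x ^+ 2 + t ^+ 2) `^ (- h) * (s * t `^ (s - 1)))).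
  exact: (is_deriveZ c0 (is_deriveM d1 d4)).
apply: is_derive_eq; rewrite /poisson_dt poisson_kernelE.
rewrite (powRB (r := - h) (s := 1)) ?(gt_eqF B0) ?implybT//.
rewrite (powRB (r := s) (s := 1)) ?(gt_eqF t0) ?implybT//.
rewrite !powRr1 ?(ltW t0) ?(ltW B0)//.
move: c0 ((_ + _) `^ _) (t `^ s) => c A D; rewrite /h.
move: (enorm x ^+ 2 + t ^+ 2) B0 => B /gt_eqF B0; field.
by rewrite B0 (gt_eqF t0).
Qed.

Lemma poisson_dt_le t x : 0 < t ->
  `|poisson_dt t x| <= (n%:R + 2 * s) / t * pk t x.
Proof.
move=> t0; have B0 := base_gt0 x t0.
rewrite /poisson_dt normrM (ger0_norm (poisson_kernel_ge0 s0 _ _)) mulrC.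
rewrite ler_wpM2r ?poisson_kernel_ge0//.
apply: le_trans (ler_normB _ _) _; rewrite ger0_norm ?divr_ge0 ?(ltW s0) ?(ltW t0)//.
rewrite ger0_norm; last first.
  by rewrite divr_ge0 ?(ltW B0)// mulr_ge0 ?addr_ge0 ?(ltW s0) ?(ltW t0).
have -> : (n%:R + 2 * s) / t = s / t + (n%:R + s) / t by field; rewrite gt_eqF.
rewrite lerD2l -mulrA ler_wpM2l ?addr_ge0 ?(ltW s0)//.
rewrite ler_pdivrMr// mulrDr; apply: ler_wpDl.
  by rewrite mulr_ge0 ?invr_ge0 ?sqr_ge0 ?(ltW t0).
by rewrite expr2 mulKf// gt_eqF.
Qed.

Lemma measurable_fun_poisson_dt d (T : measurableType d) (f : T -> R) (u : T -> 'rV[R]_n) :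
  measurable_fun setT f -> measurable_fun setT u ->
  measurable_fun setT (fun z => poisson_dt (f z) (u z)).
Proof.
move=> mf mu'; rewrite /poisson_dt; apply: measurable_fun_mul; last by meas.
exact: measurable_fun_poisson.
Qed.

Lemma continuous_poisson t x : 0 < t -> {for t, continuous (fun r : R => pk r x)}.
Proof.
move=> t0; apply/differentiable_continuous/derivable1_diffP.
by have [] := is_derive_poisson x t0.
Qed.

Lemma continuous_poisson_dt t x : 0 < t ->
  {for t, continuous (fun r : R => poisson_dt r x)}.
Proof.
move=> t0; have B0 := base_gt0 x t0.
apply: cvgM; first exact: continuous_poisson.
have ct : r @[r --> t] --> t by exact: cvg_id.
have cB : (enorm x ^+ 2 + r ^+ 2) @[r --> t] --> enorm x ^+ 2 + t ^+ 2.
  by apply: cvgD; [exact: cvg_cst|exact: (cvgM ct ct)].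
apply: cvgB.
- apply: cvgM; first exact: cvg_cst.
  by apply: cvgV => //; rewrite gt_eqF.
- apply: cvgM; first by apply: cvgM => //; exact: cvg_cst.
  by apply: cvgV => //; rewrite gt_eqF.
Qed.

(** Rests on min(1, t0^2) (|x|^2 + 1) <= |x|^2 + t^2. For t in a compact subset of (0, oo) a
    multiple of p_1 thus dominates every p_t, and also q_t; this is the common majorant for
    differentiation under the integral and for Fubini. *)
Lemma poisson_le_poisson1 (t0 t1 t : R) x : 0 < t0 -> t0 <= t <= t1 ->
  pk t x <= t1 `^ s * Num.min 1 (t0 ^+ 2) `^ (- h) * pk 1 x.
Proof.
move=> t00 /andP[t0t tt1]; have t_0 : 0 < t by exact: lt_le_trans t0t.
set m := Num.min _ _; have m0 : 0 < m by rewrite lt_min ltr01 exprn_gt0.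
rewrite !poisson_kernelE powR1 mulr1 expr1n.
have -> : t1 `^ s * m `^ (- h) * (c0 * (enorm x ^+ 2 + 1) `^ (- h)) =
  c0 * t1 `^ s * (m * (enorm x ^+ 2 + 1)) `^ (- h).
  by rewrite powRM ?addr_ge0 ?sqr_ge0 ?(ltW m0)//; move: c0 => c; ring.
apply: ler_pM; rewrite ?powR_ge0//.
- exact: mulr_ge0 (poisson_cst_ge0 _ s0) (powR_ge0 _ _).
- rewrite (ler_wpM2l (poisson_cst_ge0 _ s0))//; apply: ge0_ler_powR => //.
  + exact: ltW.
  + by rewrite nnegrE ltW.
  + by rewrite nnegrE (le_trans (ltW t_0)).
rewrite !powRN lef_pV2 ?posrE ?powR_gt0 ?base_gt0//; last first.
  by rewrite mulr_gt0// ltr_wpDl ?sqr_ge0.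
apply: ge0_ler_powR; rewrite ?(ltW h0)// ?nnegrE ?(ltW (base_gt0 _ _))//.
  by rewrite mulr_ge0 ?addr_ge0 ?sqr_ge0 ?(ltW m0).
rewrite mulrDr mulr1 lerD//.
  by apply: ler_piMl; rewrite ?sqr_ge0// ge_min lexx.
rewrite (@le_trans _ _ (t0 ^+ 2))//; first by rewrite ge_min lexx orbT.
by rewrite lerXn2r// nnegrE ltW.
Qed.

(** Peetre's inequality 1 + |y|^2 <= 2 (1 + |x|^2) (1 + |x - y|^2): moving the centre of the kernel
    costs a factor depending on x only, so integrability of f against p_1 suffices for convolutions
    at every x. *)
Lemma poisson1_sub_le x y :
  pk 1 (x - y) <= (2 * (1 + enorm x ^+ 2)) `^ h * pk 1 y.
Proof.
rewrite !poisson_kernelE powR1 mulr1 expr1n mulrCA (ler_wpM2l (poisson_cst_ge0 _ s0))//.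
have P0 z : 0 < enorm z ^+ 2 + 1 :> R by rewrite ltr_wpDl ?sqr_ge0.
rewrite !powRN ler_pdivlMr ?powR_gt0//
  mulrC ler_pdivrMr ?powR_gt0// -powRM; last 2 first.
- by rewrite mulr_ge0// addr_ge0 ?sqr_ge0.
- exact: ltW.
apply: ge0_ler_powR; rewrite ?(ltW h0)// ?nnegrE ?(ltW (P0 _))//.
- exact: ltW.
- by rewrite !mulr_ge0 ?addr_ge0 ?sqr_ge0.
have := enormD_sqr_le x (- (x - y)); rewrite enormN opprB addrC subrK.
have := sqr_ge0 (enorm x); have := sqr_ge0 (enorm (x - y)); nra.
Qed.

End poisson_derivative.

Section cauchy_schwarz.
Context d (T : measurableType d) {R : realType}.
Variable mu : {measure set T -> \bar R}.
Local Open Scope ereal_scope.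

Lemma ereal_amgm (th f : R) (g : \bar R) : (0 < th)%R -> (0 <= f)%R -> 0 <= g ->
  2%:E * (f%:E * g) <= (th * f ^+ 2)%:E + (th^-1)%:E * (g * g).
Proof.
move=> th0 f0; case: g => [g||]//; last first.
  by move=> _; rewrite mulyy [X in _ + X]gt0_muley ?lte_fin ?invr_gt0// addey// leey.
rewrite lee_fin => g0; rewrite -!EFinM -EFinD lee_fin -subr_ge0.
have -> : (th * f ^+ 2 + th^-1 * (g * g) - 2 * (f * g) = th^-1 * (th * f - g) ^+ 2)%R.
  by field; rewrite gt_eqF.
by rewrite mulr_ge0 ?sqr_ge0 ?invr_ge0 ?(ltW th0).
Qed.

(* Cauchy-Schwarz with an explicit positive bound [A] on the first factor, so
   that no product 0 * oo occurs. *)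
Lemma weighted_cauchy_schwarz (D : set T) (f : T -> R) (g : T -> \bar R) (A : R) :
  measurable D -> measurable_fun setT f -> measurable_fun setT g ->
  (forall x, (0 <= f x)%R) -> (forall x, 0 <= g x) -> (0 < A)%R ->
  \int[mu]_(x in D) (f x ^+ 2)%:E <= A%:E ->
  (\int[mu]_(x in D) ((f x)%:E * g x)) * (\int[mu]_(x in D) ((f x)%:E * g x))
  <= A%:E * \int[mu]_(x in D) (g x * g x).
Proof.
move=> mD mf mg f0 g0 A0 fA.
set B := \int[mu]_(x in D) (g x * g x); set I := \int[mu]_(x in D) _.
have B0 : 0 <= B by apply: integral_ge0 => x _; rewrite mule_ge0.
have I0 : 0 <= I by apply: integral_ge0 => x _; rewrite mule_ge0// lee_fin.
have key th : (0 < th)%R -> 2%:E * I <= (th * A)%:E + (th^-1)%:E * B.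
  move=> th0; rewrite /I /B -!ge0_integralZl_EFin//; last 5 first.
  - by move=> x _; rewrite mule_ge0.
  - by apply: measurable_funTS; meas.
  - by rewrite invr_ge0 ltW.
  - by move=> x _; rewrite mule_ge0// lee_fin.
  - by apply: measurable_funTS; meas.
  apply: (@le_trans _ _ (\int[mu]_(x in D) ((th * f x ^+ 2)%:E +
      (th^-1)%:E * (g x * g x)))).
    apply: le_nnintegral => x _; first by rewrite mule_ge0// mule_ge0// lee_fin.
    exact: ereal_amgm.
  rewrite ge0_integralD//; last 4 first.
  - by move=> x _; rewrite lee_fin mulr_ge0 ?sqr_ge0 ?ltW.
  - by apply: measurable_funTS; meas.
  - by move=> x _; rewrite mule_ge0 ?mule_ge0// lee_fin invr_ge0 ltW.
  - by apply: measurable_funTS; meas.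
  rewrite leeD2r//; under eq_integral do rewrite EFinM.
  rewrite ge0_integralZl_EFin ?(ltW th0)//; last 2 first.
  - by move=> x _; rewrite lee_fin sqr_ge0.
  - by apply: measurable_funTS; meas.
  by rewrite EFinM lee_wpmul2l// lee_fin ltW.
move: B B0 key => [b||]//; last by move=> _ _; rewrite gt0_muley ?lte_fin// leey.
rewrite lee_fin => b0 key.
have If : I \is a fin_num.
  rewrite ge0_fin_numE//; have := key 1%R ltr01; rewrite -EFinM -EFinD.
  move: I I0 {key} => [i||]//; first by rewrite ltry.
  by rewrite gt0_muley ?lte_fin.
rewrite -(fineK If) -!EFinM lee_fin; set i := fine I.
have i0 : (0 <= i)%R by exact: fine_ge0.
(* The bound [key] is to be used at the optimal parameter sqrt(b / A). As b may vanish, it is first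
   enlarged to c = b + e/A > 0. *)
apply/ler_addgt0Pr => e e0.
have be : (0 < b + e / A)%R by rewrite ltr_wpDl// divr_gt0.
set c := (b + e / A)%R in be.
have -> : (A * b + e = A * c)%R by rewrite /c mulrDr mulrCA mulfV ?mulr1// gt_eqF.
have sc : (0 < Num.sqrt (c / A))%R by rewrite sqrtr_gt0 divr_gt0.
have := key _ sc; rewrite -(fineK If) -!EFinM -EFinD lee_fin -/i => k.
have : (2 * i <= Num.sqrt (c / A) * A + (Num.sqrt (c / A))^-1 * c)%R.
  apply: le_trans k _; rewrite lerD2l ler_wpM2l ?invr_ge0 ?(ltW sc)//.
  by rewrite /c lerDl divr_ge0// ltW.
set r := Num.sqrt _ in sc *.
have rr : (r * r * A = c)%R.
  by rewrite -expr2 sqr_sqrtr ?divr_ge0 ?ltW// mulfVK// gt_eqF.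
have -> : (r^-1 * c = r * A)%R by rewrite -rr !mulrA mulVf ?mul1r// gt_eqF.
move=> k2; have k3 : (i <= r * A)%R by lra.
rewrite -rr; apply: le_trans (ler_pM i0 i0 k3 k3) _.
by rewrite le_eqVlt; apply/orP; left; apply/eqP; ring.
Qed.

Lemma ereal_sqrD_le (x y : \bar R) : 0 <= x -> 0 <= y ->
  (x + y) * (x + y) <= 2%:E * (x * x + y * y).
Proof.
case: x => [x||]//; case: y => [y||]//; rewrite ?lee_fin => x0 y0.
- by have := sqr_ge0 (x - y); nra.
- by rewrite mulyy addey// gt0_muley ?lte_fin// leey.
- by rewrite mulyy addye// gt0_muley ?lte_fin// leey.
- by rewrite !mulyy addye// gt0_muley ?lte_fin// leey.
Qed.

(** Reduces X <= C E to positive real majorants e of E, so that later arguments may divide by e and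
    take powers of it; the values E = 0 and E = +oo are settled here. *)
Lemma ereal_le_mul_eps (X E : \bar R) (C : R) : (0 < C)%R -> 0 <= E ->
  (forall e : R, (0 < e)%R -> E <= e%:E -> X <= (C * e)%:E) -> X <= C%:E * E.
Proof.
move=> C0; case: E => [E||]//; last by move=> _ _; rewrite gt0_muley ?lte_fin// leey.
rewrite lee_fin => E0 H; rewrite -EFinM; apply/lee_addgt0Pr => e e0.
have -> : (C * E)%:E + e%:E = (C * (E + e / C))%:E.
  by rewrite -EFinD mulrDr mulrCA mulfV ?mulr1// gt_eqF.
have eC : (0 < e / C)%R by rewrite divr_gt0.
by apply: H; [rewrite ltr_wpDl|rewrite lee_fin lerDl ltW].
Qed.

End cauchy_schwarz.

(** * Sobolev and Hardy bounds for Poisson potentials *)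

Section potential.
Context {R : realType} (n : nat) (s beta : R) (s0 : 0 < s).
Hypotheses (b0 : 0 < beta) (bn : beta < n%:R).
Notation mu := (@lebesgue_rV R n).
Notation lam := (@lebesgue_measure R).
Notation pk := (@poisson_kernel R n s).
Notation M := (@poisson_mass R n s).
Notation c0 := (@poisson_cst R n s).
Notation pos := (`]0%R, +oo[%classic : set R).
Local Open Scope ereal_scope.

Variable V : 'rV[R]_n -> R -> R.
Hypothesis mV : measurable_fun setT (fun z => V z.1 z.2).
Hypothesis V0 : forall x t, (0 <= V x t)%R.

Let c0_gt0 : (0 < c0)%R := poisson_cst_gt0 n s0.
Let M_gt0 : (0 < M)%R := poisson_mass_gt0 n s0.

(** [V] stands for |du/dt|, but the estimates of this part hold for any nonnegative measurable
    function on the half-space. *)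
Definition poisson_conv (x : 'rV[R]_n) (t : R) : \bar R :=
  \int[mu]_y (pk t (x - y) * V y t)%:E.

Definition slice_energy (t : R) : \bar R := \int[mu]_y (V y t ^+ 2)%:E.

Definition weighted_energy : \bar R :=
  \int[lam]_(t in pos) ((t `^ (1 - beta))%:E * slice_energy t).

Definition potential (x : 'rV[R]_n) : \bar R := \int[lam]_(t in pos) poisson_conv x t.

Definition square_function (x : 'rV[R]_n) : \bar R :=
  \int[lam]_(t in pos) ((t `^ (1 - beta))%:E * (poisson_conv x t * poisson_conv x t)).

Let h := poisson_conv.
Let N := slice_energy.
Let E := weighted_energy.
Let F := potential.
Let g := square_function.

Let h0 x t : 0 <= h x t.
Proof. by apply: integral_ge0 => y _; rewrite lee_fin mulr_ge0// poisson_kernel_ge0. Qed.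

Let N0 t : 0 <= N t.
Proof. by apply: integral_ge0 => y _; rewrite lee_fin sqr_ge0. Qed.

Let mh : measurable_fun setT (fun z : 'rV[R]_n * R => h z.1 z.2).
Proof.
apply: (@measurable_fun_fubini_tonelli_F _ _ ('rV[R]_n * R)%type 'rV[R]_n R mu
  (fun p => (pk p.1.2 (p.1.1 - p.2) * V p.2 p.1.2)%:E)).
- apply: measurable_fun_EFin; apply: measurable_fun_mul; last by meas.
  by apply: measurable_fun_poisson; meas.
- by move=> p; rewrite lee_fin mulr_ge0// poisson_kernel_ge0.
Qed.

Let mN : measurable_fun setT N.
Proof.
apply: (@measurable_fun_fubini_tonelli_G _ _ 'rV[R]_n R R mu
  (fun p => (V p.1 p.2 ^+ 2)%:E)); first by meas.
by move=> p; rewrite lee_fin sqr_ge0.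
Qed.

Let mhx x : measurable_fun setT (h x).
Proof. exact: (measurableT_comp mh (pair1_measurable x)). Qed.

Let mht t : measurable_fun setT (h^~ t).
Proof. exact: (measurableT_comp mh (pair2_measurable t)). Qed.

Let mVt t : measurable_fun setT (V^~ t).
Proof. exact: (measurableT_comp mV (pair2_measurable t)). Qed.

Let mpk t x : measurable_fun setT (fun y : 'rV[R]_n => pk t (x - y)).
Proof. by apply: measurable_fun_poisson; meas. Qed.

Let integral_pk t x : (0 < t)%R -> \int[mu]_y (pk t (x - y))%:E <= M%:E.
Proof.
move=> t0; rewrite (@lebesgue_rV_reflect _ _ (fun y => (pk t y)%:E) x).
- exact: integral_poisson_le.
- by apply/measurable_fun_EFin/measurable_fun_poisson; meas.
- by move=> y; rewrite lee_fin poisson_kernel_ge0.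
Qed.

(** Cauchy-Schwarz for the measure p_t(x - y) dy, of mass at most M, by splitting the kernel into
    two square roots. *)
Lemma poisson_conv_sqr_le x t : (0 < t)%R ->
  h x t * h x t <= M%:E * \int[mu]_y (pk t (x - y) * V y t ^+ 2)%:E.
Proof.
move=> t0.
have p0 y : (0 <= pk t (x - y))%R by exact: poisson_kernel_ge0.
have mp := mpk t x; have mv := mVt t.
have := @weighted_cauchy_schwarz _ _ _ mu setT (fun y : 'rV[R]_n => Num.sqrt (pk t (x - y)))
  (fun y : 'rV[R]_n => (Num.sqrt (pk t (x - y)) * V y t)%:E) M measurableT.
have E1 y : (Num.sqrt (pk t (x - y)))%:E * (Num.sqrt (pk t (x - y)) * V y t)%:E
    = (pk t (x - y) * V y t)%:E.
  by rewrite -EFinM mulrA -expr2 sqr_sqrtr.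
have E2 y : (Num.sqrt (pk t (x - y)) * V y t)%:E * (Num.sqrt (pk t (x - y)) * V y t)%:E
    = (pk t (x - y) * V y t ^+ 2)%:E.
  by rewrite -EFinM mulrACA -expr2 sqr_sqrtr// -expr2.
have E3 y : (Num.sqrt (pk t (x - y)) ^+ 2)%R = pk t (x - y) by rewrite sqr_sqrtr.
under eq_integral do rewrite E3.
under [X in _ -> _ -> _ -> _ -> _ -> _ -> X * _ <= _]eq_integral do rewrite E1.
under [X in _ -> _ -> _ -> _ -> _ -> _ -> _ * X <= _]eq_integral do rewrite E1.
under [X in _ -> _ -> _ -> _ -> _ -> _ -> _ <= _ * X]eq_integral do rewrite E2.
apply => //; first by meas.
- by meas.
- by move=> y; rewrite lee_fin mulr_ge0// sqrtr_ge0.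
- exact: integral_pk.
Qed.

(** The kernel is at most c0 t^(-n); this smoothing bound controls large t. *)
Lemma poisson_conv_sup_le x t : (0 < t)%R ->
  h x t * h x t <= (M * c0 * t `^ (- n%:R))%:E * N t.
Proof.
move=> t0; apply: le_trans (poisson_conv_sqr_le x t0) _.
rewrite -mulrA [in leRHS]EFinM -muleA lee_wpmul2l ?lee_fin ?(ltW M_gt0)//.
rewrite -ge0_integralZl_EFin//; last 3 first.
- by move=> y _; rewrite lee_fin sqr_ge0.
- by have := mVt t => ?; meas.
- by apply: mulr_ge0 (ltW c0_gt0) (powR_ge0 _ _).
apply: le_nnintegral => y _; rewrite lee_fin.
  by rewrite mulr_ge0 ?sqr_ge0// poisson_kernel_ge0.
by rewrite ler_wpM2r ?sqr_ge0// poisson_kernel_le.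
Qed.

(** Young's inequality on L^2: integrate the Cauchy-Schwarz bound in x and use the mass of the
    kernel once more. This bound controls small t. *)
Lemma poisson_conv_contract t : (0 < t)%R ->
  \int[mu]_x (h x t * h x t) <= (M * M)%:E * N t.
Proof.
move=> t0; have mv := mVt t.
apply: (@le_trans _ _ (\int[mu]_x (M%:E * \int[mu]_y (pk t (x - y) * V y t ^+ 2)%:E))).
  apply: le_nnintegral => x _; first exact: mule_ge0.
  exact: poisson_conv_sqr_le.
pose f (p : 'rV[R]_n * 'rV[R]_n) := (pk t (p.1 - p.2) * V p.2 t ^+ 2)%:E.
have mf : measurable_fun setT f.
  apply: measurable_fun_EFin; apply: measurable_fun_mul; last by meas.
  by apply: measurable_fun_poisson; meas.
have f0 p : 0 <= f p by rewrite lee_fin mulr_ge0 ?sqr_ge0// poisson_kernel_ge0.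
rewrite ge0_integralZl_EFin ?(ltW M_gt0)//; last 2 first.
- by move=> x _; by apply: integral_ge0 => y _; exact: (f0 (x, y)).
- exact: (measurable_fun_fubini_tonelli_F f).
rewrite [in leRHS]EFinM -muleA lee_wpmul2l ?lee_fin ?(ltW M_gt0)//.
rewrite (fubini_tonelli f)// -ge0_integralZl_EFin ?(ltW M_gt0)//; last 2 first.
- by move=> y _; rewrite lee_fin sqr_ge0.
- by meas.
apply: le_nnintegral => y _; first by apply: integral_ge0 => x _; exact: f0.
rewrite /f/=; under eq_integral do rewrite mulrC EFinM.
rewrite ge0_integralZl_EFin ?sqr_ge0//; last 2 first.
- by move=> x _; rewrite lee_fin poisson_kernel_ge0.
- by apply/measurable_fun_EFin/measurable_fun_poisson; meas.
rewrite muleC lee_wpmul2r ?lee_fin ?sqr_ge0//.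
rewrite (@lebesgue_rV_translate _ _ (fun x => (pk t x)%:E)).
- exact: integral_poisson_le.
- by apply/measurable_fun_EFin/measurable_fun_poisson; meas.
- by move=> x; rewrite lee_fin poisson_kernel_ge0.
Qed.

Lemma integral_square_function : \int[mu]_x g x <= (M * M)%:E * E.
Proof.
rewrite /g /square_function.
rewrite (@tonelli_dom _ _ 'rV[R]_n (measurableTypeR R) R mu lam pos _
  (fun z => (z.2 `^ (1 - beta))%:E * (h z.1 z.2 * h z.1 z.2)))//; last 2 first.
- by have := mh => ?; meas.
- by move=> z; rewrite mule_ge0 ?mule_ge0 ?h0// lee_fin powR_ge0.
rewrite -ge0_integralZl_EFin//; last 3 first.
- by move=> t _; rewrite mule_ge0 ?N0// lee_fin powR_ge0.
- by apply: measurable_funTS; have := mN => ?; meas.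
- by rewrite mulr_ge0 ?ltW.
apply: le_nnintegral => t; rewrite /= in_itv/= andbT => t0.
  by apply: integral_ge0 => x _; rewrite mule_ge0 ?mule_ge0 ?h0// lee_fin powR_ge0.
rewrite ge0_integralZl_EFin ?powR_ge0//; last 2 first.
- by move=> x _; rewrite mule_ge0 ?h0.
- by have := mht t => ?; meas.
rewrite muleCA lee_wpmul2l ?lee_fin ?powR_ge0//.
exact: poisson_conv_contract.
Qed.

(** Cauchy-Schwarz with the weights t^((beta-1)/2) and t^((1-beta)/2); the first is square
    integrable near 0 because beta > 0, the second produces the weight of the square function. *)
Lemma potential_near_le x T : (0 < T)%R ->
  (\int[lam]_(t in `]0%R, T]) h x t) * (\int[lam]_(t in `]0%R, T]) h x t) <=
  (T `^ beta / beta)%:E * g x.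
Proof.
move=> T0; have m1 := mhx x.
have E1 t : t \in `]0%R, T]%classic ->
  (t `^ ((beta - 1) / 2))%:E * ((t `^ ((1 - beta) / 2))%:E * h x t) = h x t.
  rewrite inE/= in_itv/= => /andP[t0 _]; rewrite muleA -EFinM -powRD; last first.
    by rewrite (gt_eqF t0) implybT.
  by rewrite -mulrDl [X in (t `^ X)%R](_ : _ = 0%R) ?powRr0 ?mul1e//; ring.
have E2 t : ((t `^ ((1 - beta) / 2))%:E * h x t) * ((t `^ ((1 - beta) / 2))%:E * h x t)
    = (t `^ (1 - beta))%:E * (h x t * h x t).
  rewrite muleACA -EFinM; congr (_%:E * _).
  rewrite -expr2 -powR_mulrn ?powR_ge0// -powRrM.
  by congr (_ `^ _)%R; field.
have E3 t : ((t `^ ((beta - 1) / 2)) ^+ 2 = t `^ (beta - 1))%R.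
  rewrite -powR_mulrn ?powR_ge0// -powRrM.
  by congr (_ `^ _)%R; field.
have <- : \int[lam]_(t in `]0%R, T]) ((t `^ ((beta - 1) / 2))%:E * ((t `^ ((1 - beta) / 2))%:E * h x t)) =
    \int[lam]_(t in `]0%R, T]) h x t by exact: eq_integral.
have : \int[lam]_(t in `]0%R, T]) ((t `^ ((beta - 1) / 2) ^+ 2)%R)%:E <= (T `^ beta / beta)%:E.
  under eq_integral do rewrite E3.
  exact: integral_powR_0.
have k0 : (0 < T `^ beta / beta)%R by rewrite divr_gt0// powR_gt0.
move=> H; apply: le_trans (@weighted_cauchy_schwarz _ _ _ lam (`]0%R, T])%classic (fun t => t `^ ((beta - 1) / 2))%R
  (fun t => (t `^ ((1 - beta) / 2))%:E * h x t) _ (measurable_itv _) _ _ _ _ k0 H) _.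
- by meas.
- by meas.
- by move=> t; exact: powR_ge0.
- by move=> t; rewrite mule_ge0 ?h0// lee_fin powR_ge0.
under eq_integral do rewrite E2.
rewrite lee_wpmul2l ?lee_fin ?divr_ge0 ?powR_ge0 ?(ltW b0)//.
apply: ge0_subset_integral => //.
- by apply: measurable_funTS; meas.
- by move=> t _; rewrite mule_ge0 ?mule_ge0 ?h0// lee_fin powR_ge0.
- by move=> t /=; rewrite !in_itv/= => /andP[->].
Qed.

(** Cauchy-Schwarz with t^((-d-1)/2) and t^((1+d)/2), then the sup bound. The exponent d stays free:
    d = n - beta turns the remaining weight into t^(1-beta), giving the energy at once, while d = (n
    - beta)/2 leaves room for an integration in x in the Hardy inequality. *)
Lemma potential_far_le x T d : (0 < T)%R -> (0 < d)%R ->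
  (\int[lam]_(t in `[T, +oo[) h x t) * (\int[lam]_(t in `[T, +oo[) h x t) <=
  (T `^ (- d) / d)%:E * \int[lam]_(t in `[T, +oo[)
     ((M * c0 * t `^ (1 + d - n%:R))%:E * N t).
Proof.
move=> T0 d0; have m1 := mhx x.
have E1 t : t \in `[T, +oo[%classic ->
  (t `^ ((- d - 1) / 2))%:E * ((t `^ ((1 + d) / 2))%:E * h x t) = h x t.
  rewrite inE/= in_itv/= andbT => Tt; have t0 : (0 < t)%R by exact: lt_le_trans Tt.
  rewrite muleA -EFinM -powRD; last by rewrite (gt_eqF t0) implybT.
  by rewrite -mulrDl [X in (t `^ X)%R](_ : _ = 0%R) ?powRr0 ?mul1e//; ring.
have E2 t : ((t `^ ((1 + d) / 2))%:E * h x t) * ((t `^ ((1 + d) / 2))%:E * h x t)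
    = (t `^ (1 + d))%:E * (h x t * h x t).
  rewrite muleACA -EFinM; congr (_%:E * _).
  rewrite -expr2 -powR_mulrn ?powR_ge0// -powRrM.
  by congr (_ `^ _)%R; field.
have E3 t : ((t `^ ((- d - 1) / 2)) ^+ 2 = t `^ (- d - 1))%R.
  rewrite -powR_mulrn ?powR_ge0// -powRrM.
  by congr (_ `^ _)%R; field.
have <- : \int[lam]_(t in `[T, +oo[) ((t `^ ((- d - 1) / 2))%:E * ((t `^ ((1 + d) / 2))%:E * h x t)) =
    \int[lam]_(t in `[T, +oo[) h x t by exact: eq_integral.
have : \int[lam]_(t in `[T, +oo[) ((t `^ ((- d - 1) / 2) ^+ 2)%R)%:E <= (T `^ (- d) / d)%:E.
  under eq_integral do rewrite E3.
  by rewrite integral_powR_infty.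
have k0 : (0 < T `^ (- d) / d)%R by rewrite divr_gt0// powR_gt0.
move=> H; apply: le_trans (@weighted_cauchy_schwarz _ _ _ lam (`[T, +oo[)%classic (fun t => t `^ ((- d - 1) / 2))%R
  (fun t => (t `^ ((1 + d) / 2))%:E * h x t) _ (measurable_itv _) _ _ _ _ k0 H) _.
- by meas.
- by meas.
- by move=> t; exact: powR_ge0.
- by move=> t; rewrite mule_ge0 ?h0// lee_fin powR_ge0.
under eq_integral do rewrite E2.
rewrite lee_wpmul2l ?lee_fin ?divr_ge0 ?powR_ge0 ?(ltW d0)//.
apply: le_nnintegral => t; rewrite /= in_itv/= andbT => Tt.
  by rewrite mule_ge0 ?mule_ge0 ?h0// lee_fin powR_ge0.
have t0 : (0 < t)%R by exact: lt_le_trans Tt.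
have -> : (M * c0 * t `^ (1 + d - n%:R) = t `^ (1 + d) * (M * c0 * t `^ (- n%:R)))%R.
  by rewrite powRD ?(gt_eqF t0) ?implybT// mulrCA.
rewrite [in leRHS]EFinM -muleA lee_wpmul2l ?lee_fin ?powR_ge0//.
exact: poisson_conv_sup_le.
Qed.

Lemma potential_split x T : (0 < T)%R ->
  F x * F x <= 2%:E *
   ((\int[lam]_(t in `]0%R, T]) h x t) * (\int[lam]_(t in `]0%R, T]) h x t) +
    (\int[lam]_(t in `[T, +oo[) h x t) * (\int[lam]_(t in `[T, +oo[) h x t)).
Proof.
move=> T0; rewrite /F /potential (integral_pos_split T0)//.
by apply: ereal_sqrD_le; exact: integral_ge0.
Qed.

Let p : R := 2 * n%:R / (n%:R - beta).
Let dn : R := n%:R - beta.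
Let dn0 : (0 < dn)%R. Proof. by rewrite subr_gt0. Qed.
Let n0 : (0 < n%:R :> R)%R. Proof. exact: lt_trans bn. Qed.
Let K : R := beta^-1 + M * c0 / dn.
Let K0 : (0 < K)%R.
Proof. by apply: addr_gt0; [rewrite invr_gt0|apply: divr_gt0 => //; apply: mulr_gt0]. Qed.
(** Here 2 K collects the constants of the near and far parts in the bound of F^2, and the exponent
    n/(n - beta) = p/2 passes from F^2 to F^p. *)
Definition pointwise_cst : R := (2 * K) `^ (n%:R / dn).

Let F0 x : 0 <= F x. Proof. exact: integral_ge0. Qed.

Let g0 x : 0 <= g x.
Proof.
by apply: integral_ge0 => t _; rewrite mule_ge0 ?mule_ge0 ?h0// lee_fin powR_ge0.
Qed.

Let E0 : 0 <= E.
Proof. by apply: integral_ge0 => t _; rewrite mule_ge0 ?N0// lee_fin powR_ge0. Qed.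

Lemma potential_sqr_le x T : (0 < T)%R ->
  F x * F x <= 2%:E * ((T `^ beta / beta)%:E * g x + (M * c0 * (T `^ (- dn) / dn))%:E * E).
Proof.
move=> T0; apply: le_trans (potential_split x T0) _.
apply: lee_wpmul2l => //; apply: leeD; first exact: potential_near_le.
apply: le_trans (potential_far_le x T0 dn0) _.
have Mc : (0 <= M * c0)%R by rewrite mulr_ge0 ?(ltW M_gt0) ?(ltW c0_gt0).
have -> : (M * c0 * (T `^ (- dn) / dn))%:E = (T `^ (- dn) / dn)%:E * (M * c0)%:E.
  by rewrite -EFinM mulrC.
rewrite -muleA lee_wpmul2l//.
  by rewrite lee_fin divr_ge0 ?powR_ge0 ?(ltW dn0).
rewrite -ge0_integralZl_EFin//; last 2 first.
- by move=> t _; rewrite mule_ge0 ?N0// lee_fin powR_ge0.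
- by apply: measurable_funTS; have := mN => ?; meas.
apply: (@le_trans _ _ (\int[lam]_(t in `[T, +oo[)
   ((M * c0)%:E * ((t `^ (1 - beta))%:E * slice_energy t)))).
  apply: le_nnintegral => t _.
    by rewrite mule_ge0 ?N0// lee_fin mulr_ge0 ?powR_ge0.
  by rewrite [leRHS]muleA -EFinM (_ : 1 + dn - n%:R = 1 - beta)%R// /dn; ring.
apply: ge0_subset_integral => //.
- by apply: measurable_funTS; have := mN => ?; meas.
- by move=> t _; rewrite mule_ge0 ?mule_ge0 ?N0// lee_fin powR_ge0.
- by move=> t /=; rewrite !in_itv/= !andbT; exact: lt_le_trans.
Qed.

(** Hedberg's argument: with the near and far parts balanced, the exponent p leaves [g x] to the
    power one, and the integral of [g] is bounded by the energy. *)
Lemma potential_pointwise_le (e : R) x : (0 < e)%R -> E <= e%:E ->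
  F x `^ p <= (pointwise_cst * e `^ (beta / dn))%:E * g x.
Proof.
move=> e0 Ee.
have C0 : (0 < pointwise_cst * e `^ (beta / dn))%R.
  by rewrite mulr_gt0 ?powR_gt0// mulr_gt0.
apply: ereal_le_mul_eps => // c c0' gc.
(* With c and e majorants of [g x] and of the energy, this T makes T^beta c and T^(beta-n) e both
   equal to e^(beta/n) c^((n-beta)/n). *)
pose T : R := ((e / c) `^ n%:R^-1)%R.
have T0 : (0 < T)%R by rewrite powR_gt0// divr_gt0.
have Mc : (0 <= M * c0)%R by rewrite mulr_ge0 ?(ltW M_gt0) ?(ltW c0_gt0).
pose A : R := (2 * K * (e `^ (beta / n%:R) * c `^ (dn / n%:R)))%R.
have FA : F x * F x <= A%:E.
  apply: le_trans (potential_sqr_le x T0) _.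
  apply: (@le_trans _ _ (2%:E * ((T `^ beta / beta)%:E * c%:E +
     (M * c0 * (T `^ (- dn) / dn))%:E * e%:E))).
    rewrite lee_wpmul2l// leeD// lee_wpmul2l// lee_fin.
      by rewrite divr_ge0 ?powR_ge0 ?(ltW b0).
    by apply: mulr_ge0 => //; rewrite divr_ge0 ?powR_ge0 ?(ltW dn0).
  have Tb : (T `^ beta * c = e `^ (beta / n%:R) * c `^ (dn / n%:R))%R.
    rewrite /T -powRrM [(n%:R^-1 * _)%R]mulrC powRM ?(ltW e0) ?invr_ge0 ?(ltW c0')//.
    rewrite -mulrA; congr (_ * _)%R.
    rewrite -[(c^-1)%R]powR_inv1 ?(ltW c0')// -powRrM -[X in (_ * X)%R]powRr1 ?(ltW c0')//.
    rewrite -powRD ?(gt_eqF c0') ?implybT//; congr (_ `^ _)%R.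
    by rewrite /dn; field; rewrite gt_eqF.
  have Td : (T `^ (- dn) * e = e `^ (beta / n%:R) * c `^ (dn / n%:R))%R.
    rewrite /T -powRrM powRM ?(ltW e0) ?invr_ge0 ?(ltW c0')//.
    rewrite mulrAC -[X in (_ * X * _)%R]powRr1 ?(ltW e0)//.
    rewrite -powRD ?(gt_eqF e0) ?implybT//; congr (_ * _)%R.
      by congr (_ `^ _)%R; rewrite /dn; field; rewrite gt_eqF.
    rewrite -[(c^-1)%R]powR_inv1 ?(ltW c0')// -powRrM; congr (_ `^ _)%R.
    by field; rewrite gt_eqF.
  rewrite -!EFinM lee_fin /A.
  rewrite [(T `^ beta / beta * c)%R]mulrAC Tb.
  rewrite (_ : M * c0 * (T `^ (- dn) / dn) * e = M * c0 / dn * (T `^ (- dn) * e))%R; last first.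
    by rewrite -!mulrA; congr (_ * (_ * _))%R; ring.
  by rewrite Td le_eqVlt /K; apply/orP; left; apply/eqP; ring.
move: (F x) (F0 x) FA => [f||]//; rewrite lee_fin => f0 FA.
rewrite poweR_EFin lee_fin.
have {}FA : (f ^+ 2 <= A)%R by rewrite expr2 -lee_fin EFinM.
have -> : (f `^ p = (f ^+ 2) `^ (n%:R / dn))%R.
  by rewrite -powR_mulrn// -powRrM; congr (_ `^ _)%R; rewrite /p /dn mulrA.
have nd : (0 <= n%:R / dn)%R by rewrite divr_ge0 ?ltW.
apply: le_trans (ge0_ler_powR nd _ _ FA) _; rewrite ?nnegrE ?sqr_ge0//.
  exact: le_trans (sqr_ge0 _) FA.
rewrite /A powRM ?mulr_ge0 ?powR_ge0 ?(ltW K0)// -mulrA.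
rewrite le_eqVlt; apply/orP; left; apply/eqP; congr (_ * _)%R.
rewrite powRM ?powR_ge0// -!powRrM.
have -> : (beta / n%:R * (n%:R / dn) = beta / dn)%R by rewrite mulrA mulfVK// gt_eqF.
have -> : (dn / n%:R * (n%:R / dn) = 1)%R.
  by rewrite mulrA mulfVK ?gt_eqF// mulfV// gt_eqF.
by rewrite powRr1 ?(ltW c0').
Qed.

Let mg : measurable_fun setT g.
Proof.
apply: (@measurable_fun_integral_dom _ _ 'rV[R]_n (measurableTypeR R) R lam pos _
  (fun z => (z.2 `^ (1 - beta))%:E * (h z.1 z.2 * h z.1 z.2))) => //.
- by have := mh => ?; meas.
- by move=> z; rewrite mule_ge0 ?mule_ge0 ?h0// lee_fin powR_ge0.
Qed.

Definition sobolev_cst : R := (pointwise_cst * (M * M)) `^ (1 - beta / n%:R).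

Let pc_gt0 : (0 < pointwise_cst)%R.
Proof. by rewrite powR_gt0// mulr_gt0. Qed.

Lemma sobolev_cst_gt0 : (0 < sobolev_cst)%R.
Proof. exact: powR_gt0 (mulr_gt0 pc_gt0 (mulr_gt0 M_gt0 M_gt0)). Qed.

(** Integrating the pointwise bound gives a multiple of e^(beta/(n-beta)) e = e^(n/(n-beta)); the
    outer power (n - beta)/n makes this linear in e. *)
Lemma potential_sobolev :
  (\int[mu]_x (F x `^ p)) `^ (1 - beta / n%:R) <= sobolev_cst%:E * E.
Proof.
have pc0 := ltW pc_gt0; have MM0 := ltW (mulr_gt0 M_gt0 M_gt0).
have pM0 := mulr_ge0 pc0 MM0.
have q0 : (0 < 1 - beta / n%:R)%R by rewrite subr_gt0 ltr_pdivrMr// mul1r.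
apply: ereal_le_mul_eps => // [|e e0 Ee]; first exact: sobolev_cst_gt0.
have H : \int[mu]_x (F x `^ p) <= (pointwise_cst * (M * M) * e `^ (n%:R / dn))%:E.
  apply: (@le_trans _ _ (\int[mu]_x ((pointwise_cst * e `^ (beta / dn))%:E * g x))).
    apply: le_nnintegral => x _; [exact: poweR_ge0|exact: potential_pointwise_le].
  rewrite ge0_integralZl_EFin//; last by exact: mulr_ge0 pc0 (powR_ge0 _ _).
  apply: (@le_trans _ _ ((pointwise_cst * e `^ (beta / dn))%:E * ((M * M)%:E * e%:E))).
    rewrite lee_wpmul2l//; first exact: mulr_ge0 pc0 (powR_ge0 _ _).
    by apply: le_trans integral_square_function _; rewrite lee_wpmul2l.
  rewrite -!EFinM lee_fin [leLHS]mulrACA (ler_wpM2l pM0)//.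
  rewrite -[X in (_ * X <= _)%R]powRr1 ?(ltW e0)//.
  rewrite -powRD ?(gt_eqF e0) ?implybT// le_eqVlt; apply/orP; left; apply/eqP.
  by congr (_ `^ _)%R; rewrite /dn; field; rewrite gt_eqF.
apply: le_trans (gt0_ler_poweR _ _ _ H) _.
- exact: ltW.
- by rewrite in_itv/= leey andbT integral_ge0// => x _; exact: poweR_ge0.
- by rewrite in_itv/= leey andbT lee_fin; exact: mulr_ge0 pM0 (powR_ge0 _ _).
rewrite poweR_EFin (powRM _ pM0) ?powR_ge0//.
rewrite -powRrM lee_fin ler_wpM2l ?powR_ge0//.
rewrite (_ : n%:R / dn * (1 - beta / n%:R) = 1)%R ?powRr1 ?(ltW e0)//.
by rewrite /dn; field; rewrite !gt_eqF.
Qed.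

(** With this half-gap, gm = (n + beta)/2 lies strictly between beta and n: |x|^(-gm) is integrable
    on balls, and the far estimate with exponent [de] supplies the missing factor |x|^(-de). *)
Let de : R := dn / 2.
Let de0 : (0 < de)%R. Proof. by rewrite divr_gt0. Qed.
Let gm : R := beta + de.
Let gm0 : (0 < gm)%R. Proof. by rewrite addr_gt0. Qed.
Let gmn : (gm < n%:R)%R. Proof. by rewrite /gm /de /dn; have := bn; lra. Qed.
Definition ball_cst : R := (gm * 2 ^+ n * ((n%:R - gm)^-1 + gm^-1))%R.
Let B0 : (0 <= ball_cst)%R.
Proof.
apply: mulr_ge0; first by rewrite mulr_ge0 ?exprn_ge0 ?(ltW gm0).
by rewrite addr_ge0// invr_ge0 ?subr_ge0 ?(ltW gmn) ?(ltW gm0).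
Qed.
Definition hardy_cst : R := 2 * (M * M / beta + M * c0 * ball_cst / de).

(** After Tonelli the x-integral of |x|^(-gm) over |x| <= t is a multiple of t^(n-gm), and
    t^(1+de-n) t^(n-gm) = t^(1-beta) is the weight of the energy. *)
Lemma potential_tail : \int[mu]_x ((enorm x `^ (- gm))%:E *
    \int[lam]_(t in pos) (if (enorm x <= t)%R then
      (M * c0 * t `^ (1 + de - n%:R))%:E * N t else 0)) <=
  (M * c0 * ball_cst)%:E * E.
Proof.
pose G t := (M * c0 * t `^ (1 + de - n%:R))%:E * N t.
have Mc : (0 <= M * c0)%R by rewrite mulr_ge0 ?(ltW M_gt0) ?(ltW c0_gt0).
have G0 t : 0 <= G t by rewrite mule_ge0 ?N0// lee_fin mulr_ge0 ?powR_ge0.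
have mG : measurable_fun setT G by have := mN => ?; rewrite /G; meas.
pose f (z : 'rV[R]_n * R) : \bar R :=
  (enorm z.1 `^ (- gm))%:E * (if (enorm z.1 <= z.2)%R then G z.2 else 0).
have f0 z : 0 <= f z.
  by rewrite mule_ge0 ?lee_fin ?powR_ge0//; case: ifP.
have mif : measurable_fun setT (fun z : 'rV[R]_n * R => if (enorm z.1 <= z.2)%R then G z.2 else 0).
  apply: measurable_fun_ifT; meas.
  by apply: measurable_fun_ler; meas.
have mf : measurable_fun setT f by rewrite /f; apply: measurable_fun_mule => //; meas.
apply: (@le_trans _ _ (\int[mu]_x \int[lam]_(t in pos) f (x, t))).
  apply: le_nnintegral => x _.
    rewrite mule_ge0 ?lee_fin ?powR_ge0//; apply: integral_ge0 => t _.
    by case: ifP => // _; exact: G0.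
  rewrite -ge0_integralZl_EFin ?powR_ge0//.
    by move=> t _; case: ifP => // _; exact: G0.
  apply: measurable_funTS.
  exact: (measurableT_comp mif (pair1_measurable x)).
rewrite (@tonelli_dom _ _ 'rV[R]_n (measurableTypeR R) R mu lam pos _ f)//.
rewrite -ge0_integralZl_EFin//; last 3 first.
- by move=> t _; rewrite mule_ge0 ?N0// lee_fin powR_ge0.
- by apply: measurable_funTS; have := mN => ?; meas.
- exact: mulr_ge0.
apply: le_nnintegral => t; rewrite /= in_itv/= andbT => t0.
  by apply: integral_ge0 => x _; exact: f0.
apply: (@le_trans _ _ (G t * \int[mu]_(x in [set x : 'rV[R]_n | (enorm x <= t)%R])
    (enorm x `^ (- gm))%:E)).
  rewrite -ge0_integralZl//; last 3 first.
  - exact: measurable_ball_enorm.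
  - by apply: measurable_funTS; meas.
  - by move=> x _; rewrite lee_fin powR_ge0.
  rewrite [leRHS]integral_mkcond; apply: le_nnintegral => x _; first exact: f0.
  rewrite patchE /f/=; case: ifPn => xt; first by rewrite mem_set// muleC.
  by rewrite mule0; case: ifP => // _; rewrite mule_ge0 ?G0// lee_fin powR_ge0.
apply: (@le_trans _ _ (G t * (ball_cst * t `^ (n%:R - gm))%:E)).
  by rewrite lee_wpmul2l ?G0//; exact: integral_ball_enorm_powR.
rewrite /G muleAC -EFinM [leRHS]muleA -EFinM lee_wpmul2r ?N0// lee_fin.
have -> : (t `^ (1 - beta) = t `^ (1 + de - n%:R) * t `^ (n%:R - gm))%R.
  rewrite -powRD ?(gt_eqF t0) ?implybT//.
  by congr (_ `^ _)%R; rewrite /gm; ring.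
by rewrite le_eqVlt; apply/orP; left; apply/eqP; ring.
Qed.

Lemma potential_hardy :
  \int[mu]_x ((enorm x `^ (- beta))%:E * (F x * F x)) <= hardy_cst%:E * E.
Proof.
pose H (x : 'rV[R]_n) := (enorm x `^ (- gm))%:E *
    \int[lam]_(t in pos) (if (enorm x <= t)%R then
      (M * c0 * t `^ (1 + de - n%:R))%:E * N t else 0).
have Mc : (0 <= M * c0)%R by rewrite mulr_ge0 ?(ltW M_gt0) ?(ltW c0_gt0).
have G0 t : 0 <= (M * c0 * t `^ (1 + de - n%:R))%:E * N t.
  by rewrite mule_ge0 ?N0// lee_fin mulr_ge0 ?powR_ge0.
have H0 x : 0 <= H x.
  rewrite mule_ge0 ?lee_fin ?powR_ge0//; apply: integral_ge0 => t _.
  by case: ifP => // _; exact: G0.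
have mH : measurable_fun setT H.
  apply: measurable_fun_mule; first by meas.
  apply: (@measurable_fun_integral_dom _ _ 'rV[R]_n (measurableTypeR R) R lam pos _
    (fun z => if (enorm z.1 <= z.2)%R then (M * c0 * z.2 `^ (1 + de - n%:R))%:E * N z.2 else 0)) => //.
  - apply: measurable_fun_ifT; last 2 first.
    + by have := mN => ?; meas.
    + exact: measurable_cst.
    + by apply: measurable_fun_ler; meas.
  - by move=> z; case: ifP => // _; exact: G0.
apply: (@le_trans _ _ (\int[mu]_x (2%:E * ((beta^-1)%:E * g x + (de^-1)%:E * H x)))).
  apply: le_nnintegral => x _; first by rewrite mule_ge0 ?mule_ge0 ?F0// lee_fin powR_ge0.
  (* At the origin the weight |x|^(-beta) is 0 by convention, and T = |x| would not be an admissible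
     splitting point. *)
  have [x0|x0] := eqVneq (enorm x) 0%R.
    rewrite x0 powR0 ?oppr_eq0 ?gt_eqF// mul0e mule_ge0// adde_ge0// mule_ge0 ?g0 ?H0//.
      by rewrite lee_fin invr_ge0 ltW.
    by rewrite lee_fin invr_ge0 ltW.
  have {}x0 : (0 < enorm x)%R by rewrite lt_neqAle eq_sym x0 enorm_ge0.
  apply: le_trans (lee_wpmul2l _ (potential_split x x0)) _.
    by rewrite lee_fin powR_ge0.
  rewrite muleCA lee_wpmul2l// ge0_muleDr ?mule_ge0 ?integral_ge0//.
  apply: leeD.
    apply: le_trans (lee_wpmul2l _ (potential_near_le x x0)) _.
      by rewrite lee_fin powR_ge0.
    rewrite muleA -EFinM mulrA -powRD ?(gt_eqF x0) ?implybT//.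
    by rewrite addNr powRr0 mul1r.
  apply: le_trans (lee_wpmul2l _ (potential_far_le x x0 de0)) _.
    by rewrite lee_fin powR_ge0.
  rewrite muleA -EFinM mulrA -powRD ?(gt_eqF x0) ?implybT// -opprD.
  rewrite mulrC EFinM -muleA lee_wpmul2l//; first by rewrite lee_fin invr_ge0 ltW.
  rewrite lee_wpmul2l ?lee_fin ?powR_ge0//.
  rewrite integral_mkcond [leRHS]integral_mkcond; apply: le_nnintegral => t _.
    by rewrite patchE; case: ifP => // _; exact: G0.
  rewrite !patchE; case: ifPn => [|_]; last first.
    by case: ifP => // _; case: ifP => // _; exact: G0.
  rewrite inE/= in_itv/= andbT => xt; rewrite mem_set ?xt//=.
  by rewrite in_itv/= andbT (lt_le_trans x0).
rewrite ge0_integralZl_EFin//; last 2 first.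
- by move=> x _; rewrite adde_ge0// mule_ge0 ?g0 ?H0// lee_fin invr_ge0 ltW.
- by have := mg => ?; meas.
rewrite ge0_integralD//; last 4 first.
- by move=> x _; rewrite mule_ge0 ?g0// lee_fin invr_ge0 ltW.
- by have := mg => ?; meas.
- by move=> x _; rewrite mule_ge0 ?H0// lee_fin invr_ge0 ltW.
- by meas.
rewrite !ge0_integralZl_EFin ?invr_ge0 ?(ltW b0) ?(ltW de0)//.
rewrite /hardy_cst EFinM -muleA lee_wpmul2l// EFinD ge0_muleDl; last 2 first.
- exact: divr_ge0 (mulr_ge0 (ltW M_gt0) (ltW M_gt0)) (ltW b0).
- exact: divr_ge0 (mulr_ge0 Mc B0) (ltW de0).
apply: leeD.
- rewrite [(_ / beta)%R]mulrC EFinM -muleA lee_wpmul2l ?lee_fin ?invr_ge0 ?(ltW b0)//.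
  exact: integral_square_function.
- rewrite [(_ / de)%R]mulrC EFinM -muleA lee_wpmul2l ?lee_fin ?invr_ge0 ?(ltW de0)//.
  exact: potential_tail.
Qed.

Lemma hardy_cst_gt0 : (0 < hardy_cst)%R.
Proof.
apply: mulr_gt0 => //; apply: ltr_wpDr.
  exact: divr_ge0 (mulr_ge0 (mulr_ge0 (ltW M_gt0) (ltW c0_gt0)) B0) (ltW de0).
exact: divr_gt0 (mulr_gt0 M_gt0 M_gt0) b0.
Qed.

End potential.

(** * Real-valued integrals: domination, differentiation, Fubini *)

Section real_integrals.
Context d (T : measurableType d) {R : realType}.
Variable mu : {measure set T -> \bar R}.

Lemma integrable_bounded_by (f g : T -> R) : measurable_fun setT f ->
  (forall x, `|f x| <= g x) -> (\int[mu]_x (g x)%:E < +oo)%E ->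
  mu.-integrable setT (EFin \o f).
Proof.
move=> mf fg gy; apply/integrableP; split; first exact/measurable_EFinP.
apply: le_lt_trans gy; apply: le_nnintegral => x _ //=.
by rewrite lee_fin.
Qed.

Lemma integrable_lty (f : T -> R) : measurable_fun setT f ->
  (\int[mu]_x (`|f x|)%:E < +oo)%E -> mu.-integrable setT (EFin \o f).
Proof. by move=> mf; apply: integrable_bounded_by. Qed.

Lemma integrable_normr_lty (f : T -> R) : mu.-integrable setT (EFin \o f) ->
  (\int[mu]_x (`|f x|)%:E < +oo)%E.
Proof. by move=> /integrableP[]. Qed.

Lemma EFin_Rintegral (f : T -> R) : mu.-integrable setT (EFin \o f) ->
  (\int[mu]_x f x)%:E = (\int[mu]_x (f x)%:E)%E.
Proof. by move=> fi; rewrite /Rintegral fineK//; exact: integrable_fin_num. Qed.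

Lemma normr_Rintegral_le (f g : T -> R) (C : R) : mu.-integrable setT (EFin \o f) ->
  (forall x, `|f x| <= g x) -> (\int[mu]_x (g x)%:E <= C%:E)%E ->
  `|\int[mu]_x f x| <= C.
Proof.
move=> fi fg gC; apply: le_trans (le_normr_Rintegral measurableT fi) _.
rewrite -lee_fin EFin_Rintegral; last exact: integrable_norm.
by apply: le_trans gC; apply: le_nnintegral => x _ //; rewrite lee_fin.
Qed.

Lemma Rintegral_dominated_cvg (f_ : nat -> T -> R) (f g : T -> R) :
  (forall k, measurable_fun setT (f_ k)) ->
  (forall x, f_ k x @[k --> \oo] --> f x) ->
  (forall k x, `|f_ k x| <= g x) -> mu.-integrable setT (EFin \o g) ->
  \int[mu]_x f_ k x @[k --> \oo] --> \int[mu]_x f x.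
Proof.
move=> mf_ f_f f_g gi.
have mf : measurable_fun setT f by apply: measurable_fun_cvg mf_ _ => x _; exact: f_f.
have [] := @dominated_convergence _ _ _ mu setT measurableT
  (fun k x => (f_ k x)%:E) (fun x => (f x)%:E) (EFin \o g) _ _ _ gi _.
- by move=> k; exact: measurable_fun_EFin.
- exact: measurable_fun_EFin.
- by apply: aeW => x _; apply: cvg_EFin; [exact: nearW|exact: f_f].
- by apply: aeW => x k _; rewrite lee_fin.
move=> fi _ H; have f_i k : mu.-integrable setT (EFin \o f_ k).
  by apply: le_integrable gi => //; [exact: measurable_fun_EFin
    |move=> x _ /=; rewrite lee_fin (le_trans (f_g k x))// ler_norm].
by apply: fine_cvg; rewrite EFin_Rintegral.
Qed.

Lemma is_derive_under_integral (f df : R -> T -> R) (a u v : R) (G : T -> R) :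
  u < a -> a < v ->
  (forall x, measurable_fun setT (f x)) ->
  (forall x, u < x < v -> mu.-integrable setT (EFin \o f x)) ->
  (forall x y, u < x < v -> is_derive x (1 : R) (f^~ y) (df x y)) ->
  (forall x y, u < x < v -> `|df x y| <= G y) ->
  mu.-integrable setT (EFin \o G) ->
  is_derive a (1 : R) (fun x => \int[mu]_y f x y) (\int[mu]_y df a y).
Proof.
move=> ua av mf fi fd dfG Gi.
have Ia : `]u, v[%classic a by rewrite /= in_itv/= ua av.
have I x : `]u, v[%classic x -> u < x < v by rewrite /= in_itv.
have E x y : u < x < v -> partial1of2 f x y = df x y.
  by move=> /fd H; rewrite partial1of2E; have [_ ->] := H y.
have G0 y : 0 <= G y by apply: le_trans (dfG a y _); rewrite ?ua.
have f1 x : `]u, v[%classic x -> mu.-integrable setT (EFin \o f x) by move=> /I; exact: fi.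
have f2 x y : `]u, v[%classic x -> setT y -> derivable (f^~ y) x 1.
  by move=> /I /fd H _; have [] := H y.
have f3 x y : `]u, v[%classic x -> setT y -> `|partial1of2 f x y| <= G y.
  by move=> /I h _; rewrite E// dfG.
apply: DeriveDef.
  exact: (@derivable_under_integral _ _ _ mu f setT measurableT a u v Ia f1 f2 G G0 Gi f3).
rewrite -derive1E.
rewrite (@differentiation_under_integral _ _ _ mu f setT measurableT a u v Ia f1 f2 G G0 Gi f3).
by apply: eq_Rintegral => y _; rewrite E// ua.
Qed.

End real_integrals.

Section real_fubini.
Context d1 d2 (T1 : measurableType d1) (T2 : measurableType d2) {R : realType}.
Variables (m1 : {sigma_finite_measure set T1 -> \bar R})
          (m2 : {sigma_finite_measure set T2 -> \bar R}).
Variable f : T1 * T2 -> R.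
Hypothesis mf : measurable_fun setT f.
Hypothesis fy : (\int[m1]_x \int[m2]_y (`|f (x, y)|)%:E < +oo)%E.

Let fi : (m1 \x m2)%E.-integrable setT (EFin \o f).
Proof. by apply/integrable12ltyP => //; exact: measurable_fun_EFin. Qed.

Let fGi : m2.-integrable setT (fubini_G m1 (EFin \o f)).
Proof.
pose g (z : T2 * T1) := (f (z.2, z.1))%:E.
have mg : measurable_fun setT g.
  apply: measurable_fun_EFin; apply: (measurableT_comp mf).
  by apply: measurable_fun_pair; [exact: measurable_snd|exact: measurable_fst].
suff gi : (m2 \x m1)%E.-integrable setT g by exact: integrable_fubini_F gi.
apply/integrable12ltyP => //; rewrite /g/=.
rewrite -(fubini_tonelli (fun z => (`|f z|)%:E))//.
exact/measurable_fun_EFin/measurable_fun_normr.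
Qed.

(** The inner integrals are finite almost everywhere, so taking [fine] of them before the outer
    integration changes nothing. *)
Let Rint_fine d (T : measurableType d) (m : {measure set T -> \bar R})
    (F : T -> \bar R) : m.-integrable setT F ->
  \int[m]_x fine (F x) = fine (\int[m]_x F x)%E.
Proof.
move=> Fi; rewrite /Rintegral; congr fine; apply: ae_eq_integral => //.
- by apply/measurable_fun_EFin/measurable_fun_fine; exact: measurable_int Fi.
- exact: measurable_int Fi.
have := integrable_ae measurableT Fi; apply: filterS => x /(_ I) h _.
by rewrite fineK.
Qed.

Lemma Rfubini :
  \int[m1]_x \int[m2]_y f (x, y) = \int[m2]_y \int[m1]_x f (x, y).
Proof.
rewrite (Rint_fine (integrable_fubini_F fi)) (Rint_fine fGi).
by rewrite /fubini_F /fubini_G; congr fine; exact: Fubini.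
Qed.

Lemma Rfubini_prod : \int[m1]_x \int[m2]_y f (x, y) = \int[(m1 \x m2)%E]_z f z.
Proof.
by rewrite (Rint_fine (integrable_fubini_F fi)) integral12_prod_meas1.
Qed.

Lemma integrable_Rfubini : m1.-integrable setT (EFin \o (fun x => \int[m2]_y f (x, y))).
Proof.
have Fi := integrable_fubini_F fi.
apply: integrable_lty; first by apply: measurable_fun_fine; exact: measurable_int Fi.
apply: le_lt_trans fy; apply: le_nnintegral => x _ //.
apply: (@le_trans _ _ (`|\int[m2]_y (f (x, y))%:E|)%E).
  by rewrite /Rintegral; case: (\int[m2]_y (f (x, y))%:E)%E => [r||] //=; rewrite leey.
apply: le_abse_integral => //; apply: measurable_fun_EFin.
exact: measurable_fun_pair2.
Qed.

End real_fubini.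

(** * The Gaussian on the line and its cosine transform *)

Section gaussian_line.
Context {R : realType}.
Notation lam := (@lebesgue_measure R).
Implicit Types (tau z x : R).

Lemma integral_gauss tau : 0 < tau ->
  (\int[lam]_x (expR (- (tau * x ^+ 2)))%:E = (Num.sqrt (pi / tau))%:E)%E.
Proof.
move=> tau0; have st : 0 < Num.sqrt tau by rewrite sqrtr_gt0.
have st0 : Num.sqrt tau != 0 by rewrite gt_eqF.
have mg : measurable_fun setT (fun x : R => (gauss_fun x)%:E).
  by rewrite /gauss_fun; meas.
have := @lebesgue_affine R (fun x => (gauss_fun x)%:E) 0 _ st0 mg.
rewrite integralT_gauss gtr0_norm// => /(_ (fun x => expR_ge0 _)).
under eq_integral do rewrite /gauss_fun add0r exprMn sqr_sqrtr ?(ltW tau0)//.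
set I := (\int[lam]_x _)%E => H.
have -> : (I = ((Num.sqrt tau)^-1)%:E * ((Num.sqrt tau)%:E * I))%E.
  by rewrite muleA -EFinM mulVf// mul1e.
by rewrite -H -EFinM mulrC sqrtrM ?pi_ge0// sqrtrV// ltW.
Qed.

Lemma integrable_gauss tau : 0 < tau ->
  lam.-integrable setT (EFin \o (fun x : R => expR (- (tau * x ^+ 2)))).
Proof.
move=> tau0.
apply: (@integrable_bounded_by _ (measurableTypeR R) _ _ _ (fun x => expR (- (tau * x ^+ 2)))).
- by meas.
- by move=> x; rewrite ger0_norm ?expR_ge0.
- by rewrite integral_gauss// ltry.
Qed.

(** Half of the exponent is spent on |x|, through |x| <= 1 + x^2 and exp(u) >= 1 + u. *)
Lemma normr_gauss_le tau x : 0 < tau ->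
  `|x| * expR (- (tau * x ^+ 2)) <= (1 + 2 / tau) * expR (- (tau / 2 * x ^+ 2)).
Proof.
move=> tau0; have -> : expR (- (tau * x ^+ 2)) =
    expR (- (tau / 2 * x ^+ 2)) * expR (- (tau / 2 * x ^+ 2)).
  by rewrite -expRD; congr expR; field.
rewrite mulrA ler_wpM2r ?expR_ge0// expRN ler_pdivrMr ?expR_gt0//.
have x2 : 0 <= x ^+ 2 by exact: sqr_ge0.
have t2 : 0 < tau / 2 by rewrite divr_gt0.
apply: (@le_trans _ _ ((1 + 2 / tau) * (1 + tau / 2 * x ^+ 2))); last first.
  by rewrite ler_wpM2l ?expR_ge1Dx// addr_ge0// divr_ge0// ltW.
have -> : (1 + 2 / tau) * (1 + tau / 2 * x ^+ 2) =
    1 + x ^+ 2 + (2 / tau + tau / 2 * x ^+ 2) by field; rewrite gt_eqF.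
have t3 : 0 <= 2 / tau + tau / 2 * x ^+ 2.
  exact: addr_ge0 (divr_ge0 (ler0n _ 2) (ltW tau0)) (mulr_ge0 (ltW t2) x2).
apply: (@le_trans _ _ (1 + x ^+ 2)); last by rewrite lerDl.
by rewrite -real_normK ?num_real//; have := sqr_ge0 (`|x| - 1); nra.
Qed.

Lemma integral_derivative0 (S f : R -> R) :
  (forall x, is_derive x (1 : R) S (f x)) -> continuous f ->
  lam.-integrable setT (EFin \o f) ->
  (fun k : nat => S k%:R - S (- k%:R)) k @[k --> \oo] --> (0 : R) ->
  \int[lam]_x f x = 0.
Proof.
move=> dS cf fi S0.
have mf : measurable_fun setT f by exact: continuous_measurable_fun.
pose f_ (k : nat) := f \_ `[- k%:R, k%:R].
have H : \int[lam]_x f_ k x @[k --> \oo] --> \int[lam]_x f x.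
  apply: (@Rintegral_dominated_cvg _ (measurableTypeR R) _ _ _ _ (fun x => `|f x|)).
  - by move=> k; apply/(measurable_restrictT _ _).1 => //; exact: measurable_funS mf.
  - move=> x; apply: cvg_near_cst; near=> k.
    rewrite /f_ patchE ifT// inE/= in_itv/= -ler_norml.
    near: k; exact: nbhs_infty_ger.
  - by move=> k x; rewrite /f_ patchE; case: ifP => // _; rewrite normr0.
  - exact: integrable_norm.
apply: (cvg_unique _ H) => //.
suff -> : (fun k : nat => \int[lam]_x f_ k x) = (fun k : nat => S k%:R - S (- k%:R)) by [].
apply/funext => k; rewrite /f_ -Rintegral_mkcond.
have [->|k0] := eqVneq k 0%N.
  by rewrite oppr0 subrr set_itv1 Rintegral_set1.
have kk : - k%:R < k%:R :> R by rewrite -subr_gt0 opprK addr_gt0// ltr0n lt0n.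
by rewrite /Rintegral (FTC_closed kk (fun x _ => dS x) (fun x _ => cf x)).
Unshelve. all: by end_near. Qed.

Lemma expRN_sqr_cvg0 tau : 0 < tau ->
  expR (- (tau * k%:R ^+ 2)) @[k --> \oo] --> (0 : R).
Proof.
move=> tau0; apply: (@squeeze_cvgr _ _ _ _ (fun=> 0) (fun k : nat => expR (- tau) ^+ k)).
- near=> k; rewrite expR_ge0/= -expRM_natr ler_expR mulNr lerN2 ler_wpM2l ?(ltW tau0)//.
  by rewrite -natrX ler_nat; case: (k) => // j; rewrite expnS leq_pmulr.
- exact: cvg_cst.
- apply: cvg_expr; rewrite ger0_norm ?expR_ge0// -expR0 ltr_expR oppr_lt0//.
Unshelve. all: by end_near. Qed.

Definition gauss_cos tau z : R := \int[lam]_x (cos (z * x) * expR (- (tau * x ^+ 2))).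

Lemma integrable_cos_gauss tau z : 0 < tau ->
  lam.-integrable setT (EFin \o (fun x : R => cos (z * x) * expR (- (tau * x ^+ 2)))).
Proof.
move=> tau0; apply: (@integrable_bounded_by _ (measurableTypeR R) _ _ _ (fun x => expR (- (tau * x ^+ 2)))).
- by meas.
- move=> x; rewrite normrM [X in _ * X]ger0_norm ?expR_ge0// ler_piMl ?expR_ge0//.
  by rewrite ler_norml cos_geN1 cos_le1.
- by rewrite integral_gauss// ltry.
Qed.

Lemma integrable_id_sin_gauss tau z : 0 < tau ->
  lam.-integrable setT (EFin \o (fun x : R => x * sin (z * x) * expR (- (tau * x ^+ 2)))).
Proof.
move=> tau0; apply: (@integrable_bounded_by _ (measurableTypeR R) _ _ _
    (fun x => (1 + 2 / tau) * expR (- (tau / 2 * x ^+ 2)))).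
- by meas.
- move=> x; rewrite !normrM; apply: le_trans (normr_gauss_le x tau0).
  rewrite [X in _ * X <= _]ger0_norm ?expR_ge0// ler_wpM2r ?expR_ge0// ler_piMr//.
  by rewrite ler_norml sin_geN1 sin_le1.
- have t2 : 0 < tau / 2 by rewrite divr_gt0.
  have t1 : 0 <= 1 + 2 / tau by rewrite addr_ge0// divr_ge0// ltW.
  under eq_integral do rewrite EFinM.
  rewrite ge0_integralZl_EFin//; last by meas.
  by rewrite integral_gauss// -EFinM ltry.
Qed.

(** The classical differential equation of the Gaussian transform: differentiate under the integral,
    then integrate by parts. *)
Lemma is_derive_gauss_cos tau z : 0 < tau ->
  is_derive z (1 : R) (gauss_cos tau) (- (z / (2 * tau)) * gauss_cos tau z).
Proof.
move=> tau0.
have H : is_derive z (1 : R) (gauss_cos tau)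
   (\int[lam]_x (- (x * sin (z * x) * expR (- (tau * x ^+ 2))))).
  pose f (z x : R) := cos (z * x) * expR (- (tau * x ^+ 2)).
  pose df (z x : R) := - (x * sin (z * x) * expR (- (tau * x ^+ 2))).
  pose G (x : R) := (1 + 2 / tau) * expR (- (tau / 2 * x ^+ 2)).
  have mf x : measurable_fun setT (f x) by rewrite /f; meas.
  have fi x : z - 1 < x < z + 1 -> lam.-integrable setT (EFin \o f x).
    by move=> _; exact: integrable_cos_gauss.
  have fd x y : z - 1 < x < z + 1 -> is_derive x (1 : R) (f^~ y) (df x y).
    by move=> _; rewrite /f /df; apply: is_derive_eq; rewrite /GRing.scale/=; ring.
  have dfG x y : z - 1 < x < z + 1 -> `|df x y| <= G y.
    move=> _; rewrite normrN !normrM; apply: le_trans (normr_gauss_le y tau0).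
    rewrite [X in _ * X <= _]ger0_norm ?expR_ge0// ler_wpM2r ?expR_ge0// ler_piMr//.
    by rewrite ler_norml sin_geN1 sin_le1.
  have Gi : lam.-integrable setT (EFin \o G).
    have t2 : 0 < tau / 2 by rewrite divr_gt0.
    rewrite /comp; under eq_fun do rewrite EFinM.
    by apply: integrableZl => //; exact: integrable_gauss.
  have u1 : z - 1 < z by rewrite ltrBlDr ltrDl.
  have u2 : z < z + 1 by rewrite ltrDl.
  exact: (@is_derive_under_integral _ (measurableTypeR R) _ lam f df z _ _ G u1 u2 mf fi fd dfG Gi).
rewrite (_ : - (z / (2 * tau)) * _ = \int[lam]_x (- (x * sin (z * x) * expR (- (tau * x ^+ 2)))))//.
(* The integral of S' over the line is 0, since S vanishes at both ends; this is the integration by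
   parts that exchanges x sin for cos. *)
pose S x := sin (z * x) * expR (- (tau * x ^+ 2)).
have dS x : is_derive x (1 : R) S
   (z * (cos (z * x) * expR (- (tau * x ^+ 2))) -
    2 * tau * (x * sin (z * x) * expR (- (tau * x ^+ 2)))).
  by apply: is_derive_eq; rewrite /GRing.scale/= mulr1; ring.
have i1 := integrable_cos_gauss z tau0; have i2 := integrable_id_sin_gauss z tau0.
have H0 : \int[lam]_x (z * (cos (z * x) * expR (- (tau * x ^+ 2))) -
    2 * tau * (x * sin (z * x) * expR (- (tau * x ^+ 2)))) = 0.
  apply: (integral_derivative0 dS).
  - move=> x; apply/differentiable_continuous/derivable1_diffP; exact: ex_derive.
  - rewrite /comp; under eq_fun do rewrite EFinB !EFinM.
    by apply: integrableB => //; apply: integrableZl.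
  - apply: norm_cvg0; apply: (@squeeze_cvgr _ _ _ _ (fun=> 0)
      (fun k : nat => 2 * expR (- (tau * k%:R ^+ 2)))).
    + near=> k; rewrite normr_ge0/=; apply: le_trans (ler_normB _ _) _.
      have S1 x : `|S x| <= expR (- (tau * x ^+ 2)).
        rewrite normrM [X in _ * X]ger0_norm ?expR_ge0// ler_piMl ?expR_ge0//.
        by rewrite ler_norml sin_geN1 sin_le1.
      have -> : 2 * expR (- (tau * k%:R ^+ 2)) =
          expR (- (tau * k%:R ^+ 2)) + expR (- (tau * (- k%:R) ^+ 2)).
        by rewrite sqrrN; ring.
      exact: lerD.
    + exact: cvg_cst.
    + rewrite -(mulr0 2); apply: cvgM; first exact: cvg_cst.
      exact: expRN_sqr_cvg0.
rewrite RintegralB// in H0; last 2 first.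
- by rewrite /comp; under eq_fun do rewrite EFinM; exact: integrableZl.
- by rewrite /comp; under eq_fun do rewrite EFinM; exact: integrableZl.
rewrite !RintegralZl// in H0.
have -> : \int[lam]_x (- (x * sin (z * x) * expR (- (tau * x ^+ 2)))) =
   - \int[lam]_x (x * sin (z * x) * expR (- (tau * x ^+ 2))).
  rewrite -mulN1r -RintegralZl//; apply: eq_Rintegral => x _; ring.
move/eqP : H0; rewrite subr_eq0 => /eqP H0.
apply: (@mulfI _ (2 * tau)); first by rewrite mulf_neq0// gt_eqF.
rewrite mulrN -H0 /gauss_cos; field.
by rewrite gt_eqF.
Unshelve. all: by end_near. Qed.

Lemma gauss_cosE tau z : 0 < tau ->
  gauss_cos tau z = Num.sqrt (pi / tau) * expR (- (z ^+ 2 / (4 * tau))).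
Proof.
move=> tau0.
(* Dividing by the expected solution leaves a function with zero derivative, which is evaluated at z
   = 0. *)
pose H z := gauss_cos tau z * expR (z ^+ 2 / (4 * tau)).
have dH x : is_derive x (1 : R) H 0.
  have d1 := is_derive_gauss_cos x tau0.
  have d2 : is_derive x (1 : R) (fun z : R => expR (z ^+ 2 / (4 * tau)))
     (x / (2 * tau) * expR (x ^+ 2 / (4 * tau))).
    by apply: is_derive_eq; rewrite /GRing.scale/= mulr1; field; rewrite gt_eqF.
  apply: (is_derive_eq (is_deriveM d1 d2)); rewrite /GRing.scale/=; ring.
have := is_derive_0_is_cst z 0 dH; rewrite /H expr0n/= mul0r expR0 mulr1.
have -> : gauss_cos tau 0 = Num.sqrt (pi / tau).
  rewrite /gauss_cos; under eq_Rintegral do rewrite mul0r cos0 mul1r.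
  by rewrite /Rintegral integral_gauss.
by move=> <-; rewrite -mulrA -expRD subrr expR0 mulr1.
Qed.

End gaussian_line.

Section signed_rV.
Context {R : realType}.
Notation lam := (@lebesgue_measure R).

Lemma integrable_rV_cons n (f : 'rV[R]_n.+1 -> R) :
  (lebesgue_rV n.+1).-integrable setT (EFin \o f) ->
  (\int[lam]_a \int[lebesgue_rV n]_y (`|f (rV_cons (a, y))|)%:E < +oo)%E.
Proof.
move=> /integrableP[mf]; rewrite integral_rV_cons//.
by apply: measurable_fun_abse.
Qed.

Lemma Rintegral_rV_cons n (f : 'rV[R]_n.+1 -> R) :
  (lebesgue_rV n.+1).-integrable setT (EFin \o f) ->
  \int[lebesgue_rV n.+1]_x f x =
  \int[lam]_a \int[lebesgue_rV n]_y f (rV_cons (a, y)).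
Proof.
move=> fi; have mc := @measurable_rV_cons R n.
have mf : measurable_fun setT f by apply/measurable_EFinP; exact: measurable_int fi.
pose g := fun z : measurableTypeR R * 'rV[R]_n => f (rV_cons z).
have mg : measurable_fun setT g by exact: measurableT_comp mf mc.
have gy : (\int[lam]_a \int[lebesgue_rV n]_y (`|g (a, y)|)%:E < +oo)%E.
  exact: integrable_rV_cons.
rewrite (Rfubini_prod mg gy) /Rintegral; congr fine.
pose J := (\int[pushforward (lam \x lebesgue_rV n) (@rV_cons R n)]_x (f x)%:E)%E.
transitivity J; first by apply: eq_measure_integral => A mA _.
rewrite /J integral_pushforward//; first by apply: measurable_fun_EFin.
by rewrite preimage_setT; apply/integrable12ltyP => //; exact: measurable_fun_EFin.
Qed.

Lemma Rintegral_rV_reflect n (f : 'rV[R]_n -> R) (b : 'rV[R]_n) :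
  measurable_fun setT f ->
  \int[lebesgue_rV n]_x f (b - x) = \int[lebesgue_rV n]_x f x.
Proof.
move=> mf; rewrite /Rintegral; congr fine; rewrite integralE [RHS]integralE.
have mp : measurable_fun setT ((EFin \o f)^\+)%E.
  by apply: measurable_funepos; exact: measurable_fun_EFin.
have mn : measurable_fun setT ((EFin \o f)^\-)%E.
  by apply: measurable_funeneg; exact: measurable_fun_EFin.
congr (_ - _)%E.
- rewrite -(lebesgue_rV_reflect b mp)//.
  by apply: eq_integral => x _; rewrite !funeposE.
- rewrite -(lebesgue_rV_reflect b mn)//.
  by apply: eq_integral => x _; rewrite !funenegE.
Qed.

End signed_rV.

(** * Gaussian Fourier transforms *)

Section gaussian_rV.
Context {R : realType}.
Notation lam := (@lebesgue_measure R).
Implicit Types (tau : R).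

Lemma dotp_rV_cons n (a b : R) (y z : 'rV[R]_n) :
  dotp (rV_cons (a, y)) (rV_cons (b, z)) = a * b + dotp y z.
Proof.
rewrite /dotp big_ord_recl !mxE unlift_none; congr (_ + _).
by apply: eq_bigr => i _; rewrite !mxE liftK.
Qed.

Lemma rV_cons_surj n (z : 'rV[R]_n.+1) :
  z = rV_cons (z 0 ord0, \row_j z 0 (lift ord0 j)).
Proof.
apply/rowP => i; rewrite mxE; case: unliftP => [j ->|->]//.
by rewrite mxE.
Qed.

Definition gauss_rV n tau (x : 'rV[R]_n) : R := expR (- (tau * enorm x ^+ 2)).

Lemma gauss_rV_ge0 n tau (x : 'rV[R]_n) : 0 <= gauss_rV tau x.
Proof. exact: expR_ge0. Qed.

Lemma measurable_fun_gauss_rV n tau d (T : measurableType d) (u : T -> 'rV[R]_n) :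
  measurable_fun setT u -> measurable_fun setT (fun t => gauss_rV tau (u t)).
Proof. by move=> mu; rewrite /gauss_rV; meas. Qed.

Lemma measurable_gauss_rV n tau : measurable_fun setT (@gauss_rV n tau).
Proof. exact: (@measurable_fun_gauss_rV _ _ _ _ (fun x => x)). Qed.

Lemma gauss_rV_cons n tau a (y : 'rV[R]_n) :
  gauss_rV tau (rV_cons (a, y)) = expR (- (tau * a ^+ 2)) * gauss_rV tau y.
Proof.
by rewrite /gauss_rV !enorm_sqr dotp_rV_cons -expRD; congr expR; ring.
Qed.

Lemma integral_gauss_rV n tau : 0 < tau ->
  (\int[lebesgue_rV n]_x (gauss_rV tau x)%:E = (Num.sqrt (pi / tau) ^+ n)%:E)%E.
Proof.
move=> tau0; have g0 m (x : 'rV[R]_m) : (0 <= (gauss_rV tau x)%:E)%E.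
  by rewrite lee_fin gauss_rV_ge0.
have mg m : measurable_fun setT (fun x : 'rV[R]_m => (gauss_rV tau x)%:E).
  by apply: measurable_fun_EFin; apply: measurable_gauss_rV.
elim: n => [|n IH].
  rewrite integral_dirac//; last exact: mg.
  rewrite diracE mem_set// mul1e expr0 /gauss_rV.
  by rewrite enorm_sqr /dotp big_ord0 mulr0 oppr0 expR0.
rewrite integral_rV_cons//.
transitivity (\int[lam]_a ((Num.sqrt (pi / tau) ^+ n)%:E * (expR (- (tau * a ^+ 2)))%:E))%E.
  apply: eq_integral => a _; under eq_integral do rewrite gauss_rV_cons EFinM.
  by rewrite ge0_integralZl_EFin ?expR_ge0//; [rewrite IH muleC|exact: mg].
rewrite ge0_integralZl_EFin ?exprn_ge0 ?sqrtr_ge0//; last by meas.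
by rewrite integral_gauss// -EFinM -exprSr.
Qed.

Lemma integrable_cos_gauss_rV n tau (z : 'rV[R]_n) : 0 < tau ->
  (lebesgue_rV n).-integrable setT (EFin \o (fun x => cos (dotp z x) * gauss_rV tau x)).
Proof.
move=> tau0; apply: (@integrable_bounded_by _ _ _ _ _ (gauss_rV tau)).
- by apply: measurable_fun_mul; [meas|exact: measurable_gauss_rV].
- move=> x; rewrite normrM [X in _ * X]ger0_norm ?gauss_rV_ge0//.
  by rewrite ler_piMl ?gauss_rV_ge0// ler_norml cos_geN1 cos_le1.
- by rewrite integral_gauss_rV// ltry.
Qed.

Lemma integrable_sin_gauss_rV n tau (z : 'rV[R]_n) : 0 < tau ->
  (lebesgue_rV n).-integrable setT (EFin \o (fun x => sin (dotp z x) * gauss_rV tau x)).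
Proof.
move=> tau0; apply: (@integrable_bounded_by _ _ _ _ _ (gauss_rV tau)).
- by apply: measurable_fun_mul; [meas|exact: measurable_gauss_rV].
- move=> x; rewrite normrM [X in _ * X]ger0_norm ?gauss_rV_ge0//.
  by rewrite ler_piMl ?gauss_rV_ge0// ler_norml sin_geN1 sin_le1.
- by rewrite integral_gauss_rV// ltry.
Qed.

(** The integrand is odd. *)
Lemma sin_gauss_rV n tau (z : 'rV[R]_n) : 0 < tau ->
  \int[lebesgue_rV n]_x (sin (dotp z x) * gauss_rV tau x) = 0.
Proof.
move=> tau0; have fi := integrable_sin_gauss_rV z tau0.
have mf : measurable_fun setT (fun x => sin (dotp z x) * gauss_rV tau x).
  by apply: measurable_fun_mul; [meas|exact: measurable_gauss_rV].
have := Rintegral_rV_reflect 0 mf.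
have -> : \int[lebesgue_rV n]_x (sin (dotp z (0 - x)) * gauss_rV tau (0 - x)) =
  \int[lebesgue_rV n]_x (-1 * (sin (dotp z x) * gauss_rV tau x)).
  apply: eq_Rintegral => x _; rewrite sub0r /gauss_rV enormN dotpC dotpNl sinN mulN1r mulNr.
  by rewrite dotpC.
rewrite RintegralZl// mulN1r => /eqP; rewrite eq_sym -addr_eq0 -mulr2n mulrn_eq0/=.
by move/eqP.
Qed.

(** Induction on the dimension with cos(a + b) expanded; the product of sines drops out by oddness,
    and the cosines factor. *)
Lemma cos_gauss_rV n tau (z : 'rV[R]_n) : 0 < tau ->
  \int[lebesgue_rV n]_x (cos (dotp z x) * gauss_rV tau x) =
  Num.sqrt (pi / tau) ^+ n * expR (- (enorm z ^+ 2 / (4 * tau))).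
Proof.
move=> tau0; elim: n z => [|n IH] z.
  rewrite /Rintegral integral_dirac//; last first.
    by apply/measurable_fun_EFin/measurable_fun_mul; [meas|exact: measurable_gauss_rV].
  rewrite diracE mem_set// mul1e/= expr0 /gauss_rV !enorm_sqr /dotp !big_ord0.
  by rewrite mulr0 mul0r oppr0 expR0 cos0 mul1r.
rewrite Rintegral_rV_cons; last exact: integrable_cos_gauss_rV.
rewrite (rV_cons_surj z); set b := z 0 ord0; set z' := \row_j _.
set C := Num.sqrt (pi / tau) ^+ n * expR (- (enorm z' ^+ 2 / (4 * tau))).
transitivity (\int[lam]_a (C * (cos (b * a) * expR (- (tau * a ^+ 2))))).
  apply: eq_Rintegral => a _.
  transitivity (\int[lebesgue_rV n]_y
     (cos (b * a) * expR (- (tau * a ^+ 2)) * (cos (dotp z' y) * gauss_rV tau y) -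
      sin (b * a) * expR (- (tau * a ^+ 2)) * (sin (dotp z' y) * gauss_rV tau y))).
    apply: eq_Rintegral => y _; rewrite gauss_rV_cons dotp_rV_cons cosD; ring.
  have i1 := integrable_cos_gauss_rV z' tau0.
  have i2 := integrable_sin_gauss_rV z' tau0.
  rewrite RintegralB//; last 2 first.
  - by rewrite /comp; under eq_fun do rewrite EFinM; exact: integrableZl.
  - by rewrite /comp; under eq_fun do rewrite EFinM; exact: integrableZl.
  by rewrite !RintegralZl// sin_gauss_rV// mulr0 subr0 IH mulrC.
rewrite RintegralZl//; last exact: integrable_cos_gauss.
have := gauss_cosE b tau0; rewrite /gauss_cos => ->.
rewrite /C mulrACA -exprSr -expRD; congr (_ * expR _).
by rewrite [in RHS]enorm_sqr dotp_rV_cons -enorm_sqr; ring.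
Qed.

End gaussian_rV.

Section modulated_gaussian.
Context {R : realType} (n : nat) (z : 'rV[R]_n) (tau : R) (tau0 : 0 < tau).
Implicit Types (f g : 'rV[R]_n -> R) (x v : 'rV[R]_n).
Notation G := (@gauss_rV R n tau).

(* The span of all products of a polynomial with cos(z.x)exp(-tau|x|^2) or
   sin(z.x)exp(-tau|x|^2), which is stable under partial derivatives. *)
Inductive mod_gauss : ('rV[R]_n -> R) -> Prop :=
| mg_cos : mod_gauss (fun x => cos (dotp z x) * G x)
| mg_sin : mod_gauss (fun x => sin (dotp z x) * G x)
| mg_coord i f : mod_gauss f -> mod_gauss (fun x => x 0 i * f x)
| mg_scale c f : mod_gauss f -> mod_gauss (fun x => c * f x)
| mg_add f g : mod_gauss f -> mod_gauss g -> mod_gauss (fun x => f x + g x).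

Lemma is_derive_line f x v (d : R) :
  is_derive (0 : R) (1 : R) (fun t : R => f (t *: v + x)) d -> is_derive x v f d.
Proof.
move=> [D E].
have Eq : (fun h : R => h^-1 *: ((f \o shift x) (h *: v) - f x)) =
    (fun h : R => h^-1 *: (((fun t : R => f (t *: v + x)) \o shift 0) (h *: (1 : R)) -
       (fun t : R => f (t *: v + x)) 0)).
  apply/funext => h /=; rewrite addr0 scale0r add0r (_ : h *: (1 : R) = h)//.
  exact: mulr1.
by apply: DeriveDef; [rewrite /derivable Eq|rewrite /derive Eq].
Qed.

Lemma dotp_line i t x y : dotp y (t *: delta_mx 0 i + x) = dotp y x + t * y 0 i.
Proof.
rewrite dotpC dotpDl addrC dotpC; congr (_ + _).
rewrite /dotp (bigD1 i)//= !mxE !eqxx mulr1 big1 ?addr0// => j ji.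
by rewrite !mxE (negbTE ji) andbF mulr0 mul0r.
Qed.

Lemma enorm_line i t x :
  enorm (t *: delta_mx 0 i + x) ^+ 2 = enorm x ^+ 2 + 2 * t * x 0 i + t ^+ 2.
Proof.
rewrite !enorm_sqr dotp_line [X in X + _]dotpC dotp_line.
by rewrite !mxE !eqxx/=; ring.
Qed.

Lemma is_derive_coord i j x : is_derive x (delta_mx 0 i) (fun y : 'rV[R]_n => y 0 j : R)
  ((i == j)%:R).
Proof.
apply: is_derive_line.
have -> : (fun t : R => (t *: delta_mx 0 i + x) 0 j) = (fun t => t * (i == j)%:R + x 0 j).
  by apply/funext => t; rewrite !mxE eqxx/= eq_sym.
by apply: is_derive_eq; rewrite /GRing.scale/=; ring.
Qed.

Lemma mod_gauss_derive f i : mod_gauss f ->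
  exists2 f', mod_gauss f' & forall x, is_derive x (delta_mx 0 i) f (f' x).
Proof.
elim=> {f} [||j f mf [f' mf' df']|c f _ [f' mf' df']|f g _ [f' mf' df'] _ [g' mg' dg']].
- exists (fun x => (- z 0 i) * (sin (dotp z x) * G x) +
    (- (2 * tau)) * (x 0 i * (cos (dotp z x) * G x))).
    by apply: mg_add; apply: mg_scale; [exact: mg_sin|apply: mg_coord; exact: mg_cos].
  move=> x; apply: is_derive_line.
  have -> : (fun t : R => cos (dotp z (t *: delta_mx 0 i + x)) * G (t *: delta_mx 0 i + x)) =
    (fun t => cos (dotp z x + t * z 0 i) *
       expR (- (tau * (enorm x ^+ 2 + 2 * t * x 0 i + t ^+ 2)))).
    by apply/funext => t; rewrite dotp_line /gauss_rV enorm_line.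
  apply: is_derive_eq; rewrite /GRing.scale/= /gauss_rV expr0n/= !(mul0r, mulr0, addr0, mulr1).
  ring.
- exists (fun x => z 0 i * (cos (dotp z x) * G x) +
    (- (2 * tau)) * (x 0 i * (sin (dotp z x) * G x))).
    by apply: mg_add; apply: mg_scale; [exact: mg_cos|apply: mg_coord; exact: mg_sin].
  move=> x; apply: is_derive_line.
  have -> : (fun t : R => sin (dotp z (t *: delta_mx 0 i + x)) * G (t *: delta_mx 0 i + x)) =
    (fun t => sin (dotp z x + t * z 0 i) *
       expR (- (tau * (enorm x ^+ 2 + 2 * t * x 0 i + t ^+ 2)))).
    by apply/funext => t; rewrite dotp_line /gauss_rV enorm_line.
  apply: is_derive_eq; rewrite /GRing.scale/= /gauss_rV expr0n/= !(mul0r, mulr0, addr0, mulr1).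
  ring.
- exists (fun x => x 0 j * f' x + (i == j)%:R * f x).
    by apply: mg_add; [exact: mg_coord|exact: mg_scale].
  move=> x; apply: (is_derive_eq (is_deriveM (is_derive_coord i j x) (df' x))).
  by rewrite /GRing.scale/=; ring.
- exists (fun x => c * f' x); first exact: mg_scale.
  by move=> x; exact: (is_deriveZ c (df' x)).
- exists (fun x => f' x + g' x); first exact: mg_add.
  by move=> x; exact: (is_deriveD (df' x) (dg' x)).
Qed.

Lemma mod_gauss_differentiable f x : mod_gauss f -> differentiable f x.
Proof.
have dco j y : differentiable (fun N : 'rV[R]_n => N 0 j : R) y by exact: differentiable_coord.
have dsum (h : 'I_n -> 'rV[R]_n -> R) y : (forall i, differentiable (h i) y) ->
    differentiable (fun w => \sum_(i < n) h i w) y.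
  move=> dh; rewrite (_ : (fun w => _) = \sum_(i < n) h i); first exact: differentiable_sum.
  by apply/funext => w; rewrite fct_sumE.
have dd y : differentiable (dotp z) y.
  by apply: dsum => i; apply: differentiableM => //; exact: differentiable_cst.
have dG y : differentiable G y.
  rewrite /gauss_rV; apply: (@differentiable_comp _ _ _ _
      (fun w : 'rV[R]_n => - (tau * enorm w ^+ 2)) expR).
    apply: differentiableN; apply: differentiableM; first exact: differentiable_cst.
    rewrite (_ : (fun w => _) = fun w : 'rV[R]_n => dotp w w); last first.
      by apply/funext => w; rewrite enorm_sqr.
    by apply: dsum => i; exact: differentiableM.
  by apply/derivable1_diffP; exact: derivable_expR.
elim=> {f} [||i f _ df|c f _ df|f g _ df _ dg].
- apply: differentiableM => //; apply: (@differentiable_comp _ _ _ _ (dotp z) cos) => //.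
  by apply/derivable1_diffP; exact: derivable_cos.
- apply: differentiableM => //; apply: (@differentiable_comp _ _ _ _ (dotp z) sin) => //.
  by apply/derivable1_diffP; exact: derivable_sin.
- exact: differentiableM.
- by apply: differentiableM => //; exact: differentiable_cst.
- exact: differentiableD.
Qed.

Lemma gauss_rV_decay (k : nat) : exists M, forall x, (1 + enorm x) ^+ k * G x <= M.
Proof.
(* From (1 + |x|)^k <= exp(k |x|); the maximum of k r - tau r^2 over r is k^2 / (4 tau). *)
exists (expR (k%:R ^+ 2 / (4 * tau))) => x.
have e0 := enorm_ge0 x.
apply: (@le_trans _ _ (expR (enorm x * k%:R) * G x)).
  rewrite ler_wpM2r ?gauss_rV_ge0// expRM_natr lerXn2r ?nnegrE ?expR_ge0 ?addr_ge0//.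
  exact: expR_ge1Dx.
rewrite -expRD ler_expR -subr_ge0.
have -> : k%:R ^+ 2 / (4 * tau) - (enorm x * k%:R - tau * enorm x ^+ 2) =
   tau * (enorm x - k%:R / (2 * tau)) ^+ 2 by field; rewrite gt_eqF.
by rewrite mulr_ge0 ?sqr_ge0 ?(ltW tau0).
Qed.

Lemma mod_gauss_decay f k : mod_gauss f ->
  exists M, forall x, (1 + enorm x) ^+ k * `|f x| <= M.
Proof.
have p0 m x : 0 <= (1 + enorm x) ^+ m by rewrite exprn_ge0// addr_ge0// enorm_ge0.
move=> mf; elim: mf k => {f} [||i f _ IH|c f _ IH|f g _ IHf _ IHg] k.
- have [M HM] := gauss_rV_decay k; exists M => x; apply: le_trans (HM x).
  rewrite ler_wpM2l// normrM [X in _ * X]ger0_norm ?gauss_rV_ge0//.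
  by rewrite ler_piMl ?gauss_rV_ge0// ler_norml cos_geN1 cos_le1.
- have [M HM] := gauss_rV_decay k; exists M => x; apply: le_trans (HM x).
  rewrite ler_wpM2l// normrM [X in _ * X]ger0_norm ?gauss_rV_ge0//.
  by rewrite ler_piMl ?gauss_rV_ge0// ler_norml sin_geN1 sin_le1.
- have [M HM] := IH k.+1; exists M => x; apply: le_trans (HM x).
  rewrite exprSr normrM -mulrA ler_wpM2l// ler_wpM2r//.
  by rewrite (le_trans (coord_le_enorm x i))// lerDr.
- have [M HM] := IH k; exists (`|c| * M) => x.
  by rewrite normrM mulrCA ler_wpM2l.
- have [M HM] := IHf k; have [N HN] := IHg k; exists (M + N) => x.
  apply: (@le_trans _ _ ((1 + enorm x) ^+ k * (`|f x| + `|g x|))).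
    by rewrite ler_wpM2l// ler_normD.
  by rewrite mulrDr lerD.
Qed.

(** Makes the modulated Gaussians admissible in the distributional definition of the Fourier
    transform; they are the test functions from which everything about f is drawn. *)
Lemma mod_gauss_schwartz f : mod_gauss f -> schwartz f.
Proof.
move=> mf; have mi l : mod_gauss (iter_partial l f).
  elim: l => [//|i l IH]; rewrite /iter_partial/= -/(iter_partial l f).
  have [f' mf' df'] := mod_gauss_derive i IH.
  rewrite (_ : (fun x => _) = f')//; apply/funext => x.
  by have [_ ->] := df' x.
by split=> [l x|l k]; [exact: mod_gauss_differentiable|exact: mod_gauss_decay].
Qed.

End modulated_gaussian.

(** * Functions whose integrals against test functions vanish *)

Section ae_zero.
Context d (T : measurableType d) {R : realType}.
Variable mu : {measure set T -> \bar R}.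
Variables (F : T -> R) (Fi : mu.-integrable setT (EFin \o F)).

Let mF : measurable_fun setT F.
Proof. by have := measurable_int _ Fi; move/measurable_EFinP. Qed.

Let mulFi (h : T -> R) : measurable_fun setT h -> (forall x, `|h x| <= 1) ->
  mu.-integrable setT (EFin \o (fun x => F x * h x)).
Proof.
move=> mh h1; apply: (integrable_bounded_by (g := fun x => `|F x|)).
- by meas.
- by move=> x; rewrite normrM ler_piMr.
- exact: integrable_normr_lty.
Qed.

Let indicN (A : set T) x : `|\1_A x : R| <= 1.
Proof. by rewrite indicE ger0_norm// lern1 leq_b1. Qed.

(** The measurable sets over which F has integral 0 form a lambda-system, with dominated convergence
    for increasing unions, so they include the sigma-algebra generated by the pi-system. *)
Lemma ae_zero_pi_system (G : set (set T)) :
  setI_closed G -> (@measurable _ T `<=` <<s G >>) -> G `<=` measurable -> G setT ->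
  (forall A, G A -> \int[mu]_x (F x * \1_A x) = 0) ->
  {ae mu, forall x, F x = 0}.
Proof.
move=> GI Gm mG GT G0.
pose H := [set A | measurable A /\ \int[mu]_x (F x * \1_A x) = 0].
have GH : <<s G >> `<=` H.
  have GH A : G A -> H A by move=> GA; split; [exact: mG|exact: G0].
  apply: (@lambda_system_subset _ G GI setT H) => //; split=> //.
  - by split=> //; exact: G0.
  - move=> A B BA [mA A0] [mB B0]; split; first exact: measurableD.
    rewrite -[RHS](subr0 0) -{1}A0 -B0 -RintegralB//; last first.
    + by apply: mulFi => //; exact: measurable_indic.
    + by apply: mulFi => //; exact: measurable_indic.
    apply: eq_Rintegral => x _; rewrite -mulrBr; congr (_ * _).
    rewrite !indicE in_setD; case: (boolP (x \in B)) => [xB|xB] /=.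
      by rewrite (mem_set (BA _ (set_mem xB))) subrr.
    by rewrite subr0 andbT.
  - move=> A ndA HA.
    have mU : measurable (\bigcup_k A k) by apply: bigcup_measurable => k _; case: (HA k).
    split=> //.
    have cA : \int[mu]_x (F x * \1_(A k) x) @[k --> \oo] -->
        \int[mu]_x (F x * \1_(\bigcup_k A k) x).
      apply: (@Rintegral_dominated_cvg _ _ _ _ _ _ (fun x => `|F x|)).
      + move=> k; have [mA _] := HA k.
        have : measurable_fun setT (\1_(A k) : T -> R) by exact: measurable_indic.
        by move=> ?; meas.
      + move=> x; apply: cvgMr; rewrite [X in _ --> X]indicE.
        case: (boolP (x \in \bigcup_k A k)) => [/set_mem[k _ Akx]|xU].
          apply: cvg_near_cst; exists k => // m /= km; rewrite indicE mem_set//.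
          by move: Akx; exact/subsetPset/ndA.
        apply: cvg_near_cst; apply: nearW => m; rewrite indicE memNset// => Amx.
        by move/negP: xU; apply; apply/mem_set; exists m.
      + by move=> k x; rewrite normrM ler_piMr.
      + exact: integrable_norm.
    apply: cvg_unique cA _ => //.
    by apply: cvg_near_cst; apply: nearW => k; case: (HA k).
have ae0 : ae_eq mu setT (EFin \o F) (cst 0%E).
  apply: integral_ae_eq => // E _ mE; rewrite integral0 integral_mkcond.
  have [_ E0] := GH _ (Gm _ mE).
  transitivity (\int[mu]_x (F x * \1_E x)%:E)%E.
    apply: eq_integral => x _; rewrite patchE indicE.
    by case: (x \in E); rewrite ?mulr1 ?mulr0.
  rewrite -EFin_Rintegral ?E0//; apply: mulFi => //; exact: measurable_indic.
by apply: filterS ae0 => x /(_ I)[].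
Qed.

End ae_zero.

Section ae_zero_rV.
Context {R : realType} {n : nat}.
Implicit Types (F h phi : 'rV[R]_n -> R).

Lemma cvg_maxr (f g : nat -> R) (a b : R) : f k @[k --> \oo] --> a ->
  g k @[k --> \oo] --> b -> Num.max (f k) (g k) @[k --> \oo] --> Num.max a b.
Proof.
move=> fa gb; rewrite maxr_absE; under eq_fun do rewrite maxr_absE.
apply: cvgMl; apply: cvgD; first exact: cvgD.
by apply: cvg_norm; exact: cvgB.
Qed.

Lemma cvg_minr (f g : nat -> R) (a b : R) : f k @[k --> \oo] --> a ->
  g k @[k --> \oo] --> b -> Num.min (f k) (g k) @[k --> \oo] --> Num.min a b.
Proof.
move=> fa gb; rewrite minr_absE; under eq_fun do rewrite minr_absE.
apply: cvgMl; apply: cvgB; first exact: cvgD.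
by apply: cvg_norm; exact: cvgB.
Qed.

(* Continuity along rays is all that the dilations of the mollifier need. *)
Definition ray_continuous phi := forall x z (u : nat -> R),
  u k @[k --> \oo] --> 0 -> phi (x + u k *: z) @[k --> \oo] --> phi x.

Let positivity_set (A : set 'rV[R]_n) := exists phi,
  [/\ measurable_fun setT phi, forall x, 0 <= phi x, ray_continuous phi &
      A = [set x | 0 < phi x]].

(** The sets where some admissible phi is positive form a pi-system, by products. They contain the
    half-spaces x_i > c, through max(0, x_i - c), hence generate the sigma-algebra; min(1, k phi)
    tends to the indicator as k grows. *)
Lemma ae_zero_rV F : (lebesgue_rV n).-integrable setT (EFin \o F) ->
  (forall h, measurable_fun setT h -> (forall x, 0 <= h x <= 1) -> ray_continuous h ->
     \int[lebesgue_rV n]_x (F x * h x) = 0) ->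
  {ae lebesgue_rV n, forall x, F x = 0}.
Proof.
move=> Fi F0.
have mF : measurable_fun setT F by have := measurable_int _ Fi; move/measurable_EFinP.
apply: (@ae_zero_pi_system _ _ _ _ _ Fi positivity_set).
- move=> A B [p [mp p0 cp ->]] [q [mq q0 cq ->]].
  exists (fun x => p x * q x); split.
  + by meas.
  + by move=> x; exact: mulr_ge0.
  + by move=> x z u u0; apply: cvgM; [exact: cp|exact: cq].
  + apply/seteqP; split=> x /=; first by move=> [px qx]; exact: mulr_gt0.
    move=> pq; split; rewrite lt_neqAle ?p0 ?q0 andbT; apply/eqP => e;
    by move: pq; rewrite -e ?mul0r ?mulr0 ltxx.
- apply: smallest_sub; first exact: smallest_sigma_algebra.
  rewrite -bigcup_seq; apply: bigcup_sub => i _ _ [B mB <-] /=; rewrite setTI.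
  suff : (@RGenOInfty.G R).-sigma.-measurable `<=`
      [set B | <<s positivity_set >> ((fun x : 'rV[R]_n => x 0 i) @^-1` B)].
    by apply; rewrite -RGenOInfty.measurableE.
  apply: smallest_sub.
    split=> [|A /= mA|A /= mA].
    + by rewrite /= preimage_set0; exact: sigma_algebra0.
    + by rewrite setTD preimage_setC -setTD; exact: sigma_algebraCD.
    + by rewrite preimage_bigcup; exact: sigma_algebra_bigcup.
  move=> _ /= [c ->]; apply: sub_sigma_algebra.
  exists (fun x => Num.max 0 (x 0 i - c)); split.
  + have mc : measurable_fun setT (fun x : 'rV[R]_n => x 0 i - c) by meas.
    exact: measurable_maxr.
  + by move=> x; rewrite le_max lexx.
  + move=> x z u u0; apply: cvg_maxr; first exact: cvg_cst.
    apply: cvgB; last exact: cvg_cst.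
    have -> : (fun k => (x + u k *: z) 0 i) = (fun k => x 0 i + u k * z 0 i).
      by apply/funext => k; rewrite !mxE.
    have {2}-> : x 0 i = x 0 i + 0 * z 0 i by rewrite mul0r addr0.
    by apply: cvgD; [exact: cvg_cst|apply: cvgMl].
  + by apply/seteqP; split=> x /=; rewrite in_itv/= andbT lt_max ltxx subr_gt0.
- move=> _ [p [mp p0 cp ->]].
  have := measurable_fun_ltr (@measurable_cst _ _ _ _ setT (0 : R)) mp.
  move=> /(_ measurableT [set true] I); rewrite setTI.
  by congr measurable; apply/seteqP; split.
- exists (fun=> 1); split=> //.
  + by move=> x z u _; exact: cvg_cst.
  + by apply/seteqP; split=> x //= _; exact: ltr01.
move=> _ [p [mp p0 cp ->]].
pose h (k : nat) x : R := Num.min 1 (k%:R * p x).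
have mh k : measurable_fun setT (h k).
  by apply: measurable_minr; [exact: measurable_cst|meas].
have h01 k x : 0 <= h k x <= 1.
  by rewrite le_min ler01 ge_min lexx/= mulr_ge0.
have cF : \int[lebesgue_rV n]_x (F x * h k x) @[k --> \oo] -->
    \int[lebesgue_rV n]_x (F x * \1_[set x | 0 < p x] x).
  apply: (@Rintegral_dominated_cvg _ _ _ _ _ _ (fun x => `|F x|)).
  - by move=> k; have := mh k => ?; meas.
  - move=> x; apply: cvgMr; rewrite [X in _ --> X]indicE.
    case: (boolP (x \in _)) => [/set_mem/= px|/negP px].
      apply: cvg_near_cst.
      exists (Num.truncn (p x)^-1).+1 => // k /= km; rewrite /h min_l//.
      rewrite -ler_pdivrMr// div1r (le_trans (ltW (Num.Theory.truncnS_gt _)))// ler_nat//.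
    have -> : (h ^~ x) = fun=> 0.
      apply/funext => k; rewrite /h; suff -> : p x = 0 by rewrite mulr0 min_r.
      apply/eqP; rewrite eq_le p0 andbT leNgt; apply/negP => px'; apply: px.
      exact/mem_set.
    exact: cvg_cst.
  - move=> k x; rewrite normrM ler_piMr// ger0_norm; by have /andP[] := h01 k x.
  - exact: integrable_norm.
apply: cvg_unique cF _ => //; apply: cvg_near_cst; apply: nearW => k.
apply: F0 => //; move=> x z u u0.
apply: cvg_minr; first exact: cvg_cst.
by apply: cvgMr; exact: cp.
Qed.

End ae_zero_rV.

(** * Mollification of a tempered function on the Fourier side *)

Section transform.
Context {R : realType} {n : nat}.
Notation mu := (@lebesgue_rV R n).
Implicit Types (h k : 'rV[R]_n -> R) (x xi : 'rV[R]_n).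

(** For real h the transform with kernel exp(-i x.xi) is [ft_cos h] minus i times [ft_sin h]. *)
Definition ft_cos h xi : R := \int[mu]_x (h x * cos (dotp x xi)).
Definition ft_sin h xi : R := \int[mu]_x (h x * sin (dotp x xi)).

Let mEF h : mu.-integrable setT (EFin \o h) -> measurable_fun setT h.
Proof. by move=> hi; have := measurable_int _ hi; move/measurable_EFinP. Qed.

Lemma integrable_mul_le1 h k : mu.-integrable setT (EFin \o h) ->
  measurable_fun setT k -> (forall x, `|k x| <= 1) ->
  mu.-integrable setT (EFin \o (fun x => h x * k x)).
Proof.
move=> hi mk k1; have mh := mEF hi.
apply: (integrable_bounded_by (g := fun x => `|h x|)).
- by meas.
- by move=> x; rewrite normrM ler_piMr.
- exact: integrable_normr_lty.
Qed.

Lemma norm_sin_le1 (t : R) : `|sin t| <= 1.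
Proof. by rewrite ler_norml sin_geN1 sin_le1. Qed.

Lemma norm_cos_le1 (t : R) : `|cos t| <= 1.
Proof. by rewrite ler_norml cos_geN1 cos_le1. Qed.

Let mcos xi : measurable_fun setT (fun x : 'rV[R]_n => cos (dotp x xi)).
Proof. by meas. Qed.

Let msin xi : measurable_fun setT (fun x : 'rV[R]_n => sin (dotp x xi)).
Proof. by meas. Qed.

Lemma ft_cos_le h L xi : mu.-integrable setT (EFin \o h) ->
  (\int[mu]_x (`|h x|)%:E <= L%:E)%E -> `|ft_cos h xi| <= L.
Proof.
move=> hi; apply: normr_Rintegral_le.
- by apply: integrable_mul_le1 => // x; exact: norm_cos_le1.
- by move=> x; rewrite normrM ler_piMr// norm_cos_le1.
Qed.

Lemma ft_sin_le h L xi : mu.-integrable setT (EFin \o h) ->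
  (\int[mu]_x (`|h x|)%:E <= L%:E)%E -> `|ft_sin h xi| <= L.
Proof.
move=> hi; apply: normr_Rintegral_le.
- by apply: integrable_mul_le1 => // x; exact: norm_sin_le1.
- by move=> x; rewrite normrM ler_piMr// norm_sin_le1.
Qed.

Section duality.
Variables h k1 k2 : 'rV[R]_n -> R.
Hypotheses (hi : mu.-integrable setT (EFin \o h))
  (k1i : mu.-integrable setT (EFin \o k1)) (k2i : mu.-integrable setT (EFin \o k2)).

Let f (z : 'rV[R]_n * 'rV[R]_n) : R :=
  h z.1 * (k1 z.2 * cos (dotp z.1 z.2) + k2 z.2 * sin (dotp z.1 z.2)).

Let mf : measurable_fun setT f.
Proof.
by rewrite /f; have := mEF hi; have := mEF k1i; have := mEF k2i => ? ? ?; meas.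
Qed.

Let f_le z : `|f z| <= `|h z.1| * (`|k1 z.2| + `|k2 z.2|).
Proof.
rewrite /f normrM ler_wpM2l// (le_trans (ler_normD _ _))// !normrM.
by apply: lerD; rewrite ler_piMr// ?norm_sin_le1 ?norm_cos_le1.
Qed.

Let H0 : (\int[mu]_x (`|h x|)%:E < +oo)%E := integrable_normr_lty hi.

Let K0 : (\int[mu]_x (`|k1 x| + `|k2 x|)%:E < +oo)%E.
Proof.
under eq_integral do rewrite EFinD.
have m1 := mEF k1i; have m2 := mEF k2i.
rewrite ge0_integralD//; first exact: lte_add_pinfty (integrable_normr_lty k1i) (integrable_normr_lty k2i).
- by meas.
- by meas.
Qed.

Let fin (X : \bar R) : (0 <= X)%E -> (X < +oo)%E -> exists2 c : R, 0 <= c & X = c%:E.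
Proof.
move=> X0 Xy; exists (fine X); first exact: fine_ge0.
by rewrite fineK// ge0_fin_numE.
Qed.

Let prod_fin (p q : 'rV[R]_n -> R) : measurable_fun setT p ->
  (forall x, 0 <= p x) -> (forall x, 0 <= q x) -> measurable_fun setT q ->
  (\int[mu]_x (p x)%:E < +oo)%E -> (\int[mu]_x (q x)%:E < +oo)%E ->
  (\int[mu]_x \int[mu]_y (p x * q y)%:E < +oo)%E.
Proof.
move=> mp p0 q0 mq py qy.
have [|c c0 cE] := fin _ py; first by apply: integral_ge0 => x _; rewrite lee_fin.
have [|e e0 eE] := fin _ qy; first by apply: integral_ge0 => x _; rewrite lee_fin.
under eq_integral => x _.
  under eq_integral do rewrite EFinM.
  rewrite ge0_integralZl//; [|by meas|by move=> y _; rewrite lee_fin|by rewrite lee_fin].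
  rewrite eE; over.
rewrite ge0_integralZr//; first by rewrite cE -EFinM ltry.
- by meas.
- by move=> y _; rewrite lee_fin.
Qed.

Let fy : (\int[mu]_x \int[mu]_y (`|f (x, y)|)%:E < +oo)%E.
Proof.
have m0 := mEF hi; have m1 := mEF k1i; have m2 := mEF k2i.
apply: le_lt_trans (prod_fin _ _ _ _ H0 K0).
- apply: le_nnintegral => x _; first by apply: integral_ge0.
  by apply: le_nnintegral => y _ //; rewrite lee_fin; exact: f_le.
- by meas.
- by [].
- by move=> x; exact: addr_ge0.
- by meas.
Qed.

Let fy' : (\int[mu]_y \int[mu]_x (`|f (x, y)|)%:E < +oo)%E.
Proof.
have m0 := mEF hi; have m1 := mEF k1i; have m2 := mEF k2i.
apply: le_lt_trans (prod_fin _ _ _ _ K0 H0).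
- apply: le_nnintegral => x _; first by apply: integral_ge0.
  by apply: le_nnintegral => y _ //; rewrite lee_fin mulrC; exact: f_le.
- by meas.
- by move=> x; exact: addr_ge0.
- by [].
- by meas.
Qed.

Let inner xi : \int[mu]_x f (x, xi) = k1 xi * ft_cos h xi + k2 xi * ft_sin h xi.
Proof.
have ci := integrable_mul_le1 hi (mcos xi) (fun x => norm_cos_le1 _).
have si := integrable_mul_le1 hi (msin xi) (fun x => norm_sin_le1 _).
rewrite /ft_cos /ft_sin -!RintegralZl// -RintegralD//.
- by apply: eq_Rintegral => x _; rewrite /f/=; ring.
- exact: (@integrableZl _ _ _ mu _ measurableT (k1 xi) _ ci).
- exact: (@integrableZl _ _ _ mu _ measurableT (k2 xi) _ si).
Qed.

Let outer x : \int[mu]_xi f (x, xi) =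
  h x * \int[mu]_xi (k1 xi * cos (dotp x xi) + k2 xi * sin (dotp x xi)).
Proof.
rewrite -RintegralZl//.
have mc : measurable_fun setT (fun xi => cos (dotp x xi)) by meas.
have ms : measurable_fun setT (fun xi => sin (dotp x xi)) by meas.
have i1 := integrable_mul_le1 k1i mc (fun _ => norm_cos_le1 _).
have i2 := integrable_mul_le1 k2i ms (fun _ => norm_sin_le1 _).
exact: (@integrableD _ _ _ mu _ measurableT _ _ i1 i2).
Qed.

(** The multiplication formula int h k^ = int h^ k in real form, by Fubini with the majorant |h(x)|
    (|k1(xi)| + |k2(xi)|). The pair k1, k2 carries the two components of a complex amplitude. *)
Lemma transform_duality :
  \int[mu]_x (h x * \int[mu]_xi (k1 xi * cos (dotp x xi) + k2 xi * sin (dotp x xi))) =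
  \int[mu]_xi (k1 xi * ft_cos h xi + k2 xi * ft_sin h xi).
Proof.
under [RHS]eq_Rintegral do rewrite -inner.
rewrite -(Rfubini mf fy); apply: eq_Rintegral => x _.
by rewrite outer.
Qed.

Lemma integrable_duality : mu.-integrable setT (EFin \o (fun x =>
  h x * \int[mu]_xi (k1 xi * cos (dotp x xi) + k2 xi * sin (dotp x xi)))).
Proof.
have := @integrable_Rfubini _ _ _ _ R mu mu _ mf fy.
by apply: eq_integrable => // x _ /=; rewrite outer.
Qed.

Lemma integrable_transform :
  mu.-integrable setT (EFin \o (fun xi => k1 xi * ft_cos h xi + k2 xi * ft_sin h xi)).
Proof.
have mf' : measurable_fun setT (fun z => f (z.2, z.1)).
  have := measurableT_comp mf (@measurable_swap _ _ 'rV[R]_n 'rV[R]_n).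
  by [].
have := @integrable_Rfubini _ _ _ _ R mu mu _ mf' fy'.
by apply: eq_integrable => // xi _ /=; rewrite inner.
Qed.

End duality.

End transform.

Section mollifier.
Context {R : realType} {n : nat}.
Notation mu := (@lebesgue_rV R n).
Implicit Types (h k : 'rV[R]_n -> R) (x y z xi : 'rV[R]_n).

(* The inverse Fourier transform of the Gaussian, up to the factor (2 pi)^n. *)
Definition mollifier (tau : R) z : R :=
  Num.sqrt (pi / tau) ^+ n * gauss_rV ((4 * tau)^-1) z.

Definition mollifier_mass : R := (2 * pi) ^+ n.

Lemma mollifier_mass_gt0 : 0 < mollifier_mass.
Proof. by rewrite exprn_gt0// mulr_gt0// pi_gt0. Qed.

Lemma mollifier_ge0 tau z : 0 <= mollifier tau z.
Proof. by rewrite mulr_ge0// ?exprn_ge0// ?sqrtr_ge0// gauss_rV_ge0. Qed.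

Lemma measurable_fun_mollifier tau d (T : measurableType d) (u : T -> 'rV[R]_n) :
  measurable_fun setT u -> measurable_fun setT (fun t => mollifier tau (u t)).
Proof.
move=> mu'; rewrite /mollifier; have := measurable_fun_gauss_rV (4 * tau)^-1 mu' => ?.
by meas.
Qed.

Lemma cos_gauss_mollifier tau z : 0 < tau ->
  \int[mu]_xi (cos (dotp z xi) * gauss_rV tau xi) = mollifier tau z.
Proof.
move=> tau0; rewrite cos_gauss_rV// /mollifier /gauss_rV; congr (_ * expR (- _)).
by rewrite mulrC.
Qed.

Lemma integral_mollifier tau x : 0 < tau ->
  (\int[mu]_y (mollifier tau (x - y))%:E = mollifier_mass%:E)%E.
Proof.
move=> tau0; have m0 := measurable_fun_mollifier tau (@measurable_id _ 'rV[R]_n setT).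
rewrite (@lebesgue_rV_reflect _ _ (fun z => (mollifier tau z)%:E))//; first last.
- by move=> z; rewrite lee_fin mollifier_ge0.
- by meas.
rewrite /mollifier; under eq_integral do rewrite EFinM.
rewrite ge0_integralZl//; first last.
- by move=> z _; rewrite lee_fin gauss_rV_ge0.
- by apply: measurable_fun_EFin; exact: measurable_gauss_rV.
rewrite integral_gauss_rV ?invr_gt0 ?mulr_gt0//; congr EFin.
rewrite -exprMn -sqrtrM ?divr_ge0 ?pi_ge0 ?(ltW tau0)//.
have -> : pi / tau * (pi / (4 * tau)^-1) = (2 * pi) ^+ 2.
  by field; rewrite gt_eqF.
by rewrite sqrtr_sqr ger0_norm// mulr_ge0// pi_ge0.
Qed.

Lemma integrable_mollifier tau x : 0 < tau ->
  mu.-integrable setT (EFin \o (fun y => mollifier tau (x - y))).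
Proof.
move=> tau0; apply: (integrable_bounded_by (g := fun y => mollifier tau (x - y))).
- by apply: measurable_fun_mollifier; meas.
- by move=> y; rewrite ger0_norm// mollifier_ge0.
- by rewrite integral_mollifier// ltry.
Qed.

Lemma integrable_gauss_rV tau : 0 < tau ->
  mu.-integrable setT (EFin \o (@gauss_rV R n tau)).
Proof.
move=> tau0; have := integrable_cos_gauss_rV (0 : 'rV[R]_n) tau0.
apply: eq_integrable => // x _ /=; congr EFin.
suff -> : dotp 0 x = 0 by rewrite cos0 mul1r.
by rewrite /dotp big1// => i _; rewrite mxE mul0r.
Qed.

Lemma dotpBl x y z : dotp (x - y) z = dotp x z - dotp y z.
Proof. by rewrite dotpDl dotpNl. Qed.

Lemma EFin_mu_lty L h : (\int[mu]_x (`|h x|)%:E <= L%:E)%E ->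
  (\int[mu]_x (`|h x|)%:E < +oo)%E.
Proof. by move=> hL; apply: le_lt_trans hL _; rewrite ltry. Qed.

Section bessel.
Variables (h : 'rV[R]_n -> R) (m L tau : R).
Hypotheses (mh : measurable_fun setT h) (hm : forall x, `|h x| <= m)
  (hL : (\int[mu]_x (`|h x|)%:E <= L%:E)%E) (tau0 : 0 < tau).

Let hi : mu.-integrable setT (EFin \o h).
Proof. by apply: integrable_lty => //; exact: EFin_mu_lty hL. Qed.

Let Gi := integrable_gauss_rV tau0.

(** Fubini gives measurability of the product with an integrable k1; a Gaussian k1 is positive and
    can be divided out again. *)
Lemma measurable_ft_cos : measurable_fun setT (ft_cos h).
Proof.
have G1 : mu.-integrable setT (EFin \o (fun=> 0 : R)).
  exact: (@integrable0 _ 'rV[R]_n R mu setT).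
have := integrable_transform hi (integrable_gauss_rV (ltr01 : 0 < 1 :> R)) G1.
move=> /measurable_int /measurable_EFinP m1.
have mG := @measurable_gauss_rV R n 1.
have -> : ft_cos h = (fun xi => (gauss_rV 1 xi)^-1 *
    (gauss_rV 1 xi * ft_cos h xi + 0 * ft_sin h xi)).
  by apply/funext => xi; rewrite mul0r addr0 mulKf// gt_eqF// expR_gt0.
by meas.
Qed.

Lemma measurable_ft_sin : measurable_fun setT (ft_sin h).
Proof.
have G1 : mu.-integrable setT (EFin \o (fun=> 0 : R)).
  exact: (@integrable0 _ 'rV[R]_n R mu setT).
have := integrable_transform hi G1 (integrable_gauss_rV (ltr01 : 0 < 1 :> R)).
move=> /measurable_int /measurable_EFinP m1.
have mG := @measurable_gauss_rV R n 1.
have -> : ft_sin h = (fun xi => (gauss_rV 1 xi)^-1 *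
    (0 * ft_cos h xi + gauss_rV 1 xi * ft_sin h xi)).
  by apply/funext => xi; rewrite mul0r add0r mulKf// gt_eqF// expR_gt0.
by meas.
Qed.

Let L0 : 0 <= L.
Proof. by rewrite -lee_fin (le_trans _ hL)//; exact: integral_ge0. Qed.

Let m0 : 0 <= m. Proof. exact: le_trans (normr_ge0 _) (hm 0). Qed.

Let hcG_i : mu.-integrable setT (EFin \o (fun xi => ft_cos h xi * gauss_rV tau xi)).
Proof.
have mG := @measurable_gauss_rV R n tau; have := measurable_ft_cos => ?.
apply: (integrable_bounded_by (g := fun xi => L * gauss_rV tau xi)).
- by meas.
- move=> xi; rewrite normrM (ger0_norm (gauss_rV_ge0 _ _)).
  by rewrite ler_wpM2r ?gauss_rV_ge0// ft_cos_le.
- have /integrable_normr_lty := @integrableZl _ _ _ mu _ measurableT L _ Gi.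
  apply: le_lt_trans; apply: le_nnintegral => x _; last by rewrite lee_fin ler_norm.
  by rewrite lee_fin mulr_ge0// gauss_rV_ge0.
Qed.

Let hsG_i : mu.-integrable setT (EFin \o (fun xi => ft_sin h xi * gauss_rV tau xi)).
Proof.
have mG := @measurable_gauss_rV R n tau; have := measurable_ft_sin => ?.
apply: (integrable_bounded_by (g := fun xi => L * gauss_rV tau xi)).
- by meas.
- move=> xi; rewrite normrM (ger0_norm (gauss_rV_ge0 _ _)).
  by rewrite ler_wpM2r ?gauss_rV_ge0// ft_sin_le.
- have /integrable_normr_lty := @integrableZl _ _ _ mu _ measurableT L _ Gi.
  apply: le_lt_trans; apply: le_nnintegral => x _; last by rewrite lee_fin ler_norm.
  by rewrite lee_fin mulr_ge0// gauss_rV_ge0.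
Qed.

Let inner x :
  \int[mu]_xi (ft_cos h xi * gauss_rV tau xi * cos (dotp x xi) +
               ft_sin h xi * gauss_rV tau xi * sin (dotp x xi)) =
  \int[mu]_y (h y * mollifier tau (x - y)).
Proof.
have mc : measurable_fun setT (fun xi => cos (dotp x xi)) by meas.
have ms : measurable_fun setT (fun xi => sin (dotp x xi)) by meas.
rewrite (_ : \int[mu]_xi _ = \int[mu]_xi (gauss_rV tau xi * cos (dotp x xi) * ft_cos h xi +
    gauss_rV tau xi * sin (dotp x xi) * ft_sin h xi)); last first.
  by apply: eq_Rintegral => xi _; ring.
rewrite -(transform_duality hi (integrable_mul_le1 Gi mc (fun _ => norm_cos_le1 _))
  (integrable_mul_le1 Gi ms (fun _ => norm_sin_le1 _))).
apply: eq_Rintegral => y _; rewrite -cos_gauss_mollifier//; congr (_ * _).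
by apply: eq_Rintegral => xi _; rewrite dotpBl cosB; ring.
Qed.

(** Duality with the amplitude h^ exp(-tau |xi|^2), whose inverse transform is h convolved with the
    mollifier: the left side equals int h (h * mollifier), and the convolution is at most m times
    the mollifier mass (2 pi)^n. *)
Lemma bessel :
  (\int[mu]_xi ((ft_cos h xi ^+ 2 + ft_sin h xi ^+ 2) * gauss_rV tau xi)%:E <=
   (mollifier_mass * m * L)%:E)%E.
Proof.
have := integrable_transform hi hcG_i hsG_i.
have := transform_duality hi hcG_i hsG_i.
have e xi : ft_cos h xi * gauss_rV tau xi * ft_cos h xi +
    ft_sin h xi * gauss_rV tau xi * ft_sin h xi =
    (ft_cos h xi ^+ 2 + ft_sin h xi ^+ 2) * gauss_rV tau xi by ring.
under [RHS]eq_Rintegral do rewrite e.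
under [X in _ -> mu.-integrable _ (EFin \o X) -> _]eq_fun do rewrite e.
move=> dual Ii; rewrite -EFin_Rintegral// lee_fin -dual.
under eq_Rintegral do rewrite inner.
have J x : `|\int[mu]_y (h y * mollifier tau (x - y))| <= mollifier_mass * m.
  apply: (@normr_Rintegral_le _ _ _ _ _ (fun y => m * mollifier tau (x - y))).
  - apply: (integrable_bounded_by (g := fun y => m * mollifier tau (x - y))).
    + have : measurable_fun setT (fun y => mollifier tau (x - y)).
        by apply: measurable_fun_mollifier; meas.
      by move=> ?; meas.
    + by move=> y; rewrite normrM (ger0_norm (mollifier_ge0 _ _)) ler_wpM2r// mollifier_ge0.
    + have /integrable_normr_lty := @integrableZl _ _ _ mu _ measurableT m _ (integrable_mollifier x tau0).
      apply: le_lt_trans; apply: le_nnintegral => y _; last by rewrite lee_fin ler_norm.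
      by rewrite lee_fin mulr_ge0// mollifier_ge0.
  - by move=> y; rewrite normrM (ger0_norm (mollifier_ge0 _ _)) ler_wpM2r// mollifier_ge0.
  - under eq_integral do rewrite EFinM.
    rewrite ge0_integralZl//; last by move=> y _; rewrite lee_fin mollifier_ge0.
      by rewrite integral_mollifier// -EFinM mulrC.
    by apply: measurable_fun_EFin; apply: measurable_fun_mollifier; meas.
apply: le_trans (ler_norm _) _.
apply: (@normr_Rintegral_le _ _ _ _ _ (fun x => mollifier_mass * m * `|h x|)).
- have := integrable_duality hi hcG_i hsG_i.
  by apply: eq_integrable => // x _ /=; rewrite inner.
- by move=> x; rewrite normrM mulrC ler_wpM2r.
- under eq_integral do rewrite EFinM.
  have ? : 0 <= mollifier_mass * m by rewrite mulr_ge0// (ltW mollifier_mass_gt0).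
  rewrite ge0_integralZl//; last by meas.
  rewrite (EFinM (mollifier_mass * m) L); apply: lee_wpmul2l => //.
Qed.

End bessel.

End mollifier.

(** For y <= 1 through 1 - exp(-y) <= y <= y^p, for y > 1 through 1 <= y^p. *)
Lemma one_sub_expRN_le {R : realType} (y p : R) : 0 <= y -> 0 < p -> p <= 1 ->
  1 - expR (- y) <= y `^ p.
Proof.
move=> y0 p0 p1; have [y1|y1] := lerP y 1.
  have h : 1 - expR (- y) <= y by have := expR_ge1Dx (- y); lra.
  have [->|yn0] := eqVneq y 0; first by rewrite powR0 ?gt_eqF// oppr0 expR0 subrr.
  have yp : 0 < y by rewrite lt_neqAle eq_sym yn0.
  by apply: le_trans h _; apply: ger1_powR => //; rewrite yp.
have := expR_ge0 (- y) => e0; apply: (@le_trans _ _ 1); first by lra.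
by rewrite -[leLHS](powRr0 y); apply: ler_powR; exact: ltW.
Qed.

Section fourier_side.
Context {R : realType} {n : nat}.
Notation mu := (@lebesgue_rV R n).
Implicit Types (h k : 'rV[R]_n -> R) (x y z xi : 'rV[R]_n) (tau : R).

Lemma tempered_gauss_lty h N tau : 0 < tau -> measurable_fun setT h ->
  (\int[mu]_x (`|h x| / (1 + enorm x) ^+ N)%:E < +oo)%E ->
  (\int[mu]_x (`|h x| * gauss_rV tau x)%:E < +oo)%E.
Proof.
move=> tau0 mh hN; have [C hC] := @gauss_rV_decay R n tau tau0 N.
have p0 x : 0 < (1 + enorm x) ^+ N.
  by rewrite exprn_gt0// ltr_pwDl// enorm_ge0.
have C0 : 0 <= C.
  by apply: le_trans (hC 0); exact: mulr_ge0 (ltW (p0 0)) (gauss_rV_ge0 tau 0).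
apply: (@le_lt_trans _ _ (\int[mu]_x (C%:E * (`|h x| / (1 + enorm x) ^+ N)%:E))%E).
  apply: le_nnintegral => x _.
    by rewrite lee_fin; apply: mulr_ge0 => //; exact: gauss_rV_ge0.
  rewrite -EFinM lee_fin mulrCA ler_wpM2l//.
  by rewrite ler_pdivlMr// mulrC.
rewrite ge0_integralZl//; last 2 first.
- by meas.
- by move=> x _; rewrite lee_fin divr_ge0// (ltW (p0 x)).
exact: lte_mul_pinfty.
Qed.

Variables (g1 g2 r : 'rV[R]_n -> R) (N : nat) (Q beta : R).
Hypotheses (mg1 : measurable_fun setT g1) (mg2 : measurable_fun setT g2)
  (mr : measurable_fun setT r)
  (g1r : forall xi, `|g1 xi| <= r xi) (g2r : forall xi, `|g2 xi| <= r xi)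
  (rN : (\int[mu]_xi (r xi / (1 + enorm xi) ^+ N)%:E < +oo)%E)
  (rQ : (\int[mu]_xi (enorm xi `^ beta * r xi ^+ 2)%:E <= Q%:E)%E)
  (b0 : 0 < beta) (b4 : beta <= 4).

Let r0 xi : 0 <= r xi. Proof. exact: le_trans (g1r xi). Qed.

(** With g1 = Re f^ and g2 = - Im f^ this is the real part of int f^(xi) exp(i x.xi - tau |xi|^2)
    dxi; with g1 = Im f^ and g2 = Re f^ it is the imaginary part. The function [r] stands for |f^|,
    and Q bounds the integral of |xi|^beta r^2. *)
Definition fourier_gauss tau x : R := \int[mu]_xi
  (g1 xi * gauss_rV tau xi * cos (dotp x xi) + g2 xi * gauss_rV tau xi * sin (dotp x xi)).

Let A := fourier_gauss.

Let rG_i tau : 0 < tau -> mu.-integrable setT (EFin \o (fun xi => r xi * gauss_rV tau xi)).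
Proof.
move=> tau0; have mG := @measurable_gauss_rV R n tau.
apply: (integrable_bounded_by (g := fun xi => `|r xi| * gauss_rV tau xi)).
- by meas.
- by move=> xi; rewrite normrM (ger0_norm (gauss_rV_ge0 _ _)).
- apply: (@tempered_gauss_lty _ N) => //.
  by under eq_integral do rewrite ger0_norm//.
Qed.

Let kG_i k tau : 0 < tau -> measurable_fun setT k -> (forall xi, `|k xi| <= r xi) ->
  mu.-integrable setT (EFin \o (fun xi => k xi * gauss_rV tau xi)).
Proof.
move=> tau0 mk kr; have mG := @measurable_gauss_rV R n tau.
apply: (integrable_bounded_by (g := fun xi => `|r xi * gauss_rV tau xi|)).
- by meas.
- move=> xi; rewrite !normrM (ger0_norm (gauss_rV_ge0 _ _)) ler_wpM2r ?gauss_rV_ge0//.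
  exact: le_trans (kr xi) (ler_norm _).
- exact: integrable_normr_lty (rG_i tau0).
Qed.

Let integrand_le tau x xi :
  `|g1 xi * gauss_rV tau xi * cos (dotp x xi) + g2 xi * gauss_rV tau xi * sin (dotp x xi)|
  <= 2 * (r xi * gauss_rV tau xi).
Proof.
have G0 := gauss_rV_ge0 tau xi; have a := g1r xi; have b := g2r xi.
have c1 := norm_cos_le1 (dotp x xi); have s1 := norm_sin_le1 (dotp x xi).
rewrite (le_trans (ler_normD _ _))// !normrM (ger0_norm G0) mulr_natl mulr2n.
by apply: lerD; rewrite -[leRHS]mulr1; apply: ler_pM => //;
  rewrite ?mulr_ge0// ler_wpM2r.
Qed.

Let integrand_i tau x : 0 < tau -> mu.-integrable setT (EFin \o (fun xi =>
  g1 xi * gauss_rV tau xi * cos (dotp x xi) + g2 xi * gauss_rV tau xi * sin (dotp x xi))).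
Proof.
move=> tau0; have mG := @measurable_gauss_rV R n tau.
apply: (integrable_bounded_by (g := fun xi => `|2 * (r xi * gauss_rV tau xi)|)).
- by meas.
- by move=> xi; apply: le_trans (ler_norm _); exact: integrand_le.
- exact: integrable_normr_lty (@integrableZl _ _ _ mu _ measurableT 2 _ (rG_i tau0)).
Qed.

Lemma fourier_gauss_bounded tau : 0 < tau -> exists C, forall x, `|A tau x| <= C.
Proof.
move=> tau0; exists (\int[mu]_xi `|2 * (r xi * gauss_rV tau xi)|) => x.
have i2 := @integrableZl _ _ _ mu _ measurableT 2 _ (rG_i tau0).
apply: (normr_Rintegral_le (integrand_i x tau0)).
- by move=> xi; apply: le_trans (ler_norm _); exact: integrand_le.
- by rewrite EFin_Rintegral//; exact: integrable_norm.
Qed.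

Lemma dotpZl (c : R) x y : dotp (c *: x) y = c * dotp x y.
Proof. by rewrite /dotp mulr_sumr; apply: eq_bigr => i _; rewrite mxE; ring. Qed.

Lemma fourier_gauss_ray_continuous tau : 0 < tau -> ray_continuous (A tau).
Proof.
move=> tau0 x z u u0; have mG := @measurable_gauss_rV R n tau.
apply: (@Rintegral_dominated_cvg _ _ _ mu _ _ (fun xi => 2 * (r xi * gauss_rV tau xi))).
- by move=> k; meas.
- move=> xi; have cd : dotp (x + u j *: z) xi @[j --> \oo] --> dotp x xi.
    have -> : (fun j => dotp (x + u j *: z) xi) = fun j => dotp x xi + u j * dotp z xi.
      by apply/funext => j; rewrite dotpDl dotpZl.
    have {2}-> : dotp x xi = dotp x xi + 0 * dotp z xi by rewrite mul0r addr0.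
    by apply: cvgD; [exact: cvg_cst|exact: cvgMl].
  apply: cvgD; apply: cvgMr.
    by apply: continuous_cvg => //; exact: continuous_cos.
  by apply: continuous_cvg => //; exact: continuous_sin.
- by move=> k xi; exact: integrand_le.
- exact: (@integrableZl _ _ _ mu _ measurableT 2 _ (rG_i tau0)).
Qed.

Lemma measurable_fourier_gauss tau : 0 < tau -> measurable_fun setT (A tau).
Proof.
move=> tau0; have Gi := integrable_gauss_rV (ltr01 : 0 < 1 :> R) (n := n).
have := integrable_duality Gi (kG_i tau0 mg1 g1r) (kG_i tau0 mg2 g2r).
move=> /measurable_int/measurable_EFinP m1; have mG := @measurable_gauss_rV R n 1.
have -> : A tau = fun x => (gauss_rV 1 x)^-1 * (gauss_rV 1 x * A tau x).
  by apply/funext => x; rewrite mulKf// gt_eqF// expR_gt0.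
by apply: measurable_fun_mul => //; meas.
Qed.

Section pairing.
Variables (h : 'rV[R]_n -> R) (m L : R).
Hypotheses (mh : measurable_fun setT h) (hm : forall x, `|h x| <= m)
  (hL : (\int[mu]_x (`|h x|)%:E <= L%:E)%E).

Let hi : mu.-integrable setT (EFin \o h).
Proof. by apply: integrable_lty => //; exact: EFin_mu_lty hL. Qed.

Let H xi : R := `|ft_cos h xi| + `|ft_sin h xi|.
Let B xi : R := ft_cos h xi ^+ 2 + ft_sin h xi ^+ 2.

Let HB xi : H xi ^+ 2 <= 2 * B xi.
Proof.
rewrite /H /B -(real_normK (num_real (ft_cos h xi))) -(real_normK (num_real (ft_sin h xi))).
have := sqr_ge0 (`|ft_cos h xi| - `|ft_sin h xi|); lra.
Qed.

Let HL xi : H xi <= 2 * L.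
Proof. by rewrite /H mulr_natl mulr2n lerD// ?ft_cos_le// ft_sin_le. Qed.

Let H0 xi : 0 <= H xi. Proof. exact: addr_ge0. Qed.

Let E xi : R := enorm xi `^ (beta / 2).

Let E2 xi : E xi ^+ 2 = enorm xi `^ beta.
Proof.
have [x0|x0] := eqVneq (enorm xi) 0.
  by rewrite /E x0 !powR0 ?expr0n//; apply: lt0r_neq0 => //; rewrite divr_gt0.
by rewrite /E expr2 -powRD; [congr (_ `^ _); lra|apply/implyP].
Qed.

Let pair_le tau xi :
  `|g1 xi * gauss_rV tau xi * ft_cos h xi + g2 xi * gauss_rV tau xi * ft_sin h xi| <=
  r xi * H xi * gauss_rV tau xi.
Proof.
have G0 := gauss_rV_ge0 tau xi; have a := g1r xi; have b := g2r xi.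
have -> : g1 xi * gauss_rV tau xi * ft_cos h xi + g2 xi * gauss_rV tau xi * ft_sin h xi =
  (g1 xi * ft_cos h xi + g2 xi * ft_sin h xi) * gauss_rV tau xi by ring.
rewrite normrM (ger0_norm G0) ler_wpM2r// (le_trans (ler_normD _ _))// !normrM mulrDr.
by apply: lerD; rewrite ler_wpM2r.
Qed.

Let pair_i tau : 0 < tau -> mu.-integrable setT (EFin \o (fun xi =>
  g1 xi * gauss_rV tau xi * ft_cos h xi + g2 xi * gauss_rV tau xi * ft_sin h xi)).
Proof.
by move=> tau0; exact: integrable_transform hi (kG_i tau0 mg1 g1r) (kG_i tau0 mg2 g2r).
Qed.

Let mB : measurable_fun setT B.
Proof.
by have := measurable_ft_cos mh hL => ?; have := measurable_ft_sin mh hL => ?;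
  rewrite /B; meas.
Qed.

Let B0 xi : 0 <= B xi. Proof. by rewrite addr_ge0// sqr_ge0. Qed.

Let G1 tau xi : 0 < tau -> gauss_rV tau xi <= 1.
Proof. by move=> t0; rewrite -expR0 ler_expR oppr_le0 mulr_ge0 ?sqr_ge0// ltW. Qed.

Let combine_le (a b tau : R) : 0 <= a -> 0 <= b -> 0 < tau ->
  (\int[mu]_xi (a * (enorm xi `^ beta * r xi ^+ 2) + b * (B xi * gauss_rV tau xi))%:E <=
   (a * Q + b * (mollifier_mass (R := R) (n := n) * m * L))%:E)%E.
Proof.
move=> a0 b0' tau0; have mG := @measurable_gauss_rV R n tau.
under eq_integral do rewrite EFinD !(EFinM a) !(EFinM b).
have e0 xi : 0 <= enorm xi `^ beta * r xi ^+ 2 by rewrite mulr_ge0 ?powR_ge0 ?sqr_ge0.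
have BG0 xi : 0 <= B xi * gauss_rV tau xi by apply: mulr_ge0 => //; exact: gauss_rV_ge0.
rewrite ge0_integralD//; last 4 first.
- by move=> xi _; rewrite mule_ge0// lee_fin.
- by meas.
- by move=> xi _; rewrite mule_ge0// lee_fin.
- by meas.
rewrite !ge0_integralZl//; try by [meas | move=> xi _; rewrite lee_fin].
by rewrite EFinD !(EFinM a) !(EFinM b); apply: leeD; apply: lee_wpmul2l; rewrite ?lee_fin//;
  exact: bessel.
Qed.

(* AM-GM pairs [r |xi|^(beta/2)] with the transform of [h], whose Gaussian-weighted
   L^2 norm is controlled by Bessel; the gain [tau^(beta/4)] comes from
   [1 - exp(-y) <= y^(beta/4)]. *)
Lemma fourier_gauss_cauchy tau tau' : 0 < tau' -> tau' <= tau ->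
  `|\int[mu]_x (h x * A tau' x) - \int[mu]_x (h x * A tau x)| <=
  tau `^ (beta / 4) * (Q / 2 + mollifier_mass (R := R) (n := n) * m * L).
Proof.
move=> t'0 t't; have t0 := lt_le_trans t'0 t't.
rewrite !(transform_duality hi (kG_i _ mg1 g1r) (kG_i _ mg2 g2r))//.
rewrite -RintegralB//; [|exact: pair_i..].
set T := tau `^ (beta / 4); have T0 : 0 <= T by exact: powR_ge0.
apply: (@normr_Rintegral_le _ _ _ _ _ (fun xi => (T / 2) * (enorm xi `^ beta * r xi ^+ 2) +
   T * (B xi * gauss_rV tau' xi))).
- exact: (@integrableB _ _ _ mu _ measurableT _ _ (pair_i t'0) (pair_i t0)).
- move=> xi; have -> : g1 xi * gauss_rV tau' xi * ft_cos h xi + g2 xi * gauss_rV tau' xi * ft_sin h xi -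
    (g1 xi * gauss_rV tau xi * ft_cos h xi + g2 xi * gauss_rV tau xi * ft_sin h xi) =
    (g1 xi * gauss_rV tau' xi * ft_cos h xi + g2 xi * gauss_rV tau' xi * ft_sin h xi) *
    (1 - gauss_rV (tau - tau') xi).
    have -> : gauss_rV tau xi = gauss_rV tau' xi * gauss_rV (tau - tau') xi.
      by rewrite /gauss_rV -expRD; congr expR; ring.
    by ring.
  rewrite normrM -E2; set e := 1 - _.
  have e0 : 0 <= e.
    by rewrite subr_ge0 -expR0 ler_expR oppr_le0 mulr_ge0 ?sqr_ge0// subr_ge0.
  have eE : e <= T * E xi.
    have d0 : 0 <= (tau - tau') * enorm xi ^+ 2 by rewrite mulr_ge0 ?sqr_ge0// subr_ge0.
    have p0 : 0 < beta / 4 by rewrite divr_gt0.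
    have p1 : beta / 4 <= 1 by have := b4; lra.
    apply: le_trans (one_sub_expRN_le d0 p0 p1) _.
    apply: (@le_trans _ _ ((tau * enorm xi ^+ 2) `^ (beta / 4))).
      apply: ge0_ler_powR; rewrite ?nnegrE ?divr_ge0 ?(ltW b0)//.
        by rewrite mulr_ge0 ?sqr_ge0// ltW.
      by rewrite ler_wpM2r ?sqr_ge0// gerBl ltW.
    rewrite powRM ?sqr_ge0 ?(ltW t0)// -powR_mulrn ?enorm_ge0// -powRrM.
    have -> : 2%:R * (beta / 4) = beta / 2 by lra.
    exact: lexx.
  have Gt := G1 xi t'0; have G0 := gauss_rV_ge0 tau' xi.
  rewrite (ger0_norm e0); apply: (@le_trans _ _ (r xi * H xi * gauss_rV tau' xi * (T * E xi))).
    by apply: ler_pM => //; exact: pair_le.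
  have := HB xi; have := H0 xi; have := r0 xi; have := powR_ge0 (enorm xi) (beta / 2).
  rewrite -/(E xi); move: (gauss_rV tau' xi) Gt G0 (H xi) (r xi) (E xi) (B xi) (B0 xi).
  move=> G G1' G0 H' r' E' B' B'0 E'0 r'0 H'0 HB'.
  have -> : r' * H' * G * (T * E') = T * ((r' * E') * (H' * G)) by ring.
  have -> : T / 2 * (E' ^+ 2 * r' ^+ 2) + T * (B' * G) =
    T * ((r' * E') ^+ 2 / 2 + B' * G) by field.
  rewrite ler_wpM2l//.
  have s := sqr_ge0 (r' * E' - H' * G).
  have : H' ^+ 2 * G ^+ 2 <= 2 * B' * G.
    apply: ler_pM; rewrite ?sqr_ge0//.
    by rewrite expr2 ler_piMr.
  by move: s; rewrite sqrrB exprMn; lra.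
- have := combine_le (a := T / 2) (b := T) _ T0 t'0.
  rewrite divr_ge0// => /(_ isT) ?; rewrite mulrDr.
  by rewrite (_ : T * (Q / 2) = T / 2 * Q)//; field.
Qed.

(** Frequencies are split at rho. Below it, |h^| is bounded through L and |xi|^(-beta) is integrable
    because beta < n; above it, 1 <= rho^(-beta/2) |xi|^(beta/2) and the Bessel bound controls h^.
    The parameters th' and th weigh the two AM-GM inequalities; all three are chosen later as powers
    of the scale. *)
Lemma fourier_gauss_pairing_decay tau rho th th' : beta < n%:R ->
  0 < tau -> 0 < rho -> 0 < th -> 0 < th' ->
  `|\int[mu]_x (h x * A tau x)| <=
  (L * th' + rho `^ (- (beta / 2)) * (th / 2)) * Q +
  rho `^ (- (beta / 2)) / th * (mollifier_mass (R := R) (n := n) * m * L) +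
  L / th' * (beta * 2 ^+ n * ((n%:R - beta)^-1 + beta^-1) * rho `^ (n%:R - beta)).
Proof.
move=> bn t0 rho0 th0 th'0.
rewrite (transform_duality hi (kG_i _ mg1 g1r) (kG_i _ mg2 g2r))//.
have pi_ := pair_i t0.
apply: le_trans (le_normr_Rintegral measurableT pi_) _.
rewrite -lee_fin EFin_Rintegral; last exact: integrable_norm.
set D := rho `^ (- (beta / 2)); have D0 : 0 <= D by exact: powR_ge0.
have L0 : 0 <= L by rewrite -lee_fin (le_trans _ hL)//; exact: integral_ge0.
set a := L * th' + D * (th / 2); set b := D / th; set c := L / th'.
have a0 : 0 <= a by rewrite addr_ge0// mulr_ge0// ltW// divr_gt0.
have b0' : 0 <= b by rewrite divr_ge0// ltW.
have c0 : 0 <= c by rewrite divr_ge0// ltW.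
have mG := @measurable_gauss_rV R n tau.
pose S := [set xi : 'rV[R]_n | (enorm xi <= rho)%R].
have mS : measurable S by exact: measurable_ball_enorm.
have mI : measurable_fun setT (\1_S : 'rV[R]_n -> R) by exact: measurable_indic.
pose f1 xi := a * (enorm xi `^ beta * r xi ^+ 2) + b * (B xi * gauss_rV tau xi).
pose f2 xi : R := c * (enorm xi `^ (- beta) * \1_S xi).
have e0 xi : 0 <= enorm xi `^ beta * r xi ^+ 2 by rewrite mulr_ge0 ?powR_ge0 ?sqr_ge0.
have BG0 xi : 0 <= B xi * gauss_rV tau xi by apply: mulr_ge0 => //; exact: gauss_rV_ge0.
have f10 xi : 0 <= f1 xi by apply: addr_ge0; exact: mulr_ge0.
have I0 xi : 0 <= enorm xi `^ (- beta) * \1_S xi by rewrite mulr_ge0 ?powR_ge0// indicE.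
have f20 xi : 0 <= f2 xi by exact: mulr_ge0.
have mf1 : measurable_fun setT f1 by rewrite /f1; meas.
have mf2 : measurable_fun setT f2 by rewrite /f2; meas.
apply: (@le_trans _ _ (\int[mu]_xi ((f1 xi)%:E + (f2 xi)%:E))%E); last first.
  rewrite ge0_integralD//; [|by move=> xi _; rewrite lee_fin|by meas|
    by move=> xi _; rewrite lee_fin|by meas].
  rewrite EFinD; apply: leeD; first exact: combine_le.
  rewrite /f2; under eq_integral do rewrite EFinM.
  rewrite ge0_integralZl//; [|by meas|by move=> xi _; rewrite lee_fin].
  rewrite (EFinM c); apply: lee_wpmul2l => //.
  apply: le_trans (integral_ball_enorm_powR b0 bn rho0).
  rewrite [leRHS]integral_mkcond; apply: le_nnintegral => xi _; first by rewrite lee_fin.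
  by rewrite patchE indicE; case: (xi \in S); rewrite ?mulr1 ?mulr0.
have n_gt0 : (0 < n)%N by rewrite -(ltr_nat R) (lt_trans b0 bn).
have mpair := measurable_int _ pi_.
apply: ae_ge0_le_integral => //.
- by move/measurable_EFinP: mpair => ?; meas.
- by move=> xi _; rewrite adde_ge0// lee_fin.
- by meas.
pose i0 : 'I_n := Ordinal n_gt0.
(* The pointwise bound fails only where |xi|^(-beta) is 0 by convention; a coordinate hyperplane
   through the origin is a null set containing that point. *)
exists [set xi : 'rV[R]_n | xi 0 i0 = 0]; split.
- rewrite -[X in measurable X]setTI.
  exact: (@measurable_coord R n i0 measurableT [set 0]).
- exact: lebesgue_rV_hyperplane.
move=> xi /=; apply: contra_notP => xi0 _; rewrite -EFinD lee_fin.
have xip : 0 < enorm xi.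
  apply: lt_le_trans (coord_le_enorm xi i0); rewrite normr_gt0; exact/eqP.
apply: le_trans (pair_le _ _) _.
have Gt := G1 xi t0; have G0 := gauss_rV_ge0 tau xi.
have := HB xi; have := H0 xi; have := HL xi; have := r0 xi; have := BG0 xi.
have [xr|xr] := lerP (enorm xi) rho.
  rewrite /f1 /f2 indicE mem_set//= mulr1 powRN.
  have : 0 < enorm xi `^ beta by exact: powR_gt0.
  move: (enorm xi `^ beta) (gauss_rV tau xi) Gt G0 (H xi) (r xi) (B xi) => e G Gle G00 H' r' B'.
  move=> e_gt0 BG r'0 HL' H'0 _.
  apply: (@le_trans _ _ (r' * (2 * L))).
    by rewrite -mulrA; apply: ler_wpM2l => //; apply: le_trans HL'; exact: ler_piMr.
  have s := sqr_ge0 (r' - (th' * e)^-1).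
  have te : 0 < th' * e by exact: mulr_gt0.
  (* AM-GM with weight th' |xi|^beta; multiplied by L it pays for r times the bound 2 L of the
     transform. *)
  have K : 2 * r' <= th' * (e * r' ^+ 2) + (th' * e)^-1.
    have := mulr_ge0 (ltW te) s.
    have -> : th' * e * (r' - (th' * e)^-1) ^+ 2 =
      th' * (e * r' ^+ 2) + (th' * e)^-1 - 2 * r'.
      by field; rewrite !gt_eqF.
    by rewrite subr_ge0.
  have := ler_wpM2l L0 K; rewrite /a /b /c.
  have -> : L * (th' * (e * r' ^+ 2) + (th' * e)^-1) =
    L * th' * (e * r' ^+ 2) + L / th' * e^-1 by field; rewrite !gt_eqF.
  have P1 : 0 <= D * (th / 2) * (e * r' ^+ 2).
    by apply: mulr_ge0; apply: mulr_ge0 => //; rewrite ?divr_ge0 ?sqr_ge0 ?(ltW th0) ?(ltW e_gt0).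
  have P2 : 0 <= D / th * (B' * G) by apply: mulr_ge0.
  have -> : r' * (2 * L) = L * (2 * r') by ring.
  by move=> ?; lra.
rewrite /f1 -E2.
(* For |xi| > rho this factor can be inserted freely and creates the weight |xi|^(beta/2) next to
   r. *)
have DE : 1 <= D * E xi.
  rewrite /D powRN ler_pdivlMl ?powR_gt0// mulr1.
  by apply: ge0_ler_powR; rewrite ?nnegrE ?divr_ge0 ?enorm_ge0 ?(ltW b0) ?(ltW rho0)// ltW.
have E0 : 0 <= E xi by exact: powR_ge0.
have F0 := f20 xi.
move: (gauss_rV tau xi) Gt G0 (H xi) (r xi) (E xi) E0 (B xi) (f2 xi) F0 DE.
move=> G Gle G00 H' r' E' E'0 B' F' F'0 DE BG r'0 _ H'0 HB'.
apply: (@le_trans _ _ (D * ((r' * E') * (H' * G)))).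
  have -> : D * ((r' * E') * (H' * G)) = (D * E') * (r' * H' * G) by ring.
  by apply: ler_peMl => //; apply: mulr_ge0 => //; exact: mulr_ge0.
have HG : H' ^+ 2 * G ^+ 2 <= 2 * B' * G.
  by apply: ler_pM; rewrite ?sqr_ge0// expr2 ler_piMr.
have s := mulr_ge0 (ltW th0) (sqr_ge0 (r' * E' - H' * G / th)).
have K : (r' * E') * (H' * G) <= th / 2 * (E' ^+ 2 * r' ^+ 2) + B' * G / th.
  have e1 : th * (r' * E' - H' * G / th) ^+ 2 =
    th * (E' ^+ 2 * r' ^+ 2) + (H' ^+ 2 * G ^+ 2) / th - 2 * (r' * E' * (H' * G)).
    by field; rewrite gt_eqF.
  have e2 : H' ^+ 2 * G ^+ 2 / th <= 2 * B' * G / th by rewrite ler_wpM2r// invr_ge0 ltW.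
  have e3 : 2 * B' * G / th = 2 * (B' * G / th) by ring.
  by move: s; rewrite e1; move: e2; rewrite e3; lra.
have := ler_wpM2l D0 K; rewrite /a /b.
have P1 : 0 <= L * th' * (E' ^+ 2 * r' ^+ 2).
  by apply: mulr_ge0; apply: mulr_ge0; rewrite ?sqr_ge0 ?(ltW th'0).
have -> : D * (th / 2 * (E' ^+ 2 * r' ^+ 2) + B' * G / th) =
  D * (th / 2) * (E' ^+ 2 * r' ^+ 2) + D / th * (B' * G) by ring.
by move=> ?; lra.
Qed.

End pairing.

End fourier_side.

Section mollification.
Context {R : realType} {n : nat}.
Notation mu := (@lebesgue_rV R n).
Implicit Types (h : 'rV[R]_n -> R) (x y z xi : 'rV[R]_n) (tau : R).

(** Dyadic scales make the increments of the mollifications decay geometrically, hence summable. *)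
Definition scale (k : nat) : R := 2^-1 ^+ k.

Lemma scale_gt0 k : 0 < scale k.
Proof. by rewrite exprn_gt0// invr_gt0. Qed.

Lemma scale_le1 k : scale k <= 1.
Proof. by rewrite exprn_ile1// ?invr_ge0// invf_le1// ler1n. Qed.

Lemma cvg_scale : scale k @[k --> \oo] --> 0.
Proof. by apply: cvg_expr; rewrite ger0_norm ?invr_ge0// invf_lt1// ltr1n. Qed.

Lemma mollifierN tau z : mollifier tau (- z) = mollifier tau z.
Proof. by rewrite /mollifier /gauss_rV enormN. Qed.

Lemma mollifier_scale (c : R) z : 0 < c ->
  c ^+ n * mollifier (c ^+ 2) (c *: z) = mollifier 1 z.
Proof.
move=> c0; rewrite /mollifier /gauss_rV mulrA -exprMn enormZ (ger0_norm (ltW c0)).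
congr (_ ^+ _ * expR (- _)); last by field; rewrite gt_eqF.
rewrite sqrtrM ?pi_ge0// sqrtrV ?sqr_ge0// sqrtr_sqr (ger0_norm (ltW c0)) divr1.
by field; rewrite gt_eqF.
Qed.

Lemma integral_mollifier0 tau : 0 < tau ->
  (\int[mu]_z (mollifier tau z)%:E = mollifier_mass (n := n)%:E)%E.
Proof.
move=> tau0; rewrite -(integral_mollifier 0 tau0); apply: eq_integral => z _.
by rewrite sub0r mollifierN.
Qed.

(** Moves polynomial weights between x and x + c z uniformly in the dilation c. The factor 2 comes
    from |v + w|^2 <= 2 |v|^2 + 2 |w|^2. *)
Lemma enorm_shift_le (c : R) x z : 0 <= c -> c <= 1 ->
  1 + enorm x <= 2 * ((1 + enorm (x + c *: z)) * (1 + enorm z)).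
Proof.
move=> c0 c1; set v := x + c *: z.
have v0 := enorm_ge0 v; have z0 := enorm_ge0 z; have x0 := enorm_ge0 x.
have : enorm x ^+ 2 <= 2 * enorm v ^+ 2 + 2 * enorm z ^+ 2.
  have -> : x = v + (- c) *: z by rewrite /v scaleNr addrK.
  apply: le_trans (enormD_sqr_le _ _) _; rewrite lerD2l ler_wpM2l//.
  rewrite enormZ normrN (ger0_norm c0) exprMn ler_piMl ?sqr_ge0//.
  by rewrite exprn_ile1.
move=> sq; have : enorm x <= 2 * (enorm v + enorm z).
  rewrite -(ler_pXn2r (n := 2))// ?nnegrE ?mulr_ge0 ?addr_ge0//.
  by apply: le_trans sq _; have := mulr_ge0 v0 z0; have := sqr_ge0 (enorm v); have := sqr_ge0 (enorm z); nra.
by have := mulr_ge0 v0 z0; nra.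
Qed.

Variables (a : 'rV[R]_n -> R) (N : nat).
Hypotheses (ma : measurable_fun setT a)
  (aN : (\int[mu]_x (`|a x| / (1 + enorm x) ^+ N)%:E < +oo)%E).

Let W : 'rV[R]_n -> R := gauss_rV 1.
Let mW : measurable_fun setT W := @measurable_gauss_rV R n 1.
Let m1 : 'rV[R]_n -> R := mollifier 1.
Let mm1 : measurable_fun setT m1.
Proof. by apply: measurable_fun_mollifier; exact: measurable_id. Qed.

Let p0 x : 0 < (1 + enorm x) ^+ N.
Proof. by rewrite exprn_gt0// ltr_pwDl// enorm_ge0. Qed.

Let m1i : mu.-integrable setT (EFin \o m1).
Proof.
apply: (integrable_bounded_by (g := m1)) => //.
- by move=> z; rewrite ger0_norm// mollifier_ge0.
- by rewrite integral_mollifier0// ltry.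
Qed.

Let moment : exists2 C, 0 <= C &
  (\int[mu]_z ((1 + enorm z) ^+ N * m1 z)%:E <= C%:E)%E.
Proof.
(* The mollifier at time 1 has exponent 1/4; written as a product of two Gaussians of exponent 1/8,
   one absorbs the polynomial and the other is integrated. *)
have e0 : (0 : R) < 8^-1 by rewrite invr_gt0.
have [C hC] := @gauss_rV_decay R n 8^-1 e0 N.
have C0 : 0 <= C.
  by apply: le_trans (hC 0); exact: mulr_ge0 (ltW (p0 0)) (gauss_rV_ge0 _ 0).
have mg := @measurable_gauss_rV R n 8^-1.
pose K := Num.sqrt (pi / 1) ^+ n * C; have K0 : 0 <= K by rewrite mulr_ge0// exprn_ge0// sqrtr_ge0.
exists (K * Num.sqrt (pi / 8^-1) ^+ n); first by rewrite mulr_ge0// exprn_ge0// sqrtr_ge0.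
rewrite EFinM -(integral_gauss_rV n e0) -ge0_integralZl//; [|by meas|
  by move=> z _; rewrite lee_fin gauss_rV_ge0].
apply: le_nnintegral => z _.
  by rewrite lee_fin; exact: mulr_ge0 (ltW (p0 z)) (mollifier_ge0 _ _).
rewrite -EFinM lee_fin /m1 /mollifier /K.
have -> : gauss_rV (4 * 1)^-1 z = gauss_rV 8^-1 z * gauss_rV 8^-1 z.
  by rewrite /gauss_rV -expRD; congr expR; field.
rewrite mulrCA -[leRHS]mulrA; apply: ler_wpM2l; first by rewrite exprn_ge0// sqrtr_ge0.
by rewrite mulrA ler_wpM2r ?gauss_rV_ge0.
Qed.

Definition mollify tau x : R := \int[mu]_y (mollifier tau (x - y) * a y).

Lemma integrable_mollify tau x : 0 < tau ->
  mu.-integrable setT (EFin \o (fun y => mollifier tau (x - y) * a y)).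
Proof.
move=> tau0; have t4 : 0 < (4 * tau)^-1 by rewrite invr_gt0 mulr_gt0.
have [C hC] := @gauss_rV_decay R n _ t4 N.
have mk : measurable_fun setT (fun y => mollifier tau (x - y)).
  by apply: measurable_fun_mollifier; meas.
pose K := Num.sqrt (pi / tau) ^+ n * (C * (2 * (1 + enorm x)) ^+ N).
apply: (integrable_bounded_by (g := fun y => `|K * (`|a y| / (1 + enorm y) ^+ N)|)).
- by meas.
- move=> y; rewrite normrM (ger0_norm (mollifier_ge0 _ _)).
  apply: le_trans (ler_norm _); rewrite /K mulrCA mulrC; apply: ler_wpM2l => //.
  rewrite ler_pdivlMr// /mollifier -!mulrA; apply: ler_wpM2l.
    by rewrite exprn_ge0// sqrtr_ge0.
  have /(lerXn2r N) := enorm_shift_le y (x - y) ler01 (lexx 1).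
  rewrite scale1r (addrC y) subrK !nnegrE => /(_ _ _) H.
  have := hC (x - y); set G := gauss_rV _ _ => hG.
  apply: (@le_trans _ _ (G * (2 * ((1 + enorm x) * (1 + enorm (x - y)))) ^+ N)).
    apply: ler_wpM2l; first exact: gauss_rV_ge0.
    by apply: H; rewrite ?mulr_ge0// addr_ge0// enorm_ge0.
  have -> : G * (2 * ((1 + enorm x) * (1 + enorm (x - y)))) ^+ N =
    ((1 + enorm (x - y)) ^+ N * G) * (2 * (1 + enorm x)) ^+ N by rewrite !exprMn; ring.
  by apply: ler_wpM2r => //; rewrite exprn_ge0// mulr_ge0// addr_ge0// enorm_ge0.
- apply: integrable_normr_lty.
  apply: (@integrableZl _ _ _ mu _ measurableT K (EFin \o (fun y => `|a y| / (1 + enorm y) ^+ N))).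
  apply: (integrable_bounded_by (g := fun y => `|a y| / (1 + enorm y) ^+ N)) => //.
  + by meas.
  + by move=> y; rewrite ger0_norm// divr_ge0// ltW.
Qed.

Section pairing.
Variable h : 'rV[R]_n -> R.
Hypotheses (mh : measurable_fun setT h) (h01 : forall x, 0 <= h x <= 1)
  (ch : ray_continuous h).

Let hW x : R := h x * W x.
Let mhW : measurable_fun setT hW. Proof. by rewrite /hW; meas. Qed.

Let W0 x : 0 <= W x. Proof. exact: gauss_rV_ge0. Qed.

Let hW0 x : 0 <= hW x.
Proof. by rewrite mulr_ge0//; have /andP[] := h01 x. Qed.

Let hW_le x : hW x <= W x.
Proof. by rewrite ler_piMl//; have /andP[] := h01 x. Qed.

Let W1 x : W x <= 1.
Proof. by rewrite -expR0 ler_expR oppr_le0 mul1r sqr_ge0. Qed.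

(** The mollified test function after the substitution x = y + scale k z, which fixes the kernel and
    moves k into the argument of h, ready for dominated convergence along rays. *)
Let J (k : nat) y : R := \int[mu]_z (hW (y + scale k *: z) * m1 z).

Let J_i k y : mu.-integrable setT (EFin \o (fun z => hW (y + scale k *: z) * m1 z)).
Proof.
apply: (integrable_bounded_by (g := m1)).
- by meas.
- move=> z; rewrite ger0_norm; last exact: mulr_ge0 (hW0 _) (mollifier_ge0 _ _).
  by rewrite ler_piMl ?mollifier_ge0// (le_trans (hW_le _)).
- by rewrite integral_mollifier0// ltry.
Qed.

Let mJ k : measurable_fun setT (J k).
Proof.
have mf : measurable_fun setT (fun p : 'rV[R]_n * 'rV[R]_n => hW (p.1 + scale k *: p.2) * m1 p.2).
  by meas.
rewrite /J /Rintegral; apply: measurable_fun_fine.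
apply: (@measurable_fun_fubini_tonelli_F _ _ _ _ R mu
  (fun p : 'rV[R]_n * 'rV[R]_n => (hW (p.1 + scale k *: p.2) * m1 p.2)%:E)).
- by meas.
- by move=> p; rewrite lee_fin; exact: mulr_ge0 (hW0 _) (mollifier_ge0 _ _).
Qed.

(** Decay of order N in y, uniform in k: after the shift inequality, W absorbs the power of 1 + |y +
    scale k z| and a moment of the mollifier absorbs that of 1 + |z|. *)
Let J_le : exists C, forall k y, 0 <= J k y <= C / (1 + enorm y) ^+ N.
Proof.
have [C1 C10 hC1] := moment.
have [C hC] := @gauss_rV_decay R n 1 ltr01 N.
have C0 : 0 <= C.
  by apply: le_trans (hC 0); exact: mulr_ge0 (ltW (p0 0)) (gauss_rV_ge0 _ 0).
exists (C * 2 ^+ N * C1) => k y; apply/andP; split.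
  by apply: Rintegral_ge0 => z _; exact: mulr_ge0 (hW0 _) (mollifier_ge0 _ _).
apply: le_trans (ler_norm _) _.
apply: (@normr_Rintegral_le _ _ _ _ _
  (fun z => C * 2 ^+ N / (1 + enorm y) ^+ N * ((1 + enorm z) ^+ N * m1 z))) => //.
- move=> z; have m1z : 0 <= m1 z by exact: mollifier_ge0.
  rewrite ger0_norm; last exact: mulr_ge0.
  rewrite [leRHS]mulrA; apply: ler_wpM2r => //; apply: le_trans (hW_le _) _.
  rewrite mulrAC ler_pdivlMr//.
  have /(lerXn2r N) := enorm_shift_le y z (ltW (scale_gt0 k)) (scale_le1 k).
  rewrite !nnegrE => /(_ _ _) H.
  apply: (@le_trans _ _ (W (y + scale k *: z) *
    (2 * ((1 + enorm (y + scale k *: z)) * (1 + enorm z))) ^+ N)).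
    apply: ler_wpM2l => //; apply: H.
      by rewrite addr_ge0// enorm_ge0.
    by rewrite !mulr_ge0// addr_ge0// enorm_ge0.
  rewrite !exprMn; have := hC (y + scale k *: z); rewrite -/(W _) => H2.
  have -> : W (y + scale k *: z) * (2 ^+ N * ((1 + enorm (y + scale k *: z)) ^+ N * (1 + enorm z) ^+ N)) =
    ((1 + enorm (y + scale k *: z)) ^+ N * W (y + scale k *: z)) * (2 ^+ N * (1 + enorm z) ^+ N) by ring.
  rewrite -(mulrA C); apply: ler_wpM2r => //.
  by apply: mulr_ge0; [rewrite exprn_ge0|exact: ltW].
- have K0 : 0 <= C * 2 ^+ N / (1 + enorm y) ^+ N.
    by rewrite divr_ge0 ?(ltW (p0 _))// mulr_ge0// exprn_ge0.
  under eq_integral do rewrite EFinM.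
  rewrite ge0_integralZl//; last 2 first.
  + by meas.
  + by move=> z _; rewrite lee_fin; exact: mulr_ge0 (ltW (p0 z)) (mollifier_ge0 _ _).
  have -> : C * 2 ^+ N * C1 / (1 + enorm y) ^+ N = C * 2 ^+ N / (1 + enorm y) ^+ N * C1.
    by ring.
  by rewrite (EFinM _ C1); apply: lee_wpmul2l.
Qed.

Let J_cvg y : J k y @[k --> \oo] --> mollifier_mass (n := n) * hW y.
Proof.
have -> : mollifier_mass (n := n) * hW y = \int[mu]_z (hW y * m1 z).
  rewrite RintegralZl// mulrC; congr (_ * _).
  by rewrite /Rintegral integral_mollifier0.
apply: (@Rintegral_dominated_cvg _ _ _ mu _ _ m1).
- by move=> k; meas.
- move=> z; apply: cvgMl; apply: cvgM.
    exact: (@ch y z _ (@cvg_scale)).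
  rewrite /W /gauss_rV; apply: continuous_cvg; first exact: continuous_expR.
  apply: cvgN; apply: cvgMr.
  have -> : (fun k => enorm (y + scale k *: z) ^+ 2) =
      fun k => enorm y ^+ 2 + (scale k * (2 * dotp y z) + scale k ^+ 2 * dotp z z).
    apply/funext => k; rewrite !enorm_sqr dotpDl !(dotpC _ (y + _)) !dotpDl.
    by rewrite !dotpZl !(dotpC _ (_ *: _)) !dotpZl (dotpC z y); ring.
  have {2}-> : enorm y ^+ 2 = enorm y ^+ 2 + (0 * (2 * dotp y z) + 0 ^+ 2 * dotp z z).
    by ring.
  have cs := @cvg_scale.
  apply: cvgD; first exact: cvg_cst.
  by apply: cvgD; apply: cvgMl => //; apply: cvgM.
- move=> k z; rewrite ger0_norm; last exact: mulr_ge0 (hW0 _) (mollifier_ge0 _ _).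
  by rewrite ler_piMl ?mollifier_ge0// (le_trans (hW_le _)).
- exact: m1i.
Qed.

Let J_change k y :
  (\int[mu]_x (hW x * mollifier (scale k ^+ 2) (x - y))%:E = (J k y)%:E)%E.
Proof.
have sk := scale_gt0 k.
have mk : measurable_fun setT (fun x => mollifier (scale k ^+ 2) (x - y)).
  by apply: measurable_fun_mollifier; meas.
rewrite (@lebesgue_rV_affine _ _ _ y (scale k))//; first last.
- by move=> x; rewrite lee_fin; exact: mulr_ge0 (hW0 _) (mollifier_ge0 _ _).
- by meas.
- by rewrite gt_eqF.
rewrite EFin_Rintegral// -ge0_integralZl//; last 2 first.
- move: (scale k) => u.
  have : measurable_fun setT (fun x => mollifier (u ^+ 2) (y + u *: x - y)).
    by apply: measurable_fun_mollifier; meas.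
  have m2 : measurable_fun setT (fun x => hW (y + u *: x)).
    by apply: (measurableT_comp mhW); meas.
  by move=> m4; apply: measurable_fun_EFin; exact: measurable_fun_mul m2 m4.
- by move=> x _; rewrite lee_fin; exact: mulr_ge0 (hW0 _) (mollifier_ge0 _ _).
apply: eq_integral => z _; rewrite -EFinM; congr EFin.
by rewrite (ger0_norm (ltW sk)) (addrC y) addrK mulrCA mollifier_scale// (addrC y).
Qed.

(** Fubini moves the mollifier from [a], which is only tempered, to the test function h W, where it
    converges pointwise with a majorant that [a] can be integrated against. *)
Lemma mollify_pairing_cvg :
  \int[mu]_x (mollify (scale k ^+ 2) x * hW x) @[k --> \oo] -->
  mollifier_mass (n := n) * \int[mu]_x (a x * hW x).
Proof.
have [C hC] := J_le.
have Ci : mu.-integrable setT (EFin \o (fun y => C * (`|a y| / (1 + enorm y) ^+ N))).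
  apply: (@integrableZl _ _ _ mu _ measurableT C (EFin \o (fun y => `|a y| / (1 + enorm y) ^+ N))).
  apply: (integrable_bounded_by (g := fun y => `|a y| / (1 + enorm y) ^+ N)) => //.
  - by meas.
  - by move=> y; rewrite ger0_norm// divr_ge0// ltW.
have aJ k y : `|a y * J k y| <= C * (`|a y| / (1 + enorm y) ^+ N).
  have /andP[J0 Jle] := hC k y.
  by rewrite normrM (ger0_norm J0) mulrCA ler_wpM2l.
have E k : \int[mu]_x (mollify (scale k ^+ 2) x * hW x) = \int[mu]_y (a y * J k y).
  pose f (p : 'rV[R]_n * 'rV[R]_n) : R := a p.1 * (hW p.2 * mollifier (scale k ^+ 2) (p.2 - p.1)).
  have mf : measurable_fun setT f.
    have : measurable_fun setT (fun p : 'rV[R]_n * 'rV[R]_n => mollifier (scale k ^+ 2) (p.2 - p.1)).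
      by apply: measurable_fun_mollifier; meas.
    by move=> ?; rewrite /f; meas.
  have mk y : measurable_fun setT (fun x => mollifier (scale k ^+ 2) (x - y)).
    by apply: measurable_fun_mollifier; meas.
  have f_i y : mu.-integrable setT (EFin \o (fun x => hW x * mollifier (scale k ^+ 2) (x - y))).
    apply: (integrable_bounded_by (g := fun x => hW x * mollifier (scale k ^+ 2) (x - y))).
    - by have := mk y => ?; meas.
    - by move=> x; rewrite ger0_norm//; exact: mulr_ge0 (hW0 _) (mollifier_ge0 _ _).
    - by rewrite J_change ltry.
  have fy : (\int[mu]_y \int[mu]_x (`|f (y, x)|)%:E < +oo)%E.
    apply: le_lt_trans (integrable_normr_lty Ci); apply: le_nnintegral => y _.
      by apply: integral_ge0.
    rewrite /f/=; under eq_integral => x _.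
      rewrite normrM (ger0_norm (mulr_ge0 (hW0 _) (mollifier_ge0 _ _))) EFinM.
      over.
    rewrite ge0_integralZl//; last 2 first.
    - by have := mk y => ?; meas.
    - by move=> x _; rewrite lee_fin; exact: mulr_ge0 (hW0 _) (mollifier_ge0 _ _).
    rewrite J_change -EFinM lee_fin.
    have /andP[J0 Jle] := hC k y; rewrite -{1}(ger0_norm J0) -normrM.
    exact: le_trans (aJ k y) (ler_norm _).
  transitivity (\int[mu]_x \int[mu]_y f (y, x)).
    apply: eq_Rintegral => x _; rewrite /mollify mulrC -RintegralZl//.
    - by apply: eq_Rintegral => y _; rewrite /f/=; ring.
    - exact: integrable_mollify (exprn_gt0 _ (scale_gt0 k)).
  rewrite -Rfubini//; apply: eq_Rintegral => y _.
  have -> : \int[mu]_x f (y, x) =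
      a y * \int[mu]_x (hW x * mollifier (scale k ^+ 2) (x - y)).
    by rewrite -RintegralZl.
  have JE : \int[mu]_x (hW x * mollifier (scale k ^+ 2) (x - y)) = J k y.
    rewrite -[LHS]/(fine (\int[mu]_x (hW x * mollifier (scale k ^+ 2) (x - y))%:E)%E).
    by rewrite J_change.
  by rewrite JE.
under eq_fun do rewrite E.
have -> : mollifier_mass (n := n) * \int[mu]_x (a x * hW x) =
    \int[mu]_y (a y * (mollifier_mass (n := n) * hW y)).
  rewrite -RintegralZl//; first by apply: eq_Rintegral => y _; ring.
  apply: (integrable_bounded_by (g := fun y => `|a y| * W y)).
  - by meas.
  - by move=> y; rewrite normrM (ger0_norm (hW0 y)) ler_wpM2l.
  - exact: tempered_gauss_lty ltr01 ma aN.
apply: (@Rintegral_dominated_cvg _ _ _ mu (fun k y => a y * J k y)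
  (fun y => a y * (mollifier_mass (n := n) * hW y)) _ _ _ aJ Ci).
- by move=> k; have := mJ k => ?; meas.
- by move=> y; apply: cvgMr; exact: J_cvg.
Qed.

End pairing.

End mollification.

(** * Almost everywhere convergence of the mollifications *)

Section summable_increments.
Context d (T : measurableType d) {R : realType}.
Variable mu : {measure set T -> \bar R}.
Variables (A : nat -> T -> R) (w : T -> R) (B q : R).
Hypotheses (mA : forall k, measurable_fun setT (A k)) (mw : measurable_fun setT w)
  (w0 : forall x, 0 < w x) (B0 : 0 <= B) (q0 : 0 <= q) (q1 : q < 1)
  (A0 : (\int[mu]_x (`|A 0%N x| * w x)%:E < +oo)%E)
  (dA : forall k, (\int[mu]_x (`|A k.+1 x - A k x| * w x)%:E <= (B * q ^+ k)%:E)%E).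

Let dd (k : nat) x : R := `|A k.+1 x - A k x| * w x.
Let d0 k x : 0 <= dd k x. Proof. by rewrite mulr_ge0// ltW. Qed.
Let md k : measurable_fun setT (dd k).
Proof. by have := mA k => ?; have := mA k.+1 => ?; rewrite /dd; meas. Qed.

Let S x : \bar R := (\sum_(k <oo) (dd k x)%:E)%E.
Let S0 x : (0 <= S x)%E. Proof. by apply: nneseries_ge0 => k _ _; rewrite lee_fin. Qed.
Let mS : measurable_fun setT S.
Proof.
have := @ge0_emeasurable_sum _ T R setT (fun k x => (dd k x)%:E) xpredT.
apply; first by move=> k x _ _; rewrite lee_fin.
by move=> k _; have := md k => ?; meas.
Qed.

Let sum_geo m : \sum_(0 <= k < m) B * q ^+ k <= B / (1 - q).
Proof.
have p1 : 0 < 1 - q by rewrite subr_gt0.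
rewrite ler_pdivlMr// -mulr_sumr -mulrA ler_piMr//.
rewrite -[leRHS]subr0; elim: m => [|m IH]; first by rewrite big_geq// mul0r subr0.
suff : (\sum_(0 <= k < m.+1) q ^+ k) * (1 - q) = 1 - q ^+ m.+1.
  by move=> ->; rewrite lerD2l lerN2 exprn_ge0.
elim: {IH} m => [|m IH]; first by rewrite big_nat1 expr0 expr1 mul1r.
by rewrite big_nat_recr//= mulrDl IH (exprS _ m.+1); ring.
Qed.

Let IS : (\int[mu]_x S x <= (B / (1 - q))%:E)%E.
Proof.
rewrite integral_nneseries//; last 2 first.
- by move=> k; have := md k => ?; meas.
- by move=> k x _; rewrite lee_fin.
apply: lime_le.
  by apply: is_cvg_nneseries => k _ _; apply: integral_ge0 => x _; rewrite lee_fin.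
apply: nearW => m; apply: (@le_trans _ _ (\sum_(0 <= k < m) (B * q ^+ k)%:E)%E).
  by apply: lee_sum => k _; exact: dA.
by rewrite sumEFin lee_fin; exact: sum_geo.
Qed.

Let E := [set x | (S x < +oo)%E].
Let mE : measurable E.
Proof.
rewrite -[E]setTI; apply: measurable_lte => //; exact: measurable_cst.
Qed.

Let Si : mu.-integrable setT S.
Proof.
apply/integrableP; split => //; apply: le_lt_trans (ltry (B / (1 - q))).
by apply: le_trans IS; apply: le_nnintegral => x _ //; rewrite gee0_abs.
Qed.

Let aeE : {ae mu, forall x, E x}.
Proof.
by apply: filterS (integrable_ae measurableT Si) => x /(_ I) /fin_numPlt/andP[].
Qed.

Let G x : R := `|A 0%N x| * w x + fine (S x).

Let Gi : mu.-integrable setT (EFin \o G).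
Proof.
have m0 := mA 0%N; have mf : measurable_fun setT (fun x => fine (S x)) by meas.
have i1 : mu.-integrable setT (EFin \o (fun x => `|A 0%N x| * w x)).
  apply: (integrable_bounded_by (g := fun x => `|A 0%N x| * w x)) => //.
  - by meas.
  - by move=> x; rewrite ger0_norm// mulr_ge0// ltW.
have i2 : mu.-integrable setT (EFin \o (fun x => fine (S x))).
  apply: (integrable_bounded_by (g := fun x => fine (S x))) => //.
  - by move=> x; rewrite ger0_norm// fine_ge0.
  - apply: le_lt_trans (ltry (B / (1 - q))); apply: le_trans IS.
    apply: le_nnintegral => x _; first by rewrite lee_fin fine_ge0.
    by case: (S x) (S0 x) => //= _; exact: leey.
exact: (@integrableD _ _ _ mu _ measurableT _ _ i1 i2).
Qed.

Let partial x m : E x -> \sum_(0 <= k < m) dd k x <= fine (S x).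
Proof.
move=> Ex; rewrite -lee_fin fineK ?ge0_fin_numE// -sumEFin.
by apply: nneseries_lim_ge => k _ _; rewrite lee_fin.
Qed.

Let telescope_le x k : `|A k x - A 0%N x| * w x <= \sum_(0 <= j < k) dd j x.
Proof.
elim: k => [|k IH]; first by rewrite subrr normr0 mul0r big_geq.
rewrite big_nat_recr//=; apply: le_trans (lerD IH (lexx _)).
rewrite /dd -mulrDl ler_wpM2r ?(ltW (w0 x))//.
have -> : A k.+1 x - A 0%N x = (A k x - A 0%N x) + (A k.+1 x - A k x) by ring.
exact: ler_normD.
Qed.

Let dominated x k : E x -> `|A k x| * w x <= G x.
Proof.
move=> Ex; have := le_trans (telescope_le x k) (partial k Ex); rewrite /G.
have : `|A k x| <= `|A 0%N x| + `|A k x - A 0%N x|.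
  by apply: le_trans (ler_normD _ _); rewrite addrC subrK.
by move=> /(ler_wpM2r (ltW (w0 x))); rewrite mulrDl; lra.
Qed.

Let cvgA x : E x -> cvgn (fun k => A k x).
Proof.
move=> Ex; suff c : cvgn (series (telescope (fun k => A k x))).
  have -> : (fun k => A k x) = (fun k => A 0%N x + series (telescope (fun k => A k x)) k).
    by apply/funext => k; exact: eq_sum_telescope.
  by apply: is_cvgD => //; exact: is_cvg_cst.
apply: normed_cvg; apply: nondecreasing_is_cvgn.
  by apply/nondecreasing_seqP => k; rewrite /normed_series_of/= /series/= big_nat_recr//= lerDl.
exists (fine (S x) / w x) => _ [m _ <-]; rewrite /series/= ler_pdivlMr// mulr_suml.
exact: partial.
Qed.

(** The series of weighted increments has finite integral by monotone convergence, so it is finite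
    off a null set, where the sequence converges absolutely. Its sum plus the first term is the
    majorant [G]. *)
Lemma ae_cvg_of_summable : exists (E : set T) (f G : T -> R),
  [/\ measurable E, {ae mu, forall x, E x}, measurable_fun setT f,
      mu.-integrable setT (EFin \o G) &
      forall x, E x -> A k x @[k --> \oo] --> f x /\ forall k, `|A k x| * w x <= G x].
Proof.
pose f x := limn (fun k => \1_E x * A k x).
have mI : measurable_fun setT (\1_E : T -> R) by exact: measurable_indic.
have fE x : \1_E x * A k x @[k --> \oo] --> f x.
  rewrite indicE; case: (boolP (x \in E)) => xE; last first.
    rewrite /f indicE (negbTE xE); under eq_fun do rewrite mul0r.
    by rewrite lim_cst//; exact: cvg_cst.
  rewrite /f indicE xE; under eq_fun do rewrite mul1r.
  exact: (cvgA (set_mem xE)).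
exists E, f, G; split=> //.
  apply: (@measurable_fun_cvg _ _ _ _ (fun k x => \1_E x * A k x)).
    by move=> k; have := mA k => ?; meas.
  by move=> x _; exact: fE.
move=> x Ex; split; last by move=> k; exact: dominated.
have := fE x; rewrite indicE mem_set//.
by under eq_fun do rewrite mul1r.
Qed.

End summable_increments.

Section sign_pairing.
Context d (T : measurableType d) {R : realType}.
Variables (mu : {measure set T -> \bar R}) (u v w : T -> R) (K : R).
Hypotheses (mu' : measurable_fun setT u) (mv : measurable_fun setT v)
  (w0 : forall x, 0 < w x).

(* Testing with the sign of the difference turns a pairing bound into an L^1 bound. *)
Lemma sign_pairing :
  (forall f : T -> R, measurable_fun setT f -> (forall x, `|f x| <= 1) ->
     mu.-integrable setT (EFin \o (fun x => u x * (f x * w x)))) ->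
  (forall f : T -> R, measurable_fun setT f -> (forall x, `|f x| <= 1) ->
     mu.-integrable setT (EFin \o (fun x => v x * (f x * w x)))) ->
  `|\int[mu]_x (Num.sg (v x - u x) * w x * v x) -
    \int[mu]_x (Num.sg (v x - u x) * w x * u x)| <= K ->
  (\int[mu]_x (`|v x - u x| * w x)%:E <= K%:E)%E.
Proof.
move=> ui vi.
have sg1 x : `|Num.sg (v x - u x)| <= 1 by rewrite normr_sg; case: (_ != 0).
have msg : measurable_fun setT (fun x => Num.sg (v x - u x)) by meas.
have i1 := vi _ msg sg1; have i2 := ui _ msg sg1.
under eq_Rintegral do rewrite mulrC.
under [X in _ - X]eq_Rintegral do rewrite mulrC.
rewrite -RintegralB// => /(le_trans (ler_norm _)); rewrite -lee_fin EFin_Rintegral.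
  apply: le_trans; apply: le_nnintegral => x _; first by rewrite lee_fin mulr_ge0// ltW.
  by rewrite lee_fin -mulrBl mulrA normrEsg (mulrC (Num.sg _)).
exact: (@integrableB _ _ _ mu _ measurableT _ _ i1 i2).
Qed.

End sign_pairing.

Section mollification_limit.
Context {R : realType} {n : nat}.
Notation mu := (@lebesgue_rV R n).

Variables (w : 'rV[R]_n -> R) (m C L : R).
Hypotheses (mw : measurable_fun setT w) (w0 : forall x, 0 < w x)
  (wc : forall x, w x <= m) (wt : (\int[mu]_x (w x)%:E <= L%:E)%E)
  (WC : forall x, gauss_rV 1 x <= C * w x).
Variables (a g1 g2 r : 'rV[R]_n -> R) (N : nat) (Q beta : R).
Hypotheses (ma : measurable_fun setT a)
  (aN : (\int[mu]_x (`|a x| / (1 + enorm x) ^+ N)%:E < +oo)%E)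
  (mg1 : measurable_fun setT g1) (mg2 : measurable_fun setT g2)
  (mr : measurable_fun setT r)
  (g1r : forall xi, `|g1 xi| <= r xi) (g2r : forall xi, `|g2 xi| <= r xi)
  (rN : (\int[mu]_xi (r xi / (1 + enorm xi) ^+ N)%:E < +oo)%E)
  (rQ : (\int[mu]_xi (enorm xi `^ beta * r xi ^+ 2)%:E <= Q%:E)%E)
  (b0 : 0 < beta) (b4 : beta <= 4).
Hypothesis aE : forall tau x, 0 < tau -> mollify a tau x = fourier_gauss g1 g2 tau x.

Let tau (k : nat) : R := scale k ^+ 2.
Let tau0 k : 0 < tau k. Proof. by rewrite exprn_gt0// scale_gt0. Qed.

Let W : 'rV[R]_n -> R := gauss_rV 1.
Let mW : measurable_fun setT W := @measurable_gauss_rV R n 1.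

Let Ak k := fourier_gauss g1 g2 (tau k).
Let mAk k : measurable_fun setT (Ak k).
Proof. exact: (measurable_fourier_gauss mg1 mg2 mr g1r g2r rN (tau0 k)). Qed.

Let Akw_i (k : nat) (f : 'rV[R]_n -> R) : measurable_fun setT f ->
  (forall x, `|f x| <= 1) -> mu.-integrable setT (EFin \o (fun x => Ak k x * (f x * w x))).
Proof.
move=> mf f1; have [D hD] := fourier_gauss_bounded mg1 mg2 mr g1r g2r rN (tau0 k).
apply: (integrable_bounded_by (g := fun x => D * w x)).
- by have := mAk k => ?; meas.
- move=> x; rewrite !normrM (ger0_norm (ltW (w0 x))) mulrA ler_wpM2r ?(ltW (w0 x))//.
  by rewrite -[leRHS]mulr1; apply: ler_pM => //; exact: hD.
- have D0 : 0 <= D by apply: le_trans (normr_ge0 _) (hD 0).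
  under eq_integral do rewrite EFinM.
  rewrite ge0_integralZl//; [|by meas|by move=> x _; rewrite lee_fin ltW].
  by rewrite lte_mul_pinfty// (le_lt_trans wt)// ltry.
Qed.

Let B0 : R := Q / 2 + mollifier_mass (R := R) (n := n) * m * L.
Let q : R := 2^-1 `^ (beta / 2).

(** Since tau k = 4^(-k), the gain tau^(beta/4) is the k-th power of the ratio q = 2^(-beta/2) <
    1. *)
Let tauq k : tau k `^ (beta / 4) = q ^+ k.
Proof.
rewrite /tau /scale /q -exprM -powR_mulrn ?invr_ge0// -powRrM -powR_mulrn ?powR_ge0// -powRrM.
by congr (_ `^ _); rewrite natrM; field.
Qed.

Let increments k : (\int[mu]_x (`|Ak k.+1 x - Ak k x| * w x)%:E <= (B0 * q ^+ k)%:E)%E.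
Proof.
pose h x := Num.sg (Ak k.+1 x - Ak k x) * w x.
have m1 := mAk k; have m2 := mAk k.+1.
have mh : measurable_fun setT h.
  by rewrite /h; move: (Ak k) (Ak k.+1) m1 m2 => u v ? ?; meas.
have sg1 (t : R) : `|Num.sg t| <= 1 by rewrite normr_sg; case: (t != 0).
have hm x : `|h x| <= m.
  rewrite normrM (ger0_norm (ltW (w0 x))); apply: le_trans (wc x).
  by rewrite ler_piMl// ltW.
have hL : (\int[mu]_x (`|h x|)%:E <= L%:E)%E.
  apply: le_trans wt; apply: le_nnintegral => x _ //; rewrite lee_fin normrM.
  by rewrite (ger0_norm (ltW (w0 x))) ler_piMl// ltW.
have t't : tau k.+1 <= tau k.
  rewrite /tau /scale -!exprM; apply: ler_wiXn2l; rewrite ?invr_ge0// ?invf_le1 ?ler1n//.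
  by rewrite leq_mul2r leqnSn orbT.
have := fourier_gauss_cauchy mg1 mg2 mr g1r g2r rN rQ b0 b4 mh hm hL (tau0 k.+1) t't.
rewrite tauq -/B0 mulrC; move: hL hm mh (Akw_i k) (Akw_i k.+1); rewrite /h -/(Ak k) -/(Ak k.+1).
move: (Ak k) (Ak k.+1) m1 m2 => u v mu' mv hL hm mh i1 i2.
exact: sign_pairing.
Qed.

Let q01 : 0 <= q /\ q < 1.
Proof.
split; first exact: powR_ge0.
rewrite /q /powR gt_eqF ?invr_gt0// -[ltRHS]expR0 ltr_expR lnV ?posrE//.
by rewrite mulrN oppr_lt0; apply: mulr_gt0; [rewrite divr_gt0|rewrite ln_gt0// ltr1n].
Qed.

(** Summable increments give an almost everywhere limit. Its pairings with h W are computed twice,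
    by dominated convergence and by [mollify_pairing_cvg], which identifies it as (2 pi)^n a. The
    majorant [G] passes to the limit and yields integrability of [a] against the weight. *)
Lemma mollify_ae_cvg :
  {ae mu, forall x, mollify a (scale k ^+ 2) x @[k --> \oo] --> mollifier_mass (n := n) * a x}
  /\ (\int[mu]_x (`|a x| * w x)%:E < +oo)%E.
Proof.
have [q0 q1] := q01.
have B00 : 0 <= B0.
  have := increments 0%N; rewrite expr0 mulr1 => H.
  rewrite -lee_fin; apply: le_trans H; apply: integral_ge0 => x _.
  by rewrite lee_fin mulr_ge0// ltW.
have A00 : (\int[mu]_x (`|Ak 0%N x| * w x)%:E < +oo)%E.
  have m1 := mAk 0%N.
  have msg : measurable_fun setT (fun x => Num.sg (Ak 0%N x)) by meas.
  have sg1 (t : R) : `|Num.sg t| <= 1 by rewrite normr_sg; case: (t != 0).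
  have /integrable_normr_lty := Akw_i 0%N msg (fun x => sg1 _).
  apply: le_lt_trans; apply: le_nnintegral => x _; first by rewrite lee_fin mulr_ge0// ltW.
  rewrite lee_fin mulrA (mulrC (Ak 0%N x)) -normrEsg normrM normr_id.
  by rewrite (ger0_norm (ltW (w0 x))).
have [E [f [G [mE aeE mf Gi EP]]]] := ae_cvg_of_summable mAk mw w0 B00 q0 q1 A00 increments.
have C0 : 0 <= C.
  have := le_trans (gauss_rV_ge0 1 0) (WC 0); by rewrite pmulr_lge0.
have mI : measurable_fun setT (\1_E : 'rV[R]_n -> R) by exact: measurable_indic.
have mG : measurable_fun setT G by have := measurable_int _ Gi; move/measurable_EFinP.
pose ft x := \1_E x * f x.
have mft : measurable_fun setT ft by rewrite /ft; meas.
have ft_le x : `|ft x| * w x <= `|G x|.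
  rewrite /ft indicE; case: (boolP (x \in E)) => xE; last by rewrite mul0r normr0 mul0r.
  have [c k_le] := EP x (set_mem xE); rewrite mul1r.
  apply: le_trans (ler_norm _).
  have : `|Ak k x| * w x @[k --> \oo] --> `|f x| * w x by apply: cvgMl; exact: cvg_norm.
  by move=> /cvgr_to_le; apply; apply: nearW => k; exact: k_le.
have Gi' : mu.-integrable setT (EFin \o (fun x => C * `|G x|)).
  exact: (@integrableZl _ _ _ mu _ measurableT C _ (integrable_norm Gi)).
have aW_i : mu.-integrable setT (EFin \o (fun x => a x * W x)).
  apply: (integrable_bounded_by (g := fun x => `|a x| * W x)).
  - by meas.
  - by move=> x; rewrite normrM (ger0_norm (gauss_rV_ge0 _ _)).
  - exact: tempered_gauss_lty ltr01 ma aN.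
have fW_i : mu.-integrable setT (EFin \o (fun x => ft x * W x)).
  apply: (integrable_bounded_by (g := fun x => `|C * `|G x| |)).
  - by meas.
  - move=> x; rewrite normrM (ger0_norm (gauss_rV_ge0 _ _)); apply: le_trans (ler_norm _).
    apply: (@le_trans _ _ (`|ft x| * (C * w x))); first by rewrite ler_wpM2l.
    by rewrite mulrCA ler_wpM2l.
  - exact: integrable_normr_lty Gi'.
set Lm := mollifier_mass (n := n).
pose F x := (ft x - Lm * a x) * W x.
have F2 x : F x = ft x * W x - Lm * (a x * W x) by rewrite /F; ring.
have LmaW_i : mu.-integrable setT (EFin \o (fun x => Lm * (a x * W x))).
  exact: (@integrableZl _ _ _ mu _ measurableT Lm _ aW_i).
have Fi : mu.-integrable setT (EFin \o F).
  rewrite (_ : F = (fun x => ft x * W x - Lm * (a x * W x))); last exact/funext.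
  exact: (@integrableB _ _ _ mu _ measurableT _ _ fW_i LmaW_i).
have F0 : {ae mu, forall x, F x = 0}.
  apply: ae_zero_rV => // h mh h01 ch.
  have h1 x : `|h x| <= 1 by have /andP[h0 ?] := h01 x; rewrite ger0_norm.
  have i1 := integrable_mul_le1 fW_i mh h1.
  have i2 := integrable_mul_le1 aW_i mh h1.
  have i3 := integrable_mul_le1 LmaW_i mh h1.
  transitivity (\int[mu]_x (ft x * W x * h x) - \int[mu]_x (Lm * (a x * W x) * h x)).
    by rewrite -RintegralB//; apply: eq_Rintegral => x _; rewrite F2 mulrBl.
  apply/eqP; rewrite subr_eq0; apply/eqP.
  have c1 : \int[mu]_x (\1_E x * Ak k x * (W x * h x)) @[k --> \oo] -->
      \int[mu]_x (ft x * (W x * h x)).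
    apply: (@Rintegral_dominated_cvg _ _ _ mu _ _ (fun x => C * `|G x|)) => //.
    - by move=> k; have := mAk k => ?; meas.
    - move=> x; apply: cvgMl; rewrite /ft indicE; case: (boolP (x \in E)) => xE.
        by apply: cvgMr; have [] := EP x (set_mem xE).
      by rewrite mul0r; under eq_fun do rewrite mul0r; exact: cvg_cst.
    - move=> k x; rewrite indicE; case: (boolP (x \in E)) => xE; last first.
        by rewrite !mul0r normr0 mulr_ge0.
      have [_ /(_ k) k_le] := EP x (set_mem xE).
      rewrite mul1r !normrM (ger0_norm (gauss_rV_ge0 _ _)).
      apply: (@le_trans _ _ (`|Ak k x| * (C * w x))).
        apply: ler_wpM2l => //; apply: le_trans (WC x).
        by rewrite -[leRHS]mulr1; apply: ler_wpM2l => //; exact: gauss_rV_ge0.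
      by rewrite mulrCA ler_wpM2l// (le_trans k_le)// ler_norm.
  have e k : \int[mu]_x (\1_E x * Ak k x * (W x * h x)) =
      \int[mu]_x (mollify a (scale k ^+ 2) x * (h x * W x)).
    have mk := mAk k; rewrite /Rintegral; congr fine.
    have mk' : measurable_fun setT (mollify a (scale k ^+ 2)).
      by rewrite (_ : mollify a _ = Ak k)//; apply/funext => x; exact: aE (tau0 k).
    apply: ae_eq_integral => //.
    - by meas.
    - by meas.
    - apply: filterS aeE => x Ex _ /=; congr EFin.
      by rewrite indicE mem_set// mul1r (aE _ (tau0 k)) (mulrC (W x)).
  have c2 := mollify_pairing_cvg ma aN mh h01 ch.
  have : \int[mu]_x (\1_E x * Ak k x * (W x * h x)) @[k --> \oo] -->
      Lm * \int[mu]_x (a x * (h x * W x)) by under eq_fun do rewrite e; exact: c2.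
  move=> c3; have eq := cvg_unique _ c1 c3.
  transitivity (\int[mu]_x (ft x * (W x * h x))).
    by apply: eq_Rintegral => x _; rewrite mulrA.
  rewrite eq// -RintegralZl//; first by apply: eq_Rintegral => x _; ring.
  by apply: eq_integrable i2 => // x _ /=; congr EFin; ring.
have ftE : {ae mu, forall x, E x /\ ft x = Lm * a x}.
  apply: filterS2 aeE F0 => x Ex /eqP; rewrite mulf_eq0 => /orP[|].
    by rewrite subr_eq0 => /eqP.
  by rewrite gt_eqF// expR_gt0.
split.
  apply: filterS ftE => x [Ex ftx]; rewrite -ftx /ft indicE mem_set// mul1r.
  have [c _] := EP x Ex.
  rewrite (_ : (fun k => mollify _ _ _) = (fun k => Ak k x))//.
  by apply/funext => k; exact: aE (tau0 k).
have Lm0 : 0 < Lm := mollifier_mass_gt0.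
apply: (@le_lt_trans _ _ (\int[mu]_x (Lm^-1 * `|G x|)%:E)%E).
  apply: ae_ge0_le_integral => //.
  - by move=> x _; rewrite lee_fin mulr_ge0// (ltW (w0 x)).
  - by have := mw => ?; apply: measurable_fun_EFin; apply: measurable_fun_mul => //; meas.
  - by move=> x _; rewrite lee_fin mulr_ge0// invr_ge0 ltW.
  - by meas.
  apply: filterS ftE => x [_ ftx] _; rewrite lee_fin.
  have := ft_le x; rewrite ftx normrM (gtr0_norm Lm0) -mulrA => H.
  by rewrite ler_pdivlMl.
under eq_integral do rewrite EFinM.
rewrite ge0_integralZl//; [|by meas|by rewrite lee_fin invr_ge0 ltW].
apply: lte_mul_pinfty => //; [by rewrite lee_fin invr_ge0 ltW|exact: integrable_normr_lty Gi].
Qed.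

End mollification_limit.

Section poisson_weight.
Context {R : realType} (n : nat) (s : R) (s0 : 0 < s).
Notation mu := (@lebesgue_rV R n).
Notation w := (@poisson_kernel R n s 1).

Let base_gt0 (x : 'rV[R]_n) : 0 < enorm x ^+ 2 + 1 ^+ 2.
Proof. by rewrite expr1n ltr_wpDl// sqr_ge0. Qed.

Lemma poisson1_gt0 x : 0 < w x.
Proof.
rewrite poisson_kernelE; apply: mulr_gt0; last exact: powR_gt0.
by rewrite powR1 mulr1; exact: poisson_cst_gt0.
Qed.

Lemma gauss_le_poisson1 : exists C, forall x, gauss_rV 1 x <= C * w x.
Proof.
pose h : R := (n%:R + s) / 2; have h0 : 0 < h by rewrite divr_gt0// ltr_wpDl.
have c := poisson_cst_gt0 n s0.
(* From exp(-|x|^2) = e exp(-(|x|^2 + 1)) and t^h exp(-t) <= h^h at t = |x|^2 + 1. *)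
exists (expR 1 * h `^ h / @poisson_cst R n s).
move=> x; rewrite poisson_kernelE powR1 mulr1 powRN.
have := powR_expRN_le h0 (ltW (base_gt0 x)).
have := powR_gt0 ((n%:R + s) / 2) (base_gt0 x); rewrite -/h.
have -> : gauss_rV 1 x = expR 1 * expR (- (enorm x ^+ 2 + 1 ^+ 2)).
  by rewrite /gauss_rV -expRD; congr expR; ring.
move: (poisson_cst s) c => c c_gt0.
move: (powR _ h) (expR (- _)) => P e P0 He.
have -> : expR 1 * h `^ h / c * (c * P^-1) = expR 1 * (h `^ h / P) by field; rewrite !gt_eqF.
by rewrite ler_wpM2l ?expR_ge0// ler_pdivlMr// mulrC.
Qed.

End poisson_weight.

Section Rintegral_more.
Context {R : realType}.

(** Positive scaling preserves infinite values, which [fine] sends to 0 on both sides. *)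
Lemma fine_scale_sub (k : R) (A B : \bar R) : 0 < k ->
  fine (k%:E * A - k%:E * B)%E = k * fine (A - B)%E.
Proof.
move=> k0; case: A B => [x| |] [y| |] //=;
  rewrite ?gt0_muley ?gt0_muleNy ?lte_fin//= ?mulr0//.
by rewrite mulrBr.
Qed.

Lemma Rintegral_rV_affine n (f : 'rV[R]_n -> R) (b : 'rV[R]_n) (c : R) :
  c != 0 -> measurable_fun setT f ->
  \int[lebesgue_rV n]_x f x = `|c| ^+ n * \int[lebesgue_rV n]_x f (b + c *: x).
Proof.
move=> c0 mf; rewrite /Rintegral integralE.
have mp : measurable_fun setT ((EFin \o f)^\+)%E.
  by apply: measurable_funepos; exact: measurable_fun_EFin.
have mn : measurable_fun setT ((EFin \o f)^\-)%E.
  by apply: measurable_funeneg; exact: measurable_fun_EFin.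
rewrite (lebesgue_rV_affine b c0 mp)// (lebesgue_rV_affine b c0 mn)//.
rewrite fine_scale_sub ?exprn_gt0 ?normr_gt0//; congr (_ * fine _).
rewrite [RHS]integralE; congr (_ - _)%E.
- by apply: eq_integral => x _; rewrite !funeposE.
- by apply: eq_integral => x _; rewrite !funenegE.
Qed.

Lemma Rintegral_rV_translate n (f : 'rV[R]_n -> R) (b : 'rV[R]_n) :
  measurable_fun setT f ->
  \int[lebesgue_rV n]_x f (b + x) = \int[lebesgue_rV n]_x f x.
Proof.
move=> mf; rewrite [RHS](Rintegral_rV_affine b (oner_neq0 R) mf) normr1 expr1n mul1r.
by apply: eq_Rintegral => x _; rewrite scale1r.
Qed.

Lemma measurable_fun_Rintegral d1 d2 (T1 : measurableType d1) (T2 : measurableType d2)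
    (m2 : {sigma_finite_measure set T2 -> \bar R}) (f : T1 * T2 -> R) :
  measurable_fun setT f -> measurable_fun setT (fun x => \int[m2]_y f (x, y)).
Proof.
move=> mf; rewrite /Rintegral; apply: measurable_fun_fine.
have mp : measurable_fun setT ((EFin \o f)^\+)%E.
  by apply: measurable_funepos; exact: measurable_fun_EFin.
have mn : measurable_fun setT ((EFin \o f)^\-)%E.
  by apply: measurable_funeneg; exact: measurable_fun_EFin.
under eq_fun do rewrite integralE.
apply: emeasurable_funB.
- have := @measurable_fun_fubini_tonelli_F _ _ T1 T2 R m2 _ mp (fun p => funepos_ge0 _ p).
  by congr measurable_fun; apply/funext => x; apply: eq_integral => y _; rewrite !funeposE.
- have := @measurable_fun_fubini_tonelli_F _ _ T1 T2 R m2 _ mn (fun p => funeneg_ge0 _ p).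
  by congr measurable_fun; apply/funext => x; apply: eq_integral => y _; rewrite !funenegE.
Qed.

End Rintegral_more.

(** * The extension and the representation formula *)

Section extension_derivative.
Context {R : realType} (n : nat) (s : R) (s0 : 0 < s).
Notation mu := (@lebesgue_rV R n).
Notation pk := (@poisson_kernel R n s).
Notation qk := (@poisson_dt R n s).
Let h : R := (n%:R + s) / 2.
Let phi (x : 'rV[R]_n) : R := (2 * (1 + enorm x ^+ 2)) `^ h.
Let phi0 x : 0 <= phi x. Proof. exact: powR_ge0. Qed.

(** The bound that makes y -> k(x - y) a(y) integrable for every x once [a] is integrable against
    p_1; the factor in x is that of [poisson1_sub_le]. It holds for p_t and q_t with one D on
    compact ranges of t. *)
Definition poisson_like (D : R) (k : 'rV[R]_n -> R) :=
  0 <= D /\ forall x y, `|k (x - y)| <= D * (2 * (1 + enorm x ^+ 2)) `^ ((n%:R + s) / 2) * pk 1 y.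

Lemma poisson_bounds (t0 t1 : R) : 0 < t0 -> t0 <= t1 -> exists2 K : R, 0 <= K &
  forall t x, t0 <= t <= t1 -> pk t x <= K * pk 1 x /\ `|qk t x| <= K * pk 1 x.
Proof.
move=> t00 t01.
pose K1 : R := t1 `^ s * Num.min 1 (t0 ^+ 2) `^ (- h).
have K10 : 0 <= K1 by rewrite mulr_ge0// powR_ge0.
pose C : R := (n%:R + 2 * s) / t0.
have C0 : 0 <= C by rewrite divr_ge0 ?addr_ge0 ?mulr_ge0// ltW.
exists (K1 + C * K1); first by rewrite addr_ge0// mulr_ge0.
move=> t x tt; have p1 := poisson_le_poisson1 s0 x t00 tt.
have /andP[ta tb] := tt; have tp : 0 < t := lt_le_trans t00 ta.
have pk0 := poisson_kernel_ge0 s0 1 x; have pt0 := poisson_kernel_ge0 s0 t x.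
have p1' : pk t x <= K1 * pk 1 x by [].
split.
  by apply: le_trans p1' _; apply: ler_wpM2r => //; rewrite lerDl mulr_ge0.
apply: le_trans (poisson_dt_le s0 x tp) _.
have ns : 0 <= n%:R + 2 * s by rewrite addr_ge0// mulr_ge0// ltW.
apply: (@le_trans _ _ (C * (K1 * pk 1 x))); last first.
  have -> : (K1 + C * K1) * pk 1 x = K1 * pk 1 x + C * (K1 * pk 1 x) by ring.
  by rewrite lerDr; exact: mulr_ge0 K10 pk0.
apply: ler_pM => //; first exact: (divr_ge0 ns (ltW tp)).
rewrite /C ler_wpM2l ?addr_ge0 ?mulr_ge0 ?(ltW s0)//.
by rewrite lef_pV2 ?posrE.
Qed.

Lemma poisson_like_bounds (t0 t1 : R) : 0 < t0 -> t0 <= t1 -> exists D : R,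
  forall t, t0 <= t <= t1 -> poisson_like D (pk t) /\ poisson_like D (qk t).
Proof.
move=> t00 t01; have [K K0 HK] := poisson_bounds t00 t01.
exists K => t tt; split; split=> // x y; have [H1 H2] := HK t (x - y) tt.
  rewrite ger0_norm; last exact: poisson_kernel_ge0.
  have := poisson1_sub_le s0 x y.
  move: (pk t (x - y)) (pk 1 (x - y)) (pk 1 y) (powR _ _) H1 => w u v P H1 Hu.
  by rewrite -mulrA; exact: le_trans H1 (ler_wpM2l K0 Hu).
have := poisson1_sub_le s0 x y.
move: (qk t (x - y)) (pk 1 (x - y)) (pk 1 y) (powR _ _) H2 => w u v P H2 Hu.
by rewrite -mulrA; exact: le_trans H2 (ler_wpM2l K0 Hu).
Qed.

Lemma measurable_pk t : measurable_fun setT (pk t).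
Proof. by apply: measurable_fun_poisson; [exact: measurable_cst|exact: measurable_id]. Qed.

Lemma measurable_qk t : measurable_fun setT (qk t).
Proof. by apply: measurable_fun_poisson_dt; [exact: measurable_cst|exact: measurable_id]. Qed.

Section fixed_function.
Variable a : 'rV[R]_n -> R.
Hypotheses (ma : measurable_fun setT a)
  (aw : (\int[mu]_y (`|a y| * pk 1 y)%:E < +oo)%E).

Let aw_i : mu.-integrable setT (EFin \o (fun y => `|a y| * pk 1 y)).
Proof.
have := measurable_pk 1 => mp.
apply: (integrable_bounded_by (g := fun y => `|a y| * pk 1 y)) => //; first by meas.
by move=> y; rewrite ger0_norm//; exact: mulr_ge0 (normr_ge0 _) (poisson_kernel_ge0 s0 _ _).
Qed.

Lemma poisson_like_integrable D k x : measurable_fun setT k -> poisson_like D k ->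
  mu.-integrable setT (EFin \o (fun y => k (x - y) * a y)).
Proof.
move=> mk [D0 Dk].
apply: (integrable_bounded_by (g := fun y => `|D * phi x * (`|a y| * pk 1 y)|)).
- by meas.
- move=> y; apply: le_trans (ler_norm _); rewrite normrM.
  have -> : D * phi x * (`|a y| * pk 1 y) = D * phi x * pk 1 y * `|a y| by ring.
  by apply: ler_wpM2r => //; exact: Dk.
- exact: integrable_normr_lty (@integrableZl _ _ _ mu _ measurableT (D * phi x) _ aw_i).
Qed.

Definition conv (k : 'rV[R]_n -> R) x : R := \int[mu]_y (k (x - y) * a y).

Lemma is_derive_poisson_conv (x : 'rV[R]_n) (t : R) : 0 < t ->
  is_derive t (1 : R) (fun r : R => conv (pk r) x) (conv (qk t) x).
Proof.
(* A neighbourhood (t/2, 2t) on which one multiple of p_1 dominates the differentiated integrand. *)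
move=> t_gt0; have h0 : 0 < t / 2 by rewrite divr_gt0.
have h1 : t / 2 <= 2 * t by lra.
have [D HD] := poisson_like_bounds h0 h1.
have [u v] : t / 2 < t /\ t < 2 * t by split; lra.
apply: (@is_derive_under_integral _ _ R mu (fun r y => pk r (x - y) * a y)
  (fun r y => qk r (x - y) * a y) t (t / 2) (2 * t)
  (fun y => D * phi x * (`|a y| * pk 1 y))) => //.
- by move=> r; have := measurable_pk r; move: (pk r) => p ?; meas.
- move=> r /andP[ra rb]; have [|H _] := HD r; first by rewrite !ltW.
  exact: poisson_like_integrable (measurable_pk r) H.
- move=> r y /andP[ra rb]; have r0 : 0 < r := lt_trans h0 ra.
  have := is_derive_poisson s (x - y) r0 => dp.
  have := @is_deriveM _ _ (fun r => pk r (x - y)) (fun=> a y) r 1 _ _ dp (is_derive_cst _ _ _).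
  by move=> dm; apply: (@is_derive_eq _ _ _ _ _ _ _ _ dm); rewrite /GRing.scale/= mulr0 add0r mulrC.
- move=> r y /andP[ra rb]; have [|_ [D0 H]] := HD r; first by rewrite !ltW.
  rewrite normrM; have -> : D * phi x * (`|a y| * pk 1 y) = D * phi x * pk 1 y * `|a y| by ring.
  by apply: ler_wpM2r => //; exact: H.
- exact: (@integrableZl _ _ _ mu _ measurableT (D * phi x) _ aw_i).
Qed.

Lemma measurable_fun_conv_qk :
  measurable_fun setT (fun z : 'rV[R]_n * R => conv (qk z.2) z.1).
Proof.
apply: (@measurable_fun_Rintegral R _ _ ('rV[R]_n * R)%type 'rV[R]_n mu
  (fun p => qk p.1.2 (p.1.1 - p.2) * a p.2)).
apply: measurable_fun_mul; last by meas.
by apply: measurable_fun_poisson_dt; meas.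
Qed.

Lemma measurable_fun_conv k : measurable_fun setT k -> measurable_fun setT (conv k).
Proof.
move=> mk; apply: (@measurable_fun_Rintegral R _ _ 'rV[R]_n 'rV[R]_n mu
  (fun p => k (p.1 - p.2) * a p.2)).
by meas.
Qed.

Section mollified.
Variables (tau : R) (tau0 : 0 < tau) (N0 : nat).
Hypothesis aN : (\int[mu]_x (`|a x| / (1 + enorm x) ^+ N0)%:E < +oo)%E.
Let g : 'rV[R]_n -> R := mollifier tau.
Let g0 z : 0 <= g z. Proof. exact: mollifier_ge0. Qed.
Let mg : measurable_fun setT g.
Proof. by apply: measurable_fun_mollifier; exact: measurable_id. Qed.

Let base_ge1 (x : 'rV[R]_n) : 1 <= 1 + enorm x ^+ 2.
Proof. by rewrite lerDl sqr_ge0. Qed.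

Let moment x : (\int[mu]_z (g z * phi (x - z))%:E < +oo)%E.
Proof.
have mphi : measurable_fun setT phi by rewrite /phi; meas.
(* As N >= 4h, (1 + |y|^2)^(2h) <= (1 + |y|)^N, so phi / (1 + |y|)^N is at most a multiple of p_1
   and phi itself is an admissible tempered function. *)
pose N := (Num.truncn (4 * h)).+1.
have c := poisson_cst_gt0 n s0.
have Npos (y : 'rV[R]_n) : 0 < (1 + enorm y) ^+ N :> R by rewrite exprn_gt0// ltr_pwDl// enorm_ge0.
have h0 : 0 < h by rewrite divr_gt0// ltr_wpDl.
have key : (\int[mu]_y (`|phi y| / (1 + enorm y) ^+ N)%:E < +oo)%E.
  apply: (@le_lt_trans _ _ (\int[mu]_y ((2 `^ h / @poisson_cst R n s)%:E * (pk 1 y)%:E))%E).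
    apply: le_nnintegral => y _; first by rewrite lee_fin divr_ge0// ltW.
    rewrite -EFinM lee_fin (ger0_norm (phi0 y)) poisson_kernelE powR1 mulr1.
    rewrite expr1n -/h (addrC _ 1).
    set b := 1 + enorm y ^+ 2; have b1 : 1 <= b := base_ge1 y.
    have b_gt0 : 0 < b := lt_le_trans ltr01 b1.
    have -> : 2 `^ h / @poisson_cst R n s * (@poisson_cst R n s * b `^ (- h)) = 2 `^ h * b `^ (- h).
      by move: (poisson_cst s) c => c' c'0; field; rewrite gt_eqF.
    rewrite /phi -/b powRM ?(ltW b_gt0)// -mulrA; apply: ler_wpM2l; first exact: powR_ge0.
    rewrite ler_pdivrMr//.
    apply: (@le_trans _ _ (b `^ (- h) * b `^ (2 * h))).
      have -> : b `^ (- h) * b `^ (2 * h) = b `^ h.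
        rewrite -powRD; last by apply/implyP => _; rewrite gt_eqF.
        by congr (_ `^ _); ring.
      exact: lexx.
    apply: ler_wpM2l; first exact: powR_ge0.
    apply: (@le_trans _ _ (((1 + enorm y) ^+ 2) `^ (2 * h))).
      have h2 : 0 <= 2 * h by exact: mulr_ge0 (ler0n _ 2) (ltW h0).
      have be : b <= (1 + enorm y) ^+ 2 by rewrite /b; have := enorm_ge0 y; nra.
      by apply: (ge0_ler_powR h2) be; rewrite nnegrE ?sqr_ge0// ltW.
    have e1 : 0 <= 1 + enorm y by rewrite addr_ge0// enorm_ge0.
    rewrite -powR_mulrn// -powRrM -powR_mulrn//.
    apply: ler_powR; first by rewrite lerDl enorm_ge0.
    rewrite (_ : 2%:R * (2 * h) = 4 * h); last by ring.
    exact/ltW/Num.Theory.truncnS_gt.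
  rewrite ge0_integralZl//; last 3 first.
  - by have := measurable_pk 1 => ?; meas.
  - by move=> y _; rewrite lee_fin; exact: poisson_kernel_ge0.
  - by rewrite lee_fin divr_ge0 ?powR_ge0 ?ltW.
  by rewrite (integral_poisson n s0 ltr01) -EFinM ltry.
have := integrable_normr_lty (integrable_mollify mphi key x tau0).
apply: le_lt_trans.
have mf : measurable_fun setT (fun z => (g z * phi (x - z))%:E) by meas.
rewrite -(lebesgue_rV_reflect x mf); last by move=> z; rewrite lee_fin mulr_ge0.
apply: le_nnintegral => y _; first by rewrite lee_fin mulr_ge0.
by rewrite lee_fin opprB addrCA subrr addr0 ler_norm.
Qed.

(** Convolutions commute: k * (mollifier * a) = mollifier * (k * a). For k = q_t this bounds the
    derivative of the extension of the mollified function by an average of the original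
    derivative. *)
Lemma conv_mollify_le D k x : measurable_fun setT k -> poisson_like D k ->
  (`|\int[mu]_y (k (x - y) * mollify a tau y)|%:E <=
   \int[mu]_z (g z * `|conv k (x - z)|)%:E)%E.
Proof.
move=> mk Dk; have [D0 HD] := Dk.
pose f (p : 'rV[R]_n * 'rV[R]_n) : R := k (x - p.2) * (g p.1 * a (p.2 - p.1)).
have mf : measurable_fun setT f by rewrite /f; meas.
have mp := measurable_pk 1.
have [A AE] : exists A : R, (\int[mu]_y (`|a y| * pk 1 y)%:E = A%:E)%E.
  exists (fine (\int[mu]_y (`|a y| * pk 1 y)%:E)%E); rewrite fineK// ge0_fin_numE//.
  by apply: integral_ge0 => y _; rewrite lee_fin; exact: mulr_ge0 (normr_ge0 _) (poisson_kernel_ge0 s0 _ _).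
have inner z : \int[mu]_y f (z, y) = g z * conv k (x - z).
  rewrite -(Rintegral_rV_translate z); last by rewrite /f; meas.
  have ki := poisson_like_integrable (x - z) mk Dk.
  rewrite /conv -RintegralZl//; apply: eq_Rintegral => y _.
  by rewrite /f/= (addrC z y) addrK opprD (addrC (- y)) addrA; ring.
have fy : (\int[mu]_z \int[mu]_y (`|f (z, y)|)%:E < +oo)%E.
  apply: (@le_lt_trans _ _ (\int[mu]_z ((D * A)%:E * (g z * phi (x - z))%:E))%E); last first.
    have A0 : 0 <= A.
      by rewrite -lee_fin -AE; apply: integral_ge0 => y _; rewrite lee_fin; exact: mulr_ge0 (normr_ge0 _) (poisson_kernel_ge0 s0 _ _).
    have mphi : measurable_fun setT phi by rewrite /phi; meas.
    rewrite ge0_integralZl//; last 3 first.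
    - by meas.
    - by move=> z _; rewrite lee_fin mulr_ge0.
    - by rewrite lee_fin mulr_ge0.
    by apply: lte_mul_pinfty => //; rewrite lee_fin mulr_ge0.
  apply: le_nnintegral => z _; first exact: integral_ge0.
  have mfz : measurable_fun setT (fun y => (`|f (z, y)|)%:E) by rewrite /f; meas.
  rewrite -(lebesgue_rV_translate z mfz)//.
  apply: (@le_trans _ _ (\int[mu]_y ((D * phi (x - z) * g z)%:E * (`|a y| * pk 1 y)%:E))%E).
    apply: le_nnintegral => y _ //; rewrite -EFinM lee_fin /f/= addrK normrM (normrM (g z)).
    rewrite (ger0_norm (g0 z)) opprD (addrC (- y)) addrA.
    have -> : D * phi (x - z) * g z * (`|a y| * pk 1 y) =
      D * phi (x - z) * pk 1 y * (g z * `|a y|) by ring.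
    by apply: ler_wpM2r; [exact: mulr_ge0|exact: HD].
  rewrite ge0_integralZl//; last 3 first.
  - by meas.
  - by move=> y _; rewrite lee_fin; exact: mulr_ge0 (normr_ge0 _) (poisson_kernel_ge0 s0 _ _).
  - by rewrite lee_fin; exact: mulr_ge0 (mulr_ge0 D0 (phi0 _)) (g0 _).
  by rewrite AE -!EFinM lee_fin (_ : D * phi (x - z) * g z * A = D * A * (g z * phi (x - z)))//; ring.
have -> : \int[mu]_y (k (x - y) * mollify a tau y) = \int[mu]_z (g z * conv k (x - z)).
  under [RHS]eq_Rintegral do rewrite -inner.
  rewrite (Rfubini mf fy); apply: eq_Rintegral => y _.
  have mfy : measurable_fun setT (fun z => f (z, y)) by rewrite /f; meas.
  rewrite -(Rintegral_rV_reflect y mfy) /mollify -RintegralZl//.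
    by apply: eq_Rintegral => z _; rewrite /f/= opprB addrCA subrr addr0.
  exact: (integrable_mollify ma aN y tau0).
have ci : mu.-integrable setT (EFin \o (fun z => g z * conv k (x - z))).
  have := integrable_Rfubini mf fy.
  by apply: eq_integrable => // z _ /=; rewrite inner.
apply: le_trans (_ : (\int[mu]_z `|g z * conv k (x - z)|)%:E <= _)%E.
  by rewrite lee_fin; exact: le_normr_Rintegral.
rewrite EFin_Rintegral; last exact: integrable_norm.
by apply: le_nnintegral => z _ //; rewrite lee_fin normrM (ger0_norm (g0 z)).
Qed.

End mollified.
End fixed_function.
End extension_derivative.

(** * Iterated convolutions with a bounded function *)

Section dominated_kernels.
Context {R : realType} (n : nat).
Notation mu := (@lebesgue_rV R n).
Notation lam := (@lebesgue_measure R).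
Variables (w b : 'rV[R]_n -> R) (c B : R).
Hypotheses (mw : measurable_fun setT w) (w0 : forall u, 0 <= w u) (c0 : 0 <= c)
  (wc : forall x, (\int[mu]_y (w (x - y))%:E = c%:E)%E)
  (mb : measurable_fun setT b) (bB : forall x, `|b x| <= B).

Let B0 : 0 <= B. Proof. exact: le_trans (normr_ge0 _) (bB 0). Qed.

(** All translates of the majorant have the same mass c, so convolutions of a bounded [b] with
    dominated kernels are bounded and can be iterated. *)
Definition dominated (K : R) (k : 'rV[R]_n -> R) := forall u, `|k u| <= K * w u.

Let scaled (A : R) x : 0 <= A -> (\int[mu]_y (A * w (x - y))%:E = (A * c)%:E)%E.
Proof.
move=> A0; under eq_integral do rewrite EFinM.
rewrite ge0_integralZl//; first by rewrite wc.
- by meas.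
- by move=> y _; rewrite lee_fin.
Qed.

Section two_kernels.
Variables (K : R) (K0 : 0 <= K).

Lemma dominated_integrable k z : measurable_fun setT k -> dominated K k ->
  mu.-integrable setT (EFin \o (fun y => k (z - y) * b y)).
Proof.
move=> mk kK; apply: (integrable_bounded_by (g := fun y : 'rV[R]_n => K * B * w (z - y))).
- by meas.
- move=> y; rewrite normrM.
  have -> : K * B * w (z - y) = K * w (z - y) * B by ring.
  by apply: ler_pM => //; exact: kK.
- by rewrite scaled ?ltry// mulr_ge0.
Qed.

Lemma dominated_conv_le k z : measurable_fun setT k -> dominated K k ->
  `|conv b k z| <= K * B * c.
Proof.
move=> mk kK; apply: (@normr_Rintegral_le _ _ _ _ _ (fun y : 'rV[R]_n => K * B * w (z - y))).
- exact: dominated_integrable.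
- move=> y; rewrite normrM.
  have -> : K * B * w (z - y) = K * w (z - y) * B by ring.
  by apply: ler_pM => //; exact: kK.
- by rewrite scaled// mulr_ge0.
Qed.

Variables k1 k2 : 'rV[R]_n -> R.
Hypotheses (mk1 : measurable_fun setT k1) (mk2 : measurable_fun setT k2)
  (d1 : dominated K k1) (d2 : dominated K k2).

Lemma dominated_conv_integrable x :
  mu.-integrable setT (EFin \o (fun z => k1 (x - z) * conv b k2 z)).
Proof.
have mc := measurable_fun_conv mb mk2.
apply: (integrable_bounded_by (g := fun z : 'rV[R]_n => K * (K * B * c) * w (x - z))).
- by meas.
- move=> z; rewrite normrM.
  have -> : K * (K * B * c) * w (x - z) = K * w (x - z) * (K * B * c) by ring.
  by apply: ler_pM => //; exact: dominated_conv_le.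
- by rewrite scaled ?ltry// !mulr_ge0.
Qed.

Let fubini_finite x :
  (\int[mu]_z \int[mu]_y (`|k1 (x - z) * (k2 (z - y) * b y)|)%:E < +oo)%E.
Proof.
apply: (@le_lt_trans _ _ (\int[mu]_z (K * (K * B * c) * w (x - z))%:E)%E); last first.
  by rewrite scaled ?ltry// !mulr_ge0.
apply: le_nnintegral => z _; first exact: integral_ge0.
apply: (@le_trans _ _ (\int[mu]_y (K * w (x - z) * (K * B) * w (z - y))%:E)%E).
  apply: le_nnintegral => y _ //; rewrite lee_fin !normrM.
  have -> : K * w (x - z) * (K * B) * w (z - y) =
    K * w (x - z) * (K * w (z - y) * B) by ring.
  by apply: ler_pM => //; apply: ler_pM => //.
rewrite scaled; last by rewrite !mulr_ge0.
by rewrite lee_fin le_eqVlt; apply/orP; left; apply/eqP; ring.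
Qed.

Lemma conv_conv_fubini x : \int[mu]_z (k1 (x - z) * conv b k2 z) =
  \int[mu]_y \int[mu]_z (k1 (x - z) * (k2 (z - y) * b y)).
Proof.
have mf : measurable_fun setT (fun p : 'rV[R]_n * 'rV[R]_n =>
    k1 (x - p.1) * (k2 (p.1 - p.2) * b p.2)) by meas.
rewrite -(Rfubini mf (fubini_finite x)); apply: eq_Rintegral => z _ /=.
by rewrite -RintegralZl//; exact: dominated_integrable.
Qed.

End two_kernels.

(** After Fubini, the reflection z -> x + y - z exchanges the arguments x - z and z - y for each
    fixed y. *)
Lemma conv_conv_sym K k1 k2 x : 0 <= K ->
  measurable_fun setT k1 -> measurable_fun setT k2 -> dominated K k1 -> dominated K k2 ->
  \int[mu]_z (k1 (x - z) * conv b k2 z) = \int[mu]_z (k2 (x - z) * conv b k1 z).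
Proof.
move=> K0 mk1 mk2 d1 d2.
rewrite (conv_conv_fubini K0 mk1 mk2 d1 d2) (conv_conv_fubini K0 mk2 mk1 d2 d1).
apply: eq_Rintegral => y _.
rewrite -(@Rintegral_rV_reflect R n (fun z => k1 (x - z) * (k2 (z - y) * b y)) (x + y)); last by meas.
apply: eq_Rintegral => z _.
have -> : x - (x + y - z) = z - y by rewrite opprB addrCA opprD (addrA x) subrr add0r.
have -> : x + y - z - y = x - z by rewrite addrAC addrK.
by ring.
Qed.

Section time_dependent.
Variables (p q : R -> 'rV[R]_n -> R) (u v K : R).
Hypotheses (uv : u < v) (K0 : 0 <= K)
  (mp : measurable_fun setT (fun z : measurableTypeR R * 'rV[R]_n => p z.1 z.2))
  (mq : measurable_fun setT (fun z : measurableTypeR R * 'rV[R]_n => q z.1 z.2))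
  (mpt : forall t, measurable_fun setT (p t)) (mqt : forall t, measurable_fun setT (q t))
  (dp : forall t, u <= t <= v -> dominated K (p t))
  (dq : forall t, u <= t <= v -> dominated K (q t))
  (pq : forall t x, u <= t <= v -> is_derive t (1 : R) (p^~ x) (q t x))
  (cp : forall t x, u <= t <= v -> {for t, continuous (p^~ x)})
  (cq : forall t x, u <= t <= v -> {for t, continuous (q^~ x)}).

Let I := [set` `[u, v]] : set (measurableTypeR R).
Let ind (t : measurableTypeR R) : R := \1_I t.
Let mI : measurable I. Proof. exact: measurable_itv. Qed.
Let mind : measurable_fun setT ind. Proof. exact: measurable_indic. Qed.

Let ind_int : (\int[lam]_t (ind t)%:E = (v - u)%:E)%E.
Proof.
rewrite /ind integral_indic// setIT.
transitivity (lam [set` `[u, v]%R]); first by [].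
by rewrite lebesgue_measure_itv/= lte_fin uv EFinB.
Qed.

Variable x : 'rV[R]_n.

(** The t-derivative of p_t(x - z) p_t(z - y) b(y), cut off to [u, v] so that the time integral runs
    over the whole line and Fubini applies. *)
Let g z y t : R :=
  ind t * ((q t (x - z) * p t (z - y) + p t (x - z) * q t (z - y)) * b y).

Let g_le z y t : `|g z y t| <= 2 * K ^+ 2 * B * w (x - z) * w (z - y) * ind t.
Proof.
rewrite /g /ind indicE; case: (boolP (t \in I)) => [/set_mem tI|_]; last first.
  by rewrite mul0r normr0 mulr0.
have tuv : u <= t <= v by move: tI; rewrite /I /= in_itv.
rewrite mul1r mulr1 normrM.
have -> : 2 * K ^+ 2 * B * w (x - z) * w (z - y) =
  ((K * w (x - z)) * (K * w (z - y)) + (K * w (x - z)) * (K * w (z - y))) * B by ring.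
apply: ler_pM => //; apply: le_trans (ler_normD _ _) _; rewrite (normrM (q t _)) (normrM (p t _)).
by apply: lerD; apply: ler_pM => //; first [exact: (dp tuv)|exact: (dq tuv)].
Qed.

Let g_time z y : \int[lam]_t g z y t =
  (p v (x - z) * p v (z - y) - p u (x - z) * p u (z - y)) * b y.
Proof.
pose F (t : R) := p t (x - z) * p t (z - y) * b y.
pose f (t : R) := (q t (x - z) * p t (z - y) + p t (x - z) * q t (z - y)) * b y.
have dF t : u <= t <= v -> is_derive t (1 : R) F (f t).
  move=> tuv; have d := is_deriveM (pq (x - z) tuv) (pq (z - y) tuv).
  have d' := is_deriveM d (is_derive_cst (b y) t 1).
  by apply: (@is_derive_eq _ _ _ _ _ _ _ _ d'); rewrite /f /GRing.scale/=; ring.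
have cf t : u <= t <= v -> {for t, continuous f}.
  move=> tuv; apply: (@continuousM _ _ (fun t : R => q t (x - z) * p t (z - y) +
    p t (x - z) * q t (z - y)) (fun=> b y)); last exact: cst_continuous.
  by apply: continuousD; apply: continuousM; first [by apply: cp|by apply: cq].
have := FTC_closed uv dF cf; rewrite integral_mkcond /Rintegral => H.
rewrite (_ : (p v (x - z) * p v (z - y) - p u (x - z) * p u (z - y)) * b y = F v - F u);
  last by rewrite /F; ring.
rewrite -[RHS]/(fine (F v - F u)%:E) -H; congr fine; apply: eq_integral => t _.
rewrite patchE /g /ind indicE; case: ifPn => tI; rewrite ?mul1r ?mul0r//.
Qed.

Let fubini_y z : \int[mu]_y \int[lam]_t g z y t = \int[lam]_t \int[mu]_y g z y t.
Proof.
have mf : measurable_fun setT (fun r : 'rV[R]_n * measurableTypeR R => g z r.1 r.2).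
  by rewrite /g; meas.
apply: (@Rfubini _ _ 'rV[R]_n (measurableTypeR R) R mu lam _ mf).
have A0 : 0 <= 2 * K ^+ 2 * B * w (x - z) by rewrite !mulr_ge0// sqr_ge0.
apply: (@le_lt_trans _ _ (\int[mu]_y (2 * K ^+ 2 * B * w (x - z) * (v - u) * w (z - y))%:E)%E).
  apply: le_nnintegral => y _; first exact: integral_ge0.
  apply: (@le_trans _ _ (\int[lam]_t ((2 * K ^+ 2 * B * w (x - z) * w (z - y))%:E * (ind t)%:E))%E).
    by apply: le_nnintegral => t _ //; rewrite -EFinM lee_fin; exact: g_le.
  rewrite ge0_integralZl//; last 3 first.
  - by meas.
  - by move=> t _; rewrite lee_fin /ind indicE.
  - by rewrite lee_fin mulr_ge0.
  by rewrite ind_int -EFinM lee_fin mulrAC.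
by rewrite scaled ?ltry// mulr_ge0// subr_ge0 ltW.
Qed.

Let G z t : R := \int[mu]_y g z y t.

Let G_in z t : I t -> G z t = q t (x - z) * conv b (p t) z + p t (x - z) * conv b (q t) z.
Proof.
move=> tI; have tuv : u <= t <= v by move: tI; rewrite /I /= in_itv.
have ip := dominated_integrable K0 z (mpt t) (dp tuv).
have iq := dominated_integrable K0 z (mqt t) (dq tuv).
rewrite /conv -!RintegralZl// -RintegralD//.
- by apply: eq_Rintegral => y _; rewrite /g /ind indicE mem_set// mul1r; ring.
- exact: (@integrableZl _ _ _ mu _ measurableT (q t (x - z)) _ ip).
- exact: (@integrableZl _ _ _ mu _ measurableT (p t (x - z)) _ iq).
Qed.

Let G_out z t : ~ I t -> G z t = 0.
Proof.
move=> tI; rewrite /G; under eq_Rintegral do rewrite /g /ind indicE memNset// mul0r.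
by rewrite /Rintegral integral0.
Qed.

Let G_le z t : `|G z t| <= 2 * K ^+ 2 * B * c * w (x - z) * ind t.
Proof.
have [tI|tI] := pselect (I t); last first.
  by rewrite G_out// normr0 /ind indicE memNset// mulr0.
have tuv : u <= t <= v by move: tI; rewrite /I /= in_itv.
rewrite G_in// /ind indicE mem_set// mulr1.
have -> : 2 * K ^+ 2 * B * c * w (x - z) =
  (K * w (x - z)) * (K * B * c) + (K * w (x - z)) * (K * B * c) by ring.
apply: le_trans (ler_normD _ _) _; rewrite (normrM (q t _)) (normrM (p t _)).
by apply: lerD; apply: ler_pM => //; first [exact: (dp tuv)|exact: (dq tuv)
  |exact: (dominated_conv_le K0 z (mpt t) (dp tuv))|exact: (dominated_conv_le K0 z (mqt t) (dq tuv))].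
Qed.

Let mG : measurable_fun setT (fun r : 'rV[R]_n * measurableTypeR R => G r.1 r.2).
Proof.
apply: (@measurable_fun_Rintegral R _ _ ('rV[R]_n * measurableTypeR R)%type 'rV[R]_n mu
  (fun r => g r.1.1 r.2 r.1.2)).
by rewrite /g; meas.
Qed.

Let fubini_z_finite : (\int[mu]_z \int[lam]_t (`|G z t|)%:E < +oo)%E.
Proof.
have A0 : 0 <= 2 * K ^+ 2 * B * c by rewrite !mulr_ge0// sqr_ge0.
apply: (@le_lt_trans _ _ (\int[mu]_z (2 * K ^+ 2 * B * c * (v - u) * w (x - z))%:E)%E).
  apply: le_nnintegral => z _; first exact: integral_ge0.
  apply: (@le_trans _ _ (\int[lam]_t ((2 * K ^+ 2 * B * c * w (x - z))%:E * (ind t)%:E))%E).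
    by apply: le_nnintegral => t _ //; rewrite -EFinM lee_fin; exact: G_le.
  rewrite ge0_integralZl//; last 3 first.
  - by meas.
  - by move=> t _; rewrite lee_fin /ind indicE.
  - by rewrite lee_fin mulr_ge0.
  by rewrite ind_int -EFinM lee_fin mulrAC.
by rewrite scaled ?ltry// mulr_ge0// subr_ge0 ltW.
Qed.

Let slice t : I t -> \int[mu]_z G z t = 2 * \int[mu]_z (p t (x - z) * conv b (q t) z).
Proof.
move=> tI; have tuv : u <= t <= v by move: tI; rewrite /I /= in_itv.
under eq_Rintegral do rewrite G_in//.
have i1 := dominated_conv_integrable K0 (mqt t) (mpt t) (dq tuv) (dp tuv) x.
have i2 := dominated_conv_integrable K0 (mpt t) (mqt t) (dp tuv) (dq tuv) x.
rewrite RintegralD// (conv_conv_sym x K0 (mqt t) (mpt t) (dq tuv) (dp tuv)).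
by rewrite mulr_natl mulr2n.
Qed.

Let total : \int[lam]_t \int[mu]_z G z t =
  \int[mu]_z (p v (x - z) * conv b (p v) z) - \int[mu]_z (p u (x - z) * conv b (p u) z).
Proof.
have vI : u <= v <= v by rewrite (ltW uv) lexx.
have uI : u <= u <= v by rewrite (ltW uv) lexx.
have i1 := dominated_conv_integrable K0 (mpt v) (mpt v) (dp vI) (dp vI) x.
have i2 := dominated_conv_integrable K0 (mpt u) (mpt u) (dp uI) (dp uI) x.
rewrite -(@Rfubini _ _ 'rV[R]_n (measurableTypeR R) R mu lam _ mG fubini_z_finite).
rewrite -RintegralB//; apply: eq_Rintegral => z _ /=.
rewrite -fubini_y; under eq_Rintegral do rewrite g_time.
have j1 := dominated_integrable K0 z (mpt v) (dp vI).
have j2 := dominated_integrable K0 z (mpt u) (dp uI).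
rewrite /conv -!RintegralZl// -RintegralB//.
- by apply: eq_Rintegral => y _; ring.
- exact: (@integrableZl _ _ _ mu _ measurableT (p v (x - z)) _ j1).
- exact: (@integrableZl _ _ _ mu _ measurableT (p u (x - z)) _ j2).
Qed.

(* By symmetry of the two convolutions, the time derivative of [p_t * (p_t * b)] is
   [2 p_t * (q_t * b)]; it is integrated under the integral sign for fixed [y], [z]. *)
Lemma iterated_conv_increment_le :
  ((`|\int[mu]_z (p v (x - z) * conv b (p v) z) -
      \int[mu]_z (p u (x - z) * conv b (p u) z)|)%:E <=
   \int[lam]_(t in `[u, v]) (2%:E * \int[mu]_z (`|p t (x - z) * conv b (q t) z|)%:E))%E.
Proof.
have mG' : measurable_fun setT (fun r : measurableTypeR R * 'rV[R]_n => G r.2 r.1).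
  exact: (measurableT_comp mG (@measurable_swap _ _ (measurableTypeR R) 'rV[R]_n)).
have fin : (\int[lam]_t \int[mu]_z (`|G z t|)%:E < +oo)%E.
  have mE : measurable_fun setT (fun r : 'rV[R]_n * measurableTypeR R => (`|G r.1 r.2|)%:E) by meas.
  rewrite -(@fubini_tonelli _ _ 'rV[R]_n (measurableTypeR R) R mu lam _ mE)//.
have Gi : lam.-integrable setT (EFin \o (fun t => \int[mu]_z G z t)).
  exact: (@integrable_Rfubini _ _ (measurableTypeR R) 'rV[R]_n R lam mu _ mG' fin).
rewrite -total; apply: (@le_trans _ _ (\int[lam]_t `|\int[mu]_z G z t|)%:E).
  by rewrite lee_fin; exact: le_normr_Rintegral.
rewrite EFin_Rintegral; last exact: integrable_norm.
rewrite [leRHS]integral_mkcond; apply: le_nnintegral => t _; first by rewrite lee_fin.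
rewrite patchE; case: ifPn => [/set_mem|/negP] tI.
  rewrite slice// normrM ger0_norm// EFinM; apply: lee_wpmul2l => //.
  have tuv : u <= t <= v by move: tI; rewrite /= in_itv.
  have i2 := dominated_conv_integrable K0 (mpt t) (mqt t) (dp tuv) (dq tuv) x.
  rewrite -EFin_Rintegral; last exact: integrable_norm.
  by rewrite lee_fin; exact: le_normr_Rintegral.
have G0 z : G z t = 0 by apply: G_out => tI'; apply: tI; exact: mem_set.
by under eq_Rintegral do rewrite G0; rewrite /Rintegral integral0 normr0.
Qed.

End time_dependent.
End dominated_kernels.

Section representation.
Context {R : realType} (n : nat) (s : R) (s0 : 0 < s).
Notation mu := (@lebesgue_rV R n).
Notation lam := (@lebesgue_measure R).
Notation pk := (@poisson_kernel R n s).
Notation qk := (@poisson_dt R n s).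
Notation c := (poisson_total n s).
Variables (b : 'rV[R]_n -> R) (B : R).
Hypotheses (mb : measurable_fun setT b) (bB : forall x, `|b x| <= B)
  (cb : ray_continuous b).

Let c_gt0 : 0 < c := poisson_total_gt0 n s0.

Lemma integral_poisson_shift t x : 0 < t ->
  (\int[mu]_y (pk t (x - y))%:E = c%:E)%E.
Proof.
move=> t0; rewrite -(integral_poisson n s0 t0).
have mp := @measurable_pk R n s t.
apply: (@lebesgue_rV_reflect _ _ (fun y => (pk t y)%:E)); first by move: (pk t) mp => ? ?; meas.
by move=> y; rewrite lee_fin; exact: poisson_kernel_ge0.
Qed.

Lemma integrable_poisson_bounded (f : 'rV[R]_n -> R) D : measurable_fun setT f ->
  (forall x, `|f x| <= D) -> mu.-integrable setT (EFin \o (fun z => pk 1 z * f z)).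
Proof.
move=> mf fD; have mp := @measurable_pk R n s 1.
have D0 : 0 <= D by exact: le_trans (normr_ge0 _) (fD 0).
have p0 := poisson_kernel_ge0 s0 1 (n := n); have pi1 := integral_poisson n s0 ltr01.
move: (pk 1) mp p0 pi1 => p mp p0 pi1.
apply: (integrable_bounded_by (g := fun z => D * p z)).
- by meas.
- by move=> z; rewrite normrM (ger0_norm (p0 z)) mulrC ler_wpM2r.
- under eq_integral do rewrite EFinM.
  rewrite ge0_integralZl//; [|by meas|by move=> z _; rewrite lee_fin].
  by rewrite pi1 -EFinM ltry.
Qed.

(** Substituting z = x - t w turns the kernel into p_1, so the limit t -> 0 is a dominated
    convergence along rays; this is where ray continuity of [b] enters. *)
Lemma Rintegral_poisson_scale (f : 'rV[R]_n -> R) D t x : 0 < t -> measurable_fun setT f ->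
  (forall x, `|f x| <= D) ->
  \int[mu]_z (pk t (x - z) * f z) = \int[mu]_w (pk 1 w * f (x + (- t) *: w)).
Proof.
move=> t0 mf fD; have mp := @measurable_pk R n s t.
have tn0 : - t != 0 by rewrite oppr_eq0 gt_eqF.
rewrite (Rintegral_rV_affine x tn0); last by move: (pk t) mp => ? ?; meas.
rewrite normrN (ger0_norm (ltW t0)).
have E w : pk 1 w = t ^+ n * pk t (x - (x + (- t) *: w)).
  rewrite -poisson_kernel_scale//; congr (pk 1 _).
  by rewrite opprD addrA subrr add0r scaleNr opprK scalerA mulVf ?gt_eqF// scale1r.
have mft : measurable_fun setT (fun w : 'rV[R]_n => f (x + (- t) *: w)) by meas.
have i1 := integrable_poisson_bounded mft (fun w => fD _).
have i2 : mu.-integrable setT (EFin \o (fun w => pk t (x - (x + (- t) *: w)) * f (x + (- t) *: w))).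
  have := @integrableZl _ _ _ mu _ measurableT (t ^- n) _ i1.
  apply: eq_integrable => // w _ /=; rewrite -EFinM; congr EFin.
  by rewrite E !mulrA mulVf ?mul1r// expf_neq0// gt_eqF.
rewrite -RintegralZl//; apply: eq_Rintegral => w _.
by rewrite E mulrA.
Qed.

Let Pt t z : R := conv b (pk t) z.

Let mPt t : measurable_fun setT (Pt t).
Proof. exact: (measurable_fun_conv mb (@measurable_pk R n s t)). Qed.

Let Pt_scale t z : 0 < t -> Pt t z = \int[mu]_w (pk 1 w * b (z + (- t) *: w)).
Proof. by move=> t0; exact: (Rintegral_poisson_scale z t0 mb bB). Qed.

Let B0 : 0 <= B. Proof. exact: le_trans (normr_ge0 _) (bB 0). Qed.

Let Pt_le t z : 0 < t -> `|Pt t z| <= c * B.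
Proof.
move=> t0; have mp := @measurable_pk R n s t.
have p0 y := poisson_kernel_ge0 s0 t (z - y); have p1 := integral_poisson_shift z t0.
rewrite /Pt /conv; move: (pk t) mp p0 p1 => p mp p0 p1.
have I1 : (\int[mu]_y (p (z - y) * B)%:E <= (c * B)%:E)%E.
  under eq_integral do rewrite EFinM.
  rewrite ge0_integralZr//; [by rewrite p1|by meas|by move=> y _; rewrite lee_fin].
have le1 y : `|p (z - y) * b y| <= p (z - y) * B.
  by rewrite normrM (ger0_norm (p0 y)) ler_wpM2l.
apply: (@normr_Rintegral_le _ _ _ _ _ (fun y : 'rV[R]_n => p (z - y) * B)) => //.
apply: (integrable_bounded_by (g := fun y : 'rV[R]_n => p (z - y) * B)) => //; first by meas.
by apply: le_lt_trans I1 _; rewrite ltry.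
Qed.

Let Dt t x : R := \int[mu]_z (pk t (x - z) * Pt t z).

Let pk1_cst (r : R) : \int[mu]_w (pk 1 w * r) = c * r.
Proof.
have i1 := integrable_poisson_bounded (@measurable_cst _ _ _ _ setT (1 : R)) (fun _ => ltac:(by rewrite normr1) : `|1 : R| <= 1).
have e : mu.-integrable setT (EFin \o pk 1).
  by apply: eq_integrable i1 => // w _ /=; rewrite mulr1.
by rewrite RintegralZr.
Qed.

Let pk1_dominated (f_ : nat -> 'rV[R]_n -> R) (f : 'rV[R]_n -> R) D :
  (forall k, measurable_fun setT (f_ k)) -> (forall k x, `|f_ k x| <= D) ->
  (forall x, f_ k x @[k --> \oo] --> f x) ->
  \int[mu]_w (pk 1 w * f_ k w) @[k --> \oo] --> \int[mu]_w (pk 1 w * f w).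
Proof.
move=> mf fD ff; have mp := @measurable_pk R n s 1.
have p0 := poisson_kernel_ge0 s0 1 (n := n).
have i1 := integrable_poisson_bounded (@measurable_cst _ _ _ _ setT D) (fun _ => lexx `|D|).
move: (pk 1) mp p0 i1 => p mp p0 i1.
apply: (@Rintegral_dominated_cvg _ _ _ mu _ _ (fun w => p w * D)) => //.
- by move=> k; have := mf k => ?; meas.
- by move=> x; apply: cvgMr; exact: ff.
- by move=> k x; rewrite normrM (ger0_norm (p0 x)) ler_wpM2l.
Qed.

(** With both kernels rescaled to p_1 the quantity is a double average of b(x - t (w + w')), and
    dominated convergence applies to each average in turn. *)
Let Dt_cvg x : Dt (scale j.+1) x @[j --> \oo] --> c * (c * b x).
Proof.
have sc : scale k.+1 @[k --> \oo] --> (0 : R).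
  by have := (@cvg_scale R); rewrite -(cvg_shiftS (fun k => scale k)).
have s_gt0 k : 0 < scale k.+1 :> R := scale_gt0 k.+1.
have E1 k : Dt (scale k.+1) x = \int[mu]_w (pk 1 w * Pt (scale k.+1) (x + (- scale k.+1) *: w)).
  exact: (Rintegral_poisson_scale x (s_gt0 k) (mPt _) (fun z => Pt_le z (s_gt0 k))).
under eq_fun do rewrite E1.
rewrite -(pk1_cst (c * b x)); apply: (pk1_dominated (D := c * B)).
- by move=> k; move: (scale k.+1) => u; have := mPt u; move: (Pt u) => P mP; meas.
- by move=> k w; exact: Pt_le.
- move=> w; under eq_fun do rewrite Pt_scale//.
  rewrite -(pk1_cst (b x)); apply: (pk1_dominated (D := B)).
  + by move=> k; move: (scale k.+1) => u; meas.
  + by move=> k w'; exact: bB.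
  + move=> w'.
    have -> : (fun k => b (x + - scale k.+1 *: w + - scale k.+1 *: w')) =
        (fun k => b (x + scale k.+1 *: - (w + w'))).
      by apply/funext => k; congr b; rewrite scalerN scalerDr opprD !scaleNr addrA.
    exact: (@cb x _ (fun k => scale k.+1) sc).
Qed.

Variables (Cd e : R).
Hypotheses (e0 : 0 < e)
  (decay : forall M x, 0 < M -> `|\int[mu]_z (pk M (x - z) * b z)| <= Cd * M `^ (- e)).

(** Paired with the lower end 2^(-(j+1)); the shift by one keeps the time interval nondegenerate
    already at j = 0. *)
Let T (j : nat) : R := 2 ^+ j.+1.
Let T_gt0 j : 0 < T j. Proof. exact: exprn_gt0. Qed.

Let Dt_far j x : `|Dt (T j) x| <= c * (Cd * (2 `^ (- e)) ^+ j.+1).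
Proof.
have E : T j `^ (- e) = (2 `^ (- e)) ^+ j.+1.
  rewrite /T -powR_mulrn// -powRrM mulrC powRrM powR_mulrn// ; exact: powR_ge0.
rewrite -E; set D := Cd * _.
have PD z : `|Pt (T j) z| <= D := decay z (T_gt0 j).
have D0 : 0 <= D := le_trans (normr_ge0 _) (PD 0).
have mp := @measurable_pk R n s (T j); have mP := mPt (T j).
have p0 z := poisson_kernel_ge0 s0 (T j) (x - z); have p1 := integral_poisson_shift x (T_gt0 j).
rewrite /Dt; move: (pk (T j)) (Pt (T j)) PD mp mP p0 p1 => p P PD mp mP p0 p1.
have I1 : (\int[mu]_y (p (x - y) * D)%:E <= (c * D)%:E)%E.
  under eq_integral do rewrite EFinM.
  rewrite ge0_integralZr//; [by rewrite p1|by meas|by move=> y _; rewrite lee_fin].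
have le1 y : `|p (x - y) * P y| <= p (x - y) * D.
  by rewrite normrM (ger0_norm (p0 y)) ler_wpM2l.
apply: (@normr_Rintegral_le _ _ _ _ _ (fun y : 'rV[R]_n => p (x - y) * D)) => //.
apply: (integrable_bounded_by (g := fun y : 'rV[R]_n => p (x - y) * D)) => //; first by meas.
by apply: le_lt_trans I1 _; rewrite ltry.
Qed.

Let V (z : 'rV[R]_n) (t : R) : R := `|conv b (qk t) z|.

Let mV : measurable_fun setT (fun z : 'rV[R]_n * R => V z.1 z.2).
Proof.
by apply: measurable_fun_normr; exact: (@measurable_fun_conv_qk R n s b mb).
Qed.

Let increment_le j x :
  ((`|Dt (T j) x - Dt (scale j.+1) x|)%:E <= 2%:E * potential s V x)%E.
Proof.
have s_gt0 : 0 < scale j.+1 :> R := scale_gt0 j.+1.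
have sT : scale j.+1 < T j.
  by apply: le_lt_trans (scale_le1 _) _; rewrite /T exprn_egt1// ltr1n.
have [K K0 HK] := poisson_bounds n s0 s_gt0 (ltW sT).
have mp1 := @measurable_pk R n s 1.
have mp : measurable_fun setT (fun z : measurableTypeR R * 'rV[R]_n => pk z.1 z.2).
  by apply: measurable_fun_poisson; [exact: measurable_fst|exact: measurable_snd].
have mq : measurable_fun setT (fun z : measurableTypeR R * 'rV[R]_n => qk z.1 z.2).
  by apply: measurable_fun_poisson_dt; [exact: measurable_fst|exact: measurable_snd].
have tpos t : scale j.+1 <= t <= T j -> 0 < t by move=> /andP[+ _]; exact: lt_le_trans.
have dp t : scale j.+1 <= t <= T j -> dominated (pk 1) K (pk t).
  move=> tt u; have [H _] := HK t u tt.
  by rewrite ger0_norm//; exact: poisson_kernel_ge0.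
have dq t : scale j.+1 <= t <= T j -> dominated (pk 1) K (qk t).
  by move=> tt u; have [_ H] := HK t u tt.
have := @iterated_conv_increment_le R n (pk 1) b c B mp1 (poisson_kernel_ge0 s0 1 (n := n))
  (ltW c_gt0) (fun x => integral_poisson_shift x ltr01) mb bB pk qk (scale j.+1) (T j) K sT K0 mp mq
  (@measurable_pk R n s) (@measurable_qk R n s) dp dq
  (fun t x tt => is_derive_poisson s x (tpos t tt))
  (fun t x tt => continuous_poisson (s := s) (x := x) (tpos t tt))
  (fun t x tt => continuous_poisson_dt (s := s) (x := x) (tpos t tt)) x.
move=> /le_trans; apply.
have -> : (2%:E * potential s V x =
    \int[lam]_(t in `]0%R, +oo[) (2%:E * poisson_conv s V x t))%E.
  rewrite /potential ge0_integralZl//.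
  - apply: measurable_funTS.
    apply: (@measurable_fun_fubini_tonelli_F _ _ (measurableTypeR R) 'rV[R]_n R mu
      (fun r => (pk r.1 (x - r.2) * V r.2 r.1)%:E)).
      apply: measurable_fun_EFin; apply: measurable_fun_mul.
        by apply: measurable_fun_poisson; meas.
      exact: (measurableT_comp mV (@measurable_swap _ _ (measurableTypeR R) 'rV[R]_n)).
    by move=> r; rewrite lee_fin; exact: mulr_ge0 (poisson_kernel_ge0 s0 _ _) (normr_ge0 _).
  - by move=> t _; apply: integral_ge0 => y _; rewrite lee_fin; exact: mulr_ge0 (poisson_kernel_ge0 s0 _ _) (normr_ge0 _).
rewrite integral_mkcond [leRHS]integral_mkcond; apply: le_nnintegral => t _.
  by rewrite patchE; case: ifP => // _; rewrite mule_ge0//; exact: integral_ge0.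
rewrite !patchE; case: ifPn => [/set_mem|_]; last first.
  case: ifP => // _; apply: mule_ge0 => //; apply: integral_ge0 => y _.
  by rewrite lee_fin; exact: mulr_ge0 (poisson_kernel_ge0 s0 _ _) (normr_ge0 _).
rewrite /= in_itv/= => tt; rewrite ifT; last first.
  by apply/mem_set; rewrite /= in_itv/= andbT; exact: tpos tt.
apply: lee_wpmul2l => //; apply: le_nnintegral => y _ //.
by rewrite lee_fin normrM (ger0_norm (poisson_kernel_ge0 s0 _ _)).
Qed.

(* [p_t * (p_t * b)] tends to [c^2 b] as t tends to 0 and to 0 as t tends to infinity. *)
Lemma poisson_representation x :
  ((c * c * `|b x|)%:E <= 2%:E * potential s (fun z t => `|conv b (qk t) z|%R) x)%E.
Proof.
have := increment_le ^~ x; rewrite -/V.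
have P0 : (0 <= 2%:E * potential s V x)%E.
  by apply: le_trans (increment_le 0%N x); rewrite lee_fin.
move: (2%:E * potential s V x)%E P0 => [r r0 H|_ _|//]; last by rewrite leey.
rewrite lee_fin.
have q1 : `|2 `^ (- e)| < 1 :> R.
  rewrite ger0_norm ?powR_ge0// powRN invf_lt1 ?powR_gt0//.
  by rewrite -[ltLHS](powRr0 2) /powR (gt_eqF (ltr0n _ 2))//= ltr_expR ltr_pM2r// ln_gt0// ltr1n.
(* The value at the small time minus the decay bound at the large time stays below r for every j,
   and the decay bound is geometric with ratio 2^(-e) < 1. *)
have l1 : `|Dt (scale j.+1) x| - c * (Cd * (2 `^ (- e)) ^+ j.+1) @[j --> \oo] --> c * c * `|b x|.
  have -> : c * c * `|b x| = `|c * (c * b x)| - c * (Cd * 0).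
    by rewrite !mulr0 subr0 !normrM (gtr0_norm c_gt0) mulrA.
  apply: cvgB; first by apply: cvg_norm; exact: Dt_cvg.
  apply: cvgMr; apply: cvgMr.
  by have := cvg_expr q1; rewrite -(cvg_shiftS (fun k => (2 `^ (- e)) ^+ k)).
move: l1 => /cvgr_to_le; apply; apply: nearW => j.
have Hj := H j; rewrite lee_fin in Hj; have far := Dt_far j x.
have tri : `|Dt (scale j.+1) x| <= `|Dt (T j) x - Dt (scale j.+1) x| + `|Dt (T j) x|.
  rewrite distrC; apply: le_trans (ler_normD _ _).
  by rewrite subrK.
have sub (A1 A2 A3 A4 r' : R) : A2 <= A1 + A3 -> A1 <= r' -> A3 <= A4 -> A2 - A4 <= r'.
  by move=> h1 h2 h3; rewrite lerBlDr; apply: le_trans h1 _; exact: lerD.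
exact: sub tri Hj far.
Qed.

End representation.

(** * From the mollifications to the function itself, real case *)

Section fatou_ae.
Context d (T : measurableType d) {R : realType}.
Variable mu : {measure set T -> \bar R}.

Lemma limn_einf_le (u : (\bar R)^nat) M : (forall k, u k <= M)%E -> (limn_einf u <= M)%E.
Proof.
move=> uM; rewrite limn_einf_lim; apply: lime_le; first exact: is_cvg_einfs.
apply: nearW => k; apply: le_trans (uM k).
by apply: ereal_inf_lbound; exists k => /=.
Qed.

Lemma fatou_ae (f_ : nat -> T -> R) (f : T -> R) (M : \bar R) :
  (forall k, measurable_fun setT (f_ k)) -> measurable_fun setT f ->
  (forall k x, 0 <= f_ k x) -> (forall x, 0 <= f x) ->
  {ae mu, forall x, f_ k x @[k --> \oo] --> f x} ->
  (forall k, \int[mu]_x (f_ k x)%:E <= M)%E -> (\int[mu]_x (f x)%:E <= M)%E.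
Proof.
move=> mf_ mf f_0 f0 cf fM.
have mE k : measurable_fun setT (fun x => (f_ k x)%:E) by have := mf_ k => ?; meas.
have F := @fatou _ T R mu setT measurableT (fun k x => (f_ k x)%:E) mE
  (fun k x _ => ltac:(by rewrite lee_fin) : (0 <= (f_ k x)%:E)%E).
apply: le_trans (le_trans F (limn_einf_le fM)).
apply: ae_ge0_le_integral => //.
- by move=> x _; rewrite lee_fin.
- by meas.
- move=> x _; rewrite limn_einf_lim; apply: lime_ge; first exact: is_cvg_einfs.
  by apply: nearW => k; apply: le_ereal_inf_tmp => _ [m _ <-]; rewrite lee_fin.
- have : measurable_fun setT (fun x => - limn_esup (fun k => - (f_ k x)%:E))%E.
    by apply: measurableT_comp => //; apply: measurable_fun_limn_esup => k; exact: measurableT_comp.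
  by congr measurable_fun; apply/funext => x; rewrite -limn_einfN; congr limn_einf; apply/funext => k /=; rewrite oppeK.
- apply: filterS cf => x cfx _.
  have cE : (f_ k x)%:E @[k --> \oo] --> (f x)%:E.
    by apply: cvg_EFin; [exact: nearW|exact: cfx].
  by have [-> _] := cvg_limn_einf_sup cE.
Qed.

End fatou_ae.

Lemma cvg_powR {R : realType} (u : nat -> R) (l p : R) : 0 < p -> (forall k, 0 <= u k) ->
  u k @[k --> \oo] --> l -> u k `^ p @[k --> \oo] --> l `^ p.
Proof.
move=> p0 u0 ul; have l0 : 0 <= l.
  by move: ul => /cvgr_to_ge; apply; exact: nearW.
have [lE|ln0] := eqVneq l 0; last first.
  have lp : 0 < l by rewrite lt_neqAle eq_sym ln0.
  have E : \forall k \near \oo, expR (p * ln (u k)) = u k `^ p.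
    move: ul => /cvgr_gt /(_ _ lp); apply: filterS => k uk.
    by rewrite /powR gt_eqF.
  rewrite {2}/powR gt_eqF//; apply: cvg_trans (near_eq_cvg E) _.
  apply: continuous_cvg; first exact: continuous_expR.
  apply: cvgMr; apply: continuous_cvg => //; exact: continuous_ln.
rewrite lE powR0 ?gt_eqF//; apply/cvgr0Pnorm_lt => e e0.
rewrite lE in ul; move/cvgr0Pnorm_lt : ul => /(_ _ (powR_gt0 p^-1 e0)).
apply: filterS => k; rewrite (ger0_norm (u0 k)) (ger0_norm (powR_ge0 _ _)) => uk.
have -> : e = (e `^ p^-1) `^ p by rewrite -powRrM mulVf ?gt_eqF// powRr1// ltW.
by apply: gt0_ltr_powR uk; rewrite ?nnegrE ?powR_ge0.
Qed.

Section slice_contraction.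
Context {R : realType} (n : nat) (g : 'rV[R]_n -> R) (L : R).
Notation mu := (@lebesgue_rV R n).
Hypotheses (mg : measurable_fun setT g) (g0 : forall z, 0 <= g z) (L0 : 0 < L)
  (gL : (\int[mu]_z (g z)%:E = L%:E)%E).

(** Young's inequality for a kernel of mass L: Cauchy-Schwarz for g(z) dz, then Tonelli and
    translation invariance. *)
Lemma slice_contraction (V V' : 'rV[R]_n -> R) :
  measurable_fun setT V -> (forall x, 0 <= V x) -> (forall x, 0 <= V' x) ->
  (forall x, ((V' x)%:E <= \int[mu]_z (g z * V (x - z)%R)%:E)%E) ->
  (\int[mu]_x (V' x ^+ 2)%:E <= (L * L)%:E * \int[mu]_x (V x ^+ 2)%:E)%E.
Proof.
move=> mV V0 V'0 V'V.
have cs x : (((V' x) ^+ 2)%:E <= L%:E * \int[mu]_z (g z * V (x - z) ^+ 2)%:E)%E.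
  apply: (@le_trans _ _ ((\int[mu]_z (g z * V (x - z)%R)%:E) * (\int[mu]_z (g z * V (x - z)%R)%:E))%E).
    by rewrite expr2 EFinM; apply: lee_pmul; rewrite ?lee_fin.
  have m1 : measurable_fun setT (fun z : 'rV[R]_n => Num.sqrt (g z)) by meas.
  have m2 : measurable_fun setT (fun z : 'rV[R]_n => (Num.sqrt (g z) * V (x - z))%:E).
    by meas.
  have m3 (z : 'rV[R]_n) : (0 <= (Num.sqrt (g z) * V (x - z))%:E)%E.
    by rewrite lee_fin mulr_ge0// sqrtr_ge0.
  have E1 z : ((Num.sqrt (g z))%:E * (Num.sqrt (g z) * V (x - z))%:E
      = (g z * V (x - z))%:E)%E.
    by rewrite -EFinM mulrA -expr2 sqr_sqrtr.
  have E2 z : ((Num.sqrt (g z) * V (x - z))%:E * (Num.sqrt (g z) * V (x - z))%:E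
      = (g z * V (x - z) ^+ 2)%:E)%E.
    by rewrite -EFinM mulrACA -expr2 sqr_sqrtr// -expr2.
  have E3 z : Num.sqrt (g z) ^+ 2 = g z by rewrite sqr_sqrtr.
  have h0 : (\int[mu]_z (Num.sqrt (g z) ^+ 2)%:E <= L%:E)%E.
    by under eq_integral do rewrite E3; rewrite gL.
  have := @weighted_cauchy_schwarz _ _ _ mu setT (fun z : 'rV[R]_n => Num.sqrt (g z))
    (fun z : 'rV[R]_n => (Num.sqrt (g z) * V (x - z))%:E) L measurableT m1 m2
    (fun z => sqrtr_ge0 _) m3 L0 h0.
  under [X in (X * _ <= _)%E -> _]eq_integral do rewrite E1.
  under [X in (_ * X <= _)%E -> _]eq_integral do rewrite E1.
  by under [X in (_ <= _ * X)%E -> _]eq_integral do rewrite E2.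
have L0' := ltW L0.
pose f (p : 'rV[R]_n * 'rV[R]_n) := (g p.2 * V (p.1 - p.2) ^+ 2)%:E.
have mf : measurable_fun setT f by rewrite /f; meas.
have f0 p : (0 <= f p)%E by rewrite lee_fin mulr_ge0 ?sqr_ge0.
apply: (@le_trans _ _ (\int[mu]_x (L%:E * \int[mu]_z f (x, z)))%E).
  by apply: le_nnintegral => x _; [rewrite lee_fin sqr_ge0|exact: cs].
rewrite ge0_integralZl_EFin//; last 2 first.
- by move=> x _; apply: integral_ge0.
- exact: (measurable_fun_fubini_tonelli_F f).
rewrite (EFinM L) -muleA; apply: lee_wpmul2l => //.
rewrite (fubini_tonelli f)//.
have inner z : (\int[mu]_x f (x, z) = (g z)%:E * \int[mu]_x (V x ^+ 2)%:E)%E.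
  rewrite /f/=; under eq_integral do rewrite EFinM.
  rewrite ge0_integralZl_EFin//; last 2 first.
  - by move=> x _; rewrite lee_fin sqr_ge0.
  - by meas.
  by congr (_ * _)%E; rewrite (@lebesgue_rV_translate _ _ (fun x => (V x ^+ 2)%:E))//;
    [meas|move=> x; rewrite lee_fin sqr_ge0].
under eq_integral do rewrite inner.
rewrite ge0_integralZr//; first by rewrite gL.
- by meas.
- by move=> z _; rewrite lee_fin.
- by apply: integral_ge0 => x _; rewrite lee_fin sqr_ge0.
Qed.

End slice_contraction.

Section real_inequalities.
Context {R : realType} (n : nat) (s beta : R).
Hypotheses (s0 : 0 < s) (b0 : 0 < beta) (bn : beta < n%:R) (b4 : beta <= 4).
Notation mu := (@lebesgue_rV R n).
Notation lam := (@lebesgue_measure R).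
Notation pk := (@poisson_kernel R n s).
Notation qk := (@poisson_dt R n s).
Notation c := (poisson_total n s).
Notation Lm := (@mollifier_mass R n).

(** The almost everywhere limit of c^2/2 |A_k| is K |a|: c^2/2 comes from the representation
    formula, the last factor from the mass of the mollifier. *)
Let K : R := c * c / 2 * Lm.
Let c_gt0 : 0 < c := poisson_total_gt0 n s0.
Let Lm0 : 0 < Lm := mollifier_mass_gt0.
Let K0 : 0 < K. Proof. by rewrite /K mulr_gt0// divr_gt0// mulr_gt0. Qed.

Let p : R := 2 * n%:R / (n%:R - beta).
Let gm : R := 1 - beta / n%:R.
Let n_gt0 : 0 < n%:R :> R := lt_trans b0 bn.
Let p0 : 0 < p. Proof. by rewrite divr_gt0 ?mulr_gt0// subr_gt0. Qed.
Let gm0 : 0 < gm. Proof. by rewrite subr_gt0 ltr_pdivrMr// mul1r. Qed.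

Definition real_sobolev_cst : R :=
  (K `^ (p * gm))^-1 * (sobolev_cst n s beta * (Lm * Lm)).
Definition real_hardy_cst : R :=
  (K ^+ 2)^-1 * (hardy_cst n s beta * (Lm * Lm)).

Lemma real_sobolev_cst_gt0 : 0 < real_sobolev_cst.
Proof.
have h := sobolev_cst_gt0 s0 b0 bn; rewrite /real_sobolev_cst.
move: (sobolev_cst _ _ _) h => S h.
by rewrite mulr_gt0 ?invr_gt0 ?powR_gt0// !mulr_gt0.
Qed.

Lemma real_hardy_cst_gt0 : 0 < real_hardy_cst.
Proof.
have h := hardy_cst_gt0 s0 b0 bn; rewrite /real_hardy_cst.
move: (hardy_cst _ _ _) h => S h.
by rewrite mulr_gt0 ?invr_gt0 ?exprn_gt0// !mulr_gt0.
Qed.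

Section function.
Variables (a g1 g2 r : 'rV[R]_n -> R) (N : nat) (Q : R).
Hypotheses (ma : measurable_fun setT a)
  (aN : (\int[mu]_x (`|a x| / (1 + enorm x) ^+ N)%:E < +oo)%E)
  (mg1 : measurable_fun setT g1) (mg2 : measurable_fun setT g2)
  (mr : measurable_fun setT r)
  (g1r : forall xi, `|g1 xi| <= r xi) (g2r : forall xi, `|g2 xi| <= r xi)
  (rN : (\int[mu]_xi (r xi / (1 + enorm xi) ^+ N)%:E < +oo)%E)
  (rQ : (\int[mu]_xi (enorm xi `^ beta * r xi ^+ 2)%:E <= Q%:E)%E)
  (aE : forall tau x, 0 < tau -> mollify a tau x = fourier_gauss g1 g2 tau x).

Let limit : {ae mu, forall x, mollify a (scale k ^+ 2) x @[k --> \oo] --> Lm * a x}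
  /\ (\int[mu]_x (`|a x| * pk 1 x)%:E < +oo)%E.
Proof.
have [C WC] := gauss_le_poisson1 n s0.
have wm x : pk 1 x <= @poisson_cst R n s.
  by have := poisson_kernel_le s0 x ltr01; rewrite powR1 mulr1.
have wt : (\int[mu]_x (pk 1 x)%:E <= c%:E)%E by rewrite (integral_poisson n s0 ltr01).
exact: (mollify_ae_cvg (@measurable_pk R n s 1) (poisson1_gt0 s0) wm wt WC
  ma aN mg1 mg2 mr g1r g2r rN rQ b0 b4 aE).
Qed.

Lemma integrable_poisson1 : (\int[mu]_x (`|a x| * pk 1 x)%:E < +oo)%E.
Proof. by have [_ ] := limit. Qed.

Let t0 k : 0 < scale k ^+ 2 :> R. Proof. by rewrite exprn_gt0// scale_gt0. Qed.

Let Ak k : 'rV[R]_n -> R := mollify a (scale k ^+ 2).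

Let AkE k : Ak k = fourier_gauss g1 g2 (scale k ^+ 2).
Proof. by apply/funext => x; exact: aE. Qed.

Let mAk k : measurable_fun setT (Ak k).
Proof. by rewrite AkE; exact: (measurable_fourier_gauss mg1 mg2 mr g1r g2r rN). Qed.

Let e : R := (n%:R - beta) / 2.
Let e0 : 0 < e. Proof. by rewrite divr_gt0// subr_gt0. Qed.

(** The pairing bound with h = p_M(x - .), so m = c0 M^(-n) and L = c. The choices rho = 1/M, th =
    M^(-n/2) and th' = M^(-e), with e = (n - beta)/2, make every term a multiple of M^(-e). *)
Let decay k : exists Cd, forall M x, 0 < M ->
  `|\int[mu]_z (pk M (x - z) * Ak k z)| <= Cd * M `^ (- e).
Proof.
pose Cb : R := beta * 2 ^+ n * ((n%:R - beta)^-1 + beta^-1).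
exists ((c + 2^-1) * Q + Lm * @poisson_cst R n s * c + c * Cb) => M x M0.
have mh : measurable_fun setT (fun z : 'rV[R]_n => pk M (x - z)).
  by have := @measurable_pk R n s M; move: (pk M) => q mq; meas.
have hm z : `|pk M (x - z)| <= @poisson_cst R n s * M `^ (- n%:R).
  by rewrite ger0_norm ?poisson_kernel_ge0//; exact: poisson_kernel_le.
have hL : (\int[mu]_z (`|pk M (x - z)|)%:E <= c%:E)%E.
  rewrite -(integral_poisson_shift s0 x M0); apply: le_nnintegral => z _ //.
  by rewrite lee_fin ger0_norm//; exact: poisson_kernel_ge0.
have := fourier_gauss_pairing_decay mg1 mg2 mr g1r g2r rN rQ b0 mh hm hL bn (t0 k)
  (powR_gt0 (- 1) M0) (powR_gt0 (- (n%:R / 2)) M0) (powR_gt0 (- e) M0).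
rewrite -AkE; move: (\int[mu]_z _) => I; move: (@poisson_cst R n s) (poisson_total n s) (@mollifier_mass R n) => c0 c' L'.
move=> /le_trans; apply; rewrite -/Cb -!powRrM le_eqVlt; apply/orP; left; apply/eqP.
have Mn : M != 0 by rewrite gt_eqF.
have PD u v : M `^ u * M `^ v = M `^ (u + v) by rewrite powRD// Mn implybT.
have PV u : (M `^ u)^-1 = M `^ (- u) by rewrite powRN.
rewrite !PV !opprK.
have h1 : M `^ (-1 * - (beta / 2)) * M `^ (- (n%:R / 2)) = M `^ (- e).
  by rewrite PD; congr (_ `^ _); rewrite /e; field.
have h2 : M `^ (-1 * - (beta / 2)) * M `^ (n%:R / 2) * M `^ (- n%:R) = M `^ (- e).
  by rewrite !PD; congr (_ `^ _); rewrite /e; field.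
have h3 : M `^ e * M `^ (-1 * (n%:R - beta)) = M `^ (- e).
  by rewrite PD; congr (_ `^ _); rewrite /e; field.
transitivity (c' * M `^ (- e) * Q + (M `^ (-1 * - (beta / 2)) * M `^ (- (n%:R / 2))) / 2 * Q +
  (M `^ (-1 * - (beta / 2)) * M `^ (n%:R / 2) * M `^ (- n%:R)) * (L' * c0 * c') +
  c' * Cb * (M `^ e * M `^ (-1 * (n%:R - beta)))); first by ring.
by rewrite h1 h2 h3; ring.
Qed.

Let va (x : 'rV[R]_n) (t : R) : R := `|conv a (qk t) x|.
Let vk k (x : 'rV[R]_n) (t : R) : R := `|conv (Ak k) (qk t) x|.

Let mva : measurable_fun setT (fun z : 'rV[R]_n * R => va z.1 z.2).
Proof. by apply: measurable_fun_normr; exact: (@measurable_fun_conv_qk R n s a ma). Qed.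
Let mvk k : measurable_fun setT (fun z : 'rV[R]_n * R => vk k z.1 z.2).
Proof. by apply: measurable_fun_normr; exact: (@measurable_fun_conv_qk R n s _ (mAk k)). Qed.

Let represent k x : ((c * c / 2 * `|Ak k x|)%:E <= potential s (vk k) x)%E.
Proof.
have [B hB] := fourier_gauss_bounded mg1 mg2 mr g1r g2r rN (t0 k).
have cA : ray_continuous (Ak k).
  by rewrite AkE; exact: (fourier_gauss_ray_continuous mg1 mg2 mr g1r g2r rN (t0 k)).
have [Cd dec] := decay k.
have bA y : `|Ak k y| <= B by rewrite AkE.
have := poisson_representation s0 (mAk k) bA cA e0 dec x; rewrite -/(vk k).
case: (potential s (vk k) x) => [y| |]; [|by rewrite leey|by rewrite gt0_muleNy ?lte_fin].
rewrite -EFinM !lee_fin; move: (c * c) `|_| => u v; lra.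
Qed.

(** Slice by slice in t: q_t * A_k is the mollification of q_t * a, and averaging costs at most the
    square of the mollifier mass in L^2. *)
Let energy_le k : (weighted_energy beta (vk k) <= (Lm * Lm)%:E * weighted_energy beta va)%E.
Proof.
have mslice : measurable_fun setT (slice_energy va : measurableTypeR R -> \bar R).
  apply: (@measurable_fun_fubini_tonelli_F _ _ (measurableTypeR R) 'rV[R]_n R mu
    (fun q => (va q.2 q.1 ^+ 2)%:E)).
    apply: measurable_fun_EFin; apply: measurable_funX.
    exact: (measurableT_comp mva (@measurable_swap _ _ (measurableTypeR R) 'rV[R]_n)).
  by move=> q; rewrite lee_fin sqr_ge0.
have s_ge0 t : (0 <= slice_energy va t)%E.
  by apply: integral_ge0 => y _; rewrite lee_fin sqr_ge0.
have -> : ((Lm * Lm)%:E * weighted_energy beta va =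
    \int[lam]_(t in `]0%R, +oo[) ((Lm * Lm)%:E * ((t `^ (1 - beta))%:E * slice_energy va t)))%E.
  rewrite /weighted_energy ge0_integralZl_EFin//.
  - by move=> t _; rewrite mule_ge0// lee_fin powR_ge0.
  - by apply: measurable_funTS; apply: measurable_fun_mule => //; meas.
  - by rewrite mulr_ge0// ltW.
rewrite /weighted_energy.
rewrite integral_mkcond [leRHS]integral_mkcond; apply: le_nnintegral => t _.
  rewrite patchE; case: ifP => // _; rewrite mule_ge0 ?lee_fin ?powR_ge0//.
  by apply: integral_ge0 => y _; rewrite lee_fin sqr_ge0.
rewrite !patchE; case: ifPn => // /set_mem; rewrite /= in_itv/= andbT => tp.
rewrite muleCA; apply: lee_wpmul2l; first by rewrite lee_fin powR_ge0.
have [D HD] := poisson_like_bounds n s0 tp (lexx t).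
have [_ Dq] := HD t (ltac:(by rewrite lexx) : t <= t <= t).
apply: (slice_contraction (g := mollifier (scale k ^+ 2))) => //.
- by apply: measurable_fun_mollifier; exact: measurable_id.
- by move=> z; exact: mollifier_ge0.
- exact: integral_mollifier0.
- by apply: measurable_fun_normr; exact: (measurable_fun_conv ma (@measurable_qk R n s t)).
- by move=> x; exact: normr_ge0.
- by move=> x; exact: normr_ge0.
- move=> x; exact: (conv_mollify_le s0 ma integrable_poisson1 (t0 k) aN x (@measurable_qk R n s t) Dq).
Qed.

Let Ecase (X : \bar R) (C : R) : 0 < C ->
  (forall y : R, weighted_energy beta va = y%:E -> (X <= (C * y)%:E)%E) ->
  (X <= C%:E * weighted_energy beta va)%E.
Proof.
move=> C0 H; have : (0 <= weighted_energy beta va)%E.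
  apply: integral_ge0 => t _; rewrite mule_ge0 ?lee_fin ?powR_ge0//.
  by apply: integral_ge0 => y _; rewrite lee_fin sqr_ge0.
case: (weighted_energy beta va) H => [y|_ _|//].
  by move=> H _; rewrite -EFinM; exact: H.
by rewrite gt0_muley ?lte_fin// leey.
Qed.

Let cvgK x : Ak k x @[k --> \oo] --> Lm * a x ->
  c * c / 2 * `|Ak k x| @[k --> \oo] --> K * `|a x|.
Proof.
move=> cx; have -> : K * `|a x| = c * c / 2 * `|Lm * a x|.
  by rewrite normrM (gtr0_norm Lm0) mulrA.
by apply: cvgMr; exact: cvg_norm.
Qed.

Let kc0 : 0 <= c * c / 2. Proof. by rewrite divr_ge0// mulr_ge0// ltW. Qed.

(** The bounds for A_k are uniform in k. The outer power is undone to reach an integral, Fatou's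
    lemma passes to the limit, and the power is applied again. *)
Lemma real_sobolev :
  ((\int[mu]_x (`|a x| `^ p)%:E) `^ gm <= real_sobolev_cst%:E * weighted_energy beta va)%E.
Proof.
apply: Ecase => [|y yE]; first exact: real_sobolev_cst_gt0.
pose S : R := sobolev_cst n s beta * (Lm * Lm) * y.
have S0' := sobolev_cst_gt0 s0 b0 bn.
have y0 : 0 <= y.
  rewrite -lee_fin -yE; apply: integral_ge0 => t _; rewrite mule_ge0 ?lee_fin ?powR_ge0//.
  by apply: integral_ge0 => z _; rewrite lee_fin sqr_ge0.
have S0 : 0 <= S.
  by rewrite /S; move: (sobolev_cst _ _ _) S0' => T T0; rewrite !mulr_ge0// ltW.
have le_k k : (\int[mu]_x (((c * c / 2 * `|Ak k x|) `^ p)%:E) <= (S `^ gm^-1)%:E)%E.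
  have : ((\int[mu]_x (((c * c / 2 * `|Ak k x|) `^ p)%:E)) `^ gm <= S%:E)%E.
    have := potential_sobolev s0 b0 bn (mvk k) (fun x t => normr_ge0 _).
    rewrite -/p -/gm => H; apply: (@le_trans _ _ ((sobolev_cst n s beta)%:E * weighted_energy beta (vk k))%E).
      apply: le_trans H; apply: gt0_ler_poweR; rewrite ?(ltW gm0)//.
      - by rewrite in_itv/= leey andbT; apply: integral_ge0 => x _; rewrite lee_fin powR_ge0.
      - by rewrite in_itv/= leey andbT; apply: integral_ge0 => x _; exact: poweR_ge0.
      - apply: le_nnintegral => x _; first by rewrite lee_fin powR_ge0.
        rewrite -poweR_EFin; apply: gt0_ler_poweR; rewrite ?(ltW p0)//.
        + by rewrite in_itv/= leey andbT lee_fin mulr_ge0.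
        + rewrite in_itv/= leey andbT; apply: le_trans (represent k x); by rewrite lee_fin mulr_ge0.
    rewrite /S -mulrA EFinM; apply: lee_wpmul2l; first by rewrite lee_fin ltW.
    by apply: le_trans (energy_le k) _; rewrite yE -EFinM.
  set X := (\int[mu]_x _)%E; have X0 : (0 <= X)%E by apply: integral_ge0 => x _; rewrite lee_fin powR_ge0.
  move=> H; have -> : X = ((X `^ gm) `^ gm^-1)%E.
    by rewrite -poweRrM mulfV ?gt_eqF// poweRe1.
  rewrite -poweR_EFin; apply: gt0_ler_poweR => //; rewrite ?invr_ge0 ?(ltW gm0)//.
  - by rewrite in_itv/= leey andbT poweR_ge0.
  - by rewrite in_itv/= leey andbT lee_fin.
have [ae_cvg _] := limit.
have lim : (\int[mu]_x (((K * `|a x|) `^ p)%:E) <= (S `^ gm^-1)%:E)%E.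
  apply: (fatou_ae (f_ := fun k x => (c * c / 2 * `|Ak k x|) `^ p)) => //.
  - by move=> k; have := mAk k; move: (Ak k) => A mA; meas.
  - by meas.
  - by move=> k x; exact: powR_ge0.
  - by move=> x; exact: powR_ge0.
  - apply: filterS ae_cvg => x cx; apply: (cvg_powR p0 _ (cvgK cx)) => k.
    exact: mulr_ge0.
have KE : (\int[mu]_x (((K * `|a x|) `^ p)%:E) = (K `^ p)%:E * \int[mu]_x (`|a x| `^ p)%:E)%E.
  rewrite -ge0_integralZl_EFin ?powR_ge0//; last by meas.
  by apply: eq_integral => x _; rewrite powRM ?(ltW K0)// EFinM.
move: lim; rewrite KE; set X := (\int[mu]_x _)%E => lim.
have X0 : (0 <= X)%E by apply: integral_ge0 => x _; rewrite lee_fin powR_ge0.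
case: X X0 lim => [z|_|//]; last by rewrite gt0_muley ?lte_fin ?powR_gt0.
rewrite lee_fin -EFinM lee_fin poweR_EFin lee_fin => z0 zS.
rewrite /real_sobolev_cst -mulrA -/S.
rewrite ler_pdivlMl ?powR_gt0//.
rewrite powRrM -powRM ?powR_ge0//.
have -> : S = (S `^ gm^-1) `^ gm by rewrite -powRrM mulVf ?gt_eqF// powRr1.
apply: ge0_ler_powR; rewrite ?nnegrE ?mulr_ge0 ?powR_ge0 ?(ltW gm0)//.
Qed.

Lemma real_hardy :
  (\int[mu]_x (enorm x `^ (- beta) * `|a x| ^+ 2)%:E <=
   real_hardy_cst%:E * weighted_energy beta va)%E.
Proof.
apply: Ecase => [|y yE]; first exact: real_hardy_cst_gt0.
have H0 := hardy_cst_gt0 s0 b0 bn.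
pose S : R := hardy_cst n s beta * (Lm * Lm) * y.
have le_k k : (\int[mu]_x (enorm x `^ (- beta) * (c * c / 2 * `|Ak k x|) ^+ 2)%:E <= S%:E)%E.
  have := potential_hardy s0 b0 bn (mvk k) (fun x t => normr_ge0 _).
  move=> H; apply: (@le_trans _ _ ((hardy_cst n s beta)%:E * weighted_energy beta (vk k))%E).
    apply: le_trans H; apply: le_nnintegral => x _.
      by rewrite lee_fin mulr_ge0 ?powR_ge0 ?sqr_ge0.
    rewrite EFinM; apply: lee_wpmul2l; first by rewrite lee_fin powR_ge0.
    by rewrite expr2 EFinM; apply: lee_pmul; rewrite ?represent// lee_fin mulr_ge0.
  rewrite /S -mulrA (EFinM (hardy_cst n s beta)); apply: lee_wpmul2l; first by rewrite lee_fin ltW.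
  by apply: le_trans (energy_le k) _; rewrite yE -EFinM.
have [ae_cvg _] := limit.
have lim : (\int[mu]_x (enorm x `^ (- beta) * (K * `|a x|) ^+ 2)%:E <= S%:E)%E.
  apply: (fatou_ae (f_ := fun k x => enorm x `^ (- beta) * (c * c / 2 * `|Ak k x|) ^+ 2)) => //.
  - by move=> k; have := mAk k; move: (Ak k) => A mA; meas.
  - by meas.
  - by move=> k x; rewrite mulr_ge0 ?powR_ge0 ?sqr_ge0.
  - by move=> x; rewrite mulr_ge0 ?powR_ge0 ?sqr_ge0.
  - by apply: filterS ae_cvg => x cx; apply: cvgMr; apply: cvgM; exact: cvgK.
have KE : (\int[mu]_x (enorm x `^ (- beta) * (K * `|a x|) ^+ 2)%:E =
    (K ^+ 2)%:E * \int[mu]_x (enorm x `^ (- beta) * `|a x| ^+ 2)%:E)%E.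
  rewrite -ge0_integralZl_EFin ?sqr_ge0//;
    try by [meas | move=> x _; rewrite lee_fin mulr_ge0 ?powR_ge0 ?sqr_ge0].
  by apply: eq_integral => x _; rewrite -EFinM exprMn mulrCA.
move: lim; rewrite KE; set X := (\int[mu]_x _)%E => lim.
have X0 : (0 <= X)%E.
  by apply: integral_ge0 => x _; rewrite lee_fin mulr_ge0 ?powR_ge0 ?sqr_ge0.
case: X X0 lim => [z|_|//]; last by rewrite gt0_muley ?lte_fin ?exprn_gt0.
rewrite lee_fin -EFinM !lee_fin => z0 zS.
by rewrite /real_hardy_cst -mulrA -/S ler_pdivlMl// exprn_gt0.
Qed.

End function.
End real_inequalities.

(** * From the distributional Fourier transform to mollification *)

Section fourier_relation.
Context {R : realType} {n : nat}.
Notation mu := (@lebesgue_rV R n).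
Local Notation re f := (fun x => complex.Re (f x)).
Local Notation im f := (fun x => complex.Im (f x)).

Lemma fourier_modulated_gauss tau (x y : 'rV[R]_n) : 0 < tau ->
  fourier (fun xi => Complex (cos (dotp x xi) * gauss_rV tau xi)
                             (sin (dotp x xi) * gauss_rV tau xi)) y =
  Complex (mollifier tau (x - y)) 0.
Proof.
move=> t0; rewrite /fourier /Cintegral -(cos_gauss_mollifier (x - y) t0) -(sin_gauss_rV (x - y) t0).
congr Complex; apply: eq_Rintegral => xi _.
- by rewrite /cexpi /= dotpBl cosB (dotpC xi) cosN sinN; ring.
- by rewrite /cexpi /= dotpBl sinB (dotpC xi) cosN sinN; ring.
Qed.

(** The distributional identity is tested against xi -> exp(i x.xi - tau |xi|^2), whose transform is
    the mollifier centred at x. Real and imaginary parts of the identity give the two equations. *)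
Lemma mollify_fourier (f g : 'rV[R]_n -> R[i]) tau x : is_fourier_transform f g -> 0 < tau ->
  mollify (re f) tau x = fourier_gauss (re g) (fun xi => - complex.Im (g xi)) tau x /\
  mollify (im f) tau x = fourier_gauss (im g) (re g) tau x.
Proof.
move=> fg t0.
have sch : cschwartz (fun xi => Complex (cos (dotp x xi) * gauss_rV tau xi)
                             (sin (dotp x xi) * gauss_rV tau xi)).
  by split; apply: (mod_gauss_schwartz (z := x) t0); [exact: mg_cos|exact: mg_sin].
have := fg _ sch; rewrite /Cintegral.
under eq_Rintegral do rewrite (fourier_modulated_gauss _ _ t0).
under [X in Complex _ X = _]eq_Rintegral do rewrite (fourier_modulated_gauss _ _ t0).
case=> h1 h2; split.
- transitivity (\int[mu]_y complex.Re (f y * Complex (mollifier tau (x - y)) 0)).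
    by apply: eq_Rintegral => y _; case: (f y) => u v /=; ring.
  by rewrite h1; apply: eq_Rintegral => xi _; case: (g xi) => u v /=; ring.
- transitivity (\int[mu]_y complex.Im (f y * Complex (mollifier tau (x - y)) 0)).
    by apply: eq_Rintegral => y _; case: (f y) => u v /=; ring.
  by rewrite h2; apply: eq_Rintegral => xi _; case: (g xi) => u v /=; ring.
Qed.

Lemma normc_ge_re (z : R[i]) : `|complex.Re z| <= normc z.
Proof.
by case: z => u v; rewrite /= -sqrtr_sqr; apply: ler_wsqrtr; rewrite lerDl sqr_ge0.
Qed.

Lemma normc_ge_im (z : R[i]) : `|complex.Im z| <= normc z.
Proof.
by case: z => u v; rewrite /= -sqrtr_sqr; apply: ler_wsqrtr; rewrite lerDr sqr_ge0.
Qed.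

Lemma normc_nneg (z : R[i]) : 0 <= normc z.
Proof. by case: z => u v; exact: sqrtr_ge0. Qed.

Lemma normc_sqr (z : R[i]) : normc z ^+ 2 = `|complex.Re z| ^+ 2 + `|complex.Im z| ^+ 2.
Proof.
by case: z => u v; rewrite /= sqr_sqrtr ?addr_ge0 ?sqr_ge0// !real_normK ?num_real.
Qed.

Lemma normc_le (z : R[i]) : normc z <= `|complex.Re z| + `|complex.Im z|.
Proof.
rewrite -(ler_pXn2r (n := 2))// ?nnegrE ?normc_nneg ?addr_ge0//.
by rewrite normc_sqr sqrrD -addrA lerD2l lerDr mulrn_wge0// mulr_ge0.
Qed.

Lemma measurable_fun_normc d (T : measurableType d) (f : T -> R[i]) :
  measurable_fun setT (re f) -> measurable_fun setT (im f) ->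
  measurable_fun setT (fun x => normc (f x)).
Proof.
move=> mr mi; rewrite (_ : (fun x => normc (f x)) =
  (fun x => Num.sqrt (complex.Re (f x) ^+ 2 + complex.Im (f x) ^+ 2))); first by meas.
by apply/funext => x; case: (f x).
Qed.

Lemma tempered_weight_le (N M : nat) (h k : 'rV[R]_n -> R) : (N <= M)%N ->
  (forall x, `|h x| <= k x) ->
  (\int[mu]_x (k x / (1 + enorm x) ^+ N)%:E < +oo)%E ->
  (\int[mu]_x (`|h x| / (1 + enorm x) ^+ M)%:E < +oo)%E.
Proof.
move=> NM hk; apply: le_lt_trans; apply: le_nnintegral => x _.
  by rewrite lee_fin divr_ge0// exprn_ge0// addr_ge0// enorm_ge0.
have p0 K : 0 < (1 + enorm x) ^+ K by rewrite exprn_gt0// ltr_pwDl// enorm_ge0.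
rewrite lee_fin; apply: ler_pM => //; first by rewrite invr_ge0 ltW.
by rewrite lef_pV2 ?posrE// ler_weXn2l// lerDl enorm_ge0.
Qed.

End fourier_relation.

(** * Entropy bound from an L^p norm *)

Section jensen.
Context d (T : measurableType d) {R : realType}.
Variable mu : {measure set T -> \bar R}.
Variables (F : T -> R) (k A p : R).
Hypotheses (mF : measurable_fun setT F) (F0 : forall x, 0 <= F x) (k0 : 0 < k) (A0 : 0 < A)
  (pE : p = 2 + 2 * k)
  (F2 : (\int[mu]_x (F x ^+ 2)%:E = 1)%E) (FA : (\int[mu]_x (F x `^ p)%:E = A%:E)%E).

(** A majorant of the entropy density. Since F^2 has integral 1 and F^p has integral A, the terms 1
    and -1 cancel and it integrates to ln(A) / k. *)
Let H x : R := k^-1 * (A^-1 * F x `^ p + (ln A - 1) * F x ^+ 2).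

Let entropy_le x : F x ^+ 2 * ln (F x ^+ 2) <= H x.
Proof.
have p0 : p != 0 by rewrite gt_eqF// pE addr_gt0// mulr_gt0.
rewrite /H; have [->|fn0] := eqVneq (F x) 0.
  by rewrite expr0n/= mul0r powR0// !mulr0 addr0 mulr0.
have f0 : 0 < F x by rewrite lt_neqAle eq_sym fn0 F0.
have -> : F x `^ p = F x ^+ 2 * F x `^ (2 * k).
  by rewrite pE powRD ?fn0 ?implybT// -powR_mulrn.
rewrite lnXn// -(ler_pM2l k0) [leRHS]mulrA mulfV ?gt_eqF// mul1r.
have y0 : 0 < F x `^ (2 * k) by exact: powR_gt0.
have : ln (F x `^ (2 * k) / A) <= F x `^ (2 * k) / A - 1.
  have := @le_ln1Dx R (F x `^ (2 * k) / A - 1).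
  by rewrite addrCA subrr addr0; apply; rewrite ltrBrDl subrr divr_gt0.
rewrite ln_div ?posrE// ln_powR.
have f2 : 0 <= F x ^+ 2 by rewrite sqr_ge0.
move=> /(ler_wpM2l f2); move: (F x ^+ 2) (ln (F x)) (_ `^ _) (ln A) => u l y L.
rewrite mulr2n; move: (A^-1) => A'; lra.
Qed.

Let Hi : mu.-integrable setT (EFin \o H) /\ \int[mu]_x H x = k^-1 * ln A.
Proof.
have i1 : mu.-integrable setT (EFin \o (fun x => F x `^ p)).
  apply: (integrable_bounded_by (g := fun x => F x `^ p)); first by meas.
    by move=> x; rewrite ger0_norm// powR_ge0.
  by rewrite FA ltry.
have i2 : mu.-integrable setT (EFin \o (fun x => F x ^+ 2)).
  apply: (integrable_bounded_by (g := fun x => F x ^+ 2)); first by meas.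
    by move=> x; rewrite ger0_norm// sqr_ge0.
  by rewrite F2 ltry.
have j1 := @integrableZl _ _ _ mu _ measurableT A^-1 _ i1.
have j2 := @integrableZl _ _ _ mu _ measurableT (ln A - 1) _ i2.
have j3 := @integrableD _ _ _ mu _ measurableT _ _ j1 j2.
split; first exact: (@integrableZl _ _ _ mu _ measurableT k^-1 _ j3).
rewrite /H RintegralZl// RintegralD// !RintegralZl//.
rewrite {1 2}/Rintegral FA F2/= mulVf ?gt_eqF// mulr1.
by congr (_ * _); ring.
Qed.

(* Integrates [ln y <= y / A - 1 + ln A] at [y = F^(2k)] against [F^2]; the entropy
   integral may be [-oo], in which case the exponential is 0. *)
Lemma entropy_jensen (b : R) : 0 < b ->
  (expeR (b%:E * \int[mu]_x (F x ^+ 2 * ln (F x ^+ 2))%:E) <= (A `^ (b / k))%:E)%E.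
Proof.
move=> b_gt0; have [Hi1 HiE] := Hi.
pose E x := F x ^+ 2 * ln (F x ^+ 2).
have mE : measurable_fun setT (EFin \o E) by rewrite /E; meas.
have mp : measurable_fun setT ((EFin \o E)^\+)%E by exact: measurable_funepos.
have mn : measurable_fun setT ((EFin \o E)^\-)%E by exact: measurable_funeneg.
have Ep : (\int[mu]_x ((EFin \o E)^\+ x) < +oo)%E.
  apply: le_lt_trans (integrable_normr_lty Hi1); apply: le_nnintegral => x _.
    exact: funepos_ge0.
  rewrite funeposE /= -EFin_max lee_fin ge_max normr_ge0 andbT.
  exact: le_trans (entropy_le x) (ler_norm _).
have [En|En] := ltP (\int[mu]_x ((EFin \o E)^\- x))%E +oo%E; last first.
  rewrite integralE; rewrite leye_eq in En; rewrite (eqP En).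
  have : (\int[mu]_x ((EFin \o E)^\+ x) \is a fin_num)%E.
    by rewrite ge0_fin_numE//; apply: integral_ge0 => x _; exact: funepos_ge0.
  case: (\int[mu]_x ((EFin \o E)^\+ x))%E => // y _ /=.
  by rewrite gt0_muleNy ?lte_fin//= lee_fin powR_ge0.
have Ei : mu.-integrable setT (EFin \o E).
  apply/integrableP; split => //.
  have aE x : (`|(EFin \o E) x| = (EFin \o E)^\+ x + (EFin \o E)^\- x)%E.
    by rewrite -[LHS]/((abse \o (EFin \o E)) x) fune_abse.
  under eq_integral do rewrite aE.
  by rewrite ge0_integralD//; exact: lte_add_pinfty.
have le1 : \int[mu]_x E x <= k^-1 * ln A.
  by rewrite -HiE; apply: le_Rintegral => // x _; exact: entropy_le.
rewrite -(EFin_Rintegral Ei) -EFinM /= lee_fin /powR gt_eqF// ler_expR.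
by apply: le_trans (ler_wpM2l (ltW b_gt0) le1) _; rewrite mulrA.
Qed.

End jensen.

(** * Energy of the extension in terms of real and imaginary parts *)

Section energy.
Context {R : realType} (n : nat) (s beta : R) (s0 : 0 < s).
Notation mu := (@lebesgue_rV R n).
Notation lam := (@lebesgue_measure R).
Notation pk := (@poisson_kernel R n s).
Notation qk := (@poisson_dt R n s).
Variable f : 'rV[R]_n -> R[i].
Let a x : R := complex.Re (f x).
Let b x : R := complex.Im (f x).
Hypotheses (ma : measurable_fun setT a) (mb : measurable_fun setT b)
  (aw : (\int[mu]_y (`|a y| * pk 1 y)%:E < +oo)%E)
  (bw : (\int[mu]_y (`|b y| * pk 1 y)%:E < +oo)%E).

Let va (x : 'rV[R]_n) (t : R) : R := `|conv a (qk t) x|.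
Let vb (x : 'rV[R]_n) (t : R) : R := `|conv b (qk t) x|.

Let dtE x t : 0 < t ->
  normc (dt_cs_extension s f x t) ^+ 2 = va x t ^+ 2 + vb x t ^+ 2.
Proof.
move=> t0; rewrite normc_sqr /=.
have reE : (fun r : R => complex.Re (cs_extension s f x r)) = (fun r => conv a (pk r) x).
  apply/funext => r; apply: eq_Rintegral => y _.
  by rewrite /a; case: (f y) => u v /=; ring.
have imE : (fun r : R => complex.Im (cs_extension s f x r)) = (fun r => conv b (pk r) x).
  apply/funext => r; apply: eq_Rintegral => y _.
  by rewrite /b; case: (f y) => u v /=; ring.
rewrite reE imE !derive1E.
have [_ ->] := is_derive_poisson_conv s0 ma aw x t0.
by have [_ ->] := is_derive_poisson_conv s0 mb bw x t0.
Qed.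

(** The kernel is real, so the extension acts on the parts separately and |du/dt|^2 is the sum of
    their squares; for t > 0 integrability against p_1 allows differentiation under the integral. *)
Lemma extension_energyE :
  (extension_energy s beta f = weighted_energy beta va + weighted_energy beta vb)%E.
Proof.
have mva : measurable_fun setT (fun z : 'rV[R]_n * measurableTypeR R => va z.1 z.2).
  by apply: measurable_fun_normr; exact: (@measurable_fun_conv_qk R n s a ma).
have mvb : measurable_fun setT (fun z : 'rV[R]_n * measurableTypeR R => vb z.1 z.2).
  by apply: measurable_fun_normr; exact: (@measurable_fun_conv_qk R n s b mb).
have mswap (v : 'rV[R]_n -> R -> R) :
    measurable_fun setT (fun z : 'rV[R]_n * measurableTypeR R => v z.1 z.2) ->
    measurable_fun setT (slice_energy v : measurableTypeR R -> \bar R).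
  move=> mv; apply: (@measurable_fun_fubini_tonelli_F _ _ (measurableTypeR R) 'rV[R]_n R mu
    (fun q => (v q.2 q.1 ^+ 2)%:E)).
    apply: measurable_fun_EFin; apply: measurable_funX.
    exact: (measurableT_comp mv (@measurable_swap _ _ (measurableTypeR R) 'rV[R]_n)).
  by move=> q; rewrite lee_fin sqr_ge0.
have sl0 v t : (0 <= slice_energy (n := n) (R := R) v t)%E.
  by apply: integral_ge0 => y _; rewrite lee_fin sqr_ge0.
pose F (z : 'rV[R]_n * measurableTypeR R) : \bar R :=
  ((va z.1 z.2 ^+ 2 + vb z.1 z.2 ^+ 2) * z.2 `^ (1 - beta))%:E.
have mF : measurable_fun setT F.
  apply: measurable_fun_EFin; apply: measurable_fun_mul; last by meas.
  by apply: measurable_fun_add; exact: measurable_funX.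
have F0 z : (0 <= F z)%E by rewrite lee_fin mulr_ge0 ?powR_ge0 ?addr_ge0 ?sqr_ge0.
have mvat t : measurable_fun setT (va^~ t).
  by apply: measurable_fun_normr; exact: (measurable_fun_conv ma (@measurable_qk R n s t)).
have mvbt t : measurable_fun setT (vb^~ t).
  by apply: measurable_fun_normr; exact: (measurable_fun_conv mb (@measurable_qk R n s t)).
transitivity (\int[mu \x lam]_(z in setT `*` `]0%R, +oo[) F z)%E.
  apply: eq_integral => -[x t] /set_mem[_ /=]; rewrite in_itv/= andbT => t0.
  by rewrite /F/= dtE.
rewrite (@tonelli_dom_prod _ _ 'rV[R]_n (measurableTypeR R) R mu lam `]0%R, +oo[ (measurable_itv _) F mF F0).
rewrite /weighted_energy -ge0_integralD//; last 4 first.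
- by move=> t _; rewrite mule_ge0// lee_fin powR_ge0.
- by apply: measurable_funTS; apply: measurable_fun_mule; [meas|exact: mswap].
- by move=> t _; rewrite mule_ge0// lee_fin powR_ge0.
- by apply: measurable_funTS; apply: measurable_fun_mule; [meas|exact: mswap].
apply: eq_integral => t _; rewrite -ge0_muleDr// /slice_energy -ge0_integralD//; last 4 first.
- by move=> y _; rewrite lee_fin sqr_ge0.
- by apply: measurable_fun_EFin; exact: measurable_funX.
- by move=> y _; rewrite lee_fin sqr_ge0.
- by apply: measurable_fun_EFin; exact: measurable_funX.
rewrite -ge0_integralZl_EFin ?powR_ge0//; last 2 first.
- by move=> y _; rewrite lee_fin addr_ge0 ?sqr_ge0.
- by apply: measurable_fun_adde; apply: measurable_fun_EFin; exact: measurable_funX.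
by apply: eq_integral => y _; rewrite /F/= mulrC EFinM.
Qed.

End energy.

Lemma powR_normc_le {R : realType} (z : R[i]) (p : R) : 0 <= p ->
  normc z `^ p <= 2 `^ p * (`|complex.Re z| `^ p + `|complex.Im z| `^ p).
Proof.
move=> p0; have := normc_le z; have := normc_nneg z.
move: (normc z) (`|complex.Re z|) (`|complex.Im z|) (normr_ge0 (complex.Re z)) (normr_ge0 (complex.Im z)).
move=> w u v u0 v0 w0 wuv.
have mono x y : 0 <= x -> x <= y -> x `^ p <= y `^ p.
  by move=> x0 xy; apply: ge0_ler_powR; rewrite ?nnegrE// (le_trans x0).
have [uv|/ltW vu] := lerP u v.
  apply: (@le_trans _ _ ((2 * v) `^ p)).
    by apply: mono => //; rewrite mulr_natl mulr2n (le_trans wuv)// lerD2r.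
  by rewrite powRM// ler_wpM2l ?powR_ge0// lerDr powR_ge0.
apply: (@le_trans _ _ ((2 * u) `^ p)).
  by apply: mono => //; rewrite mulr_natl mulr2n (le_trans wuv)// lerD2l.
by rewrite powRM// ler_wpM2l ?powR_ge0// lerDl powR_ge0.
Qed.

Lemma poweR_add_le {R : realType} (X Y : \bar R) (g : R) : (0 <= X)%E -> (0 <= Y)%E -> 0 <= g ->
  ((X + Y) `^ g <= (2 `^ g)%:E * (X `^ g + Y `^ g))%E.
Proof.
move=> X0 Y0 g0.
have mono (U V : \bar R) : (0 <= U)%E -> (U <= V)%E -> (U `^ g <= V `^ g)%E.
  by move=> U0 UV; apply: gt0_ler_poweR; rewrite ?in_itv/= ?leey ?andbT// (le_trans U0).
wlog XY : X Y X0 Y0 / (X <= Y)%E.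
  move=> H; have /orP[XY|YX] := le_total X Y; first exact: H.
  by rewrite addeC (addeC (X `^ g)%E); exact: H.
apply: (@le_trans _ _ ((2%:E * Y) `^ g)%E).
  apply: mono; first exact: adde_ge0.
  by rewrite (_ : 2%:E * Y = Y + Y)%E ?leeD2r// -mule2n mule_natl.
rewrite poweRM// poweR_EFin; apply: lee_wpmul2l; first by rewrite lee_fin powR_ge0.
by rewrite leeDr// poweR_ge0.
Qed.

(** * The inequalities *)

Section assembly.
Context {R : realType} (n : nat) (s beta : R).
Hypotheses (s0 : 0 < s) (b0 : 0 < beta) (bn : beta < n%:R) (b4 : beta <= 4).
Notation mu := (@lebesgue_rV R n).
Notation pk := (@poisson_kernel R n s).
Variable f : 'rV[R]_n -> R[i].
Hypothesis fH : hom_sobolev (beta / 2) f.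
Let a x : R := complex.Re (f x).
Let b x : R := complex.Im (f x).
Let E (h : 'rV[R]_n -> R) := weighted_energy beta (fun x t => `|conv h (@poisson_dt R n s t) x|).
Let p : R := 2 * n%:R / (n%:R - beta).
Let gm : R := 1 - beta / n%:R.
Let n_gt0 : 0 < n%:R :> R := lt_trans b0 bn.
Let p0 : 0 < p. Proof. by rewrite divr_gt0 ?mulr_gt0// subr_gt0. Qed.
Let gm0 : 0 < gm. Proof. by rewrite subr_gt0 ltr_pdivrMr// mul1r. Qed.
Notation sC := (real_sobolev_cst n s beta).
Notation hC := (real_hardy_cst n s beta).

(** Each part of the mollified f is a real Fourier integral whose amplitudes are parts of f^ up to
    sign, all bounded by |f^|, so the real results apply to Re f and Im f separately. *)
Lemma parts_inequalities : [/\ measurable_fun setT a /\ measurable_fun setT b,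
  ((\int[mu]_x (`|a x| `^ p)%:E) `^ gm <= sC%:E * E a)%E /\
  ((\int[mu]_x (`|b x| `^ p)%:E) `^ gm <= sC%:E * E b)%E,
  (\int[mu]_x (enorm x `^ (- beta) * `|a x| ^+ 2)%:E <= hC%:E * E a)%E /\
  (\int[mu]_x (enorm x `^ (- beta) * `|b x| ^+ 2)%:E <= hC%:E * E b)%E &
  extension_energy s beta f = (E a + E b)%E].
Proof.
have [[mfr mfi [N1 fN1]] [g [[mgr mgi [N2 gN2]] fg gQ]]] := fH.
pose N := maxn N1 N2.
have aN : (\int[mu]_x (`|a x| / (1 + enorm x) ^+ N)%:E < +oo)%E.
  exact: (tempered_weight_le (leq_maxl N1 N2) (fun x => normc_ge_re _) fN1).
have bN : (\int[mu]_x (`|b x| / (1 + enorm x) ^+ N)%:E < +oo)%E.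
  exact: (tempered_weight_le (leq_maxl N1 N2) (fun x => normc_ge_im _) fN1).
pose r xi := normc (g xi).
have mr : measurable_fun setT r := measurable_fun_normc mgr mgi.
have rr xi : `|r xi| <= r xi by rewrite ger0_norm// normc_nneg.
have rN : (\int[mu]_xi (r xi / (1 + enorm xi) ^+ N)%:E < +oo)%E.
  have := tempered_weight_le (leq_maxr N1 N2) rr gN2.
  by under eq_integral do rewrite ger0_norm ?normc_nneg//.
pose Q := fine (\int[mu]_xi (enorm xi `^ beta * r xi ^+ 2)%:E)%E.
have rQ : (\int[mu]_xi (enorm xi `^ beta * r xi ^+ 2)%:E <= Q%:E)%E.
  rewrite /Q fineK// ge0_fin_numE.
    move: gQ; rewrite (_ : 2 * (beta / 2) = beta)//.
    by rewrite mulrC divfK.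
  by apply: integral_ge0 => xi _; rewrite lee_fin mulr_ge0 ?powR_ge0 ?sqr_ge0.
have mgi' : measurable_fun setT (fun xi => - complex.Im (g xi)) by exact: measurable_fun_opp.
have gi' xi : `|- complex.Im (g xi)| <= r xi by rewrite normrN normc_ge_im.
have aE tau x (t0 : 0 < tau) := (mollify_fourier x fg t0).1.
have bE tau x (t0 : 0 < tau) := (mollify_fourier x fg t0).2.
split.
- by split.
- split.
  + exact: (real_sobolev s0 b0 bn b4 mfr aN mgr mgi' mr (fun xi => normc_ge_re _) gi' rN rQ aE).
  + exact: (real_sobolev s0 b0 bn b4 mfi bN mgi mgr mr (fun xi => normc_ge_im _) (fun xi => normc_ge_re _) rN rQ bE).
- split.
  + exact: (real_hardy s0 b0 bn b4 mfr aN mgr mgi' mr (fun xi => normc_ge_re _) gi' rN rQ aE).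
  + exact: (real_hardy s0 b0 bn b4 mfi bN mgi mgr mr (fun xi => normc_ge_im _) (fun xi => normc_ge_re _) rN rQ bE).
apply: extension_energyE => //.
- exact: (integrable_poisson1 s0 b0 b4 mfr aN mgr mgi' mr (fun xi => normc_ge_re _) gi' rN rQ aE).
- exact: (integrable_poisson1 s0 b0 b4 mfi bN mgi mgr mr (fun xi => normc_ge_im _) (fun xi => normc_ge_re _) rN rQ bE).
Qed.

Let E0 h : (0 <= E h)%E.
Proof.
apply: integral_ge0 => t _; rewrite mule_ge0 ?lee_fin ?powR_ge0//.
by apply: integral_ge0 => y _; rewrite lee_fin sqr_ge0.
Qed.

(** The first factor comes from |f|^p <= 2^p (|Re f|^p + |Im f|^p), the second from (X + Y)^gm <=
    2^gm (X^gm + Y^gm). *)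
Definition final_sobolev_cst : R := (2 `^ p) `^ gm * 2 `^ gm * sC.

Lemma final_sobolev_cst_gt0 : 0 < final_sobolev_cst.
Proof.
have := real_sobolev_cst_gt0 s0 b0 bn; rewrite /final_sobolev_cst.
by move: (real_sobolev_cst _ _ _) => S S0; rewrite !mulr_gt0 ?powR_gt0.
Qed.

Lemma final_sobolev :
  ((\int[mu]_x (normc (f x) `^ p)%:E) `^ gm <= final_sobolev_cst%:E * extension_energy s beta f)%E.
Proof.
have [[ma mb] [Sa Sb] _ ->] := parts_inequalities.
set X := (\int[mu]_x _)%E in Sa; set Y := (\int[mu]_x _)%E in Sb.
have X0 : (0 <= X)%E by apply: integral_ge0 => x _; rewrite lee_fin powR_ge0.
have Y0 : (0 <= Y)%E by apply: integral_ge0 => x _; rewrite lee_fin powR_ge0.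
have pp : 0 <= 2 `^ p :> R by exact: powR_ge0.
have le1 : (\int[mu]_x (normc (f x) `^ p)%:E <= (2 `^ p)%:E * (X + Y))%E.
  rewrite /X /Y -ge0_integralD//; try by [meas | move=> x _; rewrite lee_fin powR_ge0].
  rewrite -ge0_integralZl_EFin//;
    try by [meas | move=> x _; rewrite lee_fin addr_ge0 ?powR_ge0].
  apply: le_nnintegral => x _; first by rewrite lee_fin powR_ge0.
  by rewrite -EFinD -EFinM lee_fin; exact: powR_normc_le (ltW p0).
apply: (@le_trans _ _ (((2 `^ p)%:E * (X + Y)) `^ gm)%E).
  apply: gt0_ler_poweR; rewrite ?(ltW gm0)// in_itv/= leey andbT.
    by apply: integral_ge0 => x _; rewrite lee_fin powR_ge0.
  by rewrite mule_ge0 ?lee_fin// adde_ge0.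
have XY0 : (0 <= X + Y)%E by exact: adde_ge0.
have -> : (((2 `^ p)%:E * (X + Y)) `^ gm = ((2 `^ p) `^ gm)%:E * (X + Y) `^ gm)%E.
  by rewrite poweRM.
rewrite /final_sobolev_cst -!mulrA (EFinM ((2 `^ p) `^ gm)) -muleA.
apply: lee_wpmul2l; first by rewrite lee_fin powR_ge0.
apply: le_trans (poweR_add_le X0 Y0 (ltW gm0)) _.
rewrite (EFinM (2 `^ gm)) -muleA; apply: lee_wpmul2l; first by rewrite lee_fin powR_ge0.
move: (E a) (E b) (E0 a) (E0 b) Sa Sb; move: sC => S ea eb ea0 eb0 Sa Sb.
by rewrite ge0_muleDr//; exact: leeD.
Qed.

Lemma final_hardy :
  (\int[mu]_x (normc (f x) ^+ 2 / enorm x `^ beta)%:E <= hC%:E * extension_energy s beta f)%E.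
Proof.
have [[ma mb] _ [Ha Hb] ->] := parts_inequalities.
rewrite ge0_muleDr//; apply: le_trans (leeD Ha Hb).
rewrite -ge0_integralD//; last 4 first.
- by move=> x _; rewrite lee_fin mulr_ge0 ?powR_ge0 ?sqr_ge0.
- by meas.
- by move=> x _; rewrite lee_fin mulr_ge0 ?powR_ge0 ?sqr_ge0.
- by meas.
apply: le_nnintegral => x _.
  by rewrite lee_fin divr_ge0 ?powR_ge0 ?sqr_ge0.
by rewrite -EFinD lee_fin normc_sqr powRN -mulrDr mulrC.
Qed.

Lemma final_entropy : ('N[mu]_2%:E[EFin \o @normc R \o f] = 1)%E ->
  (expeR ((beta / n%:R)%:E * \int[mu]_x (normc (f x) ^+ 2 * ln (normc (f x) ^+ 2))%:E)
   <= final_sobolev_cst%:E * extension_energy s beta f)%E.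
Proof.
move=> norm1; have [[ma mb] _ _ _] := parts_inequalities.
have mF : measurable_fun setT (fun x => normc (f x)) := measurable_fun_normc ma mb.
have F0 x : 0 <= normc (f x) := normc_nneg _.
have F2 : (\int[mu]_x (normc (f x) ^+ 2)%:E = 1)%E.
  have := congr1 (fun y => y `^ 2)%E norm1.
  rewrite poweR_Lnorm// poweR_EFin powR1 => <-.
  by apply: eq_integral => x _ /=; rewrite ger0_norm// -powR_mulrn.
(* The exponential is bounded by the left side of the Sobolev inequality, so both inequalities share
   one constant. *)
apply: le_trans final_sobolev; set A := (\int[mu]_x (normc (f x) `^ p)%:E)%E.
have A0 : (0 <= A)%E by apply: integral_ge0 => x _; rewrite lee_fin powR_ge0.
case AE : A A0 => [A'| |] // A0; last by rewrite poweRyr ?gt_eqF// leey.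
(* If the L^p integral vanished, f would be 0 almost everywhere, against the normalization. *)
have A'0 : 0 < A'.
  rewrite lt_neqAle -lee_fin A0 andbT; apply/eqP => A'E.
  have ae0 : ae_eq mu setT (fun x => (normc (f x) `^ p)%:E) (cst 0%E).
    apply/(ae_eq_integral_abs mu measurableT); first by meas.
    under eq_integral do rewrite gee0_abs ?lee_fin ?powR_ge0//.
    by rewrite -/A AE -A'E.
  have : (\int[mu]_x (normc (f x) ^+ 2)%:E = 0)%E.
    rewrite (ge0_ae_eq_integral (g := cst 0%E) measurableT)//; first exact: integral0.
    - by meas.
    - by move=> x _; rewrite lee_fin sqr_ge0.
    - apply: filterS ae0 => x /(_ I) [/eqP]; rewrite powR_eq0 => /andP[/eqP -> _] _ /=.
      by rewrite expr0n.
  by rewrite F2 => /eqP; rewrite onee_eq0.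
(* Chosen so that p = 2 + 2k; then (beta/n)/k = 1 - beta/n is exactly the outer exponent of the
   Sobolev inequality. *)
pose k := beta / (n%:R - beta).
have nb : 0 < n%:R - beta by rewrite subr_gt0.
have k0 : 0 < k by rewrite divr_gt0.
have pE : p = 2 + 2 * k by rewrite /p /k; field; rewrite gt_eqF.
have gE : gm = beta / n%:R / k by rewrite /gm /k; field; rewrite !gt_eqF.
rewrite poweR_EFin gE; apply: (entropy_jensen mF F0 k0 A'0 pE F2 AE).
by rewrite divr_gt0.
Qed.

End assembly.

Theorem theorem3p2 (R : realType) (n : nat) (s beta : R)
    (hn : (1 <= n)%N) (hs0 : 0 < s) (hs2 : s < 2)
    (hbeta0 : 0 < beta) (hbeta : beta < Num.min n%:R (2 * s)) :
  exists C1 C2 C3 : R, [/\ 0 < C1, 0 < C2, 0 < C3 &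
    forall f : 'rV[R]_n -> R[i], hom_sobolev (beta / 2) f ->
    [/\
        ((\int[lebesgue_rV n]_x
            (normc (f x) `^ (2 * n%:R / (n%:R - beta)))%:E)
           `^ (1 - beta / n%:R)
         <= C1%:E * extension_energy s beta f)%E,
        ('N[lebesgue_rV n]_2%:E[EFin \o @normc R \o f] = 1)%E ->
        (expeR ((beta / n%:R)%:E *
           \int[lebesgue_rV n]_x
             (normc (f x) ^+ 2 * ln (normc (f x) ^+ 2))%:E)
         <= C2%:E * extension_energy s beta f)%E &
        (\int[lebesgue_rV n]_x (normc (f x) ^+ 2 / enorm x `^ beta)%:E
         <= C3%:E * extension_energy s beta f)%E]].
Proof.
have /andP[bn b2s] : (beta < n%:R) && (beta < 2 * s) by rewrite -lt_min.
(* Since beta < 2s < 4, the exponent beta/4 is admissible in 1 - exp(-y) <= y^(beta/4). *)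
have b4 : beta <= 4 by lra.
exists (final_sobolev_cst n s beta), (final_sobolev_cst n s beta), (real_hardy_cst n s beta).
split.
- exact: final_sobolev_cst_gt0.
- exact: final_sobolev_cst_gt0.
- exact: real_hardy_cst_gt0.
- move=> f fH; split.
  + exact: final_sobolev.
  + exact: final_entropy.
  + exact: final_hardy.
Qed.
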